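(* Let $d\ge1$, let $\varphi:[0,\infty)\to[0,\infty)$ be locally integrable with $\Lambda=\int_0^\infty\varphi(t)\,dt\in(1,\infty]$ and such that $t\mapsto\int_0^t|d\varphi(s)|$ has at most polynomial growth. Let $\alpha_0>0$ be uniquely defined by $\int_0^\infty e^{-\alpha_0t}\varphi(t)\,dt=1$. Let $(\mu_i)_{i\in\mathbb Z^d}$ be a bounded family of nonnegative numbers such that the mean value $$\mu=\lim_{r\to\infty}\frac1{\#\{i\in\mathbb Z^d:|i|\le r\}}\sum_{|i|\le r}\mu_i\quad\text{exists and is positive.}$$ Let $(Z^i_t)_{i\in\mathbb Z^d,t\ge0}$ be the nearest neighbour linear Hawkes process on $\mathbb Z^d$ with parameters $\varphi$ and $(\mu_i)_{i\in\mathbb Z^d}$ (defined in the context). Then for all $i\in\mathbb Z^d$, $e^{-\alpha_0t}Z^i_t$ goes in probability, as $t\to\infty$, to $a_0=\mu\,\alpha_0^{-2}\big(\int_0^\infty t\varphi(t)e^{-\alpha_0t}dt\big)^{-1}$.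
   Context: $\mathbb Z^d$ is endowed with the set of edges $\mathcal E=\{(i,j)\in(\mathbb Z^d)^2:|i-j|=0\text{ or }1\}$, where $|\cdot|$ is the Euclidean norm (so each point has $2d+1$ neighbours, including itself); $\sum_{j\to i}$ denotes summation over $\{j:(j,i)\in\mathcal E\}$. Given i.i.d. Poisson measures $(\pi^i(ds\,dz))_{i\in\mathbb Z^d}$ on $[0,\infty)\times[0,\infty)$ with intensity measure $ds\,dz$ (with respect to a filtration $(\mathcal F_t)_{t\ge0}$), the nearest neighbour linear Hawkes process with parameters $\varphi$ and $(\mu_i)$ is the pathwise unique family $(Z^i_t)_{i\in\mathbb Z^d,t\ge0}$ of càdlàg adapted processes such that $\sum_{i\in\mathbb Z^d}2^{-|i|}\mathbb E[Z^i_t]<\infty$ for all $t\ge0$ and a.s., for all $i\in\mathbb Z^d$, $t\ge0$, $$Z^i_t=\int_0^t\int_0^\infty\mathbf 1_{\{z\le\mu_i+(2d+1)^{-1}\sum_{j\to i}\int_0^{s-}\varphi(s-u)\,dZ^j_u\}}\,\pi^i(ds\,dz).$$ $\int_0^t|d\varphi(s)|$ is the total variation of $\varphi$ on $[0,t]$. *)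

(* Defs.v *)
(* MathComp-Analysis *)
From HB Require Import structures.
From mathcomp Require Import all_boot all_order all_algebra.
From mathcomp Require Import finmap.
From mathcomp Require Import all_classical all_reals all_analysis.
From mathcomp Require Import measurable_realfun.
Set Implicit Arguments.
Unset Strict Implicit.
Unset Printing Implicit Defensive.
Import Order.TTheory GRing.Theory Num.Theory.
Import numFieldNormedType.Exports.
Local Open Scope classical_set_scope.
Local Open Scope ring_scope.

Section lattice.
Context {R : realType} {d : nat}.
Implicit Types i j : 'rV[int]_d.

Definition enorm i : R := Num.sqrt (\sum_(k < d) ((i ord0 k)%:~R ^+ 2)).

Definition edge i j : Prop := enorm (i - j) = 0 \/ enorm (i - j) = 1.

Definition lattice_ball (r : R) : set 'rV[int]_d := [set i | enorm i <= r].

Definition ball_average (m : 'rV[int]_d -> R) (r : R) : R :=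
  (#|` fset_set (lattice_ball r)|%:R)^-1 * \sum_(i \in lattice_ball r) m i.

End lattice.
Arguments enorm R {d}.
Arguments edge R {d}.

Section independence.
Context {R : realType} {d0 : measure_display} {T : measurableType d0}.
Variable P : probability T R.

Definition independent_classes (G H : set_system T) : Prop :=
  forall A B, G A -> H B -> P (A `&` B) = (P A * P B)%E.

Definition mutually_independent (I : choiceType) (G : I -> set_system T) :
    Prop :=
  forall (J : {fset I}) (E : I -> set T),
    (forall i, i \in J -> G i (E i)) ->
    P (\bigcap_(i in [set` J]) E i) = (\prod_(i <- J) P (E i))%E.

Definition is_filtration (F : R -> set_system T) : Prop :=
  (forall t, 0 <= t -> sigma_algebra setT (F t) /\ F t `<=` measurable) /\
  (forall s t, 0 <= s -> s <= t -> F s `<=` F t).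

Definition cvg_in_probability (X : R -> T -> R) (a : R) : Prop :=
  forall e : R, 0 < e ->
    P [set w | e <= `|X t w - a|] @[t --> +oo] --> 0%E.

End independence.

Section poisson_measure.
Context {R : realType} {d0 : measure_display} {T : measurableType d0}.
Variable P : probability T R.
Local Notation leb := (@lebesgue_measure R).

Definition strip (I : set R) : set (R * R) := I `*` `[0, +oo[.

(* the sigma-algebra generated by the variables [N(A)], [A] measurable in [D] *)
Definition sigma_restr (N : T -> {measure set (R * R) -> \bar R})
    (D : set (R * R)) : set_system T :=
  smallest (sigma_algebra setT) [set E | exists A (B : set (\bar R)),
        [/\ measurable A, A `<=` D, measurable B &
            E = (fun w => N w A) @^-1` B]].

(* [N] is a Poisson measure on [0,oo) x [0,oo) with intensity ds dz, relative
   to the filtration [F]; the values of [N] outside the quadrant are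
   irrelevant.  The second argument of [poisson_prob] is a dummy. *)
Definition poisson_measure (F : R -> set_system T)
    (N : T -> {measure set (R * R) -> \bar R}) : Prop :=
  [/\ (forall A, measurable A -> A `<=` strip `[0, +oo[ ->
         measurable_fun setT (fun w => N w A)),
      (forall A, measurable A -> A `<=` strip `[0, +oo[ ->
         ((leb \x leb)%E A < +oo)%E ->
         forall k : nat, P [set w | N w A = k%:R%:E] =
           poisson_prob (fine ((leb \x leb)%E A)) 0 [set k]),
      (forall (n : nat) (A : 'I_n -> set (R * R)),
         (forall k, measurable (A k) /\ A k `<=` strip `[0, +oo[) ->
         trivIset setT A ->
         mutually_independent P
           (fun k => preimage_set_system setT (fun w => N w (A k)) measurable)),
      (forall t, 0 <= t -> sigma_restr N (strip `[0, t]) `<=` F t) &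
      (forall t, 0 <= t ->
         independent_classes P (F t) (sigma_restr N (strip `]t, +oo[)))].

(* The members are identically distributed because they share the intensity. *)
Definition iid_poisson_measures (I : choiceType) (F : R -> set_system T)
    (N : I -> T -> {measure set (R * R) -> \bar R}) : Prop :=
  (forall i, poisson_measure F (N i)) /\
  mutually_independent P (fun i => sigma_restr (N i) (strip `[0, +oo[)).

End poisson_measure.

Section hawkes.
Context {R : realType}.

Definition cadlag (z : R -> R) : Prop :=
  (forall t, 0 <= t -> z x @[x --> t^'+] --> z t) /\
  (forall t, 0 < t -> cvg (z x @[x --> t^'-])).

Definition extend0 (z : R -> R) : R -> R := fun t => if 0 <= t then z t else 0.

Definition is_cumulative (z : R -> R) : Prop :=
  nondecreasing z /\ right_continuous z.

Definition to_cumulative (z : R -> R) (H : is_cumulative z) : cumulative R R :=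
  HB.pack z (isCumulative.Build R _ R z H.1 H.2).

(* The measure [dz] on [0,oo), with the convention z(0-) = 0.  The dummy value
   for paths that are not nondecreasing and right-continuous is harmless: the
   equation in [hawkes] forces almost all paths to be so. *)
Definition dpath (z : R -> R) : {measure set (measurableTypeR R) -> \bar R} :=
  if pselect (is_cumulative (extend0 z)) is left H
  then lebesgue_stieltjes_measure (to_cumulative H) else mzero.

Context {d : nat}.
Local Notation site := 'rV[int]_d.

Definition intensity (phi : R -> R) (m : site -> R) (z : site -> R -> R)
    (i : site) (s : R) : \bar R :=
  ((m i)%:E + ((2 * d + 1)%:R^-1)%:E *
     \sum_(j \in [set j | edge R j i])
        \int[dpath (z j)]_(u in `[0%R, s[) (phi (s - u))%:E)%E.

Definition below (lambda : R -> \bar R) : set (R * R) :=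
  [set x | (x.2%:E <= lambda x.1)%E].

Context {d0 : measure_display} {T : measurableType d0}.

(* Integrals over [0, t] and [0, s-] are over the intervals [0, t] and [0, s)
   respectively; the double integral against [N i w] is the [N i w]-mass of the
   region under the intensity. *)
Definition hawkes (P : probability T R) (F : R -> set_system T)
    (N : site -> T -> {measure set (R * R) -> \bar R})
    (phi : R -> R) (m : site -> R) (Z : site -> R -> T -> R) : Prop :=
  [/\ (forall i t, 0 <= t ->
         preimage_set_system setT (Z i t) measurable `<=` F t),
      (forall i w, cadlag (fun t => Z i t w)),
      (forall t, 0 <= t ->
         (\esum_(i in [set: site])
            ((2 `^ (- enorm R i))%:E * 'E_P[Z i t]) < +oo)%E) &
      {ae P, forall w, forall i t, 0 <= t ->
         ((Z i t w)%:E = \int[N i w]_(x in strip `[0%R, t])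
            (\1_(below (intensity phi m (fun j s => Z j s w) i)) x)%:E)%E}].

End hawkes.

Section kernel.
Context {R : realType}.
Local Notation leb := (@lebesgue_measure R).

Definition locally_integrable_pos (phi : R -> R) : Prop :=
  forall t, 0 <= t -> leb.-integrable `[0, t] (EFin \o phi).

Definition polynomial_variation (phi : R -> R) : Prop :=
  exists (C : R) (n : nat), forall t, 0 <= t ->
    (total_variation 0 t phi <= (C * (1 + t) ^+ n)%:E)%E.

End kernel.

(* Main.v *)
From HB Require Import structures.
Require Import Defs.
From mathcomp Require Import all_boot all_order all_algebra.
From mathcomp Require Import finmap.
From mathcomp Require Import all_classical all_reals all_analysis.
From mathcomp Require Import measurable_realfun.
From mathcomp Require Import ring lra zify.
Set Implicit Arguments.
Unset Strict Implicit.
Unset Printing Implicit Defensive.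
Import Order.TTheory GRing.Theory Num.Theory.
Import numFieldNormedType.Exports.
Local Open Scope classical_set_scope.
Local Open Scope ring_scope.

(* Let [A] be the averaging operator over nearest neighbours, let
   [f t = phi t * exp (- alpha0 t)], a probability density, and let [A^n] act on
   the sites.  Writing each [Z^i] as its compensator plus a martingale [M^i], the
   normalized process [Y^i_t = exp (- alpha0 t) Z^i_t] satisfies
     [Y_t = exp (- alpha0 t) (M_t + t m) + int_0^t f (t - s) (A Y_s) ds].
   Let [h] solve the scalar renewal equation
     [h t = t exp (- alpha0 t) + int_0^t f (t - s) h s ds].
   The error [q_n t = E |(A^n Y_t)_i - mu h t|] satisfies [q_n <= r_n + f * q_(n+1)].
   The martingales of distinct sites are orthogonal, with second moments
   [E Z^j_t], so the noise in [r_n] is at most the square root of the largest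
   weight of [A^n] times a mean; that weight tends to [0] with [n], because a walk
   on the lattice spreads.  The deterministic part of [r_n] contains
   [(A^n m)_i - mu], which tends to [0] by the existence of the ball averages: the
   walk is compared with lazy coordinate walks, whose binomial kernel is nearly
   radial and hence a mixture of balls.  So [r_n t <= delta exp (- alpha0 t / 2)] for
   [n] large, and comparison with a bounded supersolution of the renewal
   inequality bounds [q_n] by a multiple of [delta], uniformly in [t].  Since [f] is a
   density, a bound on the upper limit of [q_(n+1)] passes to [q_n], so [q_0] tends
   to [0].

   The limit of [h] follows from conservation of mass,
     [int_0^s h (s - u) (int_u^oo f) du = int_0^s t exp (- alpha0 t) dt],
   and from the fact that [h], being near its upper (or lower) limit at one time,
   is near it on a long preceding window; this uses a lower bound of [f] on some
   interval, which holds because [phi] has bounded variation, hence is continuous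
   off a countable set. *)

(** * The averaging operator of the lattice *)

(** The noise at a single site is not small: its early fluctuations, once discounted, persist
    through the renewal equation and would by themselves leave a random limit. They cancel only in
    an average over many sites, so smallness is obtained for [A^n Y] with [n] large and then brought
    back to [n = 0]; this is possible because the equation at level [n] calls on level [n + 1]
    alone. Two obstacles shape the estimates. Averages over balls are all that is known of [m], so
    the kernel of [A^n] has to be replaced by a nearly radial one; binomial weights are explicit
    enough for this to follow from elementary inequalities. The intensity is unbounded, so second
    moments are first computed for the points below a height [K], on a fine partition of time, and
    [K] is sent to infinity afterwards. All rates are [kappa = alpha0 / 2]: one half of the discount
    absorbs the polynomial growth of [phi], the other half remains. *)

Section binomial_average.
Context {R : realType}.
Implicit Types (g : nat -> R) (l : nat).

(** The mean of [g] under the binomial law with parameters [l] and 1/2. Conditioning on one toss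
    makes induction on [l] available; binomial coefficients enter only through [bexpE]. *)
Fixpoint bexp l g : R :=
  if l is l'.+1 then (bexp l' g + bexp l' (g \o succn)) / 2 else g 0%N.

Lemma bexpD l g g' : bexp l (fun j => g j + g' j) = bexp l g + bexp l g'.
Proof.
elim: l g g' => //= l IH g g'.
by rewrite IH [bexp l (_ \o _)](IH (g \o succn) (g' \o succn)); field.
Qed.

Lemma bexpZ l c g : bexp l (fun j => c * g j) = c * bexp l g.
Proof.
elim: l g => //= l IH g.
by rewrite IH [bexp l (_ \o _)](IH (g \o succn)); field.
Qed.

Lemma eq_bexp l g' g : (forall j, g j = g' j) -> bexp l g = bexp l g'.
Proof. by move=> gg'; congr bexp; apply/funext. Qed.

Lemma bexp_cst l c : bexp l (fun=> c) = c.
Proof. by elim: l => //= l; rewrite (_ : (fun=> c) \o succn = fun=> c)// => ->; field. Qed.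

Lemma ler_bexp l g g' : (forall j, g j <= g' j) -> bexp l g <= bexp l g'.
Proof.
elim: l g g' => [|l IH] g g' gg' //=.
by rewrite ler_pM2r ?invr_gt0// lerD// IH// => j /=.
Qed.

Lemma ler_norm_bexp l g : `|bexp l g| <= bexp l (fun j => `|g j|).
Proof.
rewrite ler_norml -mulN1r -bexpZ !ler_bexp// => j; rewrite ?mulN1r ?ler_norm//.
by rewrite lerNl -normrN ler_norm.
Qed.

Lemma bexp_variance l : bexp l (fun j => (l%:R - 2 * j%:R) ^+ 2) = l%:R.
Proof.
(* The induction needs an arbitrary centre: one more toss moves it by 1 or by -1. *)
suff H n c : bexp n (fun j => (n%:R - 2 * j%:R + c) ^+ 2) = n%:R + c ^+ 2.
  have := H l 0; rewrite expr0n addr0 => H0; rewrite -[RHS]H0.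
  by apply: eq_bexp => j; rewrite addr0.
elim: n c => [|n IH] c; first by rewrite /=; ring.
have -> : bexp n.+1 (fun j => (n.+1%:R - 2 * j%:R + c) ^+ 2) =
  (bexp n (fun j => (n%:R - 2 * j%:R + (c + 1)) ^+ 2) +
   bexp n (fun j => (n%:R - 2 * j%:R + (c - 1)) ^+ 2)) / 2.
  by congr ((_ + _) / 2); apply: eq_bexp => j /=; rewrite -!natr1; ring.
by rewrite !IH -natr1; field.
Qed.

(* Discrete integration by parts: the derivative of the binomial weight is the
   weight times the centred variable. *)
Lemma bexp_grad l g : (l.+1)%:R / 2 * (bexp l g - bexp l (g \o succn)) =
  bexp l.+1 (fun j => ((l.+1)%:R - 2 * j%:R) * g j).
Proof.
elim: l g => [|l IH] g.
  by rewrite /=; field.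
have -> : bexp l.+2 (fun j => (l.+2%:R - 2 * j%:R) * g j) =
   (bexp l.+1 (fun j => (l.+2%:R - 2 * j%:R) * g j) +
    bexp l.+1 ((fun j => (l.+2%:R - 2 * j%:R) * g j) \o succn)) / 2 by [].
rewrite [X in _ = (X + _) / 2](@eq_bexp _ (fun j => (l.+1%:R - 2 * j%:R) * g j + g j)); last first.
  by move=> j; rewrite -[l.+2%:R]natr1; ring.
rewrite [X in _ = (_ + X) / 2](@eq_bexp _ (fun j => (l.+1%:R - 2 * j%:R) * (g \o succn) j
    + -1 * (g \o succn) j)); last first.
  by move=> j /=; rewrite -[l.+2%:R]natr1 -[j.+1%:R]natr1; ring.
rewrite !bexpD bexpZ -!IH.
have -> : bexp l.+1 g = (bexp l g + bexp l (g \o succn)) / 2 by [].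
have -> : bexp l.+1 (g \o succn) = (bexp l (g \o succn) + bexp l ((g \o succn) \o succn)) / 2 by [].
by rewrite -[l.+2%:R]natr1; field.
Qed.

(** Cauchy-Schwarz in the linear form [|x| <= x^2 / (2 s) + s / 2], sharpest when [s] is the
    standard deviation, so that only [bexp_variance] is used. *)
Lemma bexp_abs_le l : bexp l.+1 (fun j => `|(l.+1)%:R - 2 * j%:R|) <= Num.sqrt (l.+1)%:R.
Proof.
set s := Num.sqrt _; have s0 : 0 < s by rewrite sqrtr_gt0 ltr0n.
have s2 : s ^+ 2 = (l.+1)%:R by rewrite sqr_sqrtr// ler0n.
pose c := (2 * s)^-1.
apply: (@le_trans _ _ (bexp l.+1 (fun j => c * ((l.+1)%:R - 2 * j%:R) ^+ 2 + s / 2))).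
  apply: ler_bexp => j; set x := (X in `|X|).
  rewrite -real_normK ?num_real//; set y := `|x|.
  rewrite -subr_ge0 (_ : _ - _ = c * (y - s) ^+ 2); last first.
    by rewrite /c; field; rewrite gt_eqF.
  by rewrite mulr_ge0 ?sqr_ge0// /c invr_ge0 mulr_ge0// ltW.
rewrite (bexpD _ (fun j => c * _) (fun=> s / 2)) bexp_cst (bexpZ _ c) bexp_variance -s2 /c.
by rewrite le_eqVlt; apply/orP; left; apply/eqP; field; rewrite gt_eqF.
Qed.

(** By [bexp_grad] the difference is a mean of [g] against the centred variable, whose mean absolute
    value is at most [sqrt (l + 1)]. Hence a binomial law and its translate by 1 are at a distance
    of order [l^(-1/2)]. *)
Lemma bexp_grad_le l g K : (forall j, `|g j| <= K) ->
  `|bexp l g - bexp l (g \o succn)| <= 2 / Num.sqrt (l.+1)%:R * K.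
Proof.
move=> gK; set s := Num.sqrt _; have s0 : 0 < s by rewrite sqrtr_gt0 ltr0n.
have s2 : s ^+ 2 = (l.+1)%:R by rewrite sqr_sqrtr// ler0n.
have K0 : 0 <= K := le_trans (normr_ge0 _) (gK 0%N).
have -> : bexp l g - bexp l (g \o succn) =
    2 / s ^+ 2 * bexp l.+1 (fun j => ((l.+1)%:R - 2 * j%:R) * g j).
  by rewrite -bexp_grad -s2; field; rewrite gt_eqF.
rewrite normrM ger0_norm ?divr_ge0 ?sqr_ge0//.
rewrite [leRHS](_ : _ = 2 / s ^+ 2 * (K * s)); last by field; rewrite gt_eqF.
rewrite ler_wpM2l ?divr_ge0 ?sqr_ge0//.
apply: (le_trans (ler_norm_bexp _ _)).
apply: (@le_trans _ _ (bexp l.+1 (fun j => K * `|(l.+1)%:R - 2 * j%:R|))).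
  by apply: ler_bexp => j; rewrite normrM mulrC ler_wpM2r.
by rewrite (bexpZ _ K) ler_wpM2l// bexp_abs_le.
Qed.

Lemma bexpE l g : bexp l g = \sum_(j < l.+1) 'C(l, j)%:R / 2 ^+ l * g j.
Proof.
elim: l g => [|l IH] g; first by rewrite /= big_ord1 bin0 expr0 divr1 mul1r.
have -> : bexp l.+1 g = (bexp l g + bexp l (g \o succn)) / 2 by [].
rewrite !IH big_ord_recl [in RHS]big_ord_recl /=.
rewrite big_ord_recr [in RHS]big_ord_recr /=.
rewrite !bin0 !binn.
rewrite (eq_bigr (fun i : 'I_l => ('C(l, i.+1)%:R / 2 ^+ l * g i.+1))); last by move=> i _.
rewrite [in RHS](eq_bigr (fun i : 'I_l => ('C(l, i.+1)%:R / 2 ^+ l * g i.+1) / 2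
   + ('C(l, i)%:R / 2 ^+ l * g i.+1) / 2)); last first.
  by move=> i _; rewrite /bump /= add1n binS natrD exprS; field.
rewrite [in RHS]big_split /= -!mulr_suml /bump /= add1n exprS.
by field; rewrite expf_neq0.
Qed.

End binomial_average.

(** * Finite combinations of translations and their norms *)

Section shift_operators.
Context {R : realType} {V : zmodType}.
Implicit Types (u v : V -> R) (x y : V).
Notation op := ((V -> R) -> V -> R).
Implicit Types T : op.

(* [fin T]: [T] is a finite combination of translations; [nb T c]: the sup-norm
   of [T] is at most [c]. *)
Definition fin T := exists s : seq (R * V),
  forall u i, T u i = \sum_(p <- s) p.1 * u (i + p.2).

Definition nb T (c : R) := forall u K, (forall i, `|u i| <= K) ->
  forall i, `|T u i| <= c * K.

Definition addop T T' : op := fun u i => T u i + T' u i.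
Definition scaleop c T : op := fun u i => c * T u i.
Definition shift x : op := fun u i => u (i + x).
Definition subop T T' := addop T (scaleop (-1) T').

Lemma eq_op T T' : (forall u i, T u i = T' u i) -> T = T'.
Proof. by move=> e; apply/funext => u; apply/funext => i. Qed.

Lemma fin_shift x : fin (shift x).
Proof. by exists [:: (1, x)] => u i; rewrite big_seq1 mul1r. Qed.

Lemma fin_id : fin id.
Proof. by exists [:: (1, 0)] => u i; rewrite big_seq1 mul1r addr0. Qed.

Lemma fin_add T T' : fin T -> fin T' -> fin (addop T T').
Proof. by move=> [s e] [s' e']; exists (s ++ s') => u i; rewrite big_cat/= -e -e'. Qed.

Lemma fin_scale c T : fin T -> fin (scaleop c T).
Proof.
move=> [s e]; exists [seq (c * p.1, p.2) | p <- s] => u i.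
by rewrite big_map /scaleop e mulr_sumr; apply: eq_bigr => p _; rewrite mulrA.
Qed.

Lemma fin_sub T T' : fin T -> fin T' -> fin (subop T T').
Proof. by move=> ? ?; apply: fin_add => //; apply: fin_scale. Qed.

Lemma fin_comp T T' : fin T -> fin T' -> fin (T \o T').
Proof.
move=> [s e] [s' e'].
exists [seq (p.1 * q.1, p.2 + q.2) | p <- s, q <- s'] => u i.
rewrite big_allpairs_dep /= e; apply: eq_bigr => p _.
rewrite e' mulr_sumr; apply: eq_bigr => q _.
by rewrite mulrA addrA.
Qed.

Lemma fin_iter n T : fin T -> fin (iter n T).
Proof.
move=> fT; elim: n => [|n IH]; first exact: fin_id.
exact: (fin_comp fT IH).
Qed.

(** Translations of an abelian group commute. Smoothing factors can therefore be moved freely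
    through products of operators. *)
Lemma finC T T' : fin T -> fin T' -> T \o T' = T' \o T.
Proof.
move=> [s e] [s' e']; apply: eq_op => u i /=.
rewrite e e'; under eq_bigr do rewrite e' mulr_sumr.
under [RHS]eq_bigr do rewrite e mulr_sumr.
rewrite exchange_big /=; apply: eq_bigr => p _; apply: eq_bigr => q _.
by rewrite mulrCA addrAC.
Qed.

Lemma finC_iter n T T' u : fin T -> fin T' -> iter n T (T' u) = T' (iter n T u).
Proof. by move=> fT fT'; rewrite -[LHS]/((iter n T \o T') u) finC//; apply: fin_iter. Qed.

Lemma finD T u v : fin T -> T (fun i => u i + v i) = fun i => T u i + T v i.
Proof.
move=> [s e]; apply/funext => i; rewrite !e -big_split /=.
by apply: eq_bigr => p _; rewrite mulrDr.
Qed.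

Lemma finZ T c u : fin T -> T (fun i => c * u i) = fun i => c * T u i.
Proof.
move=> [s e]; apply/funext => i; rewrite !e mulr_sumr.
by apply: eq_bigr => p _; rewrite mulrCA.
Qed.

Lemma finB T u v : fin T -> T (fun i => u i - v i) = fun i => T u i - T v i.
Proof.
move=> fT; transitivity (T (fun i => u i + (-1) * v i)).
  by congr T; apply/funext => i; rewrite mulN1r.
by rewrite finD// finZ//; apply/funext => i; rewrite mulN1r.
Qed.

Lemma finB_at T u v i : fin T -> T (fun j => u j - v j) i = T u i - T v i.
Proof. by move=> fT; rewrite finB. Qed.

Lemma fin0 T : fin T -> T (fun=> 0) = fun=> 0.
Proof. by move=> [s e]; apply/funext => i; rewrite e big1// => p _; rewrite mulr0. Qed.

Lemma fin_sum T (J : Type) (r : seq J) (c : J -> R) (w : J -> V -> R) : fin T ->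
  T (fun i => \sum_(j <- r) c j * w j i) = fun i => \sum_(j <- r) c j * T (w j) i.
Proof.
move=> fT; elim: r => [|j r IH].
  under eq_fun do rewrite big_nil.
  by rewrite fin0//; apply/funext => i; rewrite big_nil.
transitivity (T (fun i => c j * w j i + \sum_(j <- r) c j * w j i)).
  by congr T; apply/funext => i; rewrite big_cons.
by rewrite finD// finZ// IH; apply/funext => i; rewrite big_cons.
Qed.

Lemma nb_le T c c' : c <= c' -> nb T c -> nb T c'.
Proof.
move=> cc h u K uK i; apply: (le_trans (h u K uK i)).
by rewrite ler_wpM2r// (le_trans _ (uK i)).
Qed.

Lemma nb_id : nb id 1.
Proof. by move=> u K uK i; rewrite mul1r. Qed.

Lemma nb_shift x : nb (shift x) 1.
Proof. by move=> u K uK i; rewrite mul1r; apply: uK. Qed.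

Lemma nb_comp T T' c c' : nb T c -> nb T' c' -> nb (T \o T') (c * c').
Proof. by move=> h h' u K uK i; rewrite -mulrA; apply: h => j; apply: h'. Qed.

Lemma nb_add T T' c c' : nb T c -> nb T' c' -> nb (addop T T') (c + c').
Proof.
move=> h h' u K uK i; rewrite mulrDl; apply: (le_trans (ler_normD _ _)).
by rewrite lerD// ?h// h'.
Qed.

Lemma nb_scale T c k : nb T c -> nb (scaleop k T) (`|k| * c).
Proof. by move=> h u K uK i; rewrite normrM -mulrA ler_wpM2l// h. Qed.

Lemma nb_iter1 T n : nb T 1 -> nb (iter n T) 1.
Proof.
move=> h; elim: n => [|n IH]; first exact: nb_id.
by rewrite -[1](mul1r 1); apply: (nb_comp h IH).
Qed.

Lemma fin_nb T : fin T -> exists2 c, 0 <= c & nb T c.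
Proof.
move=> [s e]; exists (\sum_(p <- s) `|p.1|); first exact: sumr_ge0.
move=> u K uK i; rewrite e mulr_suml; apply: (le_trans (ler_norm_sum _ _ _)).
by apply: ler_sum => p _; rewrite normrM ler_wpM2l.
Qed.

Definition half x : op := scaleop 2^-1 (addop id (shift x)).

Lemma half_iterE l x u i : iter l (half x) u i = bexp l (fun j => u (i + x *+ j)).
Proof.
elim: l i => [|l IH] i /=; first by rewrite addr0.
rewrite {1}/half /scaleop /addop /shift !IH mulrC; congr ((_ + _) / 2).
by apply: eq_bexp => j /=; rewrite mulrS addrA.
Qed.

Lemma fin_half x : fin (half x).
Proof. by apply: fin_scale; apply: fin_add; [exact: fin_id|exact: fin_shift]. Qed.

(** [bexp_grad_le] in the direction [x]: [l] fair steps make a first difference smaller by a factor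
    of order [l^(-1/2)]. *)
Lemma half_grad l x :
  nb (iter l (half x) \o subop id (shift x)) (2 / Num.sqrt l.+1%:R).
Proof.
move=> u K uK i /=.
rewrite (_ : iter _ _ _ _ = bexp l (fun j => u (i + x *+ j)) -
    bexp l ((fun j => u (i + x *+ j)) \o succn)); last first.
  rewrite half_iterE -[in RHS]mulN1r -bexpZ -bexpD; apply: eq_bexp => j /=.
  by rewrite /subop /addop /scaleop /shift -addrA -mulrSr.
by apply: bexp_grad_le.
Qed.

(* Second difference in direction [x], and the lazy step [(S + 2 + S^-1)/4],
   which is the square of [half x] up to a translation. *)
Definition lap x : op := fun u i => u (i + x) + u (i - x) - 2 * u i.
Definition lazy x : op := addop id (scaleop 4^-1 (lap x)).

Lemma fin_lap x : fin (lap x).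
Proof.
exists [:: (1, x); (1, - x); (-2, 0)] => u i.
by rewrite !big_cons big_nil /lap /= !addr0 !mul1r mulNr addrA.
Qed.

Lemma fin_lazy x : fin (lazy x).
Proof. by apply: fin_add; [exact: fin_id|apply: fin_scale; exact: fin_lap]. Qed.

Lemma lapE x : lap x = shift (- x) \o (subop id (shift x) \o subop id (shift x)).
Proof.
apply: eq_op => u i; rewrite /lap /= /subop /addop /scaleop /shift.
by rewrite subrK; ring.
Qed.

Lemma lazyE x : lazy x = shift (- x) \o (half x \o half x).
Proof.
apply: eq_op => u i; rewrite /lazy /lap /= /half /addop /scaleop /shift.
by rewrite subrK; field.
Qed.

Lemma lazy_iterE n x u i : iter n (lazy x) u i = iter (n + n) (half x) u (i - x *+ n).
Proof.
elim: n u i => [|n IH] u i; first by rewrite /= subr0.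
rewrite iterSr IH addnS addSn !iterSr lazyE /=.
rewrite (finC_iter (n + n) _ (fin_half x) (fin_shift (- x))).
by rewrite /shift -addrA -opprD -mulrSr.
Qed.

(** Up to translations, a second difference is a product of two first differences and [n] lazy steps
    are [2 n] half steps; each first difference is smoothed by [n] half steps of its own. *)
Lemma lap_lazy n x : nb (lap x \o iter n (lazy x)) (4 / n.+1%:R).
Proof.
have fs := fin_shift x; have fh := fin_half x.
have fD : fin (subop id (shift x)) by apply: fin_sub => //; exact: fin_id.
set s : R := Num.sqrt n.+1%:R; have s0 : 0 < s by rewrite sqrtr_gt0 ltr0n.
rewrite (_ : 4 / _ = 1 * (2 / s * (2 / s) * 1)); last first.
  by rewrite -(@sqr_sqrtr _ n.+1%:R) -/s//; field; rewrite gt_eqF.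
rewrite (_ : _ \o _ = shift (- x) \o ((iter n (half x) \o subop id (shift x)) \o
   (iter n (half x) \o subop id (shift x)) \o shift (- (x *+ n)))).
  apply: nb_comp (nb_shift _) _; apply: nb_comp _ (nb_shift _).
  by apply: nb_comp; exact: half_grad.
apply: eq_op => u i /=.
rewrite lapE /=; congr (shift _ _ i).
rewrite !(finC_iter n _ fh fD) -iterD; congr (subop _ _ (subop _ _ _)).
apply/funext => j; rewrite lazy_iterE.
by rewrite (finC_iter (n + n) _ fh (fin_shift _)).
Qed.

End shift_operators.

(** * Agreement of two operators to second order *)

Section consistency.
Context {R : realType} {V : zmodType}.
Notation op := ((V -> R) -> V -> R).
Implicit Types T X : op.
Variable B : op.
Hypothesis fB : fin B.
Hypothesis nB : nb B 1.

(** The order of [T] as seen through the smoothing by [B]: in the application a second difference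
    has order 1 and a product of two of them order 2. *)
Definition decay (p : nat) T := exists2 c : R, 0 <= c &
  forall l, nb (T \o iter l B) (c / l.+1%:R ^+ p).

Lemma decay_add p T T' : decay p T -> decay p T' -> decay p (addop T T').
Proof.
move=> [c c0 h] [c' c'0 h']; exists (c + c'); rewrite ?addr_ge0// => l.
by rewrite mulrDl; exact: (nb_add (h l) (h' l)).
Qed.

Lemma decay_scale p k T : decay p T -> decay p (scaleop k T).
Proof.
move=> [c c0 h]; exists (`|k| * c); rewrite ?mulr_ge0// => l.
by rewrite -mulrA; exact: (nb_scale k (h l)).
Qed.

Lemma decay_sub p T T' : decay p T -> decay p T' -> decay p (subop T T').
Proof. by move=> ? ?; apply: decay_add => //; apply: decay_scale. Qed.

Lemma decay_compl p T T' : fin T -> decay p T' -> decay p (T \o T').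
Proof.
move=> /fin_nb [k k0 hk] [c c0 h]; exists (k * c); rewrite ?mulr_ge0// => l.
rewrite -mulrA; exact: nb_comp hk (h l).
Qed.

Lemma decay_comp T T' : fin T -> fin T' -> decay 1 T -> decay 1 T' -> decay 2 (T \o T').
Proof.
move=> fT fT' [c c0 h] [c' c'0 h']; exists (4 * (c * c')); rewrite ?mulr_ge0// => l.
(* Half of the iterates of [B] smooth each factor. Both halves satisfy [l + 1 <= 2 (a + 1)], which
   costs a factor 2 each time, hence the constant 4. *)
pose a := (l./2)%N; pose b := (l - a)%N.
have lab : l = (b + a)%N by rewrite /b /a; lia.
apply: (@nb_le _ _ _ (c / a.+1%:R ^+ 1 * (c' / b.+1%:R ^+ 1))).
  have l0 : l.+1%:R != 0 :> R by rewrite pnatr_eq0.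
  rewrite !expr1 [leRHS](_ : _ = c * (2 / l.+1%:R) * (c' * (2 / l.+1%:R))); last first.
    by move: l0; set y : R := l.+1%:R => y0; field.
  have P n : (l.+1 <= 2 * n.+1)%N -> 0 <= (n.+1%:R : R)^-1 <= 2 / l.+1%:R.
    move=> ln; rewrite invr_ge0 ler0n /= -(ler_pM2r (x := n.+1%:R * l.+1%:R)) ?mulr_gt0 ?ltr0n//.
    rewrite mulrA mulVf ?pnatr_eq0// mul1r mulrCA mulfVK//.
    by rewrite mulrC -natrM ler_nat.
  have /andP[a0 a1] : 0 <= (a.+1%:R : R)^-1 <= 2 / l.+1%:R by apply: P; rewrite /a; lia.
  have /andP[b0 b1] : 0 <= (b.+1%:R : R)^-1 <= 2 / l.+1%:R by apply: P; rewrite /b /a; lia.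
  by apply: ler_pM; rewrite ?mulr_ge0// ler_wpM2l.
rewrite (_ : _ \o _ = (T \o iter a B) \o (T' \o iter b B)); first exact: nb_comp.
apply: eq_op => u i /=; rewrite (finC_iter a _ fB fT') -iterD.
by rewrite addnC -lab.
Qed.

(** A Taylor expansion [T = id + X + remainder], with [X] in the role of a generator and the
    remainder of order 2. *)
Definition expands T X :=
  [/\ fin T, fin X, decay 1 X & decay 2 (subop T (addop id X))].

Lemma expands_id : expands id (fun _ _ => 0).
Proof.
have f0 : @fin R V (fun _ _ => 0) by exists [::] => u i; rewrite big_nil.
split=> //; first exact: fin_id.
  by exists 0 => // l u K uK i; rewrite normr0 mul0r mul0r.
exists 0 => // l u K uK i.
by rewrite /subop /addop /scaleop /= mulN1r addr0 subrr normr0 !mul0r.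
Qed.

(** Generators add under composition. With remainders [E] and [E'] the new remainder is
    [E + X X' + X' E + T E'], and [X X'] has order 2 because both factors have order 1. *)
Lemma expands_comp T X T' X' : expands T X -> expands T' X' ->
  expands (T \o T') (addop X X').
Proof.
move=> [fT fX dX dE] [fT' fX' dX' dE']; split.
- exact: fin_comp.
- exact: fin_add.
- exact: decay_add.
set E := subop T _ in dE; set E' := subop T' _ in dE'.
rewrite (_ : subop _ _ = addop (addop E (X \o X')) (addop (X' \o E) (T \o E'))).
  apply: decay_add; apply: decay_add => //; first exact: decay_comp.
    exact: decay_compl.
  exact: decay_compl.
have fE : fin E by apply: fin_sub => //; apply: fin_add => //; exact: fin_id.
rewrite (finC fX' fE); apply: eq_op => u i.
rewrite /addop /= /E /E' /subop /addop /scaleop /= [in RHS]finD//; last first.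
rewrite [in RHS]finZ//; rewrite [in RHS]finD//; ring.
Qed.

Lemma expands_iter n T X : expands T X -> expands (iter n T) (scaleop n%:R X).
Proof.
move=> e; elim: n => [|n IH].
  rewrite (_ : scaleop _ _ = (fun _ _ => 0)); first exact: expands_id.
  by apply: eq_op => u i; rewrite /scaleop mul0r.
rewrite (_ : scaleop _ _ = addop X (scaleop n%:R X)); first exact: (expands_comp e IH).
by apply: eq_op => u i; rewrite /scaleop /addop -nat1r mulrDl mul1r.
Qed.

Lemma expands_decay T T' X : expands T X -> expands T' X -> decay 2 (subop T T').
Proof.
move=> [_ _ _ d] [_ _ _ d'].
rewrite (_ : subop T T' = subop (subop T (addop id X)) (subop T' (addop id X))).
  exact: decay_sub.
by apply: eq_op => u i; rewrite /subop /addop /scaleop /=; ring.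
Qed.

(* Lax equivalence: a one-step error of order [l^-2] along the iterates of [B]
   adds up to [O(1/n)] uniformly in the number of steps. *)
Lemma lax T : fin T -> nb T 1 -> decay 2 (subop T B) ->
  exists2 c : R, 0 <= c & forall j n,
    nb (subop (iter j T \o iter n.+1 B) (iter (j + n.+1) B)) (c / n.+1%:R).
Proof.
move=> fT nT [c c0 h]; exists c => // j.
elim: j => [|j IH] n.
  move=> u K uK i; rewrite add0n /subop /addop /scaleop /= mulN1r subrr normr0.
  by rewrite !mulr_ge0 ?invr_ge0 ?ler0n// (le_trans _ (uK i)).
(* One step of [T] is exchanged for a step of [B], in front of [n + 1] iterates of [B]; the
   remaining [j] steps then find [n + 2] of them. *)
rewrite (_ : subop _ _ = addop (iter j T \o (subop T B \o iter n.+1 B))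
   (subop (iter j T \o iter n.+2 B) (iter (j + n.+2) B))); last first.
  apply: eq_op => u i; rewrite /addop /subop /addop /scaleop /comp iterSr addSnnS.
  have fTj : fin (iter j T) by exact: fin_iter.
  rewrite [X in _ = X + _](_ : _ = iter j T (T (B (iter n B u))) i -
    iter j T (B (B (iter n B u))) i); last first.
    by rewrite -[RHS]/((fun k => _ - _) i) -finB//; congr (iter j T _ i);
       apply/funext => k; rewrite mulN1r.
  by ring.
have n1 : n.+1%:R != 0 :> R by rewrite pnatr_eq0.
have n2 : n.+2%:R != 0 :> R by rewrite pnatr_eq0.
(* Since [1/(n+2)^2 <= 1/(n+1) - 1/(n+2)], the errors telescope and the bound does not depend on
   [j]. *)
apply: (@nb_le _ _ _ (1 * (c / n.+2%:R ^+ 2) + c / n.+2%:R)); last first.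
  apply: nb_add; last exact: IH.
  exact: nb_comp (nb_iter1 _ nT) (h _).
rewrite mul1r -mulrDr ler_wpM2l//.
rewrite -subr_ge0 (_ : _ - _ = (n.+1%:R * n.+2%:R ^+ 2)^-1); last first.
  move: n1 n2; rewrite -[n.+2%:R]natr1; move: (n.+1%:R : R) => y y0 y1.
  by field; rewrite ?y0 ?y1.
by rewrite invr_ge0 mulr_ge0 ?exprn_ge0 ?ler0n.
Qed.

End consistency.

(** * Operators annihilated in the limit by the iterates of [A] *)

Section merging.
Context {R : realType} {V : zmodType}.
Notation op := ((V -> R) -> V -> R).
Implicit Types T X : op.
Variable A : op.
Hypothesis fA : fin A.
Hypothesis nA : nb A 1.

(** The norm of [A^k T] tends to 0. For [T = shift x - id] this says that the laws of the walk
    started at two points differing by [x] merge. *)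
Definition merge T := fin T /\ exists2 be : nat -> R,
  (forall k, nb (iter k A \o T) (be k)) & be @ \oo --> (0 : R).

Lemma merge_add T T' : merge T -> merge T' -> merge (addop T T').
Proof.
move=> [fT [be h c]] [fT' [be' h' c']]; split; first exact: fin_add.
exists (fun k => be k + be' k); last by rewrite -[X in _ --> X](addr0 0); exact: cvgD.
move=> k; rewrite (_ : _ \o _ = addop (iter k A \o T) (iter k A \o T')).
  exact: nb_add.
by apply: eq_op => u i /=; rewrite finD//; apply: fin_iter.
Qed.

Lemma merge_compl T T' : fin T -> merge T' -> merge (T \o T').
Proof.
move=> fT [fT' [be h c]]; split; first exact: fin_comp.
have [k k0 hk] := fin_nb fT.
exists (fun n => k * be n); last by rewrite -[X in _ --> X](mulr0 k); exact: cvgMr.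
move=> n; rewrite (_ : _ \o _ = T \o (iter n A \o T')); first exact: nb_comp.
by apply: eq_op => u i /=; rewrite finC_iter.
Qed.

Lemma merge_scale k T : merge T -> merge (scaleop k T).
Proof.
move=> mT; rewrite (_ : scaleop k T = scaleop k id \o T)//.
by apply: merge_compl => //; apply: fin_scale; exact: fin_id.
Qed.

Lemma merge_sub T T' : merge T -> merge T' -> merge (subop T T').
Proof. by move=> ? ?; apply: merge_add => //; apply: merge_scale. Qed.

Lemma merge0 : merge (fun _ _ => 0).
Proof.
split; first by exists [::] => u i; rewrite big_nil.
exists (fun=> 0); last exact: cvg_cst.
by move=> k u K uK i /=; rewrite fin0 ?normr0 ?mul0r//; apply: fin_iter.
Qed.

(* [T] with [merge (T - I)]: they form a group under composition. *)
Lemma merge1_comp T T' : merge (subop T id) -> merge (subop T' id) -> fin T ->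
  merge (subop (T \o T') id).
Proof.
move=> m m' fT.
rewrite (_ : subop _ _ = addop (T \o subop T' id) (subop T id)).
  by apply: merge_add => //; apply: merge_compl.
apply: eq_op => u i; rewrite /addop /subop /scaleop /addop /=.
rewrite [X in _ = X + _](_ : _ = T (T' u) i - T u i); first by ring.
rewrite -[RHS]/((fun k => _ - _) i) -finB//; congr (T _ i).
by apply/funext => k; rewrite mulN1r.
Qed.

Lemma merge1_iter n T : merge (subop T id) -> fin T -> merge (subop (iter n T) id).
Proof.
move=> m fT; elim: n => [|n IH]; last exact: (merge1_comp m IH fT).
rewrite (_ : subop _ _ = fun _ _ => 0); first exact: merge0.
by apply: eq_op => u i; rewrite /subop /addop /scaleop /= mulN1r subrr.
Qed.

Lemma merge1_opp x : merge (subop (shift x) id) -> merge (subop (shift (- x)) id).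
Proof.
move=> m; rewrite (_ : subop _ _ = shift (- x) \o scaleop (-1) (subop (shift x) id)).
  by apply: merge_compl; [exact: fin_shift|exact: merge_scale].
apply: eq_op => u i; rewrite /subop /addop /scaleop /shift /=.
by rewrite subrK; ring.
Qed.

Lemma merge1_lap x : merge (subop (shift x) id) -> merge (lap x).
Proof.
move=> m; rewrite lapE; apply: merge_compl; first exact: fin_shift.
have m' : merge (subop id (shift x)).
  rewrite (_ : subop _ _ = scaleop (-1) (subop (shift x) id)); first exact: merge_scale.
  by apply: eq_op => u i; rewrite /subop /addop /scaleop /=; ring.
by apply: merge_compl => //; case: m'.
Qed.

(* If [A] contains the lazy step [half x] with weight [q], a binomial number of
   such steps is made, and each of them smoothes in the direction [x]. *)
Lemma merge_shift (q : R) x X : 0 < q <= 1 -> fin X -> nb X 1 ->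
  A = addop (scaleop q (half x)) (scaleop (1 - q) X) -> merge (subop id (shift x)).
Proof.
move=> /andP[q0 q1] fX nX AE.
have fD : @fin R V (subop id (shift x)) by apply: fin_sub; [exact: fin_id|exact: fin_shift].
split => //.
pose g l : R := 2 / Num.sqrt l.+1%:R.
(* [be k l] is the mean of [g] at [l] plus a binomial number of successes in [k] trials of
   probability [q]: each step of [A] is a half step with probability [q]. *)
pose fix be k l {struct k} : R := if k is k'.+1 then q * be k' l.+1 + (1 - q) * be k' l else g l.
have nbbe k l : nb (iter k A \o (iter l (half x) \o subop id (shift x))) (be k l).
  elim: k l => [|k IH] l; first exact: half_grad.
  rewrite (_ : _ \o _ = addop (scaleop q (iter k A \o (iter l.+1 (half x) \o subop id (shift x))))
     (scaleop (1 - q) (X \o (iter k A \o (iter l (half x) \o subop id (shift x)))))); last first.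
    apply: eq_op => u i; set D := subop id (shift x).
    rewrite [LHS](_ : _ = A (iter k A (iter l (half x) (D u))) i)// {1}AE /addop /scaleop /=.
    by rewrite (finC_iter k _ fA (fin_half x)).
  apply: nb_add.
    rewrite -[X in X * _](ger0_norm (ltW q0)); apply: nb_scale; exact: IH.
  rewrite -[X in X * _]ger0_norm ?subr_ge0//; apply: nb_scale.
  rewrite -[X in nb _ X]mul1r; exact: nb_comp nX (IH l).
exists (fun k => be k 0%N); first by move=> k; exact: (nbbe k 0%N).
have gd l : 0 <= g l.+1 <= g l.
  rewrite /g divr_ge0 ?sqrtr_ge0//= ler_wpM2l// lef_pV2 ?posrE ?sqrtr_gt0 ?ltr0n//.
  by rewrite ler_sqrt ?ltr0n// ler_nat.
have beg k l : 0 <= be k l <= g l.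
  elim: k l => [|k IH] l /=; first by rewrite lexx andbT divr_ge0// sqrtr_ge0.
  have /andP[a0 a1] := IH l; have /andP[b0 b1] := IH l.+1; have /andP[_ c1] := gd l.
  rewrite addr_ge0 ?mulr_ge0 ?subr_ge0// ?(ltW q0)//=.
  rewrite [leRHS](_ : _ = q * g l + (1 - q) * g l); last by ring.
  by rewrite lerD// ler_wpM2l ?subr_ge0// ?(ltW q0)// (le_trans b1).
(* Once [be k l.+1] is below [e1], the excess of [be k l] over [e1] contracts by [1 - q] at every
   step. No estimate of binomial tails is needed. *)
have step (e0 : R) l : (forall e, e0 < e -> \forall k \near \oo, be k l.+1 <= e) ->
    (forall e, e0 < e -> \forall k \near \oo, be k l <= e).
  move=> H e e0e; have me : e0 < (e0 + e) / 2 by lra.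
  have [k0 _ Hk0] := H _ me.
  set e1 := (e0 + e) / 2 in me Hk0.
  have geo n : be (k0 + n)%N l - e1 <= (1 - q) ^+ n * `|be k0 l - e1|.
    elim: n => [|n IH]; first by rewrite addn0 expr0 mul1r ler_norm.
    rewrite addnS /= exprS -mulrA.
    have := Hk0 (k0 + n)%N; rewrite /= leq_addr => /(_ isT) b1.
    have : q * be (k0 + n)%N l.+1 <= q * e1 by rewrite ler_wpM2l// ltW.
    have : (1 - q) * (be (k0 + n)%N l - e1) <= (1 - q) * ((1 - q) ^+ n * `|be k0 l - e1|).
      by rewrite ler_wpM2l// subr_ge0.
    by lra.
  have : (fun n => (1 - q) ^+ n * `|be k0 l - e1|) @ \oo --> 0 * `|be k0 l - e1|.
    by apply: cvgMl; apply: cvg_expr; rewrite ger0_norm ?subr_ge0//; lra.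
  rewrite mul0r => /cvgrPdist_lt /(_ (e - e1)) []; first by rewrite /e1; lra.
  move=> n0 _ Hn0; exists (k0 + n0)%N => // k /= kn.
  have -> : k = (k0 + (k - k0))%N by lia.
  have := Hn0 (k - k0)%N; rewrite /= => /(_ ltac:(lia)).
  rewrite sub0r normrN => /(le_lt_trans (ler_norm _)) h.
  by have := geo (k - k0)%N; lra.
(* At level [L] the bound [be k L <= g L] holds for all [k]; it is carried down to level 0 by
   [step]. *)
have lim L : forall e, g L < e -> \forall k \near \oo, be k 0%N <= e.
  have HL : forall e, g L < e -> \forall k \near \oo, be k L <= e.
    move=> e gLe; near=> k; have /andP[_ h] := beg k L; exact: le_trans h (ltW gLe).
  move: HL; move: (g L) => e0.
  by elim: L => [//|L IH] H; apply: IH; apply: step.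
have g0 : g @ \oo --> (0 : R).
  apply/cvgrPdist_lt => e e0; have e2 : 0 < (2 / e) ^+ 2 by rewrite exprn_gt0// divr_gt0.
  exists (Num.bound ((2 / e) ^+ 2)) => // n /= hn.
  rewrite sub0r normrN ger0_norm; last by have /andP[] := beg 0%N n.
  have := archi_boundP (ltW e2) => h1.
  have h2 : (2 / e) ^+ 2 < n.+1%:R by apply: (lt_le_trans h1); rewrite ler_nat; lia.
  have h3 : 2 / e < Num.sqrt n.+1%:R.
    by rewrite -(ger0_norm (ltW (divr_gt0 _ e0)))// -sqrtr_sqr ltr_sqrt// ltr0n.
  rewrite /g ltr_pdivrMr ?sqrtr_gt0 ?ltr0n// mulrC.
  by rewrite ltr_pdivrMr// in h3.
apply/cvgrPdist_le => e e0.
have /cvgrPdist_lt /(_ _ e0) [L _ /(_ L (leqnn L))] := g0.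
rewrite sub0r normrN => /(le_lt_trans (ler_norm _)) /lim.
apply: filterS => k; rewrite sub0r normrN ger0_norm//; by have /andP[] := beg k 0%N.
Unshelve. all: by end_near.
Qed.

End merging.

(** * Monotone operators that preserve constants *)

Section positive_operators.
Context {R : realType} {V : zmodType}.
Notation op := ((V -> R) -> V -> R).
Implicit Types T : op.

Definition mono T := forall u u', (forall i, u i <= u' i) -> forall i, T u i <= T u' i.
Definition unital T := forall c, T (fun=> c) = fun=> c.

Lemma mono_comp T T' : mono T -> mono T' -> mono (T \o T').
Proof. by move=> h h' u u' uu' i; apply: h => j; apply: h'. Qed.

Lemma mono_iter n T : mono T -> mono (iter n T).
Proof. by move=> h; elim: n => [//|n IH]; apply: (mono_comp h IH). Qed.

Lemma unital_comp T T' : unital T -> unital T' -> unital (T \o T').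
Proof. by move=> h h' c /=; rewrite h' h. Qed.

Lemma unital_iter n T : unital T -> unital (iter n T).
Proof. by move=> h; elim: n => [//|n IH]; apply: (unital_comp h IH). Qed.

Lemma mono_lazy x : mono (lazy x).
Proof.
move=> u u' uu' i; rewrite /lazy /lap /addop /scaleop /=.
by have := uu' i; have := uu' (i + x); have := uu' (i - x); lra.
Qed.

Lemma unital_lazy x : unital (lazy x).
Proof. by move=> c; apply/funext => i; rewrite /lazy /lap /addop /scaleop /=; field. Qed.

Lemma mono_norm T : fin T -> mono T -> forall u M, (forall i, `|u i| <= M i) ->
  forall i, `|T u i| <= T M i.
Proof.
move=> fT mT u M uM i; rewrite ler_norml; apply/andP; split.
  rewrite lerNl -mulN1r -[leLHS]/((fun k => -1 * T u k) i) -finZ//; apply: mT => j.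
  by rewrite mulN1r (le_trans _ (uM j))// -normrN ler_norm.
by apply: mT => j; apply: le_trans (ler_norm _) (uM j).
Qed.

End positive_operators.

(** * The nearest neighbour walk on the lattice *)

Section lattice_walk.
Context {R : realType} {d : nat}.
Notation site := 'rV[int]_d.
Implicit Types (i j v x : site) (k l : 'I_d).

Definition esite k : site := \row_l (l == k)%:R.

(** The squared Euclidean norm as a natural number: edges become the values 0 and 1, and balls are
    indexed by integers, which allows summation by parts. *)
Definition nsq v : nat := (\sum_(k < d) `|v ord0 k| ^ 2)%N.

Lemma esiteE k l : esite k ord0 l = (l == k)%:R.
Proof. by rewrite mxE. Qed.

Lemma nsqE v : (nsq v)%:R = \sum_(k < d) ((v ord0 k)%:~R ^+ 2 : R).
Proof.
rewrite /nsq natr_sum; apply: eq_bigr => k _.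
by rewrite natrX natr_absz intr_norm real_normK// num_real.
Qed.

Lemma enormE v : enorm R v = Num.sqrt (nsq v)%:R.
Proof. by rewrite /enorm nsqE. Qed.

Lemma nsq_eq0 v : (nsq v == 0%N) = (v == 0).
Proof.
apply/idP/eqP => [|->]; last by rewrite /nsq big1// => k _; rewrite mxE.
rewrite /nsq sum_nat_eq0 => /forallP h; apply/rowP => k; rewrite mxE.
by have := h k; rewrite expn_eq0 absz_eq0 => /andP[/eqP].
Qed.

Lemma nsq_eq1 v : nsq v = 1%N -> exists k, v = esite k \/ v = - esite k.
Proof.
move=> v1; have [k vk] : exists k, v ord0 k != 0.
  apply/existsP; rewrite -negb_forall; apply/negP => /forallP h.
  suff /eqP : nsq v == 0%N by rewrite v1.
  by rewrite nsq_eq0; apply/eqP/rowP => k; rewrite mxE; apply/eqP.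
exists k; have : (`|v ord0 k| ^ 2 <= 1)%N.
  by rewrite -[X in (_ <= X)%N]v1 /nsq (bigD1 k)//= leq_addr.
have vk0 : (0 < `|v ord0 k|)%N by rewrite absz_gt0.
rewrite -[X in (_ <= X)%N](exp1n 2) leq_exp2r// => vk1.
have {vk0}vk1 : `|v ord0 k|%N = 1%N by lia.
have v0 l : l != k -> v ord0 l = 0.
  move=> lk; move: v1; rewrite /nsq (bigD1 k)//= vk1 exp1n => /eqP.
  rewrite -[X in _ == X]addn0 eqn_add2l sum_nat_eq0 => /forallP /(_ l).
  by rewrite lk /= expn_eq0 absz_eq0 => /andP[/eqP].
have [h|h] : v ord0 k = 1 \/ v ord0 k = -1 by lia.
  by left; apply/rowP => l; rewrite esiteE; have [->|/v0] := eqVneq l k.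
right; apply/rowP => l; rewrite mxE esiteE.
by have [->|/v0 ->] := eqVneq l k; rewrite ?h ?oppr0.
Qed.

Definition nbrs i : seq site :=
  i :: [seq i + esite k | k <- enum 'I_d] ++ [seq i - esite k | k <- enum 'I_d].

Lemma esite_neq0 k : esite k != 0.
Proof. by apply/eqP => /rowP /(_ k); rewrite esiteE eqxx mxE. Qed.

Lemma esite_inj : injective esite.
Proof.
move=> k l /rowP /(_ k); rewrite !esiteE eqxx.
by case: (eqVneq k l).
Qed.

Lemma nbrs_uniq i : uniq (nbrs i).
Proof.
have e1 : uniq [seq i + esite k | k <- enum 'I_d].
  by rewrite map_inj_uniq ?enum_uniq// => k l /addrI /esite_inj.
have e2 : uniq [seq i - esite k | k <- enum 'I_d].
  by rewrite map_inj_uniq ?enum_uniq// => k l /addrI /oppr_inj /esite_inj.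
rewrite /nbrs cons_uniq cat_uniq e1 e2 andbT mem_cat negb_or; apply/andP; split.
  apply/andP; split; apply/mapP => -[k _] /eqP.
    by rewrite -[X in X == _]addr0 (inj_eq (addrI i)) eq_sym (negbTE (esite_neq0 k)).
  by rewrite -[X in X == _]addr0 (inj_eq (addrI i)) eq_sym oppr_eq0 (negbTE (esite_neq0 k)).
apply/hasPn => _ /mapP[k _ ->]; apply/mapP => -[l _] /addrI /rowP /(_ k).
by rewrite !mxE eqxx; case: (k == l).
Qed.

Lemma edgeP i j : edge R j i <-> j \in nbrs i.
Proof.
have e v : (enorm R v = 0 \/ enorm R v = 1) <-> (nsq v = 0%N \/ nsq v = 1%N).
  rewrite enormE; split=> -[h|h].
  - left; apply/eqP; move/eqP : h; rewrite sqrtr_eq0 -[0]/(0%:R) ler_nat leqn0.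
    by [].
  - right; have := congr1 (fun y : R => y ^+ 2) h.
    by rewrite sqr_sqrtr// expr1n => /eqP; rewrite -[1]/(1%:R) eqr_nat => /eqP.
  - by left; rewrite h sqrtr0.
  - by right; rewrite h sqrtr1.
rewrite /edge e; split=> [[/eqP|/nsq_eq1[k]]|].
- by rewrite nsq_eq0 subr_eq0 => /eqP ->; rewrite mem_head.
- rewrite in_cons mem_cat => -[/eqP|/eqP]; rewrite subr_eq addrC => /eqP ->.
    by apply/or3P/Or32/mapP; exists k => //; rewrite mem_enum.
  by apply/or3P/Or33/mapP; exists k => //; rewrite mem_enum.
have n1 k : nsq (esite k) = 1%N.
  rewrite /nsq (bigD1 k)//= big1 ?addn0 ?esiteE ?eqxx// => l lk.
  by rewrite esiteE (negbTE lk).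
rewrite in_cons mem_cat => /or3P[/eqP ->|/mapP[k _ ->]|/mapP[k _ ->]].
- by left; apply/eqP; rewrite subrr nsq_eq0.
- by right; rewrite addrC addKr.
- right; rewrite addrC addKr -[RHS](n1 k) /nsq; apply: eq_bigr => l _.
  by rewrite mxE abszN.
Qed.

Lemma edge_sum (W : Type) (idx : W) (op : Monoid.com_law idx) (F : site -> W) i :
  \big[op/idx]_(j \in [set j | edge R j i]) F j = \big[op/idx]_(j <- nbrs i) F j.
Proof.
rewrite (_ : [set j | edge R j i] = [set` nbrs i]); first by rewrite -fsbig_seq// nbrs_uniq.
by apply/seteqP; split=> j /edgeP.
Qed.

(** From [|i + s e_k|^2 = |i|^2 + 1 + 2 s i_k] and [|i_k| <= |i|]. It controls the growth of the
    weights [2^|i|] under averaging. *)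
Lemma enorm_nbrs i j : j \in nbrs i -> enorm R j <= enorm R i + 1.
Proof.
have H k (s : R) : s ^+ 2 = 1 -> Num.sqrt ((nsq i)%:R + 1 + 2 * s * (i ord0 k)%:~R) <= enorm R i + 1.
  move=> s2; rewrite enormE.
  have ik : `|(i ord0 k)%:~R : R| <= Num.sqrt (nsq i)%:R.
    rewrite -sqrtr_sqr ler_sqrt// nsqE (bigD1 k)//= lerDl.
    by apply: sumr_ge0 => l _; rewrite sqr_ge0.
  have s1 : `|s| = 1 by apply/eqP; rewrite -sqrp_eq1// real_normK ?num_real// s2.
  have i0 : 0 <= Num.sqrt ((nsq i)%:R : R) by rewrite sqrtr_ge0.
  rewrite -[leRHS]ger0_norm ?addr_ge0// -sqrtr_sqr ler_sqrt ?sqr_ge0//.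
  rewrite sqrrD sqr_sqrtr// expr1n mulr1 addrAC lerD2r lerD2l.
  rewrite mulr2n -mulr2n -mulr_natl -mulrA ler_wpM2l// (le_trans (ler_norm _))//.
  by rewrite normrM s1 mul1r.
have n1 k (s : int) : s ^+ 2 = 1 -> (nsq (i + s *: esite k))%:R =
    (nsq i)%:R + 1 + 2 * s%:~R * (i ord0 k)%:~R :> R.
  move=> s2; rewrite !nsqE (bigD1 k)//= [in RHS](bigD1 k)//=.
  rewrite !mxE eqxx mulr1 (eq_bigr (fun l => (i ord0 l)%:~R ^+ 2)); last first.
    by move=> l lk; rewrite !mxE (negbTE lk) mulr0 addr0.
  have : (s%:~R : R) ^+ 2 = 1 by rewrite -rmorphXn /= s2.
  by rewrite rmorphD /= sqrrD => ->; ring.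
rewrite in_cons mem_cat => /or3P[/eqP ->|/mapP[k _ ->]|/mapP[k _ ->]].
- by rewrite lerDl.
- by rewrite -[esite k]scale1r enormE n1 ?expr1n//; apply: H; rewrite expr1n.
- by rewrite -scaleN1r enormE n1 ?sqrrN ?expr1n//; apply: H; rewrite rmorphN /= sqrrN expr1n.
Qed.

Definition avg (u : site -> R) i : R := (2 * d + 1)%:R^-1 * \sum_(j <- nbrs i) u j.

Lemma avg_sumE u i : avg u i = (2 * d + 1)%:R^-1 *
  (u i + (\sum_k u (i + esite k) + \sum_k u (i - esite k))).
Proof. rewrite /avg /nbrs big_cons big_cat; congr (_ * (_ + _)).
by congr (_ + _); rewrite big_map big_enum. Qed.

Let deg0 : (2 * d + 1)%:R != 0 :> R.
Proof. by rewrite pnatr_eq0 addn1. Qed.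

Lemma mono_avg : mono avg.
Proof.
move=> u u' uu' i; rewrite /avg ler_wpM2l ?invr_ge0 ?ler0n//.
by apply: ler_sum.
Qed.

Lemma unital_avg : unital avg.
Proof.
move=> c; apply/funext => i; rewrite avg_sumE !sumr_const card_ord.
rewrite -[c *+ d]mulr_natr; move: deg0; rewrite natrD natrM => h; field.
by [].
Qed.

Lemma fin_avg : fin avg.
Proof.
exists ([:: ((2 * d + 1)%:R^-1, 0)] ++ [seq ((2 * d + 1)%:R^-1, esite k) | k <- enum 'I_d]
   ++ [seq ((2 * d + 1)%:R^-1, - esite k) | k <- enum 'I_d]) => u i.
rewrite avg_sumE !big_cat big_seq1 /= addr0 !mulrDr !mulr_sumr; congr (_ + _).
by congr (_ + _); rewrite big_map big_enum.
Qed.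

Lemma nb_unital T : @fin R _ T -> mono T -> unital T -> @nb R site T 1.
Proof.
move=> fT mT uT u K uK i; rewrite mul1r.
by apply: (le_trans (mono_norm fT mT (M := fun=> K) uK i)); rewrite uT.
Qed.

Lemma nb_avg : nb avg 1.
Proof. by apply: nb_unital; [exact: fin_avg|exact: mono_avg|exact: unital_avg]. Qed.

Lemma avg_lapE : avg = addop id (scaleop (2 * d + 1)%:R^-1
   (fun u i => \sum_(k <- enum 'I_d) lap (esite k) u i)).
Proof.
apply: eq_op => u i; rewrite /addop /scaleop avg_sumE big_enum /= /lap.
rewrite sumrB big_split /= sumr_const card_ord.
move: (\sum_k _) (\sum_k _) => a b; rewrite -mulr_natr.
move: deg0; rewrite natrD natrM => h.
by field.
Qed.

Lemma merge_esite k : merge avg (subop id (shift (esite k))).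
Proof.
have d0 : (0 < d)%N by case: (d) k => [[]|].
have d1 : (1 : R) <= d%:R by rewrite ler1n.
pose a : R := (2 * d + 1)%:R^-1.
have a0 : 0 < a by rewrite invr_gt0.
have aE : a * (2 * d%:R + 1) = 1 by rewrite /a natrD natrM mulVf// -natrM -natrD.
have q1 : 1 - 2 * a = a * (2 * d%:R - 1) by move: aE; lra.
have q0 : 0 < 1 - 2 * a by rewrite q1 mulr_gt0//; lra.
(* Staying and stepping by [esite k] both have weight [a] in [avg]; together they form the half step
   with weight [2 a]. [X] is the normalized rest. *)
pose X := scaleop (1 - 2 * a)^-1 (subop avg (scaleop (2 * a) (half (esite k)))).
apply: (@merge_shift _ _ avg fin_avg (2 * a) _ X).
- by apply/andP; split; [rewrite mulr_gt0|move: q0; lra].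
- apply: fin_scale; apply: fin_sub; first exact: fin_avg.
  by apply: fin_scale; exact: fin_half.
- move=> u K uK i; rewrite /X /scaleop normrM gtr0_norm ?invr_gt0// mulrC ler_pdivrMr// mul1r.
  rewrite /subop /addop /scaleop avg_sumE -/a /half /addop /scaleop /shift (bigD1 k)//=.
  rewrite [X in `|X|](_ : _ = a * (\sum_(l | l != k) u (i + esite l) + \sum_l u (i - esite l))); last by field.
  rewrite normrM gtr0_norm// q1 mulrCA ler_pM2l//.
  apply: (le_trans (ler_normD _ _)).
  rewrite [leRHS](_ : _ = K *+ (d.-1) + K *+ d); last first.
    rewrite -[K *+ d.-1]mulr_natr -[K *+ d]mulr_natr -mulrDr; congr (_ * _).
    by rewrite -subn1 natrB//; ring.
  apply: lerD; apply: (le_trans (ler_norm_sum _ _ _)).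
    apply: (@le_trans _ _ (\sum_(l | l != k) K)); first by apply: ler_sum.
    by rewrite sumr_const cardC1 card_ord.
  apply: (@le_trans _ _ (\sum_(l : 'I_d) K)); first by apply: ler_sum.
  by rewrite sumr_const card_ord.
- apply: eq_op => u i; rewrite /X /addop /scaleop /subop /addop /scaleop mulrA divff ?gt_eqF//.
  by ring.
Qed.

(** The vectors [x] with this property form a subgroup of the lattice that contains its basis. *)
Lemma merge_shift_avg x : merge avg (subop (shift x) id).
Proof.
have mk k : merge avg (subop (shift (esite k)) id).
  rewrite (_ : subop _ _ = scaleop (-1) (subop id (shift (esite k)))).
    by apply: merge_scale; [exact: fin_avg|exact: merge_esite].
  by apply: eq_op => u i; rewrite /subop /addop /scaleop /=; ring.
have m0 : merge avg (subop (shift 0) id).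
  rewrite (_ : subop _ _ = fun _ _ => 0); first exact: merge0 fin_avg.
  by apply: eq_op => u i; rewrite /subop /addop /scaleop /shift /= addr0 mulN1r subrr.
have mD v w : merge avg (subop (shift v) id) -> merge avg (subop (shift w) id) ->
    merge avg (subop (shift (v + w)) id).
  move=> mv mw; rewrite (_ : shift (v + w) = shift w \o shift v).
    by apply: merge1_comp => //; [exact: fin_avg|exact: fin_shift].
  by apply: eq_op => u i; rewrite /shift /= addrAC addrA.
have mn v n : merge avg (subop (shift v) id) -> merge avg (subop (shift (v *+ n)) id).
  by move=> mv; elim: n => [|n IH]; rewrite ?mulr0n// mulrS; apply: mD.
have mz v (z : int) : merge avg (subop (shift v) id) -> merge avg (subop (shift (v *~ z)) id).
  case: z => n mv; first by rewrite -pmulrn; exact: mn.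
  by rewrite NegzE mulrNz -pmulrn; apply: merge1_opp; [exact: fin_avg|exact: mn].
rewrite (_ : x = \sum_k esite k *~ x ord0 k).
  by elim/big_rec : _ => // k v _ IH; apply: mD => //; apply: mz.
apply/rowP => l; rewrite summxE (bigD1 l)//= big1 ?addr0.
  rewrite -scaler_int mxE esiteE eqxx mulr1 -[LHS]intz; by [].
by move=> k kl; rewrite -scaler_int mxE esiteE eq_sym (negbTE kl) mulr0.
Qed.

(* The hyperplane indicator trick: [1_{x_k <= j_k}] minus its translate by
   [e_k] dominates the point mass at [j]. *)
Lemma avg_kernel_decay : (0 < d)%N -> exists2 eps : nat -> R, eps @ \oo --> (0 : R) &
  forall n i j, iter n avg (fun x => (x == j)%:R) i <= eps n.
Proof.
move=> d0; pose k := Ordinal d0.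
have [_ [be nbe be0]] := merge_esite k.
exists be => // n i j.
pose u x : R := ((x ord0 k <= j ord0 k)%R : bool)%:R.
have u1 x : `|u x| <= 1 by rewrite ger0_norm// lern1; case: (_ <= _).
have := nbe n u 1 u1 i; rewrite mulr1 => /(le_trans (ler_norm _)).
apply: le_trans => /=; apply: mono_iter; first exact: mono_avg.
move=> x; rewrite /subop /addop /scaleop /shift /u mulN1r mxE esiteE eqxx.
have [->|_] := eqVneq x j.
  rewrite lexx (_ : (_ + _ <= _)%R = false) ?subr0//.
  by apply/negbTE; rewrite -ltNge ltrDl.
by rewrite subr_ge0 ler_nat; case: leP => //= h; case: leP => //; lia.
Qed.

Lemma iter_avg_local n i : exists s : seq site, uniq s /\
  forall u v : site -> R, {in s, u =1 v} -> iter n avg u i = iter n avg v i.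
Proof.
have [s e] := fin_iter n fin_avg; exists (undup [seq i + p.2 | p <- s]).
split; first exact: undup_uniq.
move=> u v uv; rewrite !e; apply: eq_big_seq => p ps; rewrite uv//.
by rewrite mem_undup; apply/mapP; exists p.
Qed.

(** Turns [A^n] into an explicit finite weighted sum, so that integrals, Volterra operators and
    second moments can be taken term by term. *)
Lemma iter_avgE n i : exists2 s : seq site, uniq s & forall u : site -> R,
  iter n avg u i = \sum_(j <- s) iter n avg (fun x => (x == j)%:R) i * u j.
Proof.
have [s [us h]] := iter_avg_local n i; exists s => // u.
have f := fin_iter n fin_avg.
transitivity (iter n avg (fun x => \sum_(j <- s) u j * (x == j)%:R) i).
  apply: h => x xs; rewrite (bigD1_seq x)//= eqxx mulr1 big1 ?addr0//.
  by move=> j jx; rewrite eq_sym (negbTE jx) mulr0.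
rewrite (fin_sum s u (fun j x => (x == j)%:R) f).
by apply: eq_bigr => j _; rewrite mulrC.
Qed.

End lattice_walk.

(** * Comparison with independent lazy coordinate walks *)

Section isotropic_comparison.
Context {R : realType} {d : nat}.
Notation site := 'rV[int]_d.
Notation esite := (@esite d).
Notation avg := (@avg R d).
Implicit Types (i j v x : site) (k l : 'I_d) (r : seq 'I_d).

Definition lazyall r t : (site -> R) -> site -> R :=
  foldr (fun k T => iter t (lazy (esite k)) \o T) id r.

Lemma fin_lazyall r t : fin (lazyall r t).
Proof.
elim: r => [|k r IH]; first exact: fin_id.
by apply: fin_comp IH; apply: fin_iter; exact: fin_lazy.
Qed.

Lemma mono_lazyall r t : mono (lazyall r t).
Proof.
elim: r => [|k r IH]; first by [].
by apply: mono_comp IH; apply: mono_iter; exact: mono_lazy.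
Qed.

Lemma unital_lazyall r t : unital (lazyall r t).
Proof.
elim: r => [|k r IH]; first by [].
by apply: unital_comp IH; apply: unital_iter; exact: unital_lazy.
Qed.

Lemma nb_lazyall r t : nb (lazyall r t) 1.
Proof. by apply: nb_unital; [exact: fin_lazyall|exact: mono_lazyall|exact: unital_lazyall]. Qed.

Lemma iter_lazyall N r t : iter N (lazyall r t) = lazyall r (N * t).
Proof.
elim: N => [|N IH].
  by rewrite mul0n; elim: r => [//|k r IHr] /=; rewrite -IHr.
rewrite (_ : iter _ _ = lazyall r t \o iter N (lazyall r t))// IH {IH}.
elim: r => [//|k r IHr] /=.
rewrite mulSn -IHr; apply/funext => u /=; rewrite iterD; congr (iter t _ _).
by rewrite (finC_iter _ _ (fin_lazy _) (fin_lazyall r t)).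
Qed.

(** The number 4 matches generators: [lazy] carries the weight 1/4 of a second difference and [avg]
    the weight [1/(2d+1)], so four lazy steps in each direction and [2d+1] steps of [avg] both have
    the sum of the [lap (esite k)] as generator. *)
Let B := lazyall (enum 'I_d) 4.

(** Among the factors of [B^l] the [4 l] lazy steps in direction [k] smooth [lap (esite k)]; the
    other directions are contractions. *)
Lemma decay_lap k : decay B 1 (lap (esite k)).
Proof.
exists 4 => // l u K uK i; rewrite expr1 /=.
have -> : iter l B u = iter (l * 4) (lazy (esite k)) (lazyall (rem k (enum 'I_d)) (l * 4) u).
  rewrite iter_lazyall.
  have : k \in enum 'I_d by rewrite mem_enum.
  elim: (enum 'I_d) => [//|a r IH]; rewrite in_cons /=.
  have [<-//|ka /= kr] := eqVneq k a.
  rewrite IH//.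
  by rewrite (finC_iter _ _ (fin_lazy _) (fin_iter _ (fin_lazy _))).
have h := lap_lazy (l * 4) (esite k).
apply: (@le_trans _ _ (4 / (l * 4).+1%:R * K)).
  by apply: h => j; rewrite -[K]mul1r; apply: nb_lazyall.
rewrite ler_wpM2r ?(le_trans _ (uK i))// ler_wpM2l// lef_pV2 ?posrE ?ltr0n//.
by rewrite ler_nat; lia.
Qed.

Lemma expands_lazy k : expands B (iter 4 (lazy (esite k))) (lap (esite k)).
Proof.
have fB : fin B by exact: fin_lazyall.
have nB : nb B 1 by exact: nb_lazyall.
rewrite (_ : lap (esite k) = scaleop 4%:R (scaleop 4^-1 (lap (esite k)))).
  apply: expands_iter => //; split.
  - exact: fin_lazy.
  - by apply: fin_scale; exact: fin_lap.
  - by apply: decay_scale; exact: decay_lap.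
  - rewrite (_ : subop _ _ = fun _ _ => 0).
      exists 0 => // l u K uK i; by rewrite normr0 mul0r mul0r.
    by apply: eq_op => u i; rewrite /subop /lazy /addop /scaleop /=; ring.
by apply: eq_op => u i; rewrite /scaleop mulrA divff ?mul1r// pnatr_eq0.
Qed.

Lemma expands_lazyall r : expands B (lazyall r 4) (fun u i => \sum_(k <- r) lap (esite k) u i).
Proof.
have fB : fin B by exact: fin_lazyall.
have nB : nb B 1 by exact: nb_lazyall.
elim: r => [|k r IH].
  rewrite (_ : (fun _ _ => _) = fun _ _ => 0); first exact: expands_id.
  by apply: eq_op => u i; rewrite big_nil.
rewrite (_ : (fun _ _ => _) = addop (lap (esite k)) (fun u i => \sum_(k <- r) lap (esite k) u i)).
  exact: expands_comp (expands_lazy k) IH.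
by apply: eq_op => u i; rewrite big_cons.
Qed.

Lemma expands_avg : expands B (iter (2 * d + 1) avg)
  (fun u i => \sum_(k <- enum 'I_d) lap (esite k) u i).
Proof.
have fB : fin B by exact: fin_lazyall.
have nB : nb B 1 by exact: nb_lazyall.
have d0 : (2 * d + 1)%:R != 0 :> R by rewrite pnatr_eq0 addn1.
set X := (X in expands _ _ X).
have [_ fX dX _] := expands_lazyall (enum 'I_d).
rewrite (_ : X = scaleop (2 * d + 1)%:R (scaleop (2 * d + 1)%:R^-1 X)).
  apply: expands_iter => //; split.
  - exact: fin_avg.
  - exact: fin_scale.
  - exact: decay_scale.
  - rewrite (_ : subop _ _ = fun _ _ => 0).
      exists 0 => // l u K uK i; by rewrite normr0 mul0r mul0r.
    by apply: eq_op => u i; rewrite /subop avg_lapE /X /addop /scaleop /=; ring.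
by apply: eq_op => u i; rewrite /scaleop mulrA divff ?mul1r.
Qed.

(* The walk at time [(2d+1) n] is compared with [d] independent lazy binomial
   walks at time [4 n]; both have the same generator up to fourth differences. *)
Lemma avg_vs_lazy (u : site -> R) M : (forall i, `|u i| <= M) ->
  (fun n => lazyall (enum 'I_d) (n * 4) u 0) @ \oo --> (0 : R) ->
  (fun n => iter (n * (2 * d + 1)) avg u 0) @ \oo --> (0 : R).
Proof.
move=> uM Bu; have M0 : 0 <= M := le_trans (normr_ge0 _) (uM 0).
have fB : fin B by exact: fin_lazyall.
have nB : nb B 1 by exact: nb_lazyall.
pose A' := iter (2 * d + 1) avg.
have fA' : fin A' by apply: fin_iter; exact: fin_avg.
have nA' : nb A' 1 by apply: nb_iter1; exact: nb_avg.
have [c c0 lx] := lax fA' nA' (expands_decay expands_avg (expands_lazyall _)).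
have iA n : iter (n * (2 * d + 1)) avg u = iter n A' u by rewrite iterM.
apply/cvgrPdist_le => e e0.
(* [n0] fixes how many steps of [B] are applied first; the error of [lax] is then small whatever the
   number of later steps. *)
have [n0 hn0] : exists n0 : nat, c / n0.+1%:R * M <= e / 3.
  exists (Num.bound (3 * c * M / e)).
  have := archi_boundP (divr_ge0 (mulr_ge0 (mulr_ge0 (ler0n R 3) c0) M0) (ltW e0)).
  set n := Num.bound _ => h; have n1 : (n%:R : R) <= n.+1%:R by rewrite ler_nat.
  rewrite mulrAC ler_pdivrMr ?ltr0n//.
  rewrite ltr_pdivrMr// in h; have : n%:R * e <= n.+1%:R * e by rewrite ler_pM2r.
  by lra.
have m1 T : @fin R _ T -> merge avg (subop T id) -> forall n, merge avg (subop (iter n T) id).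
  by move=> fT mT n; apply: merge1_iter => //; exact: fin_avg.
have mA' : merge avg (subop (iter n0.+1 A') id).
  apply: (m1 _) => //; apply: (m1 _); first exact: fin_avg.
  have -> : subop avg id = scaleop (2 * d + 1)%:R^-1
   (fun u i => \sum_(k <- enum 'I_d) lap (esite k) u i).
    by rewrite avg_lapE; apply: eq_op => w i; rewrite /subop {1 2}/addop /scaleop /=; ring.
  apply: merge_scale; first exact: fin_avg.
  elim: (enum 'I_d) => [|k r IH].
    rewrite (_ : (fun _ _ => _) = fun _ _ => 0); first exact: merge0 fin_avg.
    by apply: eq_op => w i; rewrite big_nil.
  rewrite (_ : (fun _ _ => _) = addop (lap (esite k)) (fun u i => \sum_(k <- r) lap (esite k) u i)).
    apply: merge_add => //; first exact: fin_avg.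
    by apply: merge1_lap; [exact: fin_avg|exact: merge_shift_avg].
  by apply: eq_op => w i; rewrite big_cons.
have mB : merge avg (subop (iter n0.+1 B) id).
  apply: (m1 _) => //; rewrite /B.
  elim: (enum 'I_d) => [|k r IH] /=.
    rewrite (_ : subop _ _ = fun _ _ => 0); first exact: merge0 fin_avg.
    by apply: eq_op => w i; rewrite /subop /addop /scaleop /=; ring.
  apply: merge1_comp => //; [exact: fin_avg| |by apply: fin_iter; exact: fin_lazy].
  apply: (m1 (lazy (esite k))); first exact: fin_lazy.
  rewrite (_ : subop _ _ = scaleop 4^-1 (lap (esite k))).
    apply: merge_scale; first exact: fin_avg.
    by apply: merge1_lap; [exact: fin_avg|exact: merge_shift_avg].
  by apply: eq_op => w i; rewrite /subop /lazy {1 2}/addop /scaleop /=; ring.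
have [_ [be nbe be0]] := merge_sub fin_avg mA' mB.
have [k1 _ hk1] : \forall k \near \oo, `|be k| * M <= e / 3.
  have : (fun n : nat => `|be n| * M) @ \oo --> `|0 : R| * M.
    by apply: cvgMl; apply: cvg_norm.
  rewrite normr0 mul0r => /cvgrPdist_le /(_ (e / 3)) []; first lra.
  move=> k _ hk; exists k => // n /= kn; have := hk n kn.
  by rewrite sub0r normrN ger0_norm// mulr_ge0.
have [k2 _ hk2] : \forall k \near \oo, `|lazyall (enum 'I_d) (k * 4) u 0| <= e / 3.
  move/cvgrPdist_le : Bu => /(_ (e / 3)) []; first lra.
  by move=> k _ hk; exists k => // n /= kn; have := hk n kn; rewrite sub0r normrN.
exists (n0.+1 + k1 + k2)%N => // n /= hn; rewrite sub0r normrN iA.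
pose k := (n - n0.+1)%N; have nE : n = (k + n0.+1)%N by rewrite /k; lia.
(* Three comparisons: the [n0 + 1] innermost steps change from [A'] to [B], by merging under the [k]
   outer ones; then the outer ones change too, by [lax]; and the pure power of [B] is small by
   hypothesis. *)
have h1 : `|iter k A' (iter n0.+1 A' u) 0 - iter k A' (iter n0.+1 B u) 0| <= e / 3.
  have hk := hk1 (k * (2 * d + 1))%N; rewrite /= in hk.
  have := nbe (k * (2 * d + 1))%N u M uM 0.
  rewrite /= iterM -/A' => /le_trans h.
  rewrite -(finB_at (iter n0.+1 A' u) (iter n0.+1 B u) 0 (fin_iter k fA')).
  rewrite (_ : (fun i => _ - _) = subop (subop (iter n0.+1 A') id) (subop (iter n0.+1 B) id) u).
    apply: h; apply: (le_trans _ (hk _)); first by rewrite ler_wpM2r// ler_norm.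
    by rewrite /k; nia.
  by apply/funext => i; rewrite /subop /addop /scaleop /=; ring.
have h2 : `|iter k A' (iter n0.+1 B u) 0 - iter (k + n0.+1) B u 0| <= e / 3.
  apply: (le_trans _ hn0); have := lx k n0 u M uM 0.
  by rewrite /subop /addop /scaleop mulN1r.
have h3 : `|iter (k + n0.+1) B u 0| <= e / 3.
  by rewrite iter_lazyall; apply: hk2 => /=; rewrite /k; lia.
rewrite nE iterD.
move: h1 h2 h3; move: (iter k A' (iter n0.+1 A' u) 0) (iter k A' (iter n0.+1 B u) 0) (iter (k + n0.+1) B u 0).
move=> a b c'; rewrite !ler_norml; lra.
Qed.

End isotropic_comparison.

(** * Gaussian bounds for binomial weights *)

Section binomial_weights.
Context {R : realType}.

(** The probability that [t] lazy steps on the integers lead from 0 to [z], that is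
    [C(2t, t+z) / 4^t]. *)
Definition bw t (z : int) : R := iter t (lazy (1 : int)) (fun y => (y == z)%:R) 0.

Lemma bw_bexp t z : bw t z = bexp (t + t) (fun j => (j%:Z == z + t%:Z)%:R).
Proof.
rewrite /bw lazy_iterE half_iterE; apply: eq_bexp => j.
by congr ((nat_of_bool _)%:R); rewrite !natz sub0r; apply/idP/idP => /eqP h; apply/eqP; lia.
Qed.

Lemma bw_nat t x (z : int) : (x <= t)%N -> `|z|%N = x ->
  bw t z = 'C(t + t, t + x)%:R / 2 ^+ (t + t).
Proof.
move=> xt zx; rewrite bw_bexp bexpE.
have h : (absz (z + t%:Z)%R < (t + t).+1)%N by lia.
rewrite (bigD1 (Ordinal h))//= big1 ?addr0; last first.
  move=> j /eqP jh; rewrite (_ : (_ == _) = false) ?mulr0//.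
  by apply/negbTE/eqP => e; apply: jh; apply/val_inj => /=; lia.
rewrite (_ : (_ == _) = true) ?mulr1; last by apply/eqP; lia.
congr (_%:R / _); have [z0|z0] := leP 0 z.
  by congr ('C(_, _)); lia.
by rewrite -bin_sub; [congr ('C(_, _)); lia|lia].
Qed.

Lemma bw_ge0 t z : 0 <= bw t z.
Proof. by rewrite bw_bexp -(bexp_cst (t + t) 0); apply: ler_bexp => j; rewrite ler0n. Qed.

(** The point mass at [t] is the indicator of [j <= t] minus its translate, so the gradient bound
    replaces Stirling's formula. *)
Lemma bw0_le t : bw t 0 <= 2 / Num.sqrt (t + t).+1%:R.
Proof.
pose g j : R := (j <= t)%N%:R.
have g1 j : `|g j| <= 1 by rewrite /g; case: (j <= t)%N; rewrite ?normr1 ?normr0.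
have := bexp_grad_le (t + t) g1; rewrite mulr1; apply: le_trans; apply: le_trans (ler_norm _).
rewrite bw_bexp -mulN1r -bexpZ -bexpD; apply: ler_bexp => j /=.
by rewrite /g; case: eqP => h; case: leqP => h1; case: leqP => h2 //=; rewrite ?mulr1 ?mulr0; try lra; lia.
Qed.

Lemma bw0_le1 t : bw t 0 <= 1.
Proof.
rewrite bw_bexp -[leRHS](bexp_cst (t + t)); apply: ler_bexp => j.
by rewrite lern1; case: (_ == _).
Qed.

Let bin_step t x : (x < t)%N ->
  'C(t + t, t + x.+1)%:R * (t + x + 1)%:R = 'C(t + t, t + x)%:R * (t%:R - x%:R) :> R.
Proof.
move=> xt; rewrite -natrB ?(ltnW xt)// -!natrM; congr (_%:R).
by have := mul_bin_left (t + t) (t + x); rewrite addnS mulnC (_ : t + t - (t + x) = t - x)%N; lia.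
Qed.

(** Successive weights have the ratio [1 - (2x+1)/(t+x+1)], at most [exp (- (2x+1)/(t+X))]; the odd
    numbers sum to [|z|^2]. *)
Lemma bw_le t X (z : int) : (`|z| <= X)%N -> (X < t)%N ->
  bw t z <= bw t 0 * expR (- ((`|z| ^ 2)%:R / (t + X)%:R)).
Proof.
move=> zX Xt; have t0 : 0 < (t + X)%:R :> R by rewrite ltr0n; lia.
rewrite (@bw_nat t `|z|%N z)//; last lia.
rewrite (@bw_nat t 0 0)// addn0 -mulrAC ler_wpM2r ?invr_ge0 ?exprn_ge0//.
elim: `|z|%N zX => [|x IH] xX; first by rewrite addn0 mul0r oppr0 expR0 mulr1.
have x0 : 0 < (t + x + 1)%:R :> R by rewrite ltr0n; lia.
rewrite -(ler_pM2r x0) bin_step; last lia.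
apply: (@le_trans _ _ ('C(t + t, t)%:R * expR (- ((x ^ 2)%:R / (t + X)%:R)) * (t%:R - x%:R))).
  by apply: ler_wpM2r; [rewrite subr_ge0 ler_nat; lia|apply: IH; lia].
rewrite -!mulrA ler_wpM2l//.
rewrite (_ : (x.+1 ^ 2)%N = (x ^ 2 + (2 * x + 1))%N); last lia.
rewrite [(x ^ 2 + _)%:R]natrD mulrDl opprD expRD -mulrA ler_wpM2l ?expR_ge0//.
have -> : t%:R - x%:R = (1 - (2 * x + 1)%:R / (t + x + 1)%:R) * (t + x + 1)%:R :> R.
  rewrite mulrBl mulfVK ?gt_eqF// mul1r.
  have -> : (2 * x + 1)%:R = 2 * x%:R + 1 :> R by rewrite natrD natrM.
  by rewrite !natrD; ring.
rewrite ler_wpM2r ?(ltW x0)//.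
apply: (@le_trans _ _ (expR (- ((2 * x + 1)%:R / (t + x + 1)%:R)))).
  by apply: expR_ge1Dx.
rewrite ler_expR lerN2 ler_wpM2l ?ler0n// lef_pV2 ?posrE// ler_nat; lia.
Qed.

(** The inverse ratio is [1 + (2x+1)/(t-x)], at most [exp ((2x+1)/(t-X))]; again the odd numbers sum
    to [|z|^2]. *)
Lemma bw_ge t X (z : int) : (`|z| <= X)%N -> (X < t)%N ->
  bw t 0 * expR (- ((`|z| ^ 2)%:R / (t - X)%:R)) <= bw t z.
Proof.
move=> zX Xt; have t0 : 0 < (t - X)%:R :> R by rewrite ltr0n; lia.
rewrite (@bw_nat t `|z|%N z)//; last lia.
rewrite (@bw_nat t 0 0)// addn0 mulrAC ler_wpM2r ?invr_ge0 ?exprn_ge0//.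
elim: `|z|%N zX => [|x IH] xX; first by rewrite addn0 mul0r oppr0 expR0 mulr1.
have x0 : 0 < (t + x + 1)%:R :> R by rewrite ltr0n; lia.
rewrite -(ler_pM2r x0) bin_step; last lia.
apply: (@le_trans _ _ ('C(t + t, t)%:R * expR (- ((x ^ 2)%:R / (t - X)%:R)) * (t%:R - x%:R))); last first.
  by apply: ler_wpM2r; [rewrite subr_ge0 ler_nat; lia|apply: IH; lia].
rewrite -!mulrA ler_wpM2l//.
rewrite (_ : (x.+1 ^ 2)%N = (x ^ 2 + (2 * x + 1))%N); last lia.
rewrite [(x ^ 2 + _)%:R]natrD mulrDl opprD expRD -mulrA ler_wpM2l ?expR_ge0//.
have tx : 0 < t%:R - x%:R :> R by rewrite subr_gt0 ltr_nat; lia.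
have -> : (t + x + 1)%:R = (1 + (2 * x + 1)%:R / (t%:R - x%:R)) * (t%:R - x%:R) :> R.
  rewrite mulrDl mulfVK ?gt_eqF// mul1r.
  have -> : (2 * x + 1)%:R = 2 * x%:R + 1 :> R by rewrite natrD natrM.
  by rewrite !natrD; ring.
rewrite mulrA -[leRHS]mul1r ler_wpM2r ?(ltW tx)//.
rewrite expRN mulrC ler_pdivrMr ?expR_gt0// mul1r.
apply: (@le_trans _ _ (expR ((2 * x + 1)%:R / (t%:R - x%:R)))); first exact: expR_ge1Dx.
rewrite ler_expR ler_wpM2l ?ler0n// lef_pV2 ?posrE//.
by rewrite -natrB ?ler_nat; lia.
Qed.

End binomial_weights.

(** * Product kernels, cubes and summation over balls *)

Section product_kernel.
Context {R : realType} {d : nat}.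
Notation site := 'rV[int]_d.
Notation esite := (@esite d).
Implicit Types (i j v x : site) (k l : 'I_d) (r : seq 'I_d).

Definition prodf (ul : 'I_d -> int -> R) : site -> R := fun x => \prod_l ul l (x ord0 l).

Lemma prodf_shift ul k x (z : int) : prodf ul (x + z *: esite k) =
  ul k (x ord0 k + z) * \prod_(l | l != k) ul l (x ord0 l).
Proof.
rewrite /prodf (bigD1 k)//= !mxE eqxx mulr1; congr (_ * _); apply: eq_bigr => l lk.
by rewrite !mxE (negbTE lk) mulr0 addr0.
Qed.

Lemma lazy_prodf ul k : lazy (esite k) (prodf ul) =
  prodf (fun l => if l == k then lazy 1 (ul l) else ul l).
Proof.
apply/funext => x; rewrite /lazy /lap /addop /scaleop /=.
have := prodf_shift ul k x 1; rewrite scale1r => ->.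
have := prodf_shift ul k x (-1); rewrite scaleN1r => ->.
have := prodf_shift ul k x 0; rewrite scale0r !addr0 => ->.
rewrite /prodf [RHS](bigD1 k)//= eqxx [in RHS](eq_bigr (fun l => ul l (x ord0 l))).
  by ring.
by move=> l /negbTE ->.
Qed.

Lemma iter_lazy_prodf t ul k : iter t (lazy (esite k)) (prodf ul) =
  prodf (fun l => if l == k then iter t (lazy 1) (ul l) else ul l).
Proof.
elim: t => [|t IH] /=; first by congr prodf; apply/funext => l; rewrite if_same.
by rewrite IH lazy_prodf; congr prodf; apply/funext => l; case: eqP.
Qed.

Lemma lazyall_prodf t ul r : uniq r -> lazyall r t (prodf ul) =
  prodf (fun l => if l \in r then iter t (lazy 1) (ul l) else ul l).
Proof.
elim: r => [//|k r IH] /= /andP[kr ur]; rewrite IH// iter_lazy_prodf.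
congr prodf; apply/funext => l; rewrite in_cons.
by have [->|] := eqVneq l k => //=; rewrite (negbTE kr).
Qed.

Lemma lazyall_delta t v :
  lazyall (enum 'I_d) t (fun x => (x == v)%:R) 0 = \prod_l bw t (v ord0 l) :> R.
Proof.
rewrite (_ : (fun x => _) = prodf (fun l y => (y == v ord0 l)%:R)).
  rewrite lazyall_prodf ?enum_uniq// /prodf; apply: eq_bigr => l _.
  by rewrite mem_enum mxE.
apply/funext => x; rewrite /prodf; have [->|/eqP xv] := eqVneq x v.
  by rewrite big1// => l _; rewrite eqxx.
have [l] : exists l, x ord0 l != v ord0 l.
  apply/existsP; rewrite -negb_forall; apply/negP => /forallP h.
  by apply: xv; apply/rowP => l; apply/eqP.
by move=> /negbTE h; rewrite (bigD1 l)//= h mul0r.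
Qed.

(** Every lazy step has variance 1/2. This is the second moment used to control the walk outside a
    large ball. *)
Lemma lazyall_nsq t r x :
  lazyall r t (fun y => (nsq y)%:R) x = (nsq x)%:R + (size r * t)%:R / 2 :> R.
Proof.
have st k (c : R) : lazy (esite k) (fun y => (nsq y)%:R + c) = fun y => (nsq y)%:R + (c + 2^-1).
  apply/funext => y; rewrite /lazy /lap /addop /scaleop /=.
  have H (z : R) (zz : int) : zz%:~R = z -> (nsq (y + zz *: esite k))%:R = (nsq y)%:R + z ^+ 2 + 2 * z * (y ord0 k)%:~R :> R.
    move=> <-; rewrite !nsqE (bigD1 k)//= [in RHS](bigD1 k)//=.
    rewrite !mxE eqxx mulr1 (eq_bigr (fun l => (y ord0 l)%:~R ^+ 2)); last first.
      by move=> l lk; rewrite !mxE (negbTE lk) mulr0 addr0.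
    by rewrite rmorphD /=; ring.
  rewrite -{1}[esite k]scale1r -[- esite k]scaleN1r (H 1)// (H (-1))//.
  by field.
have it n k (c : R) : iter n (lazy (esite k)) (fun y => (nsq y)%:R + c) =
    fun y => (nsq y)%:R + (c + n%:R / 2).
  elim: n => [|n IH]; first by rewrite mul0r addr0.
  by rewrite iterS IH st; apply/funext => y; rewrite -[n.+1%:R]natr1; field.
suff -> : lazyall r t (fun y => (nsq y)%:R : R) = fun y => (nsq y)%:R + (size r * t)%:R / 2 by [].
elim: r => [|k r IH] /=; first by apply/funext => y; rewrite mul0r addr0.
by rewrite IH it; apply/funext => y; rewrite mulSn natrD; field.
Qed.

Definition cube X : seq site :=
  [seq (\row_k ((J k : nat)%:Z - X%:Z)) | J : {ffun 'I_d -> 'I_(X + X).+1}].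

Lemma size_cube X : size (cube X) = ((2 * X + 1) ^ d)%N.
Proof. by rewrite /cube size_map -cardE card_ffun !card_ord; congr (_ ^ _)%N; lia. Qed.

Lemma cube_uniq X : uniq (cube X).
Proof.
rewrite map_inj_uniq ?enum_uniq// => J J' /rowP h; apply/ffunP => k.
by have := h k; rewrite !mxE => /addIr [] /val_inj.
Qed.

Lemma mem_cube X v : (forall k, (`|v ord0 k| <= X)%N) -> v \in cube X.
Proof.
move=> vX; apply/mapP; exists [ffun k => inord (absz (v ord0 k + X%:Z))].
  by rewrite mem_enum.
apply/rowP => k; have := vX k; rewrite mxE ffunE; move: (v ord0 k) => z zX.
by rewrite inordK; lia.
Qed.

Lemma nsq_cube X v : (nsq v <= X ^ 2)%N -> v \in cube X.
Proof.
move=> vX; apply: mem_cube => k; rewrite -(@leq_exp2r _ _ 2)//; apply: leq_trans vX.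
by rewrite /nsq (bigD1 k)//= leq_addr.
Qed.

(** Summation by parts in the squared radius: a nonincreasing radial weight is a positive
    combination of indicators of balls, with total mass at most [a 0]. *)
Lemma abel_ball (s : seq site) (a : nat -> R) (F : site -> R) (b : R) Q :
  (forall q, 0 <= a q.+1 <= a q) ->
  (forall q, (q <= Q)%N -> `|\sum_(v <- s | (nsq v <= q)%N) F v| <= b) ->
  `|\sum_(v <- s | (nsq v <= Q)%N) a (nsq v) * F v| <= a 0%N * b.
Proof.
move=> ad; pose S q := \sum_(v <- s | (nsq v <= q)%N) F v.
have E : \sum_(v <- s | (nsq v <= Q)%N) a (nsq v) * F v =
    \sum_(q < Q) (a q - a q.+1) * S q + a Q * S Q.
  elim: Q => [|Q IH].
    rewrite big_ord0 add0r /S mulr_sumr; apply: eq_bigr => v.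
    by rewrite leqn0 => /eqP ->.
  have sp (G : site -> R) : \sum_(v <- s | (nsq v <= Q.+1)%N) G v =
      \sum_(v <- s | (nsq v <= Q)%N) G v + \sum_(v <- s | nsq v == Q.+1) G v.
    rewrite (bigID (fun v => (nsq v <= Q)%N))/=; congr (_ + _); apply: eq_bigl => v; lia.
  rewrite sp IH big_ord_recr /= /S sp.
  rewrite [X in _ + X = _](eq_bigr (fun v => a Q.+1 * F v)); last by move=> v /eqP ->.
  by rewrite -mulr_sumr; ring.
move=> Sb; have b0 : 0 <= b := le_trans (normr_ge0 _) (Sb 0%N (leq0n _)).
rewrite E; apply: (le_trans (ler_normD _ _)).
apply: (@le_trans _ _ (\sum_(q < Q) (a q - a q.+1) * b + a Q * b)).
  apply: lerD.
    apply: (le_trans (ler_norm_sum _ _ _)); apply: ler_sum => q _.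
    have /andP[_ h] := ad q; rewrite normrM ger0_norm ?subr_ge0//.
    by rewrite ler_wpM2l ?subr_ge0// Sb// ltnW.
  have aQ : 0 <= a Q by case: (Q) => [|q]; [have := ad 0%N; lra|have := ad q; lra].
  by rewrite normrM ger0_norm// ler_wpM2l// Sb.
rewrite -mulr_suml -mulrDl (_ : \sum_(q < Q) _ = a 0%N - a Q) ?subrK//.
by elim: (Q) => [|q IH]; rewrite ?big_ord0 ?subrr// big_ord_recr /= IH; ring.
Qed.

End product_kernel.

(** * Averages against a nearly radial kernel *)

Section radial_average.
Context {R : realType} {d : nat}.
Hypothesis d0 : (0 < d)%N.
Notation site := 'rV[int]_d.
Notation cube := (@cube d).
Implicit Types (v : site) (u : site -> R).

Let E t := @lazyall R d (enum 'I_d) t.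
Let W t v : R := \prod_l bw t (v ord0 l).

(** The product of the one-dimensional bounds has exponents [q/(t+X)] and [q/(t-X)] with
    [q = nsq v]; for [q <= X^2] and [2 X < t] both differ from [q/t] by at most [2 X^3 / t^2]. The
    second bound serves to sum the Gaussian weights against the mass of [W]. *)
Lemma W_radial t X v : (nsq v <= X ^ 2)%N -> (2 * X < t)%N ->
  `|W t v - bw t 0 ^+ d * expR (- ((nsq v)%:R / t%:R))| <=
  bw t 0 ^+ d * expR (- ((nsq v)%:R / t%:R)) * (expR ((2 * X ^ 3)%:R / (t ^ 2)%:R) - 1) /\
  bw t 0 ^+ d * expR (- ((nsq v)%:R / t%:R)) <= expR ((2 * X ^ 3)%:R / (t ^ 2)%:R) * W t v.
Proof.
move=> vX Xt; set w0 := bw t 0 ^+ d.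
have w00 : 0 <= w0 by rewrite exprn_ge0// bw_ge0.
have t0 : 0 < t%:R :> R by rewrite ltr0n; lia.
have vk k : (`|v ord0 k| <= X)%N.
  rewrite -(@leq_exp2r _ _ 2)//; apply: leq_trans vX.
  by rewrite /nsq (bigD1 k)//= leq_addr.
set q := nsq v; set de := (2 * X ^ 3)%:R / (t ^ 2)%:R.
have prodE (a : R) : \prod_(l < d) (bw t 0 * expR (- ((`|v ord0 l| ^ 2)%:R / a))) =
    w0 * expR (- (q%:R / a)).
  rewrite big_split /= prodr_const card_ord; congr (_ * _).
  rewrite -expR_sum; congr expR; rewrite sumrN -mulr_suml; congr (- (_ * _)).
  by rewrite -natr_sum.
have up : W t v <= w0 * expR (- (q%:R / (t + X)%:R)).
  by rewrite -prodE; apply: ler_prod => l _; rewrite bw_ge0 bw_le//; lia.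
have lo : w0 * expR (- (q%:R / (t - X)%:R)) <= W t v.
  rewrite -prodE; apply: ler_prod => l _; rewrite bw_ge//; last lia.
  by rewrite mulr_ge0 ?expR_ge0// bw_ge0.
have qX : q%:R <= X%:R ^+ 2 :> R by rewrite -natrX ler_nat.
have X0 : 0 <= X%:R :> R by [].
have Xt' : 2 * X%:R <= t%:R :> R by rewrite -natrM ler_nat ltnW.
have deE : de = 2 * X%:R ^+ 3 / t%:R ^+ 2 by rewrite /de natrM !natrX.
have up1 : - (q%:R / (t + X)%:R) <= - (q%:R / t%:R) + de.
  rewrite -subr_ge0 opprK (_ : _ + _ = de - q%:R * X%:R / (t%:R * (t%:R + X%:R))); last first.
    by rewrite natrD; field; rewrite !gt_eqF//; lra.
  rewrite subr_ge0 deE.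
  apply: (@le_trans _ _ (X%:R ^+ 2 * X%:R / (t%:R * t%:R))).
    apply: ler_pM.
    - by rewrite mulr_ge0.
    - by rewrite invr_ge0 mulr_ge0 ?addr_ge0// ltW.
    - by rewrite ler_wpM2r.
    rewrite lef_pV2 ?posrE ?mulr_gt0//; last by lra.
    by rewrite ler_pM2l//; lra.
  rewrite -exprSr -expr2 ler_wpM2r ?invr_ge0 ?exprn_ge0 ?(ltW t0)//.
  by rewrite ler_peMl ?exprn_ge0// ler1n.
have lo1 : - (q%:R / t%:R) - de <= - (q%:R / (t - X)%:R).
  have tX : 0 < t%:R - X%:R :> R by lra.
  rewrite natrB; last lia.
  rewrite -subr_ge0 [X in 0 <= X](_ : _ = de - q%:R * X%:R / (t%:R * (t%:R - X%:R))); last first.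
    by field; rewrite !gt_eqF//; lra.
  rewrite subr_ge0 deE.
  apply: (@le_trans _ _ (X%:R ^+ 2 * X%:R / (t%:R * (t%:R / 2)))).
    apply: ler_pM.
    - by rewrite mulr_ge0.
    - by rewrite invr_ge0 mulr_ge0// ltW.
    - by rewrite ler_wpM2r.
    rewrite lef_pV2 ?posrE ?mulr_gt0// ?divr_gt0//.
    by rewrite ler_pM2l//; lra.
  by rewrite le_eqVlt; apply/orP; left; apply/eqP; field; rewrite gt_eqF.
set g := expR (- (q%:R / t%:R)).
have de0 : 0 <= de by rewrite /de divr_ge0.
have e1 : 1 <= expR de by rewrite -expR0 ler_expR.
have up2 : W t v <= w0 * g * expR de.
  by apply: (le_trans up); rewrite -mulrA ler_wpM2l// -expRD ler_expR.
have lo2 : w0 * g <= expR de * W t v.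
  apply: (@le_trans _ _ (expR de * (w0 * expR (- (q%:R / (t - X)%:R))))).
    by rewrite mulrCA ler_wpM2l// -expRD ler_expR; move: lo1; lra.
  by rewrite ler_wpM2l// expR_ge0.
split => //.
have wg0 : 0 <= w0 * g by rewrite mulr_ge0// expR_ge0.
have W0 : 0 <= W t v by apply: prodr_ge0 => l _; exact: bw_ge0.
rewrite ler_norml; apply/andP; split; last by move: up2; lra.
rewrite -mulNr mulrBr mulr1 lerBrDr.
(* With [e = exp de], [e (2 - e) <= 1] because [(e - 1)^2 >= 0]; this gives the lower bound the same
   form as the upper one. *)
have : w0 * g * (2 - expR de) <= W t v; last by lra.
have e0 : 0 < expR de by rewrite expR_gt0.
rewrite -(ler_pM2l e0); apply: le_trans lo2.
rewrite mulrCA -[leRHS]mulr1 ler_wpM2l//.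
by have := sqr_ge0 (expR de - 1); rewrite expr2; lra.
Qed.

(* Weights of the binomial walk outside the ball of radius [X] are controlled by
   the second moment; inside, the kernel is radially decreasing up to a factor
   close to one, and Abel summation reduces to averages over balls. *)
Lemma lazyall_radial u M t X b : (forall i, `|u i| <= M) -> (2 * X < t)%N -> (0 < X)%N ->
  (forall q, (q <= X ^ 2)%N -> `|\sum_(v <- cube X | (nsq v <= q)%N) u v| <= b) ->
  `|E t u 0| <= M * ((d * t)%:R / 2 / (X ^ 2)%:R) +
     M * ((expR ((2 * X ^ 3)%:R / (t ^ 2)%:R) - 1) * expR ((2 * X ^ 3)%:R / (t ^ 2)%:R)) +
     bw t 0 ^+ d * b.
Proof.
move=> uM Xt X0 ub; have M0 : 0 <= M := le_trans (normr_ge0 _) (uM 0).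
set e := expR _.
have fE : fin (E t) by exact: fin_lazyall.
have mE : mono (E t) by exact: mono_lazyall.
have uE : unital (E t) by exact: unital_lazyall.
pose ub1 v := (nsq v <= X ^ 2)%N%:R * u v.
pose ub2 v := (~~ (nsq v <= X ^ 2)%N)%:R * u v.
have -> : E t u 0 = E t ub1 0 + E t ub2 0.
  rewrite -[RHS]/((fun i => E t ub1 i + E t ub2 i) 0) -finD//; congr (E t _ 0).
  by apply/funext => v; rewrite /ub1 /ub2; case: (_ <= _)%N; rewrite /= mul1r mul0r ?addr0 ?add0r.
(* Chebyshev: outside the ball the indicator is at most [nsq v / X^2]. *)
have h2 : `|E t ub2 0| <= M * ((d * t)%:R / 2 / (X ^ 2)%:R).
  have X2 : 0 < (X ^ 2)%:R :> R by rewrite ltr0n expn_gt0 X0.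
  pose c := M / (X ^ 2)%:R.
  have := mono_norm fE mE (u := ub2) (M := fun v => c * (nsq v)%:R) _ 0.
  rewrite finZ// {2}/E lazyall_nsq size_enum_ord (_ : (nsq 0)%:R = 0); last first.
    by rewrite (_ : nsq 0 = 0%N)//; apply/eqP; rewrite nsq_eq0.
  rewrite add0r (_ : c * _ = M * ((d * t)%:R / 2 / (X ^ 2)%:R)); last first.
    by rewrite /c mulrAC -mulrA.
  apply=> v; rewrite /ub2 /c; case: leqP => h /=; first by rewrite mul0r normr0 !mulr_ge0 ?invr_ge0.
  rewrite mul1r (le_trans (uM v))// -mulrA ler_peMr// mulrC ler_pdivlMr// mul1r ler_nat.
  exact: ltnW.
pose s := [seq v <- cube X | (nsq v <= X ^ 2)%N].
have us : uniq s by rewrite filter_uniq// cube_uniq.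
have Ew (F : site -> R) : E t (fun v => (nsq v <= X ^ 2)%N%:R * F v) 0 = \sum_(v <- s) W t v * F v.
  rewrite (_ : (fun v => _) = (fun v => \sum_(j <- s) F j * (v == j)%:R)).
    rewrite (fin_sum s F (fun j v => (v == j)%:R) fE); apply: eq_bigr => j _.
    by rewrite mulrC /E lazyall_delta.
  apply/funext => v; have [vs|vs] := boolP (v \in s).
    rewrite (bigD1_seq v)//= eqxx mulr1 big1 ?addr0; last by move=> j jv; rewrite eq_sym (negbTE jv) mulr0.
    by move: vs; rewrite mem_filter => /andP[-> _]; rewrite mul1r.
  rewrite big1_seq; last first.
    move=> j /= js; case: eqVneq => [vj|_]; last by rewrite mulr0.
    by rewrite vj js in vs.
  move: vs; rewrite mem_filter negb_and; case: (boolP (nsq v <= X ^ 2)%N) => //= h; last by rewrite mul0r.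
  by rewrite nsq_cube.
have W0 v : 0 <= W t v by apply: prodr_ge0 => l _; exact: bw_ge0.
have sW : \sum_(v <- s) W t v <= 1.
  rewrite (eq_bigr (fun v => W t v * 1)); last by move=> v _; rewrite mulr1.
  rewrite -(Ew (fun=> 1)) -[leRHS](_ : E t (fun=> 1) 0 = 1); last by rewrite uE.
  by apply: mE => v; rewrite mulr1; case: (nsq v <= X ^ 2)%N.
pose G v : R := bw t 0 ^+ d * expR (- ((nsq v)%:R / t%:R)).
have G0 v : 0 <= G v by rewrite mulr_ge0 ?expR_ge0// exprn_ge0// bw_ge0.
have sP v : v \in s -> `|W t v - G v| <= G v * (e - 1) /\ G v <= e * W t v.
  by rewrite mem_filter => /andP[vX _]; apply: W_radial.
have e1 : 0 <= e - 1 by rewrite subr_ge0 -expR0 ler_expR divr_ge0.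
(* [|W - G| <= (e - 1) G <= (e - 1) e W], and the weights [W] sum to at most 1. *)
have h1 : `|\sum_(v <- s) (W t v - G v) * u v| <= M * ((e - 1) * e).
  apply: (le_trans (ler_norm_sum _ _ _)).
  apply: (@le_trans _ _ (\sum_(v <- s) M * ((e - 1) * e) * W t v)).
    rewrite big_seq_cond [leRHS]big_seq_cond; apply: ler_sum => v; rewrite andbT => /sP[a b'].
    rewrite normrM mulrC -!mulrA; apply: ler_pM => //.
    by apply: (le_trans a); rewrite mulrC ler_wpM2l.
  rewrite -mulr_sumr -[leRHS]mulr1 ler_wpM2l// !mulr_ge0// ?expR_ge0//.
have h3 : `|\sum_(v <- s) G v * u v| <= bw t 0 ^+ d * b.
  rewrite /s big_filter /G.
  rewrite (eq_bigr (fun v => bw t 0 ^+ d * (expR (- ((nsq v)%:R / t%:R)) * u v))); last first.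
    by move=> v _; rewrite mulrA.
  rewrite -mulr_sumr normrM ger0_norm ?exprn_ge0 ?bw_ge0// ler_wpM2l ?exprn_ge0 ?bw_ge0//.
  apply: (le_trans (abel_ball (a := fun q => expR (- (q%:R / t%:R))) _ ub)).
    move=> q; rewrite expR_ge0 ler_expR lerN2 ler_wpM2r ?invr_ge0// ler_nat//.
  by rewrite mul0r oppr0 expR0 mul1r.
have -> : E t ub1 0 = \sum_(v <- s) (W t v - G v) * u v + \sum_(v <- s) G v * u v.
  rewrite (Ew u) -big_split /=; apply: eq_bigr => v _; by rewrite mulrBl subrK.
by rewrite addrC (le_trans (ler_normD _ _))// -addrA lerD// (le_trans (ler_normD _ _))// lerD.
Qed.

Lemma expR_small (M e : R) : 0 <= M -> 0 < e ->
  exists2 y : R, 0 < y & forall x, 0 <= x <= y -> M * ((expR x - 1) * expR x) <= e.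
Proof.
move=> M0 e0.
have : (fun x : R => M * ((expR x - 1) * expR x)) @ (0 : R) --> M * ((expR 0 - 1) * expR 0).
  apply: cvgMr; apply: cvgM; last exact: continuous_expR.
  by apply: cvgB; [exact: continuous_expR|exact: cvg_cst].
rewrite expR0 subrr mul0r mulr0 => /cvgrPdist_le /(_ _ e0) [y /= y0 hy].
exists (y / 2); first by rewrite divr_gt0.
move=> x /andP[x0 xy]; have := hy x; rewrite /= sub0r normrN ger0_norm// => /(_ _).
rewrite sub0r normrN; move=> /(_ _)/(le_trans (ler_norm _)); apply.
by move: y0 xy; move: (y : R) => z; lra.
Qed.

(** The scales are [X = kap s] with [s] the integer part of [sqrt t]. The tail is of order [1/kap^2]
    and the deviation from radial symmetry is governed by [kap^3 / s]. The central weight is at most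
    [2/s], so its [d]-th power times the volume of the cube stays below [D^d] with
    [D = 2 (2 kap + 1)]. First [kap] is fixed, then [t] grows. *)
Lemma lazyall_small u M : (forall i, `|u i| <= M) ->
  (forall e, 0 < e -> exists c, forall X q, (q <= X ^ 2)%N ->
     `|\sum_(v <- cube X | (nsq v <= q)%N) u v| <= e * (2 * X + 1)%:R ^+ d + c) ->
  (fun n => E (n * 4) u 0) @ \oo --> (0 : R).
Proof.
move=> uM H; have M0 : 0 <= M := le_trans (normr_ge0 _) (uM 0).
apply/cvgrPdist_le => e e0.
have e40 : 0 < e / 4 by rewrite divr_gt0.
pose kap := (Num.bound (8 * M * d%:R / e)).+1.
have hk : M * (2 * d%:R / kap%:R ^+ 2) <= e / 4.
  have k1 : 1 <= kap%:R :> R by rewrite ler1n.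
  apply: (@le_trans _ _ (M * (2 * d%:R / kap%:R))).
    have k0 : 0 < kap%:R :> R by rewrite ltr0n.
    do 2 (apply: ler_wpM2l; rewrite ?mulr_ge0//).
    by rewrite lef_pV2 ?posrE ?exprn_gt0// expr2 ler_peMr// ltW.
  have h : 8 * M * d%:R / e <= kap%:R.
    have := archi_boundP (divr_ge0 (mulr_ge0 (mulr_ge0 (ler0n R 8) M0) (ler0n _ d)) (ltW e0)).
    by rewrite /kap -natr1; lra.
  rewrite !mulrA ler_pdivrMr; last lra.
  by move: h; rewrite ler_pdivrMr//; lra.
have [y y0 hy] := expR_small M0 e40.
pose D : R := 2 * (2 * kap%:R + 1).
have D0 : 0 < D by rewrite /D mulr_gt0// addr_gt0// mulr_gt0// ltr0n.
have [c0 hc0] := H (e / 4 / D ^+ d) (divr_gt0 e40 (exprn_gt0 _ D0)).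
pose c := `|c0|.
have hc X q : (q <= X ^ 2)%N -> `|\sum_(v <- cube X | (nsq v <= q)%N) u v| <=
   e / 4 / D ^+ d * (2 * X + 1)%:R ^+ d + c.
  by move=> /hc0 /le_trans; apply; rewrite lerD2l ler_norm.
pose s1 := (Num.bound (2 * kap%:R ^+ 3 / y) + Num.bound (8 * c / e) + 2 * kap + 2)%N.
have b1 : (Num.bound (2 * kap%:R ^+ 3 / y) <= s1)%N by rewrite /s1 -!addnA leq_addr.
have b2 : (Num.bound (8 * c / e) <= s1)%N by rewrite /s1 -!addnA addnCA leq_addr.
have b3 : (2 * kap + 2 <= s1)%N by rewrite /s1 -addnA leq_addl.
clearbody s1.
exists (s1 ^ 2)%N => // n /= hn; rewrite sub0r normrN.
pose t := (n * 4)%N; rewrite -/t.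
have ts1 : (s1 ^ 2 <= t)%N by rewrite /t; lia.
clearbody t.
have [s st] : exists s, (s ^ 2 <= t < s.+1 ^ 2)%N.
  have ex : exists s, (s ^ 2 <= t)%N by exists 0%N.
  have bd s : (s ^ 2 <= t)%N -> (s <= t)%N by nia.
  case: (ex_maxnP ex bd) => s hs hmax; exists s; rewrite hs /= ltnNge.
  by apply/negP => /hmax; rewrite ltnn.
have ss1 : (s1 <= s)%N by move: st ts1 => /andP[_ st]; nia.
pose X := (kap * s)%N.
have k1 : (1 <= kap)%N by [].
have s1' : (2 * kap + 2 <= s)%N := leq_trans b3 ss1.
have Xt : (2 * X < t)%N by move: st => /andP[st _]; rewrite /X; nia.
have X0 : (0 < X)%N by rewrite /X muln_gt0; lia.
have := lazyall_radial uM Xt X0 (hc X).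
move=> /le_trans; apply.
have sR : 0 < s%:R :> R by rewrite ltr0n; lia.
have stR : s%:R ^+ 2 <= t%:R :> R by rewrite -natrX ler_nat; case/andP: st.
have tsR : t%:R <= 4 * s%:R ^+ 2 :> R.
  by rewrite -natrX -natrM ler_nat; case/andP: st; nia.
have kR : 0 < kap%:R :> R by rewrite ltr0n.
have p1 : M * ((d * t)%:R / 2 / (X ^ 2)%:R) <= e / 4.
  apply: le_trans hk; rewrite ler_wpM2l// natrX /X !natrM exprMn.
  rewrite ler_pdivrMr ?mulr_gt0 ?exprn_gt0//.
  rewrite [leRHS]mulrA mulfVK ?gt_eqF ?exprn_gt0//.
  have : d%:R * t%:R <= d%:R * (4 * s%:R ^+ 2) :> R by rewrite ler_wpM2l.
  by lra.
have p2 : M * ((expR ((2 * X ^ 3)%:R / (t ^ 2)%:R) - 1) * expR ((2 * X ^ 3)%:R / (t ^ 2)%:R)) <= e / 4.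
  apply: hy; rewrite divr_ge0//=.
  apply: (@le_trans _ _ ((2 * X ^ 3)%:R / (s%:R ^+ 4))).
    have tR : 0 < t%:R :> R by apply: lt_le_trans stR; rewrite exprn_gt0.
    apply: ler_wpM2l; first exact: ler0n.
    rewrite natrX lef_pV2 ?posrE ?exprn_gt0//.
    by rewrite (exprM _ 2 2) lerXn2r// nnegrE ?exprn_ge0// ltW.
  rewrite natrM natrX /X natrM exprMn.
  rewrite (_ : _ / _ = 2 * kap%:R ^+ 3 / s%:R); last by field; rewrite gt_eqF.
  have := archi_boundP (divr_ge0 (mulr_ge0 (ler0n R 2) (exprn_ge0 3 (ltW kR))) (ltW y0)).
  have bs : (Num.bound (2 * kap%:R ^+ 3 / y))%:R * y <= s%:R * y.
    by rewrite ler_pM2r// ler_nat (leq_trans b1).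
  by rewrite ltr_pdivrMr// ler_pdivrMr//; move: bs; lra.
have wb : bw t 0 <= 2 / s%:R :> R.
  apply: (le_trans (bw0_le t)); rewrite ler_wpM2l// lef_pV2 ?posrE ?sqrtr_gt0 ?ltr0n//; last by rewrite -(ltr0n R).
  rewrite -(ger0_norm (ltW sR)) -sqrtr_sqr ler_sqrt ?ler0n//.
  by apply: (le_trans stR); rewrite ler_nat leqW// leq_addr.
have w0 : 0 <= bw t 0 :> R by exact: bw_ge0.
have p3 : bw t 0 ^+ d * (e / 4 / D ^+ d * (2 * X + 1)%:R ^+ d + c) <= e / 4 + e / 4.
  rewrite mulrDr; apply: lerD.
    rewrite mulrCA -exprMn mulrAC -mulrA -[leRHS]mulr1 ler_wpM2l ?(ltW e40)//.
    rewrite ler_pdivrMr ?exprn_gt0// mul1r lerXn2r ?nnegrE ?(ltW D0)//.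
      by rewrite mulr_ge0.
    apply: (@le_trans _ _ (2 / s%:R * (2 * X + 1)%:R)); first by rewrite ler_wpM2r.
    rewrite mulrAC ler_pdivrMr// /D /X natrD !natrM.
    have s1R : 1 <= s%:R :> R by rewrite ler1n -(ltr0n R).
    by move: (kap%:R : R) kR (s%:R : R) s1R => x x0 z z1; nra.
  (* Against the constant [c] a single factor [bw t 0] suffices, and [d >= 1] provides one. *)
  apply: (@le_trans _ _ (bw t 0 * c)).
    rewrite ler_wpM2r ?normr_ge0//; case: (d) d0 => // d' _.
    by rewrite exprS ler_piMr// exprn_ile1// bw0_le1.
  apply: (@le_trans _ _ (2 / s%:R * c)); first by rewrite ler_wpM2r ?normr_ge0.
  rewrite mulrAC ler_pdivrMr// mulrC -mulrA.
  have := archi_boundP (divr_ge0 (mulr_ge0 (ler0n R 8) (normr_ge0 c0)) (ltW e0)).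
  rewrite -/c => h.
  have : (Num.bound (8 * c / e))%:R <= s%:R :> R by rewrite ler_nat (leq_trans b2).
  move=> /(lt_le_trans h) /ltW; rewrite ler_pdivrMr//; lra.
by move: p1 p2 p3; lra.
Qed.

End radial_average.

(** * The mean value of [m] along the walk *)

Section mean_along_walk.
Context {R : realType} {d : nat}.
Hypothesis d0 : (0 < d)%N.
Notation site := 'rV[int]_d.
Notation avg := (@avg R d).
Implicit Types (i v : site) (m : site -> R).

Lemma lattice_ballE (r : R) (X q : nat) : (q <= X ^ 2)%N -> Num.sqrt q%:R = r ->
  lattice_ball r = [set` [seq v <- @cube d X | (nsq v <= q)%N]].
Proof.
move=> qX <-; apply/seteqP; split=> v; rewrite /lattice_ball /= enormE mem_filter.
  rewrite ler_sqrt// ler_nat => vq; rewrite vq nsq_cube//; exact: leq_trans qX.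
by move=> /andP[vq _]; rewrite ler_sqrt// ler_nat.
Qed.

(** Balls of radius at most [Y] contribute a bounded amount, which goes into [c]; beyond [Y] the
    ball average is within [e] of [mu], and the ball has at most [(2X+1)^d] sites. *)
Lemma ball_sum_small m (mu M : R) : (forall i, `|m i| <= M) ->
  ball_average m r @[r --> +oo] --> mu ->
  forall e, 0 < e -> exists c, forall X q, (q <= X ^ 2)%N ->
     `|\sum_(v <- @cube d X | (nsq v <= q)%N) (m v - mu)| <= e * (2 * X + 1)%:R ^+ d + c.
Proof.
move=> mM mmu e e0; have M0 : 0 <= M := le_trans (normr_ge0 _) (mM 0).
have [A [_ hA]] : \forall r \near +oo, `|mu - ball_average m r| <= e.
  by move/cvgrPdist_le : mmu => /(_ _ e0).
pose Y := Num.bound `|A|.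
have AY : A < Y%:R by apply: le_lt_trans (archi_boundP (normr_ge0 A)); exact: ler_norm.
exists ((2 * Y + 1)%:R ^+ d * (M + `|mu|)) => X q qX.
have szX Z q' : (size [seq v <- @cube d Z | (nsq v <= q')%N])%:R <= (2 * Z + 1)%:R ^+ d :> R.
  by rewrite -natrX -size_cube ler_nat size_filter count_size.
have [qY|qY] := leP q (Y ^ 2)%N.
  have -> : \sum_(v <- @cube d X | (nsq v <= q)%N) (m v - mu) =
      \sum_(v <- [seq v <- @cube d Y | (nsq v <= q)%N]) (m v - mu).
    rewrite -big_filter; apply: perm_big; apply: uniq_perm.
    - by rewrite filter_uniq// cube_uniq.
    - by rewrite filter_uniq// cube_uniq.
    - have h1 := lattice_ballE qX erefl; have h2 := lattice_ballE qY erefl.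
      move=> v; apply/idP/idP => hv.
        by have : [set` [seq v <- @cube d X | (nsq v <= q)%N]] v by []; rewrite -h1 h2.
      by have : [set` [seq v <- @cube d Y | (nsq v <= q)%N]] v by []; rewrite -h2 h1.
  apply: (le_trans (ler_norm_sum _ _ _)).
  apply: (@le_trans _ _ (\sum_(v <- [seq v <- @cube d Y | (nsq v <= q)%N]) (M + `|mu|))).
    by apply: ler_sum => v _; apply: (le_trans (ler_normB _ _)); rewrite lerD2r.
  rewrite big_const_seq count_predT iter_addr_0 -[leLHS]mulr_natl.
  apply: (@le_trans _ _ ((2 * Y + 1)%:R ^+ d * (M + `|mu|))).
    by rewrite ler_wpM2r ?addr_ge0.
  by rewrite lerDr mulr_ge0 ?exprn_ge0// ltW.
have Aq : A < Num.sqrt q%:R.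
  apply: (lt_trans AY); rewrite -(ger0_norm (ler0n R Y)) -sqrtr_sqr ltr_sqrt; last first.
    by rewrite ltr0n; lia.
  by rewrite -natrX ltr_nat.
have := hA _ Aq; rewrite /ball_average (lattice_ballE qX erefl).
set s := [seq v <- _ | _]; have us : uniq s by rewrite filter_uniq// cube_uniq.
rewrite -fsbig_seq//.
have -> : (#|` fset_set [set` s]|)%:R = (size s)%:R :> R.
  rewrite -[LHS]/((#|` fset_set [set` s]|)%:R : R).
  transitivity (\sum_(v \in [set` s]) (1 : R)).
    by rewrite fsbig_finite//= big_const_seq count_predT iter_addr_0.
  by rewrite -fsbig_seq// big_const_seq count_predT iter_addr_0.
have s0 : 0 < (size s)%:R :> R.
  rewrite ltr0n lt0n size_eq0; apply/eqP => sE.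
  have : 0 \in s by rewrite mem_filter nsq_cube (_ : nsq 0 = 0%N)//; apply/eqP; rewrite nsq_eq0.
  by rewrite sE.
move=> h; rewrite -big_filter -/s sumrB big_const_seq count_predT iter_addr_0 -[mu *+ _]mulr_natr.
have -> : \sum_(v <- s) m v - mu * (size s)%:R =
   - ((size s)%:R * (mu - (size s)%:R^-1 * \sum_(v <- s) m v)).
  by rewrite mulrBr mulrA divff ?gt_eqF// mul1r; ring.
rewrite normrN normrM gtr0_norm//.
apply: (@le_trans _ _ ((2 * X + 1)%:R ^+ d * e)).
  by apply: ler_pM => //; exact: szX.
by rewrite mulrC lerDl mulr_ge0 ?exprn_ge0// addr_ge0.
Qed.

Theorem avg_mean m (mu M : R) : (forall i, `|m i| <= M) ->
  ball_average m r @[r --> +oo] --> mu ->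
  forall i, (fun n => iter n avg m i) @ \oo --> mu.
Proof.
move=> mM mmu i; pose u v := m v - mu.
have uM v : `|u v| <= M + `|mu| by apply: (le_trans (ler_normB _ _)); rewrite lerD2r.
have M0 : 0 <= M + `|mu| := le_trans (normr_ge0 _) (uM 0).
pose D := (2 * d + 1)%N; have D0 : (0 < D)%N by rewrite /D addn1.
have u0 : (fun n : nat => iter (n * D) avg u 0) @ \oo --> (0 : R).
  apply: (avg_vs_lazy uM); apply: lazyall_small => //.
  exact: ball_sum_small mM mmu.
have fi n : fin (iter n avg) by apply: fin_iter; exact: fin_avg.
(* From the origin to [v], since the two starting points merge. *)
have ui v : (fun n : nat => iter (n * D) avg u v) @ \oo --> (0 : R).
  have [_ [be nbe be0]] := @merge_shift_avg R d v.
  have h n : `|iter n avg u v - iter n avg u 0| <= be n * (M + `|mu|).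
    have := nbe n u _ uM 0; rewrite /= /subop /addop.
    rewrite (_ : (fun j => _) = (fun j => shift v u j - u j)); last first.
      by apply/funext => j; rewrite /scaleop mulN1r.
    by rewrite finB_at// (finC_iter n u fin_avg (fin_shift v)) /shift add0r.
  apply/cvgrPdist_le => e e0; have e2 : 0 < e / 2 by rewrite divr_gt0.
  have : (fun n : nat => be n * (M + `|mu|)) @ \oo --> 0 * (M + `|mu|) by apply: cvgMl.
  rewrite mul0r => /cvgrPdist_le /(_ _ e2) [n1 _ hn1].
  move/cvgrPdist_le : u0 => /(_ _ e2) [n2 _ hn2].
  exists (n1 + n2)%N => // n /= nn; rewrite sub0r normrN.
  have := hn2 n; rewrite /= sub0r normrN => /(_ (leq_trans (leq_addl _ _) nn)) a.
  have nD : (n1 <= n * D)%N.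
    by apply: leq_trans (leq_pmulr _ D0); apply: leq_trans nn; exact: leq_addr.
  have := hn1 _ nD; rewrite sub0r normrN => /(le_trans (ler_norm _)) b.
  rewrite -[X in `|X|](subrK (iter (n * D) avg u 0)).
  apply: (le_trans (ler_normD _ _)); rewrite [e]splitr lerD//.
  exact: le_trans (h _) b.
(* From the multiples of [D] to the other residues: one more step of [avg] is a finite average of
   sequences with limit 0. *)
have uir r v : (fun n : nat => iter (n * D + r) avg u v) @ \oo --> (0 : R).
  elim: r v => [|r IH] v; first by under eq_fun do rewrite addn0; exact: ui.
  rewrite (_ : (fun n : nat => _) = fun n : nat => (2 * d + 1)%:R^-1 *
    \sum_(j <- nbrs v) iter (n * D + r) avg u j); last by apply/funext => n; rewrite addnS.
  rewrite -[X in _ --> X](mulr0 (2 * d + 1)%:R^-1); apply: cvgMr.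
  elim: (nbrs v) => [|j s IHs]; first by under eq_fun do rewrite big_nil; exact: cvg_cst.
  under eq_fun do rewrite big_cons.
  by have h := cvgD (IH j) IHs; rewrite addr0 in h; exact: h.
have um n : iter n avg m i = mu + iter n avg u i.
  rewrite -[LHS](_ : iter n avg (fun j => mu + u j) i = _); last first.
    by congr (iter _ _ _ _); apply/funext => j; rewrite /u addrC subrK.
  by rewrite finD// unital_iter//; exact: unital_avg.
under eq_fun do rewrite um.
apply/cvgrPdist_le => e e0.
have [N hN] : exists N : nat, forall r, (r < D)%N -> forall n, (N <= n)%N ->
    `|iter (n * D + r) avg u i| <= e.
  move: {1}D => D''; elim: D'' => [|D' [N hN]]; first by exists 0%N.
  have /cvgrPdist_le /(_ _ e0) [N' _ hN'] := uir D' i.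
  exists (N + N')%N => r; rewrite ltnS leq_eqVlt => /predU1P[->|rD] n nn.
    have := hN' n; rewrite /= sub0r normrN; apply; exact: leq_trans (leq_addl _ _) nn.
  by apply: hN => //; exact: leq_trans (leq_addr _ _) nn.
exists (N * D)%N => // n /= nn; rewrite opprD addrA subrr sub0r normrN.
rewrite (divn_eq n D); apply: hN; first by rewrite ltn_mod.
by rewrite leq_divRL.
Qed.

End mean_along_walk.

(** * Poisson measures *)

Section finite_kernels.
Local Open Scope ereal_scope.
Context d d' (X : measurableType d) (Y : measurableType d') {R : realType}.
Variable k : X -> {measure set Y -> \bar R}.
Hypothesis kfin : forall x, k x setT < +oo.

Lemma measurable_kernel_gen (G : set_system Y) :
  @measurable _ Y = <<s G >> -> setI_closed G ->
  measurable_fun setT (k ^~ setT) ->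
  (forall A, G A -> measurable_fun setT (k ^~ A)) ->
  forall A, measurable A -> measurable_fun setT (k ^~ A).
Proof.
move=> GE GI kT kG A; rewrite GE; apply: (@dynkin_induction _ _ G (fun A => measurable_fun setT (k ^~ A)) GE GI) => //.
- move=> S mS kS; rewrite (_ : (fun x => _) = fun x => k x setT - k x S).
    exact: emeasurable_funB.
  apply/funext => x; rewrite -setTD measureD ?setTI//; exact: kfin.
- move=> F mF tF kF; rewrite (_ : (fun x => _) = fun x => \sum_(i <oo) k x (F i)).
    by apply: ge0_emeasurable_sum => // n x _ _; exact: measure_ge0.
  apply/funext => x; rewrite measure_semi_bigcup//; exact: bigcup_measurable.
Qed.

End finite_kernels.

Section kernel_sections.
Local Open Scope ereal_scope.
Context d d' (X : measurableType d) (Y : measurableType d') {R : realType}.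
Variable k : X -> {measure set Y -> \bar R}.
Hypothesis kfin : forall x, k x setT < +oo.
Hypothesis kmeas : forall A, measurable A -> measurable_fun setT (k ^~ A).

(** The Dynkin argument behind Fubini's theorem, for a measure that depends on [x]; finiteness is
    used for complements. It makes the mass that a random measure gives to a random region
    measurable. *)
Lemma measurable_kernel_xsection (H : set (X * Y)) : measurable H ->
  measurable_fun setT (fun x => k x (xsection H x)).
Proof.
pose G := [set A `*` B | A in @measurable _ X & B in @measurable _ Y].
have GE : @measurable _ (X * Y)%type = <<s G >> by exact: measurable_prod_measurableType.
rewrite GE.
apply: (@dynkin_induction _ _ G (fun H => measurable_fun setT (fun x => k x (xsection H x))) GE).
- move=> _ _ [A1 mA1] [B1 mB1 <-] [A2 mA2] [B2 mB2 <-].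
  exists (A1 `&` A2); first exact: measurableI.
  by exists (B1 `&` B2); [exact: measurableI|rewrite setXI].
- under eq_fun do rewrite (_ : xsection _ _ = setT) ?xsectionE//; exact: kmeas.
- move=> _ [A mA] [B mB <-].
  rewrite (_ : (fun x => _) = fun x => (\1_A x)%:E * k x B).
    apply: emeasurable_funM; last exact: kmeas.
    by apply/measurable_EFinP; exact: measurable_indic.
  apply/funext => x; rewrite indicE; have [xA|xA] := boolP (x \in A).
    by rewrite mul1e in_xsectionX.
  by rewrite mul0e notin_xsectionX.
- move=> S mS kS; rewrite (_ : (fun x => _) = fun x => k x setT - k x (xsection S x)).
    by apply: emeasurable_funB => //; exact: kmeas.
  apply/funext => x; rewrite (_ : xsection (~` S) x = setT `\` xsection S x).
    rewrite measureD ?setTI//; [exact: measurable_xsection|exact: kfin].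
  by rewrite setTD; apply/seteqP; split=> y; rewrite /xsection /= !inE.
- move=> F mF tF kF.
  rewrite (_ : (fun x => _) = fun x => \sum_(i <oo) k x (xsection (F i) x)).
    by apply: ge0_emeasurable_sum => // n x _ _; exact: measure_ge0.
  apply/funext => x; rewrite xsection_bigcup measure_semi_bigcup//.
  + by move=> i; exact: measurable_xsection.
  + exact: trivIset_xsection.
  + by apply: bigcup_measurable => i _; exact: measurable_xsection.
Qed.

End kernel_sections.

(** * Conditional means tested on events of the past *)

Section sub_sigma_algebra.
Import HBNNSimple.
Context d (T : measurableType d) {R : realType}.
Variable P : {measure set T -> \bar R}.
Implicit Types (G : set_system T) (Y W : T -> R).

Definition adapted G Y := preimage_set_system setT Y measurable `<=` G.

Lemma adapted_measurable G Y : adapted G Y ->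
  measurable_fun (setT : set (g_sigma_algebraType G)) Y.
Proof.
by move=> aY _ B mB; apply: sub_gen_smallest; apply: aY; exists B.
Qed.

Lemma sub_g_sigma_algebra G : G `<=` measurable ->
  @measurable _ (g_sigma_algebraType G) `<=` @measurable _ T.
Proof. by move=> Gm; apply: smallest_sub => //; exact: sigma_algebra_measurable. Qed.

(** The last hypothesis says that [W] and [W'] have the same conditional expectation given [G]. The
    equality passes from events of [G] to simple functions, and by monotone limits to nonnegative
    multipliers. *)
Lemma integral_mul_sub_sigma_algebra G Y W W' : G `<=` measurable ->
  sigma_algebra setT G ->
  adapted G Y -> (forall w, 0 <= Y w) ->
  measurable_fun setT W -> (forall w, 0 <= W w) ->
  measurable_fun setT W' -> (forall w, 0 <= W' w) ->
  (forall A, G A -> \int[P]_(w in A) (W w)%:E = \int[P]_(w in A) (W' w)%:E)%E ->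
  (\int[P]_w (Y w * W w)%:E = \int[P]_w (Y w * W' w)%:E)%E.
Proof.
move=> Gm sG aY Y0 mW W0 mW' W'0 WW'.
pose TG := g_sigma_algebraType G.
have mY : measurable_fun (setT : set TG) (EFin \o Y).
  by apply/measurable_EFinP; exact: adapted_measurable.
(* The approximation is made with [G] as sigma-algebra, so that the level sets of [Yn] are events of
   [G]. *)
pose Yn := nnsfun_approx (@measurableT _ TG) mY.
have mYn n : measurable_fun (setT : set T) (Yn n : T -> R).
  move=> _ B mB; rewrite setTI; apply: (sub_g_sigma_algebra Gm).
  by have := @measurable_funPTI _ _ TG _ (Yn n) B mB.
have lim (V : T -> R) : measurable_fun setT V -> (forall w, 0 <= V w) ->
    (\int[P]_w (Y w * V w)%:E = limn (fun n => \int[P]_w (Yn n w * V w)%:E))%E.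
  move=> mV V0; rewrite -monotone_convergence//.
  - apply: eq_integral => w _; apply/esym/cvg_lim => //.
    under eq_fun do rewrite EFinM; rewrite EFinM; apply: cvgeZr => //.
    by have := @cvg_nnsfun_approx _ TG R setT measurableT _ mY (fun x _ => Y0 x) w I.
  - by move=> n; apply/measurable_EFinP; exact: measurable_funM.
  - by move=> n w _; rewrite lee_fin mulr_ge0.
  - move=> w _ n m nm; rewrite lee_fin ler_wpM2r//.
    by have /lefP := nd_nnsfun_approx (@measurableT _ TG) mY nm; apply.
rewrite (lim W)// (lim W')//; congr (limn _); apply/funext => n.
have sum (V : T -> R) : measurable_fun setT V -> (forall w, 0 <= V w) ->
   (\int[P]_w (Yn n w * V w)%:E = \sum_(c \in range (Yn n)) c%:E * \int[P]_(w in Yn n @^-1` [set c]) (V w)%:E)%E.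
  move=> mV V0.
  have mc c : measurable (Yn n @^-1` [set c] : set T).
    by rewrite -[X in measurable X]setTI; exact: mYn.
  have mcV c : measurable_fun setT (fun w : T => ((\1_(Yn n @^-1` [set c]) w : R) * V w)%:E).
    by apply/measurable_EFinP; apply: measurable_funM => //; exact: measurable_indic.
  have c0 c w : 0 <= c * \1_(Yn n @^-1` [set c]) w.
    rewrite indicE; have [|_] := boolP (w \in _); last by rewrite mulr0.
    by rewrite inE /= => <-; rewrite mulr1.
  transitivity (\int[P]_w (\sum_(c \in range (Yn n)) (c * \1_(Yn n @^-1` [set c]) w * V w)%:E))%E.
    apply: eq_integral => w _; rewrite fsumEFin//; congr EFin.
    rewrite (fimfunE (Yn n) w) !fsbig_finite//= mulr_suml//.
  rewrite ge0_integral_fsum//; last 2 first.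
  - by move=> c; apply/measurable_EFinP; apply: measurable_funM => //; apply: measurable_funM.
  - by move=> c w _; rewrite lee_fin mulr_ge0.
  apply: eq_fsbigr => c; rewrite inE /= => -[w0 _ w0c].
  have cge0 : 0 <= c by rewrite -w0c.
  under eq_integral do rewrite -mulrA EFinM.
  rewrite ge0_integralZl_EFin//; last by move=> w _; rewrite lee_fin mulr_ge0.
  congr (_ * _)%E; rewrite [RHS]integral_mkcond; apply: eq_integral => w _.
  by rewrite patchE indicE; case: ifPn => _; rewrite ?mul1r ?mul0r.
rewrite sum// sum//; apply: eq_fsbigr => c _; congr (_ * _)%E; apply: WW'.
have := @measurable_funPTI _ _ TG _ (Yn n) _ (measurable_set1 c).
by rewrite /measurable /= sigma_algebra_id.
Qed.

End sub_sigma_algebra.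

(** * Moments of Poisson variables *)

Section integer_valued.
Local Open Scope ereal_scope.
Context d (T : measurableType d) {R : realType}.
Variable P : probability T R.

(** The masses [p k] sum to 1, so outside a null event [X] is one of the integers and the integral
    splits over the events [X = k]. *)
Lemma integral_integer_valued (X : T -> \bar R) (p : nat -> \bar R) (F : \bar R -> \bar R) :
  measurable_fun setT X -> (forall k : nat, P [set w | X w = k%:R%:E] = p k) ->
  \sum_(k <oo) p k = 1 -> measurable_fun setT F -> (forall x, 0 <= F x) ->
  \int[P]_w F (X w) = \sum_(k <oo) F k%:R%:E * p k.
Proof.
move=> mX pX p1 mF F0.
pose D k := [set w | X w = k%:R%:E].
have mD k : measurable (D k).
  by have := mX measurableT [set k%:R%:E] (emeasurable_set1 _); rewrite setTI.
have tD : trivIset setT D.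
  apply/trivIsetP => i j _ _ ij; rewrite -subset0 /D => w /= [-> [] /eqP].
  by rewrite eqr_nat (negbTE ij).
have mU : measurable (\bigcup_k D k) by exact: bigcup_measurable.
have PU : P (~` \bigcup_k D k) = 0.
  rewrite probability_setC// measure_semi_bigcup// (eq_eseriesr (g := p)); last first.
    by move=> k _; exact: pX.
  by rewrite p1 subee.
have mFX : measurable_fun setT (fun w => F (X w)) by exact: measurableT_comp.
rewrite (@ge0_negligible_integral _ _ _ _ _ (~` \bigcup_k D k))//; last exact: measurableC.
rewrite setTD setCK ge0_integral_bigcup//; last exact: measurable_funS mFX.
apply: eq_eseriesr => k _.
rewrite (eq_integral (cst (F k%:R%:E))); last by move=> w; rewrite inE => ->.
by rewrite integral_cst// -pX.
Qed.

End integer_valued.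

Section poisson_moments.
Local Open Scope ereal_scope.
Context {R : realType}.

Let p (a : R) k : \bar R := poisson_prob a 0 [set k].

Let p_ge0 a k : 0 <= p a k. Proof. exact: measure_ge0. Qed.

Let p_sum a : \sum_(k <oo) p a k = 1.
Proof.
rewrite /p -[RHS](@probability_setT _ _ _ (poisson_prob a 0)).
rewrite -measure_semi_bigcup//.
- by congr (poisson_prob a 0 _); apply/seteqP; split=> // k _; exists k.
- by apply/trivIsetP => i j _ _ /eqP ij; apply/seteqP; split => // k [/= -> ji]; exact: ij.
Qed.

(** The recursion of the Poisson weights, from which both moments follow by a shift of the series.
    At [a = 0] the law is by convention the Dirac mass at 0. *)
Let p_succ a k : (0 <= a)%R -> (k.+1)%:R%:E * p a k.+1 = a%:E * p a k.
Proof.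
rewrite le_eqVlt => /predU1P[<-|a0]; rewrite /p /poisson_prob.
  by rewrite ltxx !diracE mul0e [in LHS]memNset ?mule0//=.
rewrite a0 !esum_set1 ?lee_fin ?poisson_pmf_ge0// -!EFinM; congr EFin.
rewrite /poisson_pmf a0 exprS factS natrM.
have f0 : (k`!%:R != 0 :> R)%R by rewrite pnatr_eq0 -lt0n fact_gt0.
have k0 : (k.+1%:R != 0 :> R)%R by rewrite pnatr_eq0.
move: f0 k0; move: (k`!%:R)%R (k.+1%:R)%R => x y x0 y0.
by field; rewrite x0 y0.
Qed.

Lemma poisson_mean a : (0 <= a)%R -> \sum_(k <oo) k%:R%:E * p a k = a%:E.
Proof.
move=> a0; rewrite nneseries_recl//; last by move=> k _; rewrite mule_ge0.
rewrite mul0e add0e -(@nneseries_addn _ (fun k => k%:R%:E * p a k) 1); last first.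
  by move=> k; rewrite mule_ge0.
under eq_eseriesr do rewrite addn1 p_succ//.
by rewrite nneseriesZl// p_sum mule1.
Qed.

Lemma poisson_square a : (0 <= a)%R -> \sum_(k <oo) (k%:R ^+ 2)%:E * p a k = (a + a ^+ 2)%:E.
Proof.
move=> a0; rewrite nneseries_recl//; last first.
  by move=> k _; rewrite mule_ge0// lee_fin sqr_ge0.
rewrite expr0n mul0e add0e -(@nneseries_addn _ (fun k => (k%:R ^+ 2)%:E * p a k) 1); last first.
  by move=> k; rewrite mule_ge0// lee_fin sqr_ge0.
rewrite (eq_eseriesr (g := fun k => a%:E * (p a k + k%:R%:E * p a k))); last first.
  move=> k _; rewrite addn1 expr2 EFinM -muleA p_succ// muleCA; congr (_ * _).
  by rewrite -natr1 addrC EFinD ge0_muleDl// mul1e.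
rewrite nneseriesZl; last by move=> k _; rewrite adde_ge0// mule_ge0.
rewrite nneseriesD//; last by move=> k _ _; rewrite mule_ge0.
by rewrite p_sum poisson_mean// -EFinD -EFinM mulrDr mulr1 expr2.
Qed.

Context d (T : measurableType d).
Variables (P : probability T R) (X : T -> \bar R) (a : R).
Hypotheses (mX : measurable_fun setT X) (a0 : (0 <= a)%R).
Hypothesis pX : forall k : nat, P [set w | X w = k%:R%:E] = p a k.
Hypothesis X0 : forall w, 0 <= X w.

Lemma poisson_integral : \int[P]_w X w = a%:E.
Proof.
rewrite -(poisson_mean a0); under eq_integral do rewrite -[X _]gee0_abs//.
rewrite (integral_integer_valued (F := abse) mX pX)//.
by apply: eq_eseriesr => k _; rewrite gee0_abs.
Qed.

Lemma poisson_integral_square : \int[P]_w (X w * X w) = (a + a ^+ 2)%:E.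
Proof.
rewrite -(poisson_square a0).
rewrite (eq_integral (fun w => (fun x => `|x| * `|x|) (X w))); last first.
  by move=> w _; rewrite !gee0_abs.
rewrite (integral_integer_valued (F := fun x => `|x| * `|x|) mX pX)//.
- by apply: eq_eseriesr => k _; rewrite gee0_abs// -EFinM.
- by apply: emeasurable_funM; exact: abse_measurable.
Qed.

Lemma poisson_integer : {ae P, forall w, exists k : nat, X w = k%:R%:E}.
Proof.
pose D k := [set w | X w = k%:R%:E].
have mD k : measurable (D k).
  by have := mX measurableT (emeasurable_set1 k%:R%:E); rewrite setTI.
exists (~` \bigcup_k D k); split.
- by apply: measurableC; exact: bigcup_measurable.
- rewrite probability_setC//; last exact: bigcup_measurable.
  rewrite measure_semi_bigcup//; last 2 first.
  + apply/trivIsetP => i j _ _ ij; rewrite -subset0 /D => w /= [-> [] /eqP].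
    by rewrite eqr_nat (negbTE ij).
  + exact: bigcup_measurable.
  rewrite (eq_eseriesr (g := p a)); last by move=> k _; exact: pX.
  by rewrite p_sum subee.
- by move=> w /= h [k _ kw]; apply: h; exists k.
Qed.

End poisson_moments.

(** * Expectations of independent variables *)

Section independent_expectation.
Context d (T : measurableType d) {R : realType}.
Variable P : probability T R.

Lemma sigma_algebra_preimage d' (U : measurableType d') (f : T -> U) :
  sigma_algebra setT (preimage_set_system setT f measurable).
Proof. by apply: sigma_algebra_preimage; exact: sigma_algebra_measurable. Qed.

(** Given the sigma-algebra of [W], the indicator of [A] has the constant conditional expectation
    [P A]. *)
Lemma integral_indep_event (A : set T) (W : T -> R) : measurable A ->
  measurable_fun setT W -> (forall w, 0 <= W w) ->
  (forall B, measurable B -> P (A `&` W @^-1` B) = (P A * P (W @^-1` B))%E) ->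
  (\int[P]_(w in A) (W w)%:E = P A * \int[P]_w (W w)%:E)%E.
Proof.
move=> mA mW W0 ind.
have pA : (0 <= fine (P A))%R by rewrite fine_ge0.
have fA : P A = (fine (P A))%:E by rewrite fineK// fin_num_measure.
have Gm : preimage_set_system setT W measurable `<=` @measurable _ T.
  by move=> _ [B mB <-]; exact: mW.
transitivity (\int[P]_w (W w * \1_A w)%:E)%E.
  rewrite integral_mkcond; apply: eq_integral => w _.
  by rewrite patchE indicE; case: ifPn => _; rewrite ?mulr1 ?mulr0.
rewrite (@integral_mul_sub_sigma_algebra _ _ _ P (preimage_set_system setT W measurable)
  W _ (cst (fine (P A))))//; last 2 first.
- exact: sigma_algebra_preimage.
- move=> _ [B mB <-]; rewrite setTI.
  have mWB : measurable (W @^-1` B) by rewrite -[X in measurable X]setTI; exact: mW.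
  rewrite -[RHS]/(\int[P]_(w in _) (cst (fine (P A))%:E w))%E.
  rewrite integral_indic// integral_cst// -fA; exact: ind.
under eq_integral do rewrite mulrC EFinM /=.
rewrite ge0_integralZl_EFin//; first by rewrite -fA.
  by move=> w _; rewrite lee_fin.
exact/measurable_EFinP.
Qed.

(** Given the sigma-algebra of [V], the variable [W] has a constant conditional expectation, its
    mean. *)
Lemma integral_indep_product (W V : T -> R) :
  measurable_fun setT W -> (forall w, 0 <= W w) ->
  measurable_fun setT V -> (forall w, 0 <= V w) ->
  (\int[P]_w (W w)%:E < +oo)%E ->
  (forall A B, measurable A -> measurable B ->
     P (V @^-1` A `&` W @^-1` B) = (P (V @^-1` A) * P (W @^-1` B))%E) ->
  (\int[P]_w (V w * W w)%:E = \int[P]_w (V w)%:E * \int[P]_w (W w)%:E)%E.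
Proof.
move=> mW W0 mV V0 fW ind.
have EW0 : (0 <= \int[P]_w (W w)%:E)%E by apply: integral_ge0 => w _; rewrite lee_fin.
have fE : (\int[P]_w (W w)%:E = (fine (\int[P]_w (W w)%:E))%:E)%E.
  by rewrite fineK// ge0_fin_numE.
rewrite (@integral_mul_sub_sigma_algebra _ _ _ P (preimage_set_system setT V measurable)
  V _ (cst (fine (\int[P]_w (W w)%:E))))//; last 4 first.
- by move=> _ [B mB <-]; exact: mV.
- exact: sigma_algebra_preimage.
- by move=> w; rewrite fine_ge0.
- move=> _ [B mB <-]; rewrite setTI.
  have mVB : measurable (V @^-1` B) by rewrite -[X in measurable X]setTI; exact: mV.
  rewrite (integral_indep_event mVB mW W0 (fun C mC => ind B C mB mC)).
  rewrite -[RHS]/(\int[P]_(w in _) (cst (fine (\int[P]_w (W w)%:E))%:E w))%E.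
  by rewrite integral_cst// -fE muleC.
under eq_integral do rewrite mulrC EFinM.
rewrite ge0_integralZl_EFin// -?fE ?fine_ge0//; first by rewrite muleC.
  by move=> w _; rewrite lee_fin.
exact/measurable_EFinP.
Qed.

End independent_expectation.

(** * Equality of integrated kernels on a generated sigma-algebra *)

Section kernel_integral_unique.
Local Open Scope ereal_scope.
Context d d' (X : measurableType d) (Y : measurableType d') {R : realType}.
Variables (P : {measure set X -> \bar R}) (k k' : X -> {measure set Y -> \bar R}).
Hypotheses (kfin : forall x, k x setT < +oo) (k'fin : forall x, k' x setT < +oo).
Hypothesis kmeas : forall A, measurable A -> measurable_fun setT (k ^~ A).
Hypothesis k'meas : forall A, measurable A -> measurable_fun setT (k' ^~ A).
Variable G : set_system (X * Y).
Hypotheses (Gm : G `<=` measurable) (GI : setI_closed G).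
Hypothesis intT : \int[P]_x k x setT < +oo.
Hypothesis eqT : \int[P]_x k x setT = \int[P]_x k' x setT.
Hypothesis eqG : forall H, G H ->
  \int[P]_x k x (xsection H x) = \int[P]_x k' x (xsection H x).

(** Dynkin induction; the finite total mass is what allows subtraction at complements. Applied to a
    Poisson measure and to Lebesgue measure, it carries the compensation formula from rectangles to
    all predictable sets. *)
Lemma kernel_integral_unique H : <<s G >> H ->
  \int[P]_x k x (xsection H x) = \int[P]_x k' x (xsection H x).
Proof.
pose C (H : set (X * Y)) := \int[P]_x k x (xsection H x) = \int[P]_x k' x (xsection H x).
have sm S : <<s G >> S -> measurable S.
  by move: S; apply: smallest_sub => //; exact: sigma_algebra_measurable.
have mk := measurable_kernel_xsection kfin kmeas.
have mk' := measurable_kernel_xsection k'fin k'meas.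
have xT x : xsection [set: X * Y] x = setT by apply/seteqP; split => y; rewrite /xsection /= inE.
apply: (@dynkin_induction _ (g_sigma_algebraType G) G C) => //.
- rewrite /C; under eq_integral do rewrite xT.
  by under [RHS]eq_integral do rewrite xT.
- move=> S /sm mS CS.
  have xC x : xsection (~` S) x = ~` xsection S x.
    by apply/seteqP; split=> y; rewrite /xsection /= !inE.
  have split (l : X -> {measure set Y -> \bar R}) :
      (forall A, measurable A -> measurable_fun setT (fun x => l x (xsection A x))) ->
      \int[P]_x l x (xsection (~` S) x) + \int[P]_x l x (xsection S x) = \int[P]_x l x setT.
    move=> ml; rewrite -ge0_integralD//; last 2 first.
    - by apply: ml; exact: measurableC.
    - exact: ml.
    apply: eq_integral => x _; rewrite xC -measureU//.
    + by rewrite setUC setUv.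
    + by apply: measurableC; exact: measurable_xsection.
    + exact: measurable_xsection.
    + by rewrite setICl.
  have e1 := split k mk; have e2 := split k' mk'.
  have fS : \int[P]_x k x (xsection S x) \is a fin_num.
    rewrite ge0_fin_numE; last by apply: integral_ge0.
    apply: le_lt_trans intT; rewrite -e1 leeDr//; exact: integral_ge0.
  by rewrite /C -[LHS](@addeK _ _ _ fS) e1 -[RHS](@addeK _ _ _ fS) {2}CS e2 eqT.
- move=> S mS tS CS; rewrite /C.
  have sE (l : X -> {measure set Y -> \bar R}) :
      (forall A, measurable A -> measurable_fun setT (fun x => l x (xsection A x))) ->
      \int[P]_x l x (xsection (\bigcup_n S n) x) = \sum_(n <oo) \int[P]_x l x (xsection (S n) x).
    move=> ml; rewrite -integral_nneseries//; last by move=> n; apply: ml; exact: sm (mS n).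
    apply: eq_integral => x _; rewrite xsection_bigcup measure_semi_bigcup//.
    + by move=> n; apply: measurable_xsection; exact: sm (mS _).
    + exact: trivIset_xsection.
    + by apply: bigcup_measurable => n _; apply: measurable_xsection; exact: sm (mS n).
  by rewrite (sE k mk) (sE k' mk'); apply: eq_eseriesr => n _; exact: CS.
Qed.

End kernel_integral_unique.

(** * Predictable integrals against Poisson measures *)

Section predictable_sets.
Context {R : realType} d (T : measurableType d).
Variable F : R -> set_system T.

(* The second kind of set only serves to make the family stable under
   intersection while containing the whole space. *)
Definition predictable_rect : set_system (T * (R * R)) :=
  [set H | (exists s G B, [/\ 0 <= s, F s G, measurable B &
              H = G `*` (`]s, +oo[ `*` B)]) \/
           (exists2 B, measurable B & H = setT `*` (setT `*` B))].

Hypothesis Fsa : forall t, 0 <= t -> sigma_algebra setT (F t).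
Hypothesis Fm : forall t, 0 <= t -> F t `<=` measurable.
Hypothesis Fmono : forall s t, 0 <= s -> s <= t -> F s `<=` F t.

Lemma predictable_rect_measurable : predictable_rect `<=` measurable.
Proof.
move=> H [[s [G [B [s0 FG mB ->]]]]|[B mB ->]].
  apply: measurableX; first exact: Fm FG.
  by apply: measurableX => //; exact: measurable_itv.
by apply: measurableX => //; exact: measurableX.
Qed.

Lemma predictable_measurable : <<s predictable_rect >> `<=` measurable.
Proof.
apply: smallest_sub; first exact: sigma_algebra_measurable.
exact: predictable_rect_measurable.
Qed.

Lemma sigma_algebra_setI (G : set_system T) A B : sigma_algebra setT G ->
  G A -> G B -> G (A `&` B).
Proof.
move=> sG; rewrite -{1 2 3}(sigma_algebra_id sG) => GA GB.
exact: (@measurableI _ (g_sigma_algebraType G)).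
Qed.

Lemma predictable_rectI : setI_closed predictable_rect.
Proof.
move=> _ _ [[s [G [B [s0 FG mB ->]]]]|[B mB ->]] [[s' [G' [B' [s'0 FG' mB' ->]]]]|[B' mB' ->]].
- left; exists (Num.max s s'), (G `&` G'), (B `&` B'); split.
  + by rewrite le_max s0.
  + apply: sigma_algebra_setI; first by apply: Fsa; rewrite le_max s0.
    * by apply: Fmono FG => //; rewrite le_max lexx.
    * by apply: Fmono FG' => //; rewrite le_max lexx orbT.
  + exact: measurableI.
  + rewrite -setXI; congr (_ `*` _); rewrite -setXI; congr (_ `*` _).
    by apply/seteqP; split => x; rewrite /= !in_itv/= !andbT gt_max => /andP.
- left; exists s, G, (B `&` B'); split => //; first exact: measurableI.
  by rewrite -!setXI !setIT.
- left; exists s', G', (B `&` B'); split => //; first exact: measurableI.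
  by rewrite -!setXI !setTI.
- right; exists (B `&` B'); first exact: measurableI.
  by rewrite -!setXI !setIT.
Qed.

(** Progressive measurability: a generating rectangle that starts after [t] has an empty trace on
    times up to [t], and the others are based on events of [F t]. *)
Lemma predictable_restr t H : 0 <= t -> <<s predictable_rect >> H ->
  @measurable _ (g_sigma_algebraType (F t) * (R * R))%type
    (H `&` (setT `*` (`]-oo, t] `*` setT))).
Proof.
move=> t0; pose D : set (T * (R * R)) := setT `*` (`]-oo, t] `*` setT).
pose mu := @measurable _ (g_sigma_algebraType (F t) * (R * R))%type.
have mI : @measurable _ (R * R)%type (`]-oo, t] `*` setT) by apply: measurableX => //; exact: measurable_itv.
have mD : mu D by apply: measurableX.
suff : <<s predictable_rect >> `<=` [set H | mu (H `&` D)] by apply.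
apply: smallest_sub.
- split => /=.
  + by rewrite set0I; exact: measurable0.
  + move=> A mA; rewrite setTD (_ : ~` A `&` D = D `\` (A `&` D)).
      exact: measurableD.
    by rewrite setDIr setDv setU0 setDE setIC.
  + by move=> A mA; rewrite setI_bigcupl; exact: bigcupT_measurable.
- move=> _ [[s [G [B [s0 FG mB ->]]]]|[B mB ->]] /=.
  + have [st|ts] := leP s t.
      rewrite /D -setXI setIT; apply: measurableX.
        by apply: sub_sigma_algebra; exact: Fmono FG.
      rewrite -setXI; apply: measurableX; apply: measurableI => //; exact: measurable_itv.
    rewrite /D -!setXI (_ : `]s, +oo[ `&` _ = set0).
      by rewrite set0X setX0; exact: measurable0.
    by apply/seteqP; split => x //=; rewrite !in_itv/= andbT => -[sx xt]; lra.
  + rewrite /D -!setXI setTI setIT; apply: measurableX => //.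
    by apply: measurableX => //; rewrite setTI; exact: measurable_itv.
Qed.

End predictable_sets.

Lemma integral_cst_prob d (T : measurableType d) (R : realType) (P : probability T R) (x : \bar R) :
  (\int[P]__ x = x)%E.
Proof.
have e := @integral_cst _ _ _ P setT measurableT x.
have p1 : P setT = 1%E by exact: probability_setT.
by apply: (etrans e); rewrite -[RHS]mule1 -p1.
Qed.

(** The cross term [(a - b) (z - l)] has mean zero and [(z - l)^2 <= z^2 + l^2]. Products with a
    minus sign are moved to the other side, so that only nonnegative functions are integrated. *)
Lemma integral_square_increment d (T : measurableType d) (R : realType) (P : probability T R)
  (X' a b z l : T -> R) :
  measurable_fun setT a -> measurable_fun setT b -> measurable_fun setT z -> measurable_fun setT l ->
  (forall w, 0 <= a w) -> (forall w, 0 <= b w) -> (forall w, 0 <= z w) -> (forall w, 0 <= l w) ->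
  (\int[P]_w (a w * z w)%:E = \int[P]_w (a w * l w)%:E)%E ->
  (\int[P]_w (b w * z w)%:E = \int[P]_w (b w * l w)%:E)%E ->
  (\int[P]_w (a w * l w)%:E < +oo)%E -> (\int[P]_w (b w * l w)%:E < +oo)%E ->
  (forall w, X' w = a w + z w - (b w + l w)) ->
  (\int[P]_w (X' w ^+ 2)%:E <=
   \int[P]_w ((a w - b w) ^+ 2)%:E + (\int[P]_w (z w ^+ 2)%:E + \int[P]_w (l w ^+ 2)%:E))%E.
Proof.
move=> ma mb mz ml a0 b0 z0 l0 az bz fal fbl XE.
(* [V] is the mean of [U = a l + b z] and also of [U' = a z + b l], the products that occur in the
   square with negative and with positive sign. *)
pose V := (\int[P]_w (a w * l w)%:E + \int[P]_w (b w * l w)%:E)%E.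
have p0 (f g : T -> R) : (forall w, 0 <= f w) -> (forall w, 0 <= g w) -> (0 <= \int[P]_w (f w * g w)%:E)%E.
  by move=> f0 g0; apply: integral_ge0 => w _; rewrite lee_fin mulr_ge0.
have fV : V \is a fin_num by rewrite /V fin_numD !ge0_fin_numE ?fal ?fbl// p0.
have fVV : (V + V)%E \is a fin_num by rewrite fin_numD fV.
rewrite -(@leeD2rE _ (V + V)%E)//.
have D0 (f g : T -> R) : measurable_fun setT f -> measurable_fun setT g ->
    (forall w, 0 <= f w) -> (forall w, 0 <= g w) ->
    (\int[P]_w (f w)%:E + \int[P]_w (g w)%:E = \int[P]_w (f w + g w)%:E)%E.
  move=> mf mg f0 g0; under [RHS]eq_integral do rewrite EFinD.
  by rewrite ge0_integralD//; [move=> w _; rewrite lee_fin|exact/measurable_EFinP|move=> w _; rewrite lee_fin|exact/measurable_EFinP].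
have mM (f g : T -> R) : measurable_fun setT f -> measurable_fun setT g -> measurable_fun setT (fun w => f w * g w).
  by move=> mf mg; exact: measurable_funM.
have mD (f g : T -> R) : measurable_fun setT f -> measurable_fun setT g -> measurable_fun setT (fun w => f w + g w).
  by move=> mf mg; exact: measurable_funD.
have m2 (f : T -> R) : measurable_fun setT f -> measurable_fun setT (fun w => f w ^+ 2).
  by move=> mf; exact: measurable_funX.
have mX : measurable_fun setT X'.
  by rewrite (funext XE); apply: measurable_funB; exact: mD.
have mab : measurable_fun setT (fun w => a w - b w) by exact: measurable_funB.
have [U [mU U0 UE VU]] : exists U : T -> R, [/\ measurable_fun setT U, forall w, 0 <= U w,
    (forall w, U w = a w * l w + b w * z w) & V = (\int[P]_w (U w)%:E)%E].
  exists (fun w => a w * l w + b w * z w); split => //.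
  - by apply: mD; exact: mM.
  - by move=> w; rewrite addr_ge0 ?mulr_ge0.
  - by rewrite /V -bz D0//; [exact: mM|exact: mM|move=> w; rewrite mulr_ge0|move=> w; rewrite mulr_ge0].
have [U' [mU' U'0 UE' VU']] : exists U : T -> R, [/\ measurable_fun setT U, forall w, 0 <= U w,
    (forall w, U w = a w * z w + b w * l w) & V = (\int[P]_w (U w)%:E)%E].
  exists (fun w => a w * z w + b w * l w); split => //.
  - by apply: mD; exact: mM.
  - by move=> w; rewrite addr_ge0 ?mulr_ge0.
  - by rewrite /V -az D0//; [exact: mM|exact: mM|move=> w; rewrite mulr_ge0|move=> w; rewrite mulr_ge0].
have -> : (\int[P]_w (X' w ^+ 2)%:E + (V + V) = \int[P]_w (X' w ^+ 2 + (U w + U w))%:E)%E.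
  rewrite VU D0// D0//; [exact: m2|exact: mD|by move=> w; rewrite sqr_ge0|by move=> w; rewrite addr_ge0].
have -> : (\int[P]_w ((a w - b w) ^+ 2)%:E + (\int[P]_w (z w ^+ 2)%:E + \int[P]_w (l w ^+ 2)%:E) + (V + V) =
    \int[P]_w (((a w - b w) ^+ 2 + (z w ^+ 2 + l w ^+ 2)) + (U' w + U' w))%:E)%E.
  have zl0 w : 0 <= z w ^+ 2 + l w ^+ 2 by rewrite addr_ge0 ?sqr_ge0.
  have mzl : measurable_fun setT (fun w => z w ^+ 2 + l w ^+ 2) by apply: mD; exact: m2.
  have ab0 w : 0 <= (a w - b w) ^+ 2 by exact: sqr_ge0.
  have mab2 := m2 _ mab.
  rewrite VU' (D0 U')// (D0 (fun w => z w ^+ 2))//; last 4 first.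
  - exact: m2.
  - exact: m2.
  - by move=> w; exact: sqr_ge0.
  - by move=> w; exact: sqr_ge0.
  rewrite D0// D0//; [exact: mD|exact: mD|by move=> w; rewrite addr_ge0|by move=> w; rewrite addr_ge0].
apply: ge0_le_integral => //.
- by move=> w _; rewrite lee_fin addr_ge0 ?sqr_ge0 ?addr_ge0.
- by apply/measurable_EFinP; apply: (mD (fun w => X' w ^+ 2) (fun w => U w + U w)); [exact: m2|exact: mD].
- apply/measurable_EFinP.
  exact: (mD _ _ (mD _ _ (m2 _ mab) (mD _ _ (m2 _ mz) (m2 _ ml))) (mD _ _ mU' mU')).
move=> w _; rewrite lee_fin XE UE UE'.
have := mulr_ge0 (z0 w) (l0 w).
by move: (a w) (b w) (z w) (l w) => x1 x2 x3 x4 h; nra.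
Qed.

Section plane_area.
Context {R : realType}.
Local Notation leb2 := (@lebesgue_measure R \x @lebesgue_measure R)%E.
Definition plane_area (A : set (R * R)) : set (R * R) -> \bar R :=
  fun U => leb2 (U `&` A).
Lemma plane_area0 A : plane_area A set0 = 0%E.
Proof. by rewrite /plane_area set0I; exact: measure0. Qed.
Lemma plane_area_ge0 A U : (0 <= plane_area A U)%E.
Proof. exact: measure_ge0. Qed.
Lemma plane_area_additive A (mA : measurable A) : semi_sigma_additive (plane_area A).
Proof. exact: (@measure_semi_sigma_additive _ _ _ (mrestr leb2 mA)). Qed.
Definition plane_measure A (mA : measurable A) : {measure set (R * R) -> \bar R} :=
  HB.pack (plane_area A) (isMeasure.Build _ (R * R)%type R (plane_area A) (plane_area0 A) (plane_area_ge0 A) (plane_area_additive mA)).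
Lemma plane_measureE A (mA : measurable A) U : plane_measure mA U = leb2 (U `&` A).
Proof. by []. Qed.
End plane_area.

(** * Poisson counts of predictable regions *)

Section poisson_family.
Context {R : realType} d (T : measurableType d) (P : probability T R) (I : eqType).
Variables (F : R -> set_system T) (N : I -> T -> {measure set (R * R) -> \bar R}).
Local Notation leb2 := (@lebesgue_measure R \x @lebesgue_measure R)%E.

(* A family of independent Poisson measures, with exceptional events removed
   so that local finiteness holds surely. *)
Record poisson_family : Prop := PoissonFamily {
  past_sigma : forall t, 0 <= t -> sigma_algebra setT (F t);
  past_measurable : forall t, 0 <= t -> F t `<=` measurable;
  past_mono : forall s t, 0 <= s -> s <= t -> F s `<=` F t;
  count_adapted : forall i t A, 0 <= t -> measurable A -> A `<=` strip `[0, t] ->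
    forall B, measurable B -> F t ((fun w => N i w A) @^-1` B);
  count_finite : forall i w (a b : R), (N i w (`[0%R, a] `*` `[0%R, b]) < +oo)%E;
  count_mean : forall i s G A, 0 <= s -> F s G -> measurable A ->
    A `<=` strip `]s, +oo[ -> (leb2 A < +oo)%E ->
    (\int[P]_(w in G) N i w A = P G * leb2 A)%E;
  count_square : forall i A, measurable A -> A `<=` strip `[0, +oo[ ->
    (leb2 A < +oo)%E -> (\int[P]_w (N i w A * N i w A) = leb2 A + leb2 A * leb2 A)%E;
  count_cross : forall i j A, i != j -> measurable A -> A `<=` strip `[0, +oo[ ->
    (leb2 A < +oo)%E -> (\int[P]_w (N i w A * N j w A) = leb2 A * leb2 A)%E;
  count_integer : forall i A, measurable A -> A `<=` strip `[0, +oo[ ->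
    (leb2 A < +oo)%E -> {ae P, forall w, exists k : nat, N i w A = k%:R%:E} }.

Hypothesis PN : poisson_family.
Variable H : I -> set (T * (R * R)).
Hypothesis Hpred : forall i, <<s predictable_rect F >> (H i).

(** Half-open in time, so that consecutive cells are disjoint and each lies strictly after its
    starting time; bounded in height, so that counts and areas are finite. *)
Definition cell (K s t : R) : set (R * R) := `]s, t] `*` `[0, K].

Lemma measurable_cell K s t : measurable (cell K s t).
Proof. by apply: measurableX; exact: measurable_itv. Qed.

Lemma cell_strip K s t : 0 <= s -> cell K s t `<=` strip `[0, t].
Proof.
by move=> s0 [x y]; rewrite /cell /strip/= !in_itv/= => -[/andP[sx xt] /andP[y0 _]]; rewrite xt y0 ltW//; exact: le_lt_trans sx.
Qed.

Lemma cell_strip_quadrant K s t : 0 <= s -> cell K s t `<=` strip `[0, +oo[.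
Proof.
by move=> s0 [x y]; rewrite /cell /strip/= !in_itv/= => -[/andP[sx xt] /andP[y0 _]]; rewrite y0 ltW//; exact: le_lt_trans sx.
Qed.

Lemma cell_strip_gt K s t : cell K s t `<=` strip `]s, +oo[.
Proof.
by move=> [x y]; rewrite /cell /strip/= !in_itv/= => -[/andP[sx xt] /andP[y0 _]]; rewrite sx y0.
Qed.

Lemma leb2_cell K s t : 0 <= K -> s <= t -> leb2 (cell K s t) = (K * (t - s))%:E.
Proof.
move=> K0 st; have -> : leb2 (cell K s t) = (lebesgue_measure `]s, t] * lebesgue_measure `[0%R, K])%E.
  by apply: product_measure1E; exact: measurable_itv.
rewrite !lebesgue_measure_itv/= !lte_fin.
have [->|ts] := eqVneq s t; first by rewrite ltxx mul0e subrr mulr0.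
rewrite lt_neqAle ts st/=; case: ifPn => [_|]; first by rewrite -!EFinB -EFinM mulrC subr0.
by rewrite -leNgt => K1; rewrite (_ : K = 0) ?mul0r ?mule0//; lra.
Qed.

Let count_cell i w K s t : 0 <= s -> (N i w (cell K s t) < +oo)%E.
Proof.
move=> s0; apply: le_lt_trans (count_finite PN i w t K).
apply: le_measure; rewrite ?inE; [exact: measurable_cell|by apply: measurableX; exact: measurable_itv|].
by move=> [x y]; rewrite /cell/= !in_itv/= => -[/andP[sx ->] ->]; rewrite ltW// (le_lt_trans s0 sx).
Qed.

Let leb2_fin K s t : 0 <= K -> s <= t -> (leb2 (cell K s t) < +oo)%E.
Proof. by move=> K0 st; rewrite leb2_cell// ltry. Qed.

Definition region i w K s t := xsection (H i) w `&` cell K s t.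

Lemma measurable_region i w K s t : measurable (region i w K s t).
Proof.
apply: measurableI (measurable_cell _ _ _); apply: measurable_xsection.
by apply: (predictable_measurable (past_measurable PN)); exact: Hpred.
Qed.

Definition jumps i K s t w : R := fine (N i w (region i w K s t)).
Definition area i K s t w : R := fine (leb2 (region i w K s t)).

Lemma jumpsE i K s t w : 0 <= s -> ((jumps i K s t w)%:E = N i w (region i w K s t))%E.
Proof.
move=> s0; rewrite fineK// ge0_fin_numE//; apply: le_lt_trans (count_cell i w K t s0).
apply: le_measure; rewrite ?inE; [exact: measurable_region|exact: measurable_cell|].
exact: subIsetr.
Qed.

Lemma areaE i K s t w : 0 <= K -> s <= t -> ((area i K s t w)%:E = leb2 (region i w K s t))%E.
Proof.
move=> K0 st; rewrite fineK// ge0_fin_numE//; apply: le_lt_trans (leb2_fin K0 st).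
apply: le_measure; rewrite ?inE; [exact: measurable_region|exact: measurable_cell|].
exact: subIsetr.
Qed.

Lemma jumps_ge0 i K s t w : 0 <= jumps i K s t w. Proof. exact: fine_ge0. Qed.
Lemma area_ge0 i K s t w : 0 <= area i K s t w. Proof. exact: fine_ge0. Qed.

Lemma jumps_le i K s t w : 0 <= s -> jumps i K s t w <= fine (N i w (cell K s t)).
Proof.
move=> s0; rewrite -lee_fin jumpsE// fineK; last by rewrite ge0_fin_numE ?count_cell.
apply: le_measure; rewrite ?inE; [exact: measurable_region|exact: measurable_cell|].
exact: subIsetr.
Qed.

Lemma area_le i K s t w : 0 <= K -> s <= t -> area i K s t w <= K * (t - s).
Proof.
move=> K0 st; rewrite -lee_fin areaE// -leb2_cell//.
apply: le_measure; rewrite ?inE; [exact: measurable_region|exact: measurable_cell|].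
exact: subIsetr.
Qed.

Let regionU i w K s t u : s <= t -> t <= u ->
  region i w K s u = region i w K s t `|` region i w K t u.
Proof.
move=> st tu; rewrite /region -setIUr; congr (_ `&` _).
apply/seteqP; split => -[x y]; rewrite /cell/= !in_itv/=.
  by move=> [/andP[sx xu] ->]; have [xt|tx] := leP x t; [left|right]; rewrite ?sx ?xu.
by move=> [][/andP[sx xu] ->]; rewrite ?sx ?xu ?andbT; split=> //; lra.
Qed.

Let region_disj i w K s t u : region i w K s t `&` region i w K t u = set0.
Proof.
apply/seteqP; split => -[x y]//; rewrite /region /cell/= !in_itv/=.
by move=> -[[_ [/andP[sx xt] _]] [_ [/andP[]]]]; rewrite ltNge xt.
Qed.

Lemma jumps_add i K s t u w : 0 <= s -> s <= t -> t <= u ->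
  jumps i K s u w = jumps i K s t w + jumps i K t u w.
Proof.
move=> s0 st tu; apply: EFin_inj; have t0 := le_trans s0 st.
rewrite EFinD !jumpsE// (regionU _ _ _ st tu) measureU//; try exact: measurable_region.
Qed.

Lemma area_add i K s t u w : 0 <= K -> s <= t -> t <= u ->
  area i K s u w = area i K s t w + area i K t u w.
Proof.
move=> K0 st tu; apply: EFin_inj; have su := le_trans st tu.
rewrite EFinD; apply: (etrans (areaE i w K0 su)).
apply: (etrans _ (esym (f_equal2 adde (areaE i w K0 st) (areaE i w K0 tu)))).
rewrite (regionU i w K st tu).
apply: (@measureU _ _ _ leb2); [exact: measurable_region..|exact: region_disj].
Qed.


Let kN i K s t w : {measure set (R * R) -> \bar R} := mrestr (N i w) (measurable_cell K s t).
Let kL K s t : {measure set (R * R) -> \bar R} := plane_measure (measurable_cell K s t).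

Let kN_fin i K s t w : 0 <= s -> (kN i K s t w setT < +oo)%E.
Proof. by move=> s0; rewrite /kN/= /mrestr setTI count_cell. Qed.

Let kL_fin K s t : 0 <= K -> s <= t -> (kL K s t setT < +oo)%E.
Proof. by move=> K0 st; rewrite plane_measureE setTI leb2_fin. Qed.

Let past t := g_sigma_algebraType (F t).

Let kN_adapted i K s t : 0 <= s -> s <= t -> forall A, measurable A ->
  measurable_fun (setT : set (past t)) (fun w => kN i K s t w A).
Proof.
move=> s0 st A mA _ B mB; rewrite setTI; apply: sub_sigma_algebra.
apply: (count_adapted PN i (t := t) (A := A `&` cell K s t)) => //.
- exact: le_trans st.
- by apply: measurableI => //; exact: measurable_cell.
- by apply: subset_trans (@cell_strip K s t s0); exact: subIsetr.
Qed.

Let kN_measurable i K s t : 0 <= s -> s <= t -> forall A, measurable A ->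
  measurable_fun (setT : set T) (fun w => kN i K s t w A).
Proof.
move=> s0 st A mA _ B mB; apply: (sub_g_sigma_algebra (past_measurable PN (le_trans s0 st))).
exact: (kN_adapted i K s0 st mA).
Qed.

(** [H i] cut at time [t], to be measurable for [F t] in the outcome; inside cells that end at [t]
    the cut changes nothing. *)
Let HD i t : set (T * (R * R)) := H i `&` (setT `*` (`]-oo, t] `*` setT)).

Let xsection_HD i t K s w : xsection (HD i t) w `&` cell K s t = region i w K s t.
Proof.
apply/seteqP; split=> -[x y]; rewrite /HD /region /cell /xsection/= !in_setE/= !in_itv/=.
  by move=> [[Hw _] ?]; split.
by move=> [Hw [xst y0]]; split => //; split => //; split => //; by case/andP: xst.
Qed.

Lemma jumps_measurable i K s t : 0 <= s -> s <= t ->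
  measurable_fun (setT : set (past t)) (jumps i K s t).
Proof.
move=> s0 st; apply: measurableT_comp => //.
have := @measurable_kernel_xsection _ _ (past t) (R * R)%type R (kN i K s t)
  (fun w => kN_fin i K t w s0) (kN_adapted i K s0 st) (HD i t).
move/(_ (predictable_restr (past_mono PN) (le_trans s0 st) (Hpred i))).
by under eq_fun do rewrite /kN/= /mrestr xsection_HD.
Qed.

Lemma area_measurable i K s t : 0 <= K -> 0 <= s -> s <= t ->
  measurable_fun (setT : set (past t)) (area i K s t).
Proof.
move=> K0 s0 st; apply: measurableT_comp => //.
have := @measurable_kernel_xsection _ _ (past t) (R * R)%type R (fun=> kL K s t)
  (fun=> kL_fin K0 st) (fun A mA => @measurable_cst _ _ _ _ _ _) (HD i t).
move/(_ (predictable_restr (past_mono PN) (le_trans s0 st) (Hpred i))).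
by under eq_fun do rewrite plane_measureE xsection_HD.
Qed.

Lemma past_adapted t (Y : T -> R) : 0 <= t ->
  measurable_fun (setT : set (past t)) Y -> adapted (F t) Y.
Proof.
move=> t0 mY _ [B mB <-]; rewrite setTI.
have := mY measurableT B mB; rewrite setTI /measurable/= sigma_algebra_id//.
exact: (past_sigma PN).
Qed.

Lemma adapted_measurable_fun t (Y : T -> R) : 0 <= t -> adapted (F t) Y ->
  measurable_fun (setT : set T) Y.
Proof.
by move=> t0 aY _ B mB; apply: (past_measurable PN t0); apply: aY; exists B.
Qed.

Lemma past_setT t : 0 <= t -> F t setT.
Proof.
by move=> /(past_sigma PN)[F0 FC _]; rewrite -(setD0 setT); exact: FC.
Qed.

(** The compensation formula. On rectangles it is the independence of the points after [u] from
    [F u]; [kernel_integral_unique] extends it to predictable sets, and the event [A] is absorbed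
    into the predictable set [HA]. *)
Lemma jumps_area_integral i K s t A : 0 <= K -> 0 <= s -> s <= t -> F s A ->
  (\int[P]_(w in A) (jumps i K s t w)%:E = \int[P]_(w in A) (area i K s t w)%:E)%E.
Proof.
move=> K0 s0 st FA.
have mA : measurable A by apply: (past_measurable PN s0).
pose HA := H i `&` (A `*` (`]s, +oo[ `*` setT)).
have HAs : <<s predictable_rect F >> HA.
  apply: (@sigma_algebra_setI _ _ <<s predictable_rect F >>); [exact: smallest_sigma_algebra|exact: Hpred|].
  by apply: sub_sigma_algebra; left; exists s, A, setT; split.
have xHA w : w \in A -> xsection HA w `&` cell K s t = region i w K s t.
  move=> /set_mem wA; apply/seteqP; split=> -[x y]; rewrite /HA /region /cell /xsection/= !in_setE/= !in_itv/=.
    by move=> [[Hw _] ?]; split.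
  by move=> [Hw [/andP[sx xt] y0]]; rewrite sx xt.
have xHA0 w : w \notin A -> xsection HA w = set0.
  move=> wA; apply/seteqP; split=> // p; rewrite /HA /xsection/= in_setE/= => -[_ [wA' _]].
  by rewrite notin_setE in wA.
have mkN w : (kN i K s t w setT < +oo)%E by exact: kN_fin.
have mkL (w : T) : (kL K s t setT < +oo)%E by exact: kL_fin.
have xs (l : T -> {measure set (R * R) -> \bar R}) G B :
    measurable G -> (forall V, measurable V -> measurable_fun setT (fun w => l w V)) ->
    measurable B ->
    (\int[P]_w l w (xsection (G `*` B) w) = \int[P]_(w in G) l w B)%E.
  move=> mG ml mB; rewrite [RHS]integral_mkcond; apply: eq_integral => w _.
  rewrite patchE; case: ifPn => wG; first by rewrite in_xsectionX.
  by rewrite notin_xsectionX// measure0.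
have mean G B u : 0 <= u -> F u G -> measurable B -> B `&` cell K s t `<=` strip `]u, +oo[ ->
    (\int[P]_(w in G) kN i K s t w B = \int[P]_(w in G) kL K s t B)%E.
  move=> u0 FG mB Bu; rewrite /kN/= /mrestr.
  rewrite (count_mean PN i u0 FG _ Bu); last 2 first.
  - by apply: measurableI => //; exact: measurable_cell.
  - apply: le_lt_trans (leb2_fin K0 st); apply: le_measure; rewrite ?inE; last exact: subIsetr.
      by apply: measurableI => //; exact: measurable_cell.
    exact: measurable_cell.
  apply: etrans (esym (@integral_cst _ _ _ P G (past_measurable PN u0 FG) (kL K s t B))).
  exact: muleC.
have kNm := kN_measurable i K s0 st.
have kLm V : measurable V -> measurable_fun (setT : set T) (fun=> kL K s t V) by [].
have E G B u : 0 <= u -> F u G -> measurable B -> B `&` cell K s t `<=` strip `]u, +oo[ ->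
    (\int[P]_w kN i K s t w (xsection (G `*` B) w) = \int[P]_w kL K s t (xsection (G `*` B) w))%E.
  move=> u0 FG mB Bu; have mG := past_measurable PN u0 FG.
  by rewrite (xs _ _ _ mG kNm mB) (xs (fun=> kL K s t) _ _ mG kLm mB); exact: mean FG mB Bu.
have eqT : (\int[P]_w kN i K s t w setT = \int[P]_w kL K s t setT)%E.
  apply: (mean _ _ s) => //; last by rewrite setTI; exact: cell_strip_gt.
  exact: past_setT.
have := @kernel_integral_unique _ _ T (R * R)%type R P (kN i K s t) (fun=> kL K s t)
  mkN mkL kNm kLm (predictable_rect F) (predictable_rect_measurable (past_measurable PN))
  (predictable_rectI (past_sigma PN) (past_mono PN)) _ eqT _ HA HAs.
have -> : (\int[P]_w kN i K s t w (xsection HA w) = \int[P]_(w in A) (jumps i K s t w)%:E)%E.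
  rewrite [RHS]integral_mkcond; apply: eq_integral => w _; rewrite patchE.
  case: ifPn => wA; first by rewrite jumpsE// /kN/= /mrestr xHA.
  by rewrite xHA0 ?measure0.
have -> : (\int[P]_w kL K s t (xsection HA w) = \int[P]_(w in A) (area i K s t w)%:E)%E.
  rewrite [RHS]integral_mkcond; apply: eq_integral => w _; rewrite patchE.
  case: ifPn => wA; first by rewrite (areaE i w K0 st) plane_measureE xHA.
  by rewrite xHA0 ?measure0.
apply.
- by rewrite eqT integral_cst_prob; exact: mkL point.
- move=> _ [[u [G [B [u0 FG mB ->]]]]|[B mB ->]].
    apply: (E _ _ u) => //; first by apply: measurableX => //; exact: measurable_itv.
    by move=> [x y]; rewrite /cell /strip/= !in_itv/= !andbT => -[[-> _] [_ /andP[-> _]]].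
  apply: (E _ _ s) => //.
  + exact: past_setT.
  + exact: measurableX.
  + by move=> p [_]; exact: cell_strip_gt.
Qed.

Let jm i K s t : 0 <= s -> s <= t -> measurable_fun (setT : set T) (jumps i K s t).
Proof.
move=> s0 st; have t0 := le_trans s0 st.
by apply: (adapted_measurable_fun t0); apply: past_adapted => //; exact: jumps_measurable.
Qed.

Let am i K s t : 0 <= K -> 0 <= s -> s <= t -> measurable_fun (setT : set T) (area i K s t).
Proof.
move=> K0 s0 st; have t0 := le_trans s0 st.
by apply: (adapted_measurable_fun t0); apply: past_adapted => //; exact: area_measurable.
Qed.

Lemma integral_mul_jumps i K s t Y : 0 <= K -> 0 <= s -> s <= t ->
  adapted (F s) Y -> (forall w, 0 <= Y w) ->
  (\int[P]_w (Y w * jumps i K s t w)%:E = \int[P]_w (Y w * area i K s t w)%:E)%E.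
Proof.
move=> K0 s0 st aY Y0.
apply: (integral_mul_sub_sigma_algebra (past_measurable PN s0) (past_sigma PN s0)) => //.
- exact: jm.
- by move=> w; exact: jumps_ge0.
- exact: am.
- by move=> w; exact: area_ge0.
- by move=> A FA; exact: jumps_area_integral.
Qed.

Let a (K s t : R) : R := K * (t - s).

Let Nc i K s t w := fine (N i w (cell K s t)).

Let NcE i K s t w : 0 <= s -> (Nc i K s t w)%:E = N i w (cell K s t).
Proof. by move=> s0; rewrite fineK// ge0_fin_numE// count_cell. Qed.

Let Nc_measurable i K s t : 0 <= s -> s <= t -> measurable_fun (setT : set T) (Nc i K s t).
Proof.
move=> s0 st; apply: measurableT_comp => //.
have := kN_measurable i K s0 st (@measurableT _ (R * R)%type).
by under eq_fun do rewrite /kN/= /mrestr setTI.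
Qed.

Lemma jumps_mean_fin i K s t : 0 <= K -> 0 <= s -> s <= t ->
  (\int[P]_w (jumps i K s t w)%:E <= (a K s t)%:E)%E.
Proof.
move=> K0 s0 st; rewrite (jumps_area_integral i K0 s0 st (past_setT s0)).
apply: (@le_trans _ _ (\int[P]_w (a K s t)%:E)%E).
  apply: ge0_le_integral => //.
  - by move=> w _; rewrite lee_fin area_ge0.
  - by apply/measurable_EFinP; exact: am.
  - by move=> w _; rewrite lee_fin area_le.
by rewrite integral_cst_prob.
Qed.

(* [z (z - 1) <= n (n - 1)] for [0 <= z <= n] as soon as [n] is an integer. *)
Lemma jumps_square i K s t : 0 <= K -> 0 <= s -> s <= t ->
  (\int[P]_w (jumps i K s t w ^+ 2)%:E <=
   \int[P]_w (jumps i K s t w)%:E + (a K s t ^+ 2)%:E)%E.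
Proof.
move=> K0 s0 st.
have mj := jm i K s0 st; have mN := Nc_measurable i K s0 st.
have aN : (\int[P]_w (Nc i K s t w)%:E = (a K s t)%:E)%E.
  under eq_integral do rewrite NcE//.
  rewrite (count_mean PN i s0 (past_setT s0)) ?leb2_fin//; last exact: cell_strip_gt.
    by rewrite probability_setT mul1e leb2_cell.
  exact: measurable_cell.
have aN2 : (\int[P]_w (Nc i K s t w ^+ 2)%:E = (a K s t + a K s t ^+ 2)%:E)%E.
  under eq_integral do rewrite expr2 EFinM NcE//.
  rewrite (count_square PN i) ?leb2_fin//; last exact: cell_strip_quadrant.
    by rewrite leb2_cell// -EFinM -EFinD expr2.
  exact: measurable_cell.
(* Adding the mean of [Nc] to both sides turns the claim into the pointwise inequality
   [n + z^2 <= n^2 + z]. *)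
rewrite -(@leeD2lE _ (a K s t)%:E)// -{1}aN -ge0_integralD//; last 4 first.
- by move=> w _; rewrite lee_fin fine_ge0.
- exact/measurable_EFinP.
- by move=> w _; rewrite lee_fin sqr_ge0.
- by apply/measurable_EFinP; exact: measurable_funX.
rewrite addeCA -EFinD -aN2 -ge0_integralD//; last 4 first.
- by move=> w _; rewrite lee_fin jumps_ge0.
- exact/measurable_EFinP.
- by move=> w _; rewrite lee_fin sqr_ge0.
- by apply/measurable_EFinP; exact: measurable_funX.
apply: ae_ge0_le_integral => //.
- by move=> w _; rewrite -EFinD lee_fin addr_ge0 ?sqr_ge0 ?fine_ge0.
- by apply/measurable_EFinP; apply: measurable_funD => //; exact: measurable_funX.
- by move=> w _; rewrite -EFinD lee_fin addr_ge0 ?sqr_ge0 ?jumps_ge0.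
- by apply/measurable_EFinP; apply: measurable_funD => //; exact: measurable_funX.
have := count_integer PN i (@measurable_cell K s t) (@cell_strip_quadrant K s t s0) (leb2_fin K0 st).
apply: filterS => w [n Nn] _; rewrite -!EFinD lee_fin.
have := jumps_le i K t w s0; have := jumps_ge0 i K s t w.
rewrite /Nc Nn/=; move: (jumps i K s t w) => z z0 zn.
case: n zn {Nn} => [|n] zn; first by have -> : z = 0 by lra.
have : 1 <= n.+1%:R :> R by rewrite ler1n.
by move: (n.+1%:R : R) zn => x zx x1; nra.
Qed.

(** The counts of the whole cell dominate, and for distinct sites they are uncorrelated. The bound
    is quadratic in [t - s], hence negligible on a fine partition. *)
Lemma jumps_cross i j K s t : i != j -> 0 <= K -> 0 <= s -> s <= t ->
  (\int[P]_w (jumps i K s t w * jumps j K s t w)%:E <= (a K s t ^+ 2)%:E)%E.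
Proof.
move=> ij K0 s0 st.
have -> : (a K s t ^+ 2)%:E = (\int[P]_w (Nc i K s t w * Nc j K s t w)%:E)%E.
  under eq_integral do rewrite EFinM !NcE//.
  rewrite (count_cross PN ij) ?leb2_fin//; last exact: cell_strip_quadrant.
    by rewrite leb2_cell// -EFinM expr2.
  exact: measurable_cell.
apply: ge0_le_integral => //.
- by move=> w _; rewrite lee_fin mulr_ge0 ?jumps_ge0.
- by apply/measurable_EFinP; apply: measurable_funM; exact: jm.
- by apply/measurable_EFinP; apply: measurable_funM; exact: Nc_measurable.
- by move=> w _; rewrite lee_fin ler_pM ?jumps_ge0 ?jumps_le.
Qed.

Section second_moment.
Variables (J : seq I) (c : I -> R).
Hypotheses (uJ : uniq J) (c0 : forall j, 0 <= c j).
Variable K : R.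
Hypothesis K0 : 0 <= K.

Let A s t w := \sum_(j <- J) c j * jumps j K s t w.
Let B s t w := \sum_(j <- J) c j * area j K s t w.
Let X t w := A 0 t w - B 0 t w.
Let e j s t : R := fine (\int[P]_w (jumps j K s t w)%:E)%E.
Let C := \sum_(j <- J) c j.

Let eE j s t : 0 <= s -> s <= t -> ((e j s t)%:E = \int[P]_w (jumps j K s t w)%:E)%E.
Proof.
move=> s0 st; rewrite fineK// ge0_fin_numE; last first.
  by apply: integral_ge0 => w _; rewrite lee_fin jumps_ge0.
by apply: le_lt_trans (jumps_mean_fin j K0 s0 st) _; rewrite ltry.
Qed.

Let C0 : 0 <= C. Proof. exact: sumr_ge0. Qed.
Let A0 s t w : 0 <= A s t w.
Proof. by apply: sumr_ge0 => j _; rewrite mulr_ge0 ?jumps_ge0. Qed.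
Let B0 s t w : 0 <= B s t w.
Proof. by apply: sumr_ge0 => j _; rewrite mulr_ge0 ?area_ge0. Qed.

Let B_le s t w : s <= t -> B s t w <= C * a K s t.
Proof. by move=> st; rewrite /C mulr_suml ler_sum// => j _; rewrite ler_wpM2l ?area_le. Qed.

Let A_past s t : 0 <= s -> s <= t -> measurable_fun (setT : set (past t)) (A s t).
Proof.
move=> s0 st; apply: measurable_sum => j; apply: measurable_funM => //.
exact: jumps_measurable.
Qed.

Let B_past s t : 0 <= s -> s <= t -> measurable_fun (setT : set (past t)) (B s t).
Proof.
move=> s0 st; apply: measurable_sum => j; apply: measurable_funM => //.
exact: area_measurable.
Qed.

Let Am s t : 0 <= s -> s <= t -> measurable_fun (setT : set T) (A s t).
Proof. by move=> s0 st; apply: measurable_sum => j; apply: measurable_funM => //; exact: jm. Qed.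

Let Bm s t : 0 <= s -> s <= t -> measurable_fun (setT : set T) (B s t).
Proof. by move=> s0 st; apply: measurable_sum => j; apply: measurable_funM => //; exact: am. Qed.

Let mean_AB s t Y : 0 <= s -> s <= t -> adapted (F s) Y -> (forall w, 0 <= Y w) ->
  (\int[P]_w (Y w * A s t w)%:E = \int[P]_w (Y w * B s t w)%:E)%E.
Proof.
move=> s0 st aY Y0; have mY := adapted_measurable_fun s0 aY.
have sum (V : I -> T -> R) : (forall j, measurable_fun (setT : set T) (V j)) ->
    (forall j w, 0 <= V j w) ->
    (\int[P]_w (Y w * \sum_(j <- J) c j * V j w)%:E =
     \sum_(j <- J) (c j)%:E * \int[P]_w (Y w * V j w)%:E)%E.
  move=> mV V0.
  under eq_integral do rewrite mulr_sumr -sumEFin.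
  rewrite ge0_integral_sum//; last 2 first.
  - by move=> j; apply/measurable_EFinP; apply: measurable_funM => //; exact: measurable_funM.
  - by move=> j w _; rewrite lee_fin !mulr_ge0.
  apply: eq_bigr => j _; under eq_integral do rewrite mulrCA EFinM.
  rewrite ge0_integralZl_EFin// => [w _|]; first by rewrite lee_fin mulr_ge0.
  by apply/measurable_EFinP; exact: measurable_funM.
rewrite /A (sum (fun j w => jumps j K s t w)); last 2 first.
- by move=> j; exact: jm.
- by move=> j w; exact: jumps_ge0.
rewrite /B (sum (fun j w => area j K s t w)); last 2 first.
- by move=> j; exact: am.
- by move=> j w; exact: area_ge0.
by apply: eq_bigr => j _; rewrite integral_mul_jumps.
Qed.

Let square_A s t : 0 <= s -> s <= t ->
  (\int[P]_w (A s t w ^+ 2)%:E <= (\sum_(j <- J) c j ^+ 2 * e j s t + (C * a K s t) ^+ 2)%:E)%E.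
Proof.
move=> s0 st.
under eq_integral do rewrite expr2 /A big_distrlr/= -sumEFin.
rewrite ge0_integral_sum//; last 2 first.
- move=> i; apply/measurable_EFinP; apply: measurable_sum => j.
  by apply: measurable_funM; apply: measurable_funM => //; exact: jm.
- move=> i w _; rewrite lee_fin sumr_ge0// => j _.
  by rewrite !mulr_ge0 ?jumps_ge0.
apply: (@le_trans _ _ (\sum_(i <- J) \sum_(j <- J) (c i * c j * ((i == j)%:R * e i s t + a K s t ^+ 2))%:E)%E).
  apply: lee_sum => i _.
  under eq_integral do rewrite -sumEFin.
  rewrite ge0_integral_sum//; last 2 first.
  - by move=> j; apply/measurable_EFinP; apply: measurable_funM; apply: measurable_funM => //; exact: jm.
  - by move=> j w _; rewrite lee_fin !mulr_ge0 ?jumps_ge0.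
  apply: lee_sum => j _.
  under eq_integral do rewrite mulrACA EFinM.
  rewrite ge0_integralZl_EFin//; last 3 first.
  - by move=> w _; rewrite lee_fin mulr_ge0 ?jumps_ge0.
  - by apply/measurable_EFinP; apply: measurable_funM; exact: jm.
  - by rewrite mulr_ge0.
  rewrite [leRHS]EFinM; apply: lee_wpmul2l; first by rewrite lee_fin mulr_ge0.
  have [<-|ij] := eqVneq i j.
    under eq_integral do rewrite -expr2.
    by rewrite mul1r EFinD (eE i s0 st); exact: jumps_square.
  by rewrite mul0r add0r; exact: jumps_cross.
under eq_bigr do rewrite sumEFin.
rewrite sumEFin lee_fin le_eqVlt; apply/orP; left; apply/eqP.
under eq_bigr do under eq_bigr do rewrite mulrDr.
under eq_bigr do rewrite big_split/=.
rewrite big_split/=; congr (_ + _).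
  apply: eq_big_seq => i iJ; rewrite (bigD1_seq i)//= eqxx big1 ?addr0 ?mul1r ?expr2//.
  by move=> j; rewrite eq_sym => /negbTE ->; rewrite mul0r mulr0.
under eq_bigr do rewrite -mulr_suml -mulr_sumr.
by rewrite -!mulr_suml -/C /a; ring.
Qed.

(** The increment is orthogonal to the past by [mean_AB]. Its square costs the variance term and
    twice [(C K (t - s))^2], once from the jumps and once from the area. *)
Let step s t : 0 <= s -> s <= t ->
  (\int[P]_w (X t w ^+ 2)%:E <= \int[P]_w (X s w ^+ 2)%:E +
     (\sum_(j <- J) c j ^+ 2 * e j s t + 2 * (C * a K s t) ^+ 2)%:E)%E.
Proof.
move=> s0 st; have t0 := le_trans s0 st.
pose a' := A 0 s; pose b := B 0 s; pose z := A s t; pose l := B s t.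
have ma : measurable_fun setT a' by exact: Am.
have mb : measurable_fun setT b by exact: Bm.
have mz : measurable_fun setT z by exact: Am.
have ml : measurable_fun setT l by exact: Bm.
have az : (\int[P]_w (a' w * z w)%:E = \int[P]_w (a' w * l w)%:E)%E.
  exact: (mean_AB s0 st (past_adapted s0 (A_past (lexx 0) s0)) (A0 0 s)).
have bz : (\int[P]_w (b w * z w)%:E = \int[P]_w (b w * l w)%:E)%E.
  exact: (mean_AB s0 st (past_adapted s0 (B_past (lexx 0) s0)) (B0 0 s)).
have XE w : X t w = a' w + z w - (b w + l w).
  rewrite /X /a' /b /z /l /A /B -!big_split/=.
  congr (_ - _); apply: eq_bigr => j _; rewrite -mulrDr; congr (_ * _).
    by rewrite (jumps_add j K w (lexx 0) s0 st).
  by rewrite (area_add j w K0 s0 st).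
have mean_fin u v : 0 <= u -> u <= v -> (\int[P]_w (A u v w)%:E < +oo)%E.
  move=> u0 uv; have := @mean_AB u v (cst 1) u0 uv.
  under eq_integral do rewrite mul1r.
  under [X in _ -> _ -> _ = X]eq_integral do rewrite mul1r.
  move=> -> //; last first.
    apply: past_adapted => //.
  apply: (@le_lt_trans _ _ (\int[P]_w (C * a K u v)%:E)%E); last first.
    by rewrite integral_cst_prob ltry.
  apply: ge0_le_integral => //.
  - by move=> w _; rewrite lee_fin B0.
  - by apply/measurable_EFinP; exact: Bm.
  - by move=> w _; rewrite lee_fin B_le.
have fin_mul (f g : T -> R) (M : R) : measurable_fun setT f -> measurable_fun setT g ->
    (forall w, 0 <= f w) -> (forall w, 0 <= g w <= M) ->
    (\int[P]_w (f w)%:E < +oo -> \int[P]_w (f w * g w)%:E < +oo)%E.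
  move=> mf mg f0 gM fi.
  have M0 : 0 <= M by have /andP[h1 h2] := gM point; exact: le_trans h1 h2.
  apply: (@le_lt_trans _ _ (\int[P]_w (M%:E * (f w)%:E))%E).
    apply: ge0_le_integral => //.
    - by move=> w _; rewrite lee_fin mulr_ge0//; case/andP: (gM w).
    - by apply/measurable_EFinP; exact: measurable_funM.
    - by apply: emeasurable_funM => //; exact/measurable_EFinP.
    - by move=> w _; rewrite -EFinM lee_fin mulrC ler_wpM2r//; case/andP: (gM w).
  rewrite ge0_integralZl_EFin//; first by rewrite lte_mul_pinfty.
    by move=> w _; rewrite lee_fin.
  exact/measurable_EFinP.
have fal : (\int[P]_w (a' w * l w)%:E < +oo)%E.
  apply: (@fin_mul _ _ (C * a K s t)) => //; [exact: A0| |exact: mean_fin].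
  by move=> w; rewrite B0 B_le.
have fbz : (\int[P]_w (b w * z w)%:E < +oo)%E.
  under eq_integral do rewrite mulrC.
  apply: (@fin_mul _ _ (C * a K 0 s)) => //; [exact: A0| |exact: mean_fin].
  by move=> w; rewrite B0 B_le.
have fbl : (\int[P]_w (b w * l w)%:E < +oo)%E by rewrite -bz.
apply: le_trans (integral_square_increment ma mb mz ml (A0 _ _) (B0 _ _) (A0 _ _) (B0 _ _) az bz fal fbl XE) _.
apply: leeD => //.
rewrite (_ : 2 * (C * a K s t) ^+ 2 = (C * a K s t) ^+ 2 + (C * a K s t) ^+ 2); last by ring.
apply: le_trans (leeD (square_A s0 st) (_ : _ <= ((C * a K s t) ^+ 2)%:E)%E) _; last by rewrite -EFinD addrA.
apply: (@le_trans _ _ (\int[P]_w ((C * a K s t) ^+ 2)%:E)%E); last by rewrite integral_cst_prob.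
apply: ge0_le_integral => //.
- by move=> w _; rewrite lee_fin sqr_ge0.
- by apply/measurable_EFinP; exact: measurable_funX.
- by move=> w _; rewrite lee_fin ler_sqr ?nnegrE ?B0 ?mulr_ge0 ?B_le ?subr_ge0.
Qed.

(** On a partition into [n] equal pieces the variance terms add up exactly, and the quadratic errors
    of [step] sum to [2 (C K t)^2 / n]. No stochastic integral or bracket is required. *)
Lemma second_moment t : 0 <= t ->
  (\int[P]_w ((\sum_(j <- J) c j * (jumps j K 0 t w - area j K 0 t w)) ^+ 2)%:E <=
   (\sum_(j <- J) c j ^+ 2 * fine (\int[P]_w (jumps j K 0 t w)%:E))%:E)%E.
Proof.
move=> t0.
have -> : (\int[P]_w ((\sum_(j <- J) c j * (jumps j K 0 t w - area j K 0 t w)) ^+ 2)%:E =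
   \int[P]_w (X t w ^+ 2)%:E)%E.
  apply: eq_integral => w _; congr (_ ^+ 2)%:E.
  by rewrite /X /A /B -sumrB; apply: eq_bigr => j _; rewrite mulrBr.
have e_add j s u : 0 <= s -> s <= u -> e j 0 u = e j 0 s + e j s u.
  move=> s0 su; apply: EFin_inj; rewrite EFinD !eE//; last exact: le_trans su.
  under eq_integral do rewrite (jumps_add j K _ (lexx 0) s0 su) EFinD.
  rewrite ge0_integralD//.
  - by move=> w _; rewrite lee_fin jumps_ge0.
  - by apply/measurable_EFinP; exact: jm.
  - by move=> w _; rewrite lee_fin jumps_ge0.
  - by apply/measurable_EFinP; exact: jm.
have jumps0 j w : jumps j K 0 0 w = 0.
  by rewrite /jumps /region /cell set_itv_ge ?bnd_simp ?ltxx// set0X setI0 measure0.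
have area0 j w : area j K 0 0 w = 0.
  by rewrite /area /region /cell set_itv_ge ?bnd_simp ?ltxx// set0X setI0 measure0.
have main n : (0 < n)%N -> (\int[P]_w (X t w ^+ 2)%:E <=
   (\sum_(j <- J) c j ^+ 2 * e j 0%R t + 2 * (C * K * t) ^+ 2 / n%:R)%:E)%E.
  move=> n0; pose D := t / n%:R; have n0' : (n%:R : R) != 0 by rewrite pnatr_eq0 -lt0n.
  have D0 : 0 <= D by rewrite divr_ge0.
  suff : forall k, (\int[P]_w (X (k%:R * D) w ^+ 2)%:E <=
      (\sum_(j <- J) c j ^+ 2 * e j 0%R (k%:R * D) + k%:R * (2 * (C * K * D) ^+ 2))%:E)%E.
    move/(_ n); rewrite mulrCA mulfV// mulr1 => h; apply: le_trans h _.
    rewrite lee_fin lerD2l le_eqVlt; apply/orP; left; apply/eqP.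
    by rewrite /D; move: (n%:R : R) n0' => x x0; field.
  elim=> [|k IH].
    rewrite mul0r integral0_eq ?lee_fin => [|w _].
      by rewrite mul0r addr0 sumr_ge0// => j _; rewrite mulr_ge0 ?sqr_ge0 ?fine_ge0// integral_ge0// => w _; rewrite lee_fin jumps_ge0.
    rewrite /X /A /B big1 ?big1 ?subrr ?expr0n// => j _; first by rewrite area0 mulr0.
    by rewrite jumps0 mulr0.
  have s0 : 0 <= k%:R * D by rewrite mulr_ge0.
  have su : k%:R * D <= k.+1%:R * D by rewrite ler_wpM2r// ler_nat.
  apply: le_trans (step s0 su) _.
  apply: le_trans (leeD IH (lexx _)) _.
  rewrite -EFinD lee_fin le_eqVlt; apply/orP; left; apply/eqP.
  have -> : a K (k%:R * D) (k.+1%:R * D) = K * D by rewrite /a -natr1; ring.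
  rewrite addrACA -big_split/= -natr1; congr (_ + _); last by ring.
  by apply: eq_bigr => j _; rewrite -mulrDr; congr (_ * _); rewrite natr1 -e_add.
apply/lee_addgt0Pr => eps eps0.
pose n := (Num.bound (2 * (C * K * t) ^+ 2 / eps)).+1.
apply: le_trans (main n _) _ => //; rewrite -EFinD lee_fin lerD2l.
have n0 : 0 < n%:R :> R by rewrite ltr0n.
rewrite ler_pdivrMr// -ler_pdivrMl// mulrC.
apply: le_trans (ltW (archi_boundP _)) _; first by rewrite divr_ge0 ?mulr_ge0 ?sqr_ge0// ltW.
by rewrite ler_nat.
Qed.

End second_moment.

End poisson_family.

(** * The compensated Hawkes process *)

Lemma ge0_integral_mrestr d (X : measurableType d) (R : realType) (mu : {measure set X -> \bar R})
  (D : set X) (mD : measurable D) (f : X -> \bar R) :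
  measurable_fun setT f -> (forall x, 0 <= f x)%E ->
  (\int[mrestr mu mD]_x f x = \int[mu]_(x in D) f x)%E.
Proof.
move=> mf f0; rewrite (@ge0_negligible_integral _ _ _ (mrestr mu mD) setT (~` D))//; last 2 first.
- exact: measurableC.
- by rewrite /= /mrestr setICl measure0.
rewrite setTD setCK; apply: eq_measure_integral => A mA AD.
by rewrite /= /mrestr setIidl.
Qed.

Section lebesgue_reflection.
Context {R : realType}.
Local Notation leb := (@lebesgue_measure R).

Lemma lebesgue_measure_reflect (c : R) (A : set R) : measurable A ->
  pushforward leb (fun x => c - x : measurableTypeR R) A = leb A.
Proof.
have mc : measurable_fun setT (fun x : measurableTypeR R => c - x : measurableTypeR R).
  by apply: measurable_funB.
move=> mA; apply/esym.
apply: (@lebesgue_measure_unique _ (measure_function_pushforward__canonical__measure_function_Measure leb mc)) => //= _ [[a b]] _ <-.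
rewrite /pushforward (_ : _ @^-1` _ = `[c - b, c - a[%classic); last first.
  by apply/seteqP; split=> x; rewrite /= !in_itv/= => /andP[h1 h2]; apply/andP; split; lra.
rewrite !lebesgue_measure_itv/= !lte_fin ltrD2l ltrN2; case: ifPn => // _.
by rewrite -!EFinB; congr EFin; ring.
Qed.

Lemma ge0_integral_reflect (c : R) (f : R -> \bar R) :
  measurable_fun setT f -> (forall x, 0 <= f x)%E ->
  (\int[leb]_x f x = \int[leb]_x f (c - x)%R)%E.
Proof.
move=> mf f0.
have mc : measurable_fun setT (fun x : measurableTypeR R => c - x : measurableTypeR R).
  by apply: measurable_funB.
transitivity (\int[pushforward leb (fun x => (c - x)%R : measurableTypeR R)]_x f x)%E.
  by apply: eq_measure_integral => //= A mA AS; exact/esym/lebesgue_measure_reflect.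
by rewrite ge0_integral_pushforward.
Qed.

End lebesgue_reflection.

(** * The Stieltjes measure of a nondecreasing path *)

Section path_measure.
Context {R : realType}.
Variable z : R -> R.
Hypothesis zc : is_cumulative (extend0 z).

Lemma dpathE : dpath z = lebesgue_stieltjes_measure (to_cumulative zc).
Proof.
rewrite /dpath; case: pselect => [H|//].
by have -> : H = zc by exact: Prop_irrelevance.
Qed.

Lemma dpath_oc (a b : R) : a <= b ->
  dpath z `]a, b]%classic = (extend0 z b - extend0 z a)%:E.
Proof.
move=> ab; rewrite dpathE/= /lebesgue_stieltjes_measure /measure_extension measurable_mu_extE/=; last exact: is_ocitv.
by rewrite wlength_itv_bnd.
Qed.

Let z_ge0 t : 0 <= t -> 0 <= z t.
Proof.
move=> t0; have := zc.1 (-1) t; rewrite /extend0 t0 lerNr oppr0 ler10; apply; lra.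
Qed.

Let extend0_neg t : t < 0 -> extend0 z t = 0.
Proof. by move=> t0; rewrite /extend0 leNgt t0. Qed.

(** The extension of [z] is 0 before time 0 and [z 0] there, so [[0, q]] carries the same mass as
    []-1, q]]. *)
Lemma dpath_cc (q : R) : 0 <= q -> dpath z `[0, q]%classic = (z q)%:E.
Proof.
move=> q0.
have n0 : dpath z `]-1, 0[%classic = 0%E.
  apply/eqP; rewrite eq_le measure_ge0 andbT.
  have -> : `]-1, 0[%classic = \bigcup_n `]-1, (- n.+1%:R^-1)]%classic :> set R.
    apply/seteqP; split=> x /=.
      rewrite in_itv/= => /andP[x1 x0].
      exists (Num.bound (- x)^-1) => //; rewrite /= in_itv/= x1/=.
      have xV : 0 < (- x)^-1 by rewrite invr_gt0; lra.
      rewrite lerNr -[leRHS]invrK lef_pV2 ?posrE//.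
      apply: ltW; apply: lt_trans (archi_boundP (ltW xV)) _.
      by rewrite ltr_nat.
    move=> [n _]; rewrite /= !in_itv/= => /andP[-> xn]; apply: le_lt_trans xn _.
    by rewrite oppr_lt0 invr_gt0.
  apply: le_trans (measure_sigma_subadditive _ _ _ (@subset_refl _ _)) _ => //.
    by apply: bigcup_measurable => n _; exact: measurable_itv.
  rewrite eseries0// => n _ _; have n1 : (n.+1%:R^-1 : R) <= 1 by rewrite invf_le1 ?ler1n.
  have n2 : 0 < (n.+1%:R^-1 : R) by rewrite invr_gt0.
  move: (n.+1%:R^-1 : R) n1 n2 => v v1 v2; rewrite dpath_oc ?extend0_neg ?subrr//; lra.
have : dpath z `]-1, q]%classic = (z q)%:E.
  rewrite dpath_oc; last lra.
  by rewrite (extend0_neg (t := -1)) ?subr0 /extend0 ?q0//; lra.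
have -> : `]-1, q]%classic = `]-1, 0[ `|` `[0, q] :> set R.
  apply/seteqP; split=> x; rewrite /= !in_itv/=.
    by move=> /andP[x1 xq]; case: (ltP x 0) => x0; [left|right]; rewrite ?x1 ?x0.
  by move=> [/andP[x1 x0]|/andP[x0 x1]]; apply/andP; split; lra.
have -> : dpath z (`]-1, 0[%classic `|` `[0, q]%classic) = (dpath z `](-1)%R, 0%R[%classic + dpath z `[0%R, q]%classic)%E.
  apply: measureU; [exact: measurable_itv|exact: measurable_itv|].
  by apply/seteqP; split=> // x [] /=; rewrite !in_itv/= => /andP[_ x0] /andP[x0' _]; lra.
by rewrite n0 add0e.
Qed.

(** The mass of [[0, r[] is a left limit of the path. Here it is read off countably many values,
    which is what predictability of the intensity rests on. *)
Lemma dpath_co_gt (r y : R) : 0 <= y ->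
  (y%:E < dpath z `[0%R, r[%classic)%E <-> exists q : rat, [/\ 0 <= ratr q :> R, ratr q < r & y < z (ratr q)].
Proof.
move=> y0; split; last first.
  move=> [q [q0 qr yz]]; apply: lt_le_trans (_ : (z (ratr q))%:E <= _)%E; first by rewrite lte_fin.
  rewrite -dpath_cc//; apply: le_measure; rewrite ?inE//.
  by move=> x; rewrite /= !in_itv/= => /andP[-> xq]; exact: le_lt_trans xq qr.
apply: contraPP => nq; apply/negP; rewrite -leNgt.
have [r0|r0] := leP r 0.
  by rewrite set_itv_ge ?measure0 ?lee_fin// bnd_simp -leNgt.
have E : `[0, r[%classic = \bigcup_n `[0, (r - n.+1%:R^-1)]%classic :> set R.
  apply/seteqP; split=> x /=.
    rewrite in_itv/= => /andP[x0 xr].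
    exists (Num.bound (r - x)^-1) => //; rewrite /= in_itv/= x0/=.
    have xV : 0 < (r - x)^-1 by rewrite invr_gt0; lra.
    rewrite lerBrDr addrC -lerBrDr.
    rewrite -[leRHS]invrK lef_pV2 ?posrE//.
    apply: ltW; apply: lt_trans (archi_boundP (ltW xV)) _.
    by rewrite ltr_nat.
  move=> [n _]; rewrite /= !in_itv/= => /andP[-> xn]; apply: le_lt_trans xn _.
  by rewrite ltrBlDr ltrDl invr_gt0.
rewrite E.
pose J n : set R := `[0, (r - n.+1%:R^-1)]%classic.
have ndJ : nondecreasing_seq J.
  move=> n k nk; apply/subsetPset => x; rewrite /J /= !in_itv/= => /andP[-> /le_trans] -> //.
  by rewrite lerB// lef_pV2 ?posrE// ler_nat.
have cvJ : dpath z \o J @ \oo --> dpath z (\bigcup_n J n).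
  apply: (@nondecreasing_cvg_mu _ (measurableTypeR R) R (dpath z) J) ndJ.
    by move=> n; exact: measurable_itv.
  by apply: bigcup_measurable => n _; exact: measurable_itv.
rewrite -(cvg_lim _ cvJ)//; apply: lime_le; first by apply/cvg_ex; eexists; exact: cvJ.
apply: nearW => n /=.
  have n2 : 0 < (n.+1%:R^-1 : R) by rewrite invr_gt0.
  have /rat_in_itvoo[q] : Num.max 0 (r - n.+1%:R^-1) < r by rewrite gt_max r0 ltrBlDr ltrDl.
  rewrite in_itv/= gt_max => /andP[/andP[q0 nq'] qr].
  apply: (@le_trans _ _ (z (ratr q))%:E).
    rewrite -(dpath_cc (ltW q0)); apply: le_measure; rewrite ?inE//.
    - exact: measurable_itv.
    - by move=> x; rewrite /J /= !in_itv/= => /andP[-> /le_trans] -> //; exact: ltW.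
  by rewrite lee_fin leNgt; apply/negP => yz; apply: nq; exists q; rewrite (ltW q0).
Qed.

End path_measure.

(** * Predictability of the intensity *)

Section predictable_intensity.
Context {R : realType} {d : nat} d0 (T : measurableType d0).
Variable F : R -> set_system T.
Hypothesis Fmono : forall s t, 0 <= s -> s <= t -> F s `<=` F t.
Variable phi : R -> R.
Hypotheses (phi_ge0 : forall t, 0 <= phi t) (mphi : measurable_fun setT phi).

Definition predictable_time : set_system (T * R) :=
  [set H | exists s G, [/\ 0 <= s, F s G & H = G `*` `]s, +oo[]].

Local Notation PT := (g_sigma_algebraType predictable_time).

Section one_path.
Variable z : T -> R -> R.
Hypothesis zc : forall w, is_cumulative (extend0 (z w)).
Hypothesis za : forall t, 0 <= t -> adapted (F t) (z ^~ t).

Let refl (s : R) (u : measurableTypeR R) : measurableTypeR R := s - u.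

Let mrefl s : measurable_fun setT (refl s). Proof. exact: measurable_funB. Qed.

(* The measure [dz] on [0, s), seen from [s]. *)
Let reversed (p : PT) : {measure set (measurableTypeR R) -> \bar R} :=
  measure_function_pushforward__canonical__measure_function_Measure
   (mrestr (dpath (z p.1)) (measurable_itv `[0, p.2[)) (mrefl p.2).

Let reversed_gt p a : 0 <= a -> reversed p `]a, +oo[%classic = dpath (z p.1) `[0, (p.2 - a)[%classic.
Proof.
move=> a0; rewrite /reversed/= /pushforward /mrestr; congr (dpath _ _).
apply/seteqP; split=> u; rewrite /refl/= !in_itv/= ?andbT.
  by move=> [au /andP[u0 us]]; rewrite u0/=; lra.
by move=> /andP[u0 us]; rewrite u0; split=> /=; lra.
Qed.

Let reversed_lt0 p a : a < 0 -> reversed p `]a, +oo[%classic = reversed p `]0, +oo[%classic.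
Proof.
move=> a0; rewrite /reversed/= /pushforward /mrestr; congr (dpath _ _).
apply/seteqP; split=> u; rewrite /refl/= !in_itv/= ?andbT => -[au /andP[u0 us]]; rewrite u0 us; split=> //; lra.
Qed.

Let reversedT p : reversed p setT = reversed p `]0, +oo[%classic.
Proof.
rewrite /reversed/= /pushforward /mrestr; congr (dpath _ _).
apply/seteqP; split=> u; rewrite /refl/= !in_itv/= ?andbT => -[au /andP[u0 us]]; rewrite u0 us; split=> //; lra.
Qed.

Let reversed_fin p : (reversed p setT < +oo)%E.
Proof.
rewrite reversedT reversed_gt// subr0.
have [s0|s0] := leP 0 p.2; last by rewrite set_itv_ge ?measure0// bnd_simp -leNgt ltW.
apply: (@le_lt_trans _ _ (dpath (z p.1) `[0, p.2]%classic)).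
  by apply: le_measure; rewrite ?inE// => x; rewrite /= !in_itv/= => /andP[-> /ltW].
by rewrite dpath_cc// ltry.
Qed.

(** The mass of []a, +oo[] is that of [[0, s - a[] under the path. It exceeds [y] iff the path does
    so at a rational [q < s - a]; for each [q] this is an event of [F q] on the times after [q + a],
    a predictable rectangle. *)
Let reversed_gt_measurable a : measurable_fun setT (fun p => reversed p `]a, +oo[%classic).
Proof.
wlog a0 : a / 0 <= a.
  move=> h; have [|a0] := leP 0 a; first exact: h.
  by under eq_fun do rewrite reversed_lt0//; exact: h.
set f := (fun p => reversed p _); have fE p : f p = dpath (z p.1) `[0, (p.2 - a)[%classic := reversed_gt p a0; clearbody f.
apply: (measurability _ (ErealGenOInfty.measurableE R)) => // _ [_ [y ->] <-]; rewrite setTI.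
have [y0|y0] := ltP y 0.
  rewrite (_ : _ @^-1` _ = setT)//; apply/seteqP; split=> // p _ /=.
  by rewrite in_itv/= andbT fE (lt_le_trans _ (measure_ge0 _ _))// lte_fin.
rewrite (_ : _ @^-1` _ = \bigcup_(q in [set q : rat | 0 <= ratr q :> R])
    ((z ^~ (ratr q)) @^-1` `]y, +oo[ `*` `](ratr q + a), +oo[)); last first.
  apply/seteqP; split=> -[w s] /=; rewrite in_itv/= andbT fE/=.
    move/(dpath_co_gt (zc w) _ y0) => [q [q0 qs yz]]; exists q => //; split=> /=; rewrite in_itv/= andbT//; lra.
  move=> [q /= q0 [/=]]; rewrite !in_itv/= !andbT => yz qs.
  by apply/(dpath_co_gt (zc w) _ y0); exists q; split => //; lra.
rewrite bigcup_mkcond; apply: bigcupT_measurable_rat => q; case: ifPn => [/set_mem/= q0|_]; last exact: measurable0.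
apply: sub_sigma_algebra; exists (ratr q + a), ((z ^~ (ratr q)) @^-1` `]y, +oo[).
split => //; first exact: addr_ge0.
apply: (Fmono q0); first by rewrite lerDl.
by apply: (za q0); exists `]y, +oo[%classic; [exact: measurable_itv|rewrite setTI].
Qed.

Let reversed_measurable A : measurable A -> measurable_fun setT (fun p => reversed p A).
Proof.
move=> mA; have := @measurable_kernel_gen _ _ PT (measurableTypeR R) R reversed reversed_fin (@RGenOInfty.G R) _ _ _ _ A mA.
move=> h; apply: (h).
- exact: RGenOInfty.measurableE.
- move=> _ _ [a ->] [b ->]; exists (Num.max a b).
  by apply/seteqP; split=> x; rewrite /= !in_itv/= !andbT gt_max => /andP.
- under eq_fun do rewrite reversedT; exact: reversed_gt_measurable.
- by move=> _ [a ->]; exact: reversed_gt_measurable.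
Qed.

(** The time [s] enters the integrand, the domain and the path. After reversal only the measure
    depends on it: the integral is that of the fixed function [phi] against a measurable kernel. *)
Lemma path_integral_predictable : measurable_fun (setT : set PT)
  (fun p => \int[dpath (z p.1)]_(u in `[0%R, p.2[) (phi (p.2 - u))%:E)%E.
Proof.
have mEphi : measurable_fun setT (EFin \o phi) by exact/measurable_EFinP.
have := @measurable_fun_integral_kernel _ _ PT (measurableTypeR R) R reversed reversed_measurable
  (EFin \o phi) (fun x => phi_ge0 x) mEphi.
apply: eq_measurable_fun => p _.
rewrite /reversed ge0_integral_pushforward//; last by move=> x _; rewrite lee_fin.
apply: (@ge0_integral_mrestr _ _ _ (dpath (z p.1)) _ (measurable_itv `[0, p.2[) (fun u => (phi (p.2 - u))%:E)).
  by apply: measurableT_comp mEphi _; exact: mrefl.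
by move=> x; rewrite lee_fin.
Qed.

End one_path.

Variables (m : 'rV[int]_d -> R) (Z : 'rV[int]_d -> R -> T -> R).
Hypothesis Zc : forall i w, is_cumulative (extend0 (Z i ^~ w)).
Hypothesis Za : forall i t, 0 <= t -> adapted (F t) (Z i t).

Lemma intensity_predictable i : measurable_fun (setT : set PT)
  (fun p => intensity phi m (fun j s => Z j s p.1) i p.2).
Proof.
apply: emeasurable_funD => //; apply: emeasurable_funM => //.
under eq_fun do rewrite edge_sum.
apply: emeasurable_sum => j.
by apply: (@path_integral_predictable (fun w s => Z j s w)) => //; exact: Za.
Qed.

Definition below_intensity i : set (T * (R * R)) :=
  [set p | (p.2.2%:E <= intensity phi m (fun j s => Z j s p.1) i p.2.1)%E].

Lemma below_intensityE i w : xsection (below_intensity i) w = below (intensity phi m (fun j s => Z j s w) i).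
Proof. by apply/seteqP; split=> -[s y]; rewrite /xsection/= inE. Qed.

(** Rectangles based on the past make the intensity measurable, rectangles of the second kind make
    the height measurable, and the region compares the two. *)
Lemma below_intensity_predictable i : <<s predictable_rect F >> (below_intensity i).
Proof.
pose PS := g_sigma_algebraType (predictable_rect F).
have mtime : measurable_fun (setT : set PS) (fun p : T * (R * R) => (p.1, p.2.1) : PT).
  apply: (@measurability _ _ PS PT) => //.
  move=> _ [_ [s [G [s0 FG ->]]] <-]; apply: sub_sigma_algebra; left; exists s, G, setT; split => //.
  by rewrite setTI; apply/seteqP; split=> -[w [x y]] /=; [case=> ? ?; do ?split|case=> ? []].
have mlevel : measurable_fun (setT : set PS) (fun p : T * (R * R) => (p.2.2)%:E).
  apply/measurable_EFinP => _ B mB; apply: sub_sigma_algebra; right; exists B => //.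
  by rewrite setTI; apply/seteqP; split=> -[w [x y]] /=; [move=> ?; do ?split|case=> ? []].
have := @measurable_lee _ PS R setT measurableT _ _ mlevel (measurableT_comp (intensity_predictable i) mtime).
by rewrite setTI.
Qed.

End predictable_intensity.

Section plane_measure_lemmas.
Context {R : realType}.
Local Notation leb2 := (@lebesgue_measure R \x @lebesgue_measure R)%E.
Implicit Types A B : set (R * R).

Lemma le_leb2 A B : measurable A -> measurable B -> A `<=` B -> (leb2 A <= leb2 B)%E.
Proof. by move=> mA mB AB; apply: (@le_measure _ _ _ leb2); rewrite ?inE. Qed.

Lemma leb2_nondecreasing_cvg (A : (set (R * R))^nat) : (forall n, measurable (A n)) ->
  nondecreasing_seq A -> (fun n => leb2 (A n)) @ \oo --> leb2 (\bigcup_n A n).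
Proof.
move=> mA ndA.
have mU : measurable (\bigcup_n A n) by apply: bigcup_measurable => n _; exact: mA.
exact: (@nondecreasing_cvg_mu _ _ _ leb2 A mA mU ndA).
Qed.

End plane_measure_lemmas.

(** * Moments of the compensated process *)

Section hawkes_moments.
Context {R : realType} {d : nat} d0 (T : measurableType d0) (P : probability T R).
Variables (F : R -> set_system T) (N : 'rV[int]_d -> T -> {measure set (R * R) -> \bar R}).
Hypothesis PN : poisson_family P F N.
Variable phi : R -> R.
Hypotheses (phi_ge0 : forall t, 0 <= phi t) (mphi : measurable_fun setT phi).
Variables (m : 'rV[int]_d -> R) (Z : 'rV[int]_d -> R -> T -> R).
Hypothesis m_ge0 : forall i, 0 <= m i.
Hypothesis Zc : forall i w, is_cumulative (extend0 (Z i ^~ w)).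
Hypothesis Za : forall i t, 0 <= t -> adapted (F t) (Z i t).
Hypothesis Zint : forall i t, 0 <= t -> (\int[P]_w (Z i t w)%:E < +oo)%E.
Hypothesis N0 : forall i w, N i w (strip `[0, 0]) = 0%E.
Let lam i w := intensity phi m (fun j s => Z j s w) i.
Hypothesis Zeq : forall i t w, 0 <= t -> ((Z i t w)%:E = N i w (strip `[0%R, t] `&` below (lam i w)))%E.
Local Notation leb := (@lebesgue_measure R).
Local Notation leb2 := (@lebesgue_measure R \x @lebesgue_measure R)%E.

Let H := below_intensity phi m Z.
Let Hpred i : <<s predictable_rect F >> (H i).
Proof. exact: (below_intensity_predictable (past_mono PN)). Qed.

Let mj i K s t : 0 <= s -> s <= t -> measurable_fun (setT : set T) (jumps N H i K s t).
Proof.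
move=> s0 st; have t0 := le_trans s0 st.
by apply: (adapted_measurable_fun PN t0); apply: (past_adapted PN) => //; exact: (jumps_measurable PN Hpred).
Qed.

Let ma i K s t : 0 <= K -> 0 <= s -> s <= t -> measurable_fun (setT : set T) (area H i K s t).
Proof.
move=> K0 s0 st; have t0 := le_trans s0 st.
by apply: (adapted_measurable_fun PN t0); apply: (past_adapted PN) => //; apply: (area_measurable PN).
Qed.

(** The integrated intensity, written as the area below it, which makes sense even where the
    intensity is infinite. *)
Definition compensator i t w : \bar R := leb2 (xsection (H i) w `&` strip `]0, t]).

Let region_nd i w t : nondecreasing_seq (fun n : nat => region H i w n%:R 0 t).
Proof.
move=> n k nk; apply/subsetPset => -[x y]; rewrite /region /cell/= !in_itv/=.
by move=> [? [-> /andP[-> yn]]]; do ?split => //=; rewrite (le_trans yn)// ler_nat.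
Qed.

Let region_cup i w t : \bigcup_(n : nat) region H i w n%:R 0 t = xsection (H i) w `&` strip `]0, t].
Proof.
apply/seteqP; split=> -[x y]; rewrite /region /cell /strip/=.
  by move=> [n _] /= [? []]; rewrite !in_itv/= => ? /andP[-> _].
rewrite !in_itv/= andbT => -[? [? y0]]; have yb := ltW (archi_boundP y0).
by exists (Num.bound y) => //=; rewrite !in_itv/= y0 yb.
Qed.

Let measurable_region i w n t : measurable (region H i w n%:R 0 t).
Proof. exact: (measurable_region PN). Qed.

(** Monotone limit in the height. Cells leave out the line at time 0, which carries no points by
    [N0]. *)
Let jumps_cvg i w t : 0 <= t -> (fun n : nat => (jumps N H i n%:R 0 t w)%:E) @ \oo --> (Z i t w)%:E.
Proof.
move=> t0; under eq_fun do rewrite (jumpsE PN Hpred)//.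
have -> : (Z i t w)%:E = N i w (\bigcup_(n : nat) region H i w n%:R 0 t).
  rewrite Zeq// region_cup -below_intensityE.
  have mH : measurable (xsection (below_intensity phi m Z i) w).
    apply: measurable_xsection; apply: (predictable_measurable (past_measurable PN)); exact: Hpred.
  have ms I : measurable I -> measurable (strip I : set (R * R)).
    by move=> mI; apply: measurableX => //; exact: measurable_itv.
  have -> : strip `[0, t] `&` xsection (below_intensity phi m Z i) w =
     (xsection (H i) w `&` strip `]0, t]) `|` (xsection (H i) w `&` strip `[0, 0]).
    apply/seteqP; split=> -[x y]; rewrite /strip/= !in_itv/=.
      move=> [[/andP[x0 xt] y0] Hxy]; move: x0; rewrite le_eqVlt => /predU1P[x0|x0].
        by right; split => //; split => //; rewrite -x0 eqxx lexx.
      by left; rewrite x0 xt.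
    move=> [[? [/andP[x0 ->] ->]]|[? [/andP[x0 x0'] ->]]]; rewrite ?(ltW x0)//.
    by rewrite x0/= (le_trans x0').
  rewrite measureU//.
  - rewrite [X in (_ + X)%E](_ : _ = 0%E) ?adde0//.
    apply/eqP; rewrite eq_le measure_ge0 andbT -(N0 i w).
    by apply: le_measure; rewrite ?inE//; [apply: measurableI => //; apply: ms|apply: ms].
  - by apply: measurableI => //; apply: ms.
  - by apply: measurableI => //; apply: ms.
  - apply/seteqP; split=> // -[x y]; rewrite /strip/= !in_itv/= => -[[_ [/andP[x0 _] _]] [_ [/andP[_ x0'] _]]].
    by move: x0; rewrite ltNge x0'.
apply: nondecreasing_cvg_mu; last exact: region_nd.
- by move=> n; exact: measurable_region.
- by apply: bigcup_measurable => n _; exact: measurable_region.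
Qed.

Let area_cvg i w t : 0 <= t -> (fun n : nat => (area H i n%:R 0 t w)%:E) @ \oo --> compensator i t w.
Proof.
move=> t0; under eq_fun do rewrite (areaE PN Hpred)//.
rewrite /compensator -region_cup.
apply: leb2_nondecreasing_cvg; last exact: region_nd.
by move=> n; exact: measurable_region.
Qed.

Lemma hawkes_path_ge0 i t w : 0 <= t -> 0 <= Z i t w.
Proof. by move=> t0; rewrite -lee_fin Zeq. Qed.

Let mZ i t : 0 <= t -> measurable_fun (setT : set T) (Z i t).
Proof. by move=> t0; apply: (adapted_measurable_fun PN t0); exact: Za. Qed.

Let jumps_nd i w t n k : 0 <= t -> (n <= k)%N -> jumps N H i n%:R 0 t w <= jumps N H i k%:R 0 t w.
Proof.
move=> t0 nk; rewrite -lee_fin !(jumpsE PN Hpred)//.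
by apply: le_measure; rewrite ?inE//; have /subsetPset := region_nd i w t nk.
Qed.

Let area_nd i w t n k : 0 <= t -> (n <= k)%N -> area H i n%:R 0 t w <= area H i k%:R 0 t w.
Proof.
move=> t0 nk; rewrite -lee_fin (areaE PN Hpred i w (ler0n R n) t0) (areaE PN Hpred i w (ler0n R k) t0).
apply: le_leb2; [exact: measurable_region..|].
by have /subsetPset := region_nd i w t nk.
Qed.

Lemma compensator_measurable i t : 0 <= t -> measurable_fun (setT : set T) (compensator i t).
Proof.
move=> t0; apply: (emeasurable_fun_cvg (fun n w => (area H i n%:R 0 t w)%:E)).
  by move=> n; apply/measurable_EFinP; exact: ma.
by move=> w _; exact: area_cvg.
Qed.

Let jumps_le_Z i t n w : 0 <= t -> jumps N H i n%:R 0 t w <= Z i t w.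
Proof.
move=> t0; rewrite -lee_fin -(cvg_lim _ (jumps_cvg (i := i) (w := w) t0))//.
apply: lime_ge; first by apply/cvg_ex; eexists; exact: jumps_cvg.
by exists n => // k /= nk; rewrite lee_fin jumps_nd.
Qed.

Lemma integral_compensator i t : 0 <= t ->
  (\int[P]_w compensator i t w = \int[P]_w (Z i t w)%:E)%E.
Proof.
move=> t0.
have -> : (\int[P]_w compensator i t w = limn (fun n => \int[P]_w (area H i n%:R 0%R t w)%:E))%E.
  rewrite -monotone_convergence//.
  - by apply: eq_integral => w _; apply/esym/cvg_lim => //; exact: area_cvg.
  - by move=> n; apply/measurable_EFinP; exact: ma.
  - by move=> n w _; rewrite lee_fin area_ge0.
  - by move=> w _ n k nk; rewrite lee_fin area_nd.
have -> : (\int[P]_w (Z i t w)%:E = limn (fun n => \int[P]_w (jumps N H i n%:R 0%R t w)%:E))%E.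
  rewrite -monotone_convergence//.
  - by apply: eq_integral => w _; apply/esym/cvg_lim => //; exact: jumps_cvg.
  - by move=> n; apply/measurable_EFinP; exact: mj.
  - by move=> n w _; rewrite lee_fin jumps_ge0.
  - by move=> w _ n k nk; rewrite lee_fin jumps_nd.
congr (limn _); apply/funext => n; apply/esym.
exact: (jumps_area_integral PN Hpred i _ (lexx 0) t0 (past_setT PN (lexx 0))).
Qed.

Lemma compensator_ge0 i t w : (0 <= compensator i t w)%E.
Proof. exact: measure_ge0. Qed.

Lemma compensator_fin i t : 0 <= t -> {ae P, forall w, compensator i t w \is a fin_num}.
Proof.
move=> t0; have mC := compensator_measurable i t0.
have : P.-integrable setT (compensator i t).
  apply/integrableP; split => //; under eq_integral do rewrite gee0_abs ?compensator_ge0//.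
  by rewrite integral_compensator// Zint.
by move/integrable_ae => /(_ measurableT); apply: filterS => w; apply.
Qed.

(** The squares converge almost surely, but not monotonically, as the height grows, so the bound of
    [second_moment] passes to the limit by Fatou's lemma. *)
Lemma noise_second_moment (J : seq 'rV[int]_d) (c : 'rV[int]_d -> R) t : uniq J ->
  (forall j, 0 <= c j) -> 0 <= t ->
  (\int[P]_w ((\sum_(j <- J) c j * (Z j t w - fine (compensator j t w))) ^+ 2)%:E <=
   \sum_(j <- J) (c j ^+ 2)%:E * \int[P]_w (Z j t w)%:E)%E.
Proof.
move=> uJ c0 t0.
pose X n w := \sum_(j <- J) c j * (jumps N H j n%:R 0 t w - area H j n%:R 0 t w).
have mX n : measurable_fun (setT : set T) (X n).
  apply: measurable_sum => j; apply: measurable_funM => //.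
  by apply: measurable_funB; [exact: mj|exact: ma].
have mE j : (\int[P]_w (Z j t w)%:E \is a fin_num)%E.
  rewrite ge0_fin_numE ?Zint// integral_ge0// => w _.
  by rewrite lee_fin hawkes_path_ge0.
have XB n : (\int[P]_w (X n w ^+ 2)%:E <= \sum_(j <- J) (c j ^+ 2)%:E * \int[P]_w (Z j t w)%:E)%E.
  have := second_moment PN Hpred uJ c0 (ler0n R n) t0; move=> /le_trans; apply.
  rewrite -sumEFin; apply: lee_sum => j _; rewrite EFinM lee_wpmul2l ?lee_fin ?sqr_ge0//.
  have jZ : (\int[P]_w (jumps N H j n%:R 0%R t w)%:E <= \int[P]_w (Z j t w)%:E)%E.
    apply: ge0_le_integral => //.
    - by move=> w _; rewrite lee_fin jumps_ge0.
    - by apply/measurable_EFinP; exact: mj.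
    - by apply/measurable_EFinP; exact: mZ.
    - by move=> w _; rewrite lee_fin jumps_le_Z.
  rewrite fineK// ge0_fin_numE; first exact: le_lt_trans jZ (Zint j t0).
  by apply: integral_ge0 => w _; rewrite lee_fin jumps_ge0.
have mX2 n : measurable_fun (setT : set T) (fun w => (X n w ^+ 2)%:E).
  by apply/measurable_EFinP; exact: measurable_funX.
have mlim : measurable_fun setT (fun w => limn_einf (fun n => (X n w ^+ 2)%:E)).
  apply: (emeasurable_fun_cvg (fun n w => einfs (fun n => (X n w ^+ 2)%:E) n)).
    by move=> n; exact: measurable_fun_einfs.
  by move=> w _; rewrite limn_einf_lim; exact: is_cvg_einfs.
have einfs0 w n : (0 <= einfs (fun n => (X n w ^+ 2)%:E) n)%E.
  by apply: le_ereal_inf_tmp => _ [k _ <-]; rewrite lee_fin sqr_ge0.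
apply: (@le_trans _ _ (\int[P]_w limn_einf (fun n => (X n w ^+ 2)%:E))%E); last first.
  apply: le_trans (fatou P measurableT mX2 _) _.
    by move=> n w _; rewrite lee_fin sqr_ge0.
  rewrite limn_einf_lim; apply: lime_le; first exact: is_cvg_einfs.
  apply: nearW => n; apply: le_trans (XB n).
  by apply: ereal_inf_lbound; exists n => /=.
have aeX : {ae P, forall w, (fun n => (X n w ^+ 2)%:E) @ \oo -->
    ((\sum_(j <- J) c j * (Z j t w - fine (compensator j t w))) ^+ 2)%:E}.
  have aeC : {ae P, forall w, forall j, j \in J -> compensator j t w \is a fin_num}.
    elim: {+}J => [|j J' IH]; first by apply: nearW.
    have := compensator_fin j t0; apply: filterS2 IH => w h1 h2 k.
    by rewrite inE => /predU1P[->|/h1].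
  apply: filterS aeC => w fC; apply/cvg_EFin; first exact: nearW.
  rewrite /comp/=.
  under eq_fun do rewrite expr2.
  rewrite expr2.
  have cX : (fun n => X n w) @ \oo --> \sum_(j <- J) c j * (Z j t w - fine (compensator j t w)).
    have {}fC : forall j, j \in J -> compensator j t w \is a fin_num := fC.
    rewrite /X; move: fC; elim: {+}J => [|j J' IH] fC.
      by under eq_fun do rewrite big_nil; rewrite big_nil; exact: cvg_cst.
    under eq_fun do rewrite big_cons; rewrite big_cons.
    apply: cvgD; last by apply: IH => k kJ; apply: fC; rewrite inE kJ orbT.
    apply: cvgM; first exact: cvg_cst.
    apply: cvgB; first exact: (fine_cvg (jumps_cvg (i := j) (w := w) t0)).
    have := area_cvg (i := j) (w := w) t0; rewrite -(fineK (fC j (mem_head _ _))) => h.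
    exact: fine_cvg h.
  exact: cvgM.
apply: ae_ge0_le_integral => //.
- by move=> w _; rewrite lee_fin sqr_ge0.
- apply/measurable_EFinP; apply: measurable_funX; apply: measurable_sum => j.
  apply: measurable_funM => //; apply: measurable_funB; first exact: mZ.
  by apply: measurableT_comp => //; exact: compensator_measurable.
- by move=> w _; rewrite limn_einf_lim; apply: lime_ge; [exact: is_cvg_einfs|exact: nearW].
apply: filterS aeX => w /cvg_limn_einf_sup[-> _] _ //.
Qed.

End hawkes_moments.

(** * The compensator as a convolution *)

Section path_convolution.
Context {R : realType}.

Lemma path_integral_measurable (z : R -> R) (zc : is_cumulative (extend0 z)) (phi : R -> R) :
  (forall s, 0 <= phi s) -> measurable_fun setT phi ->
  measurable_fun setT (fun s : R => \int[dpath z]_(u in `[0%R, s[) (phi (s - u))%:E)%E.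
Proof.
move=> phi0 mphi; rewrite dpathE; set nu := lebesgue_stieltjes_measure _.
pose A : set (R * R) := [set p | 0 <= p.2] `\` [set p | p.1 <= p.2].
have mle (f g : R * R -> R) : measurable_fun setT f -> measurable_fun setT g -> measurable [set p | f p <= g p].
  by move=> mf mg; rewrite -[X in measurable X]setTI; exact: measurable_fun_le.
have mA : measurable A.
  by apply: measurableD; exact: mle.
pose f (p : R * R) := (\1_A p * phi (p.1 - p.2))%:E.
have mf : measurable_fun setT f.
  apply/measurable_EFinP; apply: measurable_funM; first exact: measurable_indic.
  by apply: measurableT_comp => //; apply: measurable_funB; [exact: measurable_fst|exact: measurable_snd].
have f0 p : (0 <= f p)%E by rewrite lee_fin mulr_ge0.
have := @measurable_fun_fubini_tonelli_F _ _ (measurableTypeR R) (measurableTypeR R) R nu f mf f0.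
apply: eq_measurable_fun => s _; rewrite [RHS]integral_mkcond; apply: eq_integral => u _.
rewrite patchE /f indicE.
have -> : ((s, u) \in A) = (u \in `[0, s[%classic).
  by apply/idP/idP; rewrite !inE /A/= in_itv/=; [move=> [-> /negP]; rewrite ltNge|move=> /andP[-> us]; split => //; apply/negP; rewrite -ltNge].
by case: ifPn => _; rewrite ?mul1r ?mul0r.
Qed.

Lemma intensity_measurable d (phi : R -> R) (m : 'rV[int]_d -> R) (z : 'rV[int]_d -> R -> R) i :
  (forall s, 0 <= phi s) -> measurable_fun setT phi ->
  measurable_fun setT (intensity phi m z i).
Proof.
move=> phi0 mphi; apply: emeasurable_funD => //; apply: emeasurable_funM => //.
under eq_fun do rewrite edge_sum.
apply: emeasurable_sum => j.
have [zc|nzc] := pselect (is_cumulative (extend0 (z j))); first exact: path_integral_measurable.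
rewrite /dpath; case: pselect => // _.
under eq_fun do rewrite integral_measure_zero.
exact: measurable_cst.
Qed.

Lemma below_measurable (lam : R -> \bar R) : measurable_fun setT lam -> measurable (below lam).
Proof.
move=> ml; rewrite -[X in measurable X]setTI; apply: measurable_lee => //.
- by apply/measurable_EFinP; exact: measurable_snd.
- by apply: measurableT_comp ml _; exact: measurable_fst.
Qed.

(** Tonelli, then for fixed [u] the reflection [s -> t + u - s], which exchanges [phi (s - u)] with
    [phi (t - s)]; what is left to integrate over [u] is the mass of [[0, s]], which is [z s]. *)
Lemma path_convolution (z : R -> R) (zc : is_cumulative (extend0 z)) (phi : R -> R) (t : R) : (forall s, 0 <= phi s) -> measurable_fun setT phi ->
  (\int[@lebesgue_measure R]_(s in `]0%R, t]) \int[dpath z]_(u in `[0%R, s[) (phi (s - u))%:E =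
   \int[@lebesgue_measure R]_(s in `[0%R, t]) (phi (t - s) * z s)%:E)%E.
Proof.
move=> phi0 mphi; rewrite dpathE; set nu := lebesgue_stieltjes_measure _.
pose A : set (R * R) := [set p | [/\ 0 < p.1, p.1 <= t, 0 <= p.2 & p.2 < p.1]].
(* The image of [A] under the reflection, hence the strict inequality at [t]; the missing endpoint
   is negligible. *)
pose B : set (R * R) := [set p | [/\ 0 <= p.2, p.2 <= p.1 & p.1 < t]].
have mfst : measurable_fun setT (fun p : R * R => p.1) by exact: measurable_fst.
have msnd : measurable_fun setT (fun p : R * R => p.2) by exact: measurable_snd.
have mle (f g : R * R -> R) : measurable_fun setT f -> measurable_fun setT g -> measurable [set p | f p <= g p].
  by move=> mf mg; rewrite -[X in measurable X]setTI; exact: measurable_fun_le.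
have mlt (f g : R * R -> R) : measurable_fun setT f -> measurable_fun setT g -> measurable [set p | f p < g p].
  move=> mf mg; rewrite (_ : [set p | f p < g p] = ~` [set p | g p <= f p]).
    by apply: measurableC; exact: mle.
  by apply/seteqP; split=> p /=; rewrite ltNge => /negP.
have mA : measurable A.
  rewrite (_ : A = ([set p | 0 < p.1] `&` [set p | p.1 <= t]) `&` ([set p | 0 <= p.2] `&` [set p | p.2 < p.1])).
    by apply: measurableI; apply: measurableI; [exact: mlt|exact: mle|exact: mle|exact: mlt].
  by apply/seteqP; split => -[a b] /=; [case|case=> -[? ?] []].
have mB : measurable B.
  rewrite (_ : B = ([set p | 0 <= p.2] `&` [set p | p.2 <= p.1]) `&` [set p | p.1 < t]).
    by apply: measurableI; [apply: measurableI; exact: mle|exact: mlt].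
  by apply/seteqP; split => -[a b] /=; [case|case=> -[? ?]].
pose f (p : R * R) := (\1_A p * phi (p.1 - p.2))%:E.
pose g (p : R * R) := (\1_B p * phi (t - p.1))%:E.
have mf : measurable_fun setT f.
  apply/measurable_EFinP; apply: measurable_funM; first exact: measurable_indic.
  by apply: measurableT_comp => //; exact: measurable_funB.
have mg : measurable_fun setT g.
  apply/measurable_EFinP; apply: measurable_funM; first exact: measurable_indic.
  by apply: measurableT_comp => //; exact: measurable_funB.
have f0 p : (0 <= f p)%E by rewrite lee_fin mulr_ge0.
have g0 p : (0 <= g p)%E by rewrite lee_fin mulr_ge0.
have FE s : s \in `]0, t]%classic -> (\int[nu]_(u in `[0%R, s[) (phi (s - u))%:E = \int[nu]_u f (s, u))%E.
  rewrite inE/= in_itv/= => /andP[s0 st].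
  rewrite integral_mkcond; apply: eq_integral => u _; rewrite patchE /f indicE.
  have -> : ((s, u) \in A) = (u \in `[0, s[%classic).
    by apply/idP/idP; rewrite !inE/= in_itv/=; [case=> _ _ /= -> ->|move=> /andP[]; split].
  by case: ifPn => _; rewrite ?mul1r ?mul0r.
have F0 s : s \notin `]0, t]%classic -> (\int[nu]_u f (s, u) = 0)%E.
  move=> st; apply: integral0_eq => u _; rewrite /f indicE memNset ?mul0r//.
  by move=> [/= s0 st' _ _]; move: st; rewrite notin_setE/= in_itv/= s0 st'.
have GE s : s \in `[0, t[%classic -> (\int[nu]_u g (s, u) = (phi (t - s) * z s)%:E)%E.
  rewrite mulrC EFinM inE/= in_itv/= => /andP[s0 st].
  rewrite -(dpath_cc zc s0) dpathE -/nu muleC.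
  transitivity (\int[nu]_(u in `[0%R, s]) (phi (t - s))%:E)%E; last first.
    by apply: integral_cst; exact: measurable_itv.
  rewrite [RHS]integral_mkcond; apply: eq_integral => u _; rewrite patchE /g indicE.
  have -> : ((s, u) \in B) = (u \in `[0, s]%classic).
    by apply/idP/idP; rewrite !inE/= in_itv/=; [case=> /= -> ->|move=> /andP[]; split].
  by case: ifPn => _; rewrite ?mul1r ?mul0r.
have mG := @measurable_fun_fubini_tonelli_F _ _ (measurableTypeR R) (measurableTypeR R) R nu g mg g0.
transitivity (\int[lebesgue_measure]_s \int[nu]_u f (s, u))%E.
  rewrite integral_mkcond; apply: eq_integral => s _; rewrite patchE.
  by case: ifPn => st; [rewrite FE|rewrite F0].
transitivity (\int[lebesgue_measure]_s \int[nu]_u g (s, u))%E; last first.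
  rewrite -integral_itv_bndo_bndc; last first.
    by apply: eq_measurable_fun (measurable_funTS mG) => s /GE <-.
  rewrite [RHS]integral_mkcond; apply: eq_integral => s _; rewrite patchE; case: ifPn => st.
    exact: GE.
  apply: integral0_eq => u _; rewrite /g indicE memNset ?mul0r//.
  by move=> [/= u0 us st']; move: st; rewrite notin_setE/= in_itv/= st' (le_trans u0 us).
have E1 := @fubini_tonelli _ _ (measurableTypeR R) (measurableTypeR R) R lebesgue_measure nu f mf f0.
have E2 := @fubini_tonelli _ _ (measurableTypeR R) (measurableTypeR R) R lebesgue_measure nu g mg g0.
apply: (etrans E1); apply: (etrans _ (esym E2)).
apply: eq_integral => u _; rewrite /fubini_G.
rewrite (ge0_integral_reflect (t + u)); last 2 first.
- by apply: measurableT_comp mf _; exact: measurable_fun_pair.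
- by move=> s; exact: f0.
apply: eq_integral => s _; rewrite /f /g /= !indicE.
have -> : ((t + u - s, u) \in A) = ((s, u) \in B).
  by apply/idP/idP; rewrite !inE /A /B/=; [case=> *; split; lra|case=> *; split; lra].
have -> : t + u - s - u = t - s by ring.
by [].
Qed.


End path_convolution.

Section compensator_formula.
Context {R : realType} {d : nat} d0 (T : measurableType d0).
Variable phi : R -> R.
Hypotheses (phi_ge0 : forall t, 0 <= phi t) (mphi : measurable_fun setT phi).
Variables (m : 'rV[int]_d -> R) (Z : 'rV[int]_d -> R -> T -> R).
Hypothesis m_ge0 : forall i, 0 <= m i.
Hypothesis Zc : forall i w, is_cumulative (extend0 (Z i ^~ w)).
Local Notation leb := (@lebesgue_measure R).

Lemma compensatorE i t w : 0 <= t ->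
  compensator phi m Z i t w = ((m i * t)%:E + ((2 * d + 1)%:R^-1)%:E *
    \sum_(j <- nbrs i) \int[leb]_(s in `[0%R, t]) (phi (t - s) * Z j s w)%:E)%E.
Proof.
move=> t0.
pose G j s := (\int[dpath (Z j ^~ w)]_(u in `[0%R, s[) (phi (s - u))%:E)%E.
pose lam s := intensity phi m (fun j s => Z j s w) i s.
have lamE s : lam s = ((m i)%:E + ((2 * d + 1)%:R^-1)%:E * \sum_(j <- nbrs i) G j s)%E.
  by rewrite /lam /intensity edge_sum.
have G0 j s : (0 <= G j s)%E by apply: integral_ge0 => u _; rewrite lee_fin.
have lam0 s : (0 <= lam s)%E.
  rewrite lamE adde_ge0 ?lee_fin// mule_ge0 ?lee_fin ?invr_ge0//.
  by apply: sume_ge0.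
have mG j : measurable_fun (`]0, t]%classic : set R) (G j).
  exact: measurable_funTS (path_integral_measurable (Zc j w) phi_ge0 mphi).
have -> : compensator phi m Z i t w = (\int[leb]_(s in `]0%R, t]) lam s)%E.
  rewrite /compensator /= /product_measure1 [RHS]integral_mkcond; apply: eq_integral => s _ /=.
  rewrite patchE; case: ifPn => st; last first.
    rewrite (_ : xsection _ _ = set0) ?measure0//; apply/seteqP; split=> // y.
    rewrite /xsection /strip/= inE/= => -[_ [st' _]].
    by move: st; rewrite notin_setE.
  rewrite (_ : xsection _ _ = [set y | 0 <= y /\ (y%:E <= lam s)%E]); last first.
    apply/seteqP; split=> y; rewrite /xsection /strip /below_intensity/= !in_setE/= !in_itv/= ?andbT.
      by move=> [/set_mem/= ? []].
    by move=> [? ?]; split; [exact: mem_set|split => //; move: st; rewrite inE/= in_itv].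
  have := lam0 s; case: (lam s) => [r| |//] r0.
    rewrite (_ : [set y | _] = `[0, r]%classic); last first.
      by apply/seteqP; split=> y; rewrite /= in_itv/= lee_fin => /andP.
    rewrite lebesgue_measure_itv/= lte_fin; case: ifPn => [_|]; first by rewrite oppr0 adde0.
    by rewrite lee_fin in r0; rewrite -leNgt => r1; congr EFin; lra.
  rewrite (_ : [set y | _] = `[0, +oo[%classic); last first.
    by apply/seteqP; split=> y; rewrite /= in_itv/= leey andbT; [case|].
  by rewrite lebesgue_measure_itv/= ltry.
under eq_integral do rewrite lamE.
have msum : measurable_fun (`]0, t]%classic : set R) (fun s => \sum_(j <- nbrs i) G j s)%E.
  by apply: emeasurable_sum.
rewrite ge0_integralD//; last 3 first.
- by move=> s _; rewrite lee_fin.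
- by move=> s _; rewrite mule_ge0 ?lee_fin ?invr_ge0// sume_ge0.
- by apply: emeasurable_funM.
congr (_ + _)%E.
  rewrite integral_cst//=; rewrite lebesgue_measure_itv/= lte_fin.
  by move: t0; rewrite le_eqVlt => /predU1P[<-|t0]; [rewrite ltxx mule0 mulr0|rewrite t0 -EFinD subr0 EFinM].
rewrite ge0_integralZl_EFin//; last by move=> s _; rewrite sume_ge0.
rewrite ge0_integral_sum//.
congr (_ * _)%E; apply: eq_bigr => j _.
exact: (path_convolution (Zc j w) t phi_ge0 mphi).
Qed.

End compensator_formula.

(** * Removal of exceptional events *)

Section clean_hawkes.
Context {R : realType} {d : nat} d0 (T : measurableType d0) (P : probability T R).

(* The equation holds for all outcomes, not only almost surely. *)
Record clean_hawkes (F : R -> set_system T)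
    (N : 'rV[int]_d -> T -> {measure set (R * R) -> \bar R})
    (phi : R -> R) (m : 'rV[int]_d -> R) (Z : 'rV[int]_d -> R -> T -> R) : Prop := CleanHawkes {
  clean_poisson : poisson_family P F N;
  clean_cumulative : forall i w, is_cumulative (extend0 (Z i ^~ w));
  clean_adapted : forall i t, 0 <= t -> adapted (F t) (Z i t);
  clean_integral : forall t, 0 <= t -> exists C : R, forall i,
    (\int[P]_w (Z i t w)%:E <= (C * 2 `^ enorm R i)%:E)%E;
  clean_null : forall i w, N i w (strip `[0, 0]) = 0%E;
  clean_equation : forall i t w, 0 <= t ->
    ((Z i t w)%:E = N i w (strip `[0%R, t] `&` below (intensity phi m (fun j s => Z j s w) i)))%E }.

Variables (F : R -> set_system T) (F_filt : is_filtration F).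
Variable N : 'rV[int]_d -> T -> {measure set (R * R) -> \bar R}.
Hypothesis N_poisson : iid_poisson_measures P F N.
Variable phi : R -> R.
Hypotheses (phi_ge0 : forall t, 0 <= phi t) (mphi : measurable_fun setT phi).
Variable m : 'rV[int]_d -> R.
Variables (Z : 'rV[int]_d -> R -> T -> R) (Z_hawkes : hawkes P F N phi m Z).
Local Notation leb2 := (@lebesgue_measure R \x @lebesgue_measure R)%E.
Local Notation quadrant := (strip `[0%R, +oo[ : set (R * R)).

Let mN i A : measurable A -> A `<=` quadrant -> measurable_fun setT (fun w => N i w A).
Proof. by have [/(_ i)[+ _ _ _ _] _] := N_poisson; apply. Qed.

Let pN i A : measurable A -> A `<=` quadrant -> (leb2 A < +oo)%E -> forall k : nat,
  P [set w | N i w A = k%:R%:E] = poisson_prob (fine (leb2 A)) 0 [set k].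
Proof. by have [/(_ i)[_ + _ _ _] _] := N_poisson; apply. Qed.

Let leb2E A : (leb2 A < +oo)%E -> leb2 A = (fine (leb2 A))%:E.
Proof. by move=> fA; rewrite fineK// ge0_fin_numE. Qed.

Let EN i A : measurable A -> A `<=` quadrant -> (leb2 A < +oo)%E ->
  (\int[P]_w N i w A = leb2 A)%E.
Proof.
move=> mA Aq fA; rewrite [RHS]leb2E//.
by apply: (poisson_integral (mN i mA Aq) _ (pN i mA Aq fA)) => //; exact: fine_ge0.
Qed.

Let EN2 i A : measurable A -> A `<=` quadrant -> (leb2 A < +oo)%E ->
  (\int[P]_w (N i w A * N i w A) = leb2 A + leb2 A * leb2 A)%E.
Proof.
move=> mA Aq fA; rewrite (leb2E fA) -EFinM -EFinD -expr2.
by apply: (poisson_integral_square (mN i mA Aq) _ (pN i mA Aq fA)) => //; exact: fine_ge0.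
Qed.

Let N_finite i A : measurable A -> A `<=` quadrant -> (leb2 A < +oo)%E ->
  {ae P, forall w, N i w A \is a fin_num}.
Proof.
move=> mA Aq fA.
have : P.-integrable setT (fun w => N i w A).
  apply/integrableP; split; first exact: mN.
  by under eq_integral do rewrite gee0_abs//; rewrite EN.
by move/integrable_ae => /(_ measurableT); apply: filterS => w; apply.
Qed.

Let square n : set (R * R) := `[0%R, n%:R] `*` `[0%R, n%:R].

Let measurable_square n : measurable (square n).
Proof. by apply: measurableX; exact: measurable_itv. Qed.

Let leb2_square n : (leb2 (square n) < +oo)%E.
Proof.
have -> : leb2 (square n) = (lebesgue_measure `[0%R, n%:R]%classic * lebesgue_measure `[0%R, n%:R]%classic)%E.
  by apply: product_measure1E; exact: measurable_itv.
rewrite !lebesgue_measure_itv/= !lte_fin; case: ifPn => _; last by rewrite mul0e ltry.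
by rewrite -EFinD -EFinM ltry.
Qed.

Let square_quadrant n : square n `<=` quadrant.
Proof. by move=> [x y]; rewrite /square /strip/= !in_itv/= !andbT => -[/andP[-> _] /andP[-> _]]. Qed.

Let mstrip (I : interval R) : measurable (strip [set` I] : set (R * R)).
Proof. by apply: measurableX; exact: measurable_itv. Qed.

Let strip00_quadrant : strip `[0, 0] `<=` quadrant.
Proof. by move=> [x y]; rewrite /strip/= !in_itv/= !andbT => -[/andP[-> _] ->]. Qed.

Let leb2_strip00 : leb2 (strip `[0, 0]) = 0%E.
Proof.
have -> : leb2 (strip `[0, 0]) = (lebesgue_measure `[0%R, 0%R]%classic * lebesgue_measure `[0%R, +oo[%classic)%E.
  by apply: product_measure1E; exact: measurable_itv.
by rewrite lebesgue_measure_itv/= ltxx mul0e.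
Qed.

Let N_strip00 i : {ae P, forall w, N i w (strip `[0, 0]) = 0%E}.
Proof.
have mA := mN i (mstrip `[0, 0]) strip00_quadrant.
have := EN i (mstrip `[0, 0]) strip00_quadrant; rewrite leb2_strip00 => /(_ (ltry 0)) E0.
have : (\int[P]_w `|N i w (strip `[0%R, 0%R])| = 0)%E.
  by under eq_integral do rewrite gee0_abs//.
by move/(ae_eq_integral_abs P measurableT mA); apply: filterS => w; apply.
Qed.

Let ae_site (Q : 'rV[int]_d -> T -> Prop) : (forall i, {ae P, forall w, Q i w}) -> {ae P, forall w, forall i, Q i w}.
Proof.
move=> h; have : {ae P, forall w, forall n : nat, forall i, @choice.unpickle _ n = Some i -> Q i w}.
  apply: ae_foralln => n; case: (@choice.unpickle 'rV[int]_d n) => [i|]; last exact: nearW.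
  by apply: filterS (h i) => w Qw _ [<-].
by apply: filterS => w hw i; apply: (hw (choice.pickle i)); rewrite choice.pickleK.
Qed.

Let good (w : T) : Prop :=
  [/\ forall i n, N i w (square n) \is a fin_num,
      forall i, N i w (strip `[0, 0]) = 0%E &
      forall i t, 0 <= t ->
         ((Z i t w)%:E = \int[N i w]_(x in strip `[0%R, t])
            (\1_(below (intensity phi m (fun j s => Z j s w) i)) x)%:E)%E].

Let good_event : exists O, [/\ measurable O, P O = 1%E & forall w, w \in O -> good w].
Proof.
have : {ae P, forall w, good w}.
  have h1 : {ae P, forall w, forall i n, N i w (square n) \is a fin_num}.
    by apply: ae_site => i; apply: ae_foralln => n; exact: N_finite.
  have h2 := ae_site N_strip00; have [_ _ _ h3] := Z_hawkes.
  by apply: filterS3 h1 h2 h3 => w; split.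
move=> [A [mA PA0 Asub]]; exists (~` A); split.
- exact: measurableC.
- by rewrite probability_setC// PA0 sube0.
- by move=> w; rewrite inE/= => nA; apply: contrapT => ng; apply: nA; exact: Asub.
Qed.

(** Outside the good event the measures and the paths are set to zero, which still solves the
    equation. The new past consists of the events that have the same trace on [Om] as some event of
    the old one; it keeps the modified variables adapted and, since [Om] has full measure, the
    independence of the future. *)
Lemma hawkes_clean : exists (F' : R -> set_system T)
    (N' : 'rV[int]_d -> T -> {measure set (R * R) -> \bar R}) (Z' : 'rV[int]_d -> R -> T -> R),
  clean_hawkes F' N' phi m Z' /\ {ae P, forall w, forall i t, Z' i t w = Z i t w}.
Proof.
have [Om [mO PO goodO]] := good_event.
have PCO : P (~` Om) = 0%E by rewrite probability_setC// PO subee.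
pose F' t := [set G | measurable G /\ exists2 G', F t G' & G `&` Om = G' `&` Om].
pose N' i w : {measure set (R * R) -> \bar R} := if w \in Om then N i w else mzero.
pose Z' i t w := if w \in Om then Z i t w else 0.
have aeOm : {ae P, forall w, w \in Om}.
  exists (~` Om); split => //; first exact: measurableC.
  by move=> w /= nO Ow; apply: nO; rewrite inE.
exists F', N', Z'; split; last first.
  by apply: filterS aeOm => w Ow i t; rewrite /Z' Ow.
have NN' i A : {ae P, forall w, N' i w A = N i w A}.
  by apply: filterS aeOm => w Ow; rewrite /N' Ow.
have [Fsa Fmono] := F_filt.
have Fm t t0 := (Fsa t t0).2.
have mif (X : T -> \bar R) : measurable_fun setT X -> measurable_fun setT (fun w => if w \in Om then X w else 0%E).
  move=> mX; rewrite (_ : (fun w => _) = (X \_ Om)).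
    by apply/(measurable_restrictT _ _).1 => //; exact: measurable_funTS.
  by apply/funext => w; rewrite patchE.
have N'E i A w : N' i w A = if w \in Om then N i w A else 0%E.
  by rewrite /N'; case: ifP.
have mN' i A : measurable A -> A `<=` quadrant -> measurable_fun setT (fun w => N' i w A).
  by move=> mA Aq; under eq_fun do rewrite N'E; apply: mif; exact: mN.
have gtq s : 0 <= s -> strip `]s, +oo[ `<=` quadrant.
  by move=> s0 [x y]; rewrite /strip/= !in_itv/= !andbT => -[sx ->]; split => //; lra.
have ccq s : strip `[0, s] `<=` quadrant.
  by move=> [x y]; rewrite /strip/= !in_itv/= !andbT => -[/andP[-> _] ->].
have [Np Nind] := N_poisson.
have PI X : measurable X -> P (X `&` Om) = P X.
  move=> mX; rewrite [RHS](measureDI P mX mO) [X in (X + _)%E](_ : _ = 0%E) ?add0e//.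
  apply/eqP; rewrite eq_le measure_ge0 andbT -PCO; apply: le_measure; rewrite ?inE.
  - exact: measurableD.
  - exact: measurableC.
  - by move=> w [].
have EW i A : measurable A -> A `<=` quadrant -> (leb2 A < +oo)%E ->
    (\int[P]_w (fine (N i w A))%:E = leb2 A)%E.
  move=> mA Aq fA; rewrite -(EN i mA Aq fA); apply: ge0_ae_eq_integral => //.
  - by apply/measurable_EFinP; apply: measurableT_comp => //; exact: mN.
  - exact: mN.
  - by apply: filterS (N_finite i mA Aq fA) => w fw _; rewrite fineK.
have mfine (B : set R) : measurable B -> measurable (fine @^-1` B : set (\bar R)).
  have mf : measurable_fun setT (@fine R) by exact: fine_measurable.
  by move=> mB; rewrite -[X in measurable X]setTI; exact: mf.
have PF : poisson_family P F' N'.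
  split.
  - move=> t t0; have [F0 FC FU] := (Fsa t t0).1; split.
    + by split; [exact: measurable0|exists set0].
    + move=> A [mA [A' FA' AA']]; split; first by rewrite setTD; exact: measurableC.
      exists (setT `\` A'); first exact: FC.
      rewrite !setTD; apply/seteqP; split => w /= [nA Ow]; split => // A'w; apply: nA.
        by have [] : (A `&` Om) w by rewrite AA'.
      by have [] : (A' `&` Om) w by rewrite -AA'.
    + move=> A FA; split; first by apply: bigcupT_measurable => n; exact: (FA n).1.
      have /choice[A' A'P] : forall n, exists G', F t G' /\ A n `&` Om = G' `&` Om.
        by move=> n; have [_ [G' FG' e]] := FA n; exists G'.
      exists (\bigcup_n A' n); first by apply: FU => n; exact: (A'P n).1.
      by rewrite !setI_bigcupl; apply: eq_bigcupr => n _; exact: (A'P n).2.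
  - by move=> t t0 A [].
  - by move=> s t s0 st A [mA [A' FA' AA']]; split => //; exists A' => //; exact: Fmono FA'.
  - move=> i t A t0 mA At B mB; have [_ _ _ Nt _] := Np i.
    have FB : F t ((fun w => N i w A) @^-1` B).
      by apply: Nt => //; apply: sub_sigma_algebra; exists A, B.
    split.
      by rewrite -[X in measurable X]setTI; apply: mN' => //; exact: subset_trans (ccq t).
    exists ((fun w => N i w A) @^-1` B) => //.
    by apply/seteqP; split => w /= [+ Ow]; rewrite N'E mem_set.
  - move=> i w a b; rewrite N'E; case: ifP => [/goodO[fN _ _]|_]; last exact: ltry.
    pose n := Num.bound (Num.max 0 (Num.max a b)).
    have nb : Num.max 0 (Num.max a b) <= n%:R by rewrite ltW// archi_boundP// le_max lexx.
    apply: (@le_lt_trans _ _ (N i w (square n))); last by have := fN i n; rewrite ge0_fin_numE.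
    apply: le_measure; rewrite ?inE//.
      by apply: measurableX; exact: measurable_itv.
    move: nb; rewrite !ge_max => /andP[_ /andP[an bn]].
    by move=> [x y]; rewrite /square/= !in_itv/= => -[/andP[-> xa] /andP[-> yb]]; rewrite (le_trans xa an) (le_trans yb bn).
  - move=> i s G A s0 [mG [G' FG' GG']] mA As fA; have [_ _ _ _ Nfut] := Np i.
    have Aq := subset_trans As (gtq s s0).
    have mG' : measurable G' by exact: Fm FG'.
    have PGG' : P G = P G' by rewrite -(PI G)// -(PI G')// GG'.
    have -> : (\int[P]_(w in G) N' i w A = \int[P]_(w in G') (fine (N i w A))%:E)%E.
      rewrite integral_mkcond [RHS]integral_mkcond; apply: ge0_ae_eq_integral => //.
      - by apply/(measurable_restrictT _ _).1 => //; apply: measurable_funTS; exact: mN'.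
      - apply/(measurable_restrictT _ _).1 => //; apply: measurable_funTS; apply/measurable_EFinP.
        by apply: measurableT_comp => //; exact: mN.
      - by move=> w _; rewrite patchE; case: ifPn.
      - by move=> w _; rewrite patchE; case: ifPn => // _; rewrite lee_fin fine_ge0.
      - apply: filterS3 aeOm (NN' i A) (N_finite i mA Aq fA) => w Ow e fw _; rewrite !patchE e.
        have -> : (w \in G) = (w \in G').
          apply/idP/idP; rewrite !inE => Gw.
            by have [] : (G' `&` Om) w by rewrite -GG'; split => //; rewrite inE in Ow.
          by have [] : (G `&` Om) w by rewrite GG'; split => //; rewrite inE in Ow.
        by case: ifPn => // _; rewrite fineK.
    rewrite (integral_indep_event mG').
    + by rewrite PGG' EW.
    + by apply: measurableT_comp => //; exact: mN.
    + by move=> w; exact: fine_ge0.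
    + move=> B mB; apply: (Nfut s s0) => //; apply: sub_sigma_algebra.
      by exists A, (fine @^-1` B); split => //; exact: mfine.
  - move=> i A mA Aq fA; rewrite -(EN2 i mA Aq fA); apply: ge0_ae_eq_integral => //.
    + by apply: emeasurable_funM; exact: mN'.
    + by apply: emeasurable_funM; exact: mN.
    + by apply: filterS (NN' i A) => w -> _.
  - move=> i j A ij mA Aq fA.
    pose V w := fine (N i w A); pose W w := fine (N j w A).
    have mW : measurable_fun setT W by apply: measurableT_comp => //; exact: mN.
    have mV : measurable_fun setT V by apply: measurableT_comp => //; exact: mN.
    have -> : (\int[P]_w (N' i w A * N' j w A) = \int[P]_w (V w * W w)%:E)%E.
      apply: ge0_ae_eq_integral => //.
      + by apply: emeasurable_funM; exact: mN'.
      + by apply/measurable_EFinP; exact: measurable_funM.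
      + by move=> w _; rewrite lee_fin mulr_ge0 ?fine_ge0.
      + apply: filterS3 aeOm (N_finite i mA Aq fA) (N_finite j mA Aq fA) => w Ow fi fj _.
        by rewrite !N'E Ow EFinM !fineK.
    rewrite (integral_indep_product mW _ mV)//.
    + by rewrite !EW.
    + by move=> w; exact: fine_ge0.
    + by move=> w; exact: fine_ge0.
    + by rewrite EW.
    + move=> B C mB mC.
      pose E k := if k == i then V @^-1` B else W @^-1` C.
      have Ei : E i = V @^-1` B by rewrite /E eqxx.
      have Ej : E j = W @^-1` C by rewrite /E eq_sym (negbTE ij).
      have := Nind [fset i; j]%fset E.
      have -> : \bigcap_(k in [set` [fset i; j]%fset]) E k = V @^-1` B `&` W @^-1` C.
        apply/seteqP; split => w /=.
          move=> h; split; first by have := h i; rewrite /E eqxx; apply; rewrite /= !inE eqxx.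
          by have := h j; rewrite /E eq_sym (negbTE ij); apply; rewrite /= !inE eqxx orbT.
        by move=> [Vw Ww] k _; rewrite /E; case: ifP.
      rewrite big_fsetU1 ?inE//= big_seq_fset1 Ei Ej; apply.
      move=> k; rewrite !inE => /orP[/eqP->|/eqP->]; rewrite ?Ei ?Ej.
        by apply: sub_sigma_algebra; exists A, (fine @^-1` B); split => //; exact: mfine.
      by apply: sub_sigma_algebra; exists A, (fine @^-1` C); split => //; exact: mfine.
  - move=> i A mA Aq fA.
    have := poisson_integer (mN i mA Aq) (pN i mA Aq fA).
    by apply: filterS2 (NN' i A) => w ->.
have [Zadapt Zcadlag Zsum Zeq] := Z_hawkes.
have mZ i t : 0 <= t -> measurable_fun setT (Z i t).
  by move=> t0 _ B mB; apply: (Fm t t0); apply: (Zadapt i t t0); exists B.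
have mZ' i t : 0 <= t -> measurable_fun setT (Z' i t).
  move=> t0; rewrite /Z' (_ : (fun w => _) = (Z i t \_ Om)).
    by apply/(measurable_restrictT _ _).1 => //; apply: measurable_funTS; exact: mZ.
  by apply/funext => w; rewrite patchE.
have mbelow w i : measurable (below (intensity phi m (fun j s => Z' j s w) i)).
  by apply: below_measurable; exact: intensity_measurable.
have Z'eq i t w : 0 <= t ->
    ((Z' i t w)%:E = N' i w (strip `[0%R, t] `&` below (intensity phi m (fun j s => Z' j s w) i)))%E.
  move=> t0; rewrite N'E; have := mbelow w i; rewrite /Z'; case: ifPn => // Ow mb.
  have [_ _ ->//] := goodO w Ow.
  have ms := mstrip `[0, t].
  by rewrite integral_indic// setIC.
have Z'0 i t w : 0 <= t -> 0 <= Z' i t w by move=> t0; rewrite -lee_fin Z'eq.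
split.
- exact: PF.
- move=> i w; split.
    move=> s t st; rewrite /extend0; case: ifPn => s0; last first.
      by case: ifPn => // t0; exact: Z'0.
    have t0 := le_trans s0 st; rewrite t0 -lee_fin !Z'eq//.
    apply: le_measure; rewrite ?inE; [by apply: measurableI => //; apply: (mstrip `[0, _])..|].
    apply: setSI => -[x y]; rewrite /strip/= !in_itv/= => -[/andP[-> xs] ->].
    by rewrite (le_trans xs st).
  move=> t; have [t0|t0] := leP 0 t.
    rewrite /extend0 t0.
    have Zr : (Z' i x w @[x --> t^'+] --> Z' i t w).
      rewrite /Z'; case: ifP => _; last exact: cvg_cst.
      by have [+ _] := Zcadlag i w; apply.
    apply: cvg_trans Zr; apply: near_eq_cvg; near=> x.
    suff -> : 0 <= x by [].
    by apply: (le_trans t0); apply: ltW; near: x; exact: nbhs_right_gt.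
  rewrite {2}/extend0 leNgt t0/=; apply: cvg_near_cst; near=> x; rewrite /extend0.
  suff -> : 0 <= x = false by [].
  by apply/negbTE; rewrite -ltNge; near: x; exact: nbhs_right_lt.
- move=> i t t0 _ [B mB <-]; rewrite setTI; split.
    by rewrite -[X in measurable X]setTI; exact: mZ'.
  exists (Z i t @^-1` B); first by apply: (Zadapt i t t0); exists B; rewrite ?setTI.
  by apply/seteqP; split => w /= [+ Ow]; rewrite /Z' mem_set.
- move=> t t0; have := Zsum t t0.
  set S := (\esum_(i in _) _)%E => Sfin.
  have EZ i : (\int[P]_w (Z' i t w)%:E = 'E_P[Z i t])%E.
    rewrite unlock; apply: ae_eq_integral => //.
    + by apply/measurable_EFinP; exact: mZ'.
    + by apply/measurable_EFinP; exact: mZ.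
    + by apply: filterS aeOm => w Ow _; rewrite /Z' Ow.
  have E0 i : (0 <= 'E_P[Z i t])%E.
    by rewrite -EZ; apply: integral_ge0 => w _; rewrite lee_fin Z'0.
  have p0 i : 0 < 2 `^ (- enorm R i) by rewrite powR_gt0.
  (* Every term of a nonnegative series is at most its sum, which bounds the means by a constant
     times [2^|i|], uniformly in [i]. *)
  have le i : ((2 `^ (- enorm R i))%:E * 'E_P[Z i t] <= S)%E.
    apply: esum_ge; exists [set i]; first by split; [exact: finite_set1|].
    by rewrite fsbig_set1.
  have S0 : (0 <= S)%E by apply: esum_ge0 => i _; rewrite mule_ge0// lee_fin ltW.
  have fS : S \is a fin_num by rewrite ge0_fin_numE.
  exists (fine S) => i; rewrite EZ.
  have := le i; rewrite -lee_pdivlMl// => /le_trans; apply.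
  by rewrite powRN invrK -{1}(fineK fS) -EFinM mulrC.
- by move=> i w; rewrite N'E; case: ifPn => // /goodO[].
- exact: Z'eq.
Unshelve. all: end_near. Qed.

End clean_hawkes.

(** * Renewal equations *)

Section exponential_integrals.
Context {R : realType}.
Local Notation leb := (@lebesgue_measure R).

Lemma expR_lin_cvg0 (c : R) : 0 < c -> expR (- (c * t)) @[t --> +oo] --> (0 : R).
Proof.
move=> c0.
have h : (c * t) @[t --> +oo%R] --> +oo%R.
  apply/cvgryPge => A; near=> t.
  by rewrite mulrC -ler_pdivrMr//; near: t; exact: nbhs_pinfty_ge.
exact: (@cvg_comp _ _ _ (fun t => c * t) (fun x => expR (- x)) _ _ _ h (@cvgr_expR R)).
Unshelve. all: end_near. Qed.

(* [y <= 2 exp (y / 2)], so [t exp (- c t)] is dominated by [exp (- c t / 2)]. *)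
Lemma mul_expR_le (c t : R) : 0 < c -> 0 <= t -> t * expR (- (c * t)) <= 2 / c * expR (- (c / 2 * t)).
Proof.
move=> c0 t0.
have e : expR (- (c * t)) = expR (- (c / 2 * t)) * expR (- (c / 2 * t)).
  by rewrite -expRD; congr expR; field.
rewrite e mulrA ler_wpM2r ?expR_ge0//.
rewrite expRN ler_pdivrMr ?expR_gt0//.
have h := expR_ge1Dx (c / 2 * t).
have : c / 2 * t <= expR (c / 2 * t) by lra.
have p : 0 <= 2 / c by rewrite divr_ge0// ltW.
move/(ler_wpM2l p).
by apply: le_trans; rewrite le_eqVlt; apply/orP; left; apply/eqP; field; rewrite gt_eqF.
Qed.

Lemma mul_expR_cvg0 (c : R) : 0 < c -> t * expR (- (c * t)) @[t --> +oo] --> (0 : R).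
Proof.
move=> c0; apply: (@squeeze_cvgr _ _ _ _ (cst 0) (fun t => 2 / c * expR (- (c / 2 * t)))).
- near=> t; have t0 : 0 <= t by near: t; exact: nbhs_pinfty_ge.
  by rewrite mul_expR_le// mulr_ge0 ?expR_ge0.
- exact: cvg_cst.
- rewrite -(mulr0 (2 / c)); apply: cvgM; first exact: cvg_cst.
  by apply: expR_lin_cvg0; rewrite divr_gt0.
Unshelve. all: end_near. Qed.

Lemma integral_expR (c T : R) : 0 < c ->
  (\int[leb]_(t in `[T, +oo[) (expR (- (c * t)))%:E = (c^-1 * expR (- (c * T)))%:E)%E.
Proof.
move=> c0; pose G (t : R) : R := - (c^-1 * expR (- (c * t))).
have dG (t : R) : is_derive t 1 G (expR (- (c * t))).
  by apply: is_derive_eq; rewrite /GRing.scale/=; field; rewrite gt_eqF.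
have cG t : {for t, continuous G}.
  by apply: differentiable_continuous; apply/derivable1_diffP; apply: ex_derive.
rewrite (@ge0_continuous_FTC2y _ _ G T 0) /G.
- by rewrite -EFinB sub0r opprK.
- by move=> t _; exact: expR_ge0.
- by apply: continuous_subspaceT => t; apply: differentiable_continuous; apply/derivable1_diffP; apply: ex_derive.
- rewrite -oppr0 -(mulr0 c^-1); apply: cvgN; apply: cvgM; first exact: cvg_cst.
  exact: expR_lin_cvg0.
- by move=> t _; apply: ex_derive.
- exact: (cvg_at_right_filter (cG T)).
- by move=> t _; rewrite derive1E derive_val.
Qed.

Lemma integral_mul_expR (c : R) : 0 < c ->
  (\int[leb]_(t in `[0%R, +oo[) (t * expR (- (c * t)))%:E = (c ^- 2)%:E)%E.
Proof.
move=> c0; pose G (t : R) : R := - (c^-1 * (t * expR (- (c * t))) + c ^- 2 * expR (- (c * t))).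
have dG (t : R) : is_derive t 1 G (t * expR (- (c * t))).
  by apply: is_derive_eq; rewrite /GRing.scale/=; field; rewrite gt_eqF.
have cG t : {for t, continuous G}.
  by apply: differentiable_continuous; apply/derivable1_diffP; apply: ex_derive.
rewrite (@ge0_continuous_FTC2y _ _ G 0 0) /G.
- by rewrite -EFinB mul0r !mulr0 oppr0 expR0 mulr1 !add0r opprK.
- by move=> t t0; rewrite mulr_ge0 ?expR_ge0.
- by apply: continuous_subspaceT => t; apply: differentiable_continuous; apply/derivable1_diffP; apply: ex_derive.
- rewrite [X in _ --> X](_ : 0 = - (c^-1 * 0 + c ^- 2 * 0)); last by rewrite !mulr0 addr0 oppr0.
  apply: cvgN; apply: cvgD; apply: cvgM; try exact: cvg_cst.
    exact: mul_expR_cvg0.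
  exact: expR_lin_cvg0.
- by move=> t _; apply: ex_derive.
- exact: (cvg_at_right_filter (cG 0)).
- by move=> t _; rewrite derive1E derive_val.
Qed.

End exponential_integrals.

(** * Volterra operators with nonnegative kernel *)

Section convolution.
Context {R : realType}.
Local Notation leb := (@lebesgue_measure R).
Variable f : R -> R.
Hypotheses (f_ge0 : forall t, 0 <= f t) (mf : measurable_fun setT f).
Implicit Types (u v : R -> \bar R) (s t : R).
Local Notation I t := (`[0%R, t%R]%classic : set R).

Definition volterra u (t : R) : \bar R := (\int[leb]_(s in `[0%R, t]) ((f (t - s))%:E * u s))%E.

Let mfr t : measurable_fun setT (fun s : R => (f (t - s))%:E).
Proof. by apply/measurable_EFinP; apply: measurableT_comp => //; exact: measurable_funB. Qed.

Lemma measurable_volterra_integrand u t : measurable_fun (I t) u ->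
  measurable_fun (I t) (fun s => (f (t - s))%:E * u s)%E.
Proof. by move=> mu; apply: emeasurable_funM => //; exact: measurable_funTS. Qed.

Lemma volterra_ge0 u t : (forall s, 0 <= s <= t -> (0 <= u s)%E) -> (0 <= volterra u t)%E.
Proof.
move=> u0; apply: integral_ge0 => s; rewrite /= in_itv/= => st.
by rewrite mule_ge0 ?lee_fin ?u0.
Qed.

Lemma le_volterra u v t : measurable_fun (I t) u -> measurable_fun (I t) v ->
  (forall s, 0 <= s <= t -> (0 <= u s)%E) -> (forall s, 0 <= s <= t -> (u s <= v s)%E) ->
  (volterra u t <= volterra v t)%E.
Proof.
move=> mu mv u0 uv; apply: ge0_le_integral => //.
- by move=> s; rewrite /= in_itv/= => st; rewrite mule_ge0 ?lee_fin ?u0.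
- exact: measurable_volterra_integrand.
- exact: measurable_volterra_integrand.
- by move=> s; rewrite /= in_itv/= => st; rewrite lee_wpmul2l ?lee_fin ?uv.
Qed.

Lemma eq_volterra u v t : (forall s, 0 <= s <= t -> u s = v s) -> volterra u t = volterra v t.
Proof.
move=> uv; apply: eq_integral => s; rewrite inE/= in_itv/= => st.
by rewrite uv.
Qed.

Lemma volterraD u v t : measurable_fun (I t) u -> measurable_fun (I t) v ->
  (forall s, 0 <= s <= t -> (0 <= u s)%E) -> (forall s, 0 <= s <= t -> (0 <= v s)%E) ->
  volterra (fun s => u s + v s)%E t = (volterra u t + volterra v t)%E.
Proof.
move=> mu mv u0 v0; rewrite /volterra -ge0_integralD//.
- apply: eq_integral => s; rewrite inE/= in_itv/= => st.
  by rewrite ge0_muleDr ?u0 ?v0.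
- by move=> s; rewrite /= in_itv/= => st; rewrite mule_ge0 ?lee_fin ?u0.
- exact: measurable_volterra_integrand.
- by move=> s; rewrite /= in_itv/= => st; rewrite mule_ge0 ?lee_fin ?v0.
- exact: measurable_volterra_integrand.
Qed.

Lemma volterraZ (k : R) u t : 0 <= k -> measurable_fun (I t) u ->
  (forall s, 0 <= s <= t -> (0 <= u s)%E) ->
  volterra (fun s => k%:E * u s)%E t = (k%:E * volterra u t)%E.
Proof.
move=> k0 mu u0; rewrite /volterra -ge0_integralZl_EFin//.
- by apply: eq_integral => s _; rewrite muleCA.
- by move=> s; rewrite /= in_itv/= => st; rewrite mule_ge0 ?lee_fin ?u0.
- exact: measurable_volterra_integrand.
Qed.

Lemma volterra_reflect u t : measurable_fun (I t) u ->
  (forall s, 0 <= s <= t -> (0 <= u s)%E) ->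
  volterra u t = (\int[leb]_(r in `[0%R, t]) ((f r)%:E * u (t - r)%R))%E.
Proof.
move=> mu u0; rewrite /volterra integral_mkcond [RHS]integral_mkcond.
rewrite (ge0_integral_reflect t).
- apply: eq_integral => s _; rewrite !patchE.
  have -> : (t - s \in `[0, t]%classic) = (s \in `[0, t]%classic).
    by apply/idP/idP; rewrite !inE/= !in_itv/= => /andP[h1 h2]; apply/andP; split; lra.
  by case: ifPn => // _; rewrite subKr.
- by apply/(measurable_restrictT _ _).1 => //; exact: measurable_volterra_integrand.
- move=> s; rewrite patchE; case: ifPn => //; rewrite inE/= in_itv/= => st.
  by rewrite mule_ge0 ?lee_fin ?u0.
Qed.

Lemma measurable_volterra u : measurable_fun setT u -> (forall s, 0 <= u s)%E ->
  measurable_fun setT (volterra u).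
Proof.
move=> mu u0.
pose A : set (R * R) := [set p | 0 <= p.2] `&` [set p | p.2 <= p.1].
have mle (k l : R * R -> R) : measurable_fun setT k -> measurable_fun setT l -> measurable [set p | k p <= l p].
  by move=> mk ml; rewrite -[X in measurable X]setTI; exact: measurable_fun_le.
have mA : measurable A.
  by apply: measurableI; apply: mle; [|exact: measurable_snd|exact: measurable_snd|exact: measurable_fst].
pose k (p : R * R) := ((\1_A p)%:E * ((f (p.1 - p.2))%:E * u p.2))%E.
have mk : measurable_fun setT k.
  apply: emeasurable_funM; first by apply/measurable_EFinP; exact: measurable_indic.
  apply: emeasurable_funM; last by apply: measurableT_comp mu _; exact: measurable_snd.
  apply/measurable_EFinP; apply: measurableT_comp => //.
  by apply: measurable_funB; [exact: measurable_fst|exact: measurable_snd].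
have k0 p : (0 <= k p)%E by rewrite !mule_ge0 ?lee_fin.
have := @measurable_fun_fubini_tonelli_F _ _ (measurableTypeR R) (measurableTypeR R) R leb k mk k0.
apply: eq_measurable_fun => t _; rewrite /volterra [RHS]integral_mkcond; apply: eq_integral => s _.
rewrite patchE /k indicE.
have -> : ((t, s) \in A) = (s \in `[0, t]%classic).
  by apply/idP/idP; rewrite !inE /A/= in_itv/= => /andP.
by case: ifPn => _; rewrite ?mul1e ?mul0e.
Qed.

End convolution.

(** * Comparison and existence for the renewal equation *)

Section renewal.
Context {R : realType}.
Local Notation leb := (@lebesgue_measure R).
Local Notation I t := (`[0%R, t%R]%classic : set R).
Variables (f : R -> R) (kappa Cf : R).
Hypotheses (f_ge0 : forall t, 0 <= f t) (mf : measurable_fun setT f).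
Hypotheses (kappa0 : 0 < kappa) (Cf0 : 0 <= Cf).
Hypothesis f_le : forall t, 0 <= t -> f t <= Cf * expR (- (kappa * t)).
Hypothesis f_neg : forall t, t < 0 -> f t = 0.
Hypothesis f_int : (\int[leb]_t (f t)%:E = 1)%E.
Local Notation volterra := (volterra f).

Let mEf : measurable_fun setT (EFin \o f). Proof. exact/measurable_EFinP. Qed.

Let weight (r : R) := Num.min 1 (kappa * r).

Let mweight : measurable_fun setT weight.
Proof. by apply: measurable_minr => //; exact: measurable_funM. Qed.

Let D : \bar R := (\int[leb]_(r in `[0%R, +oo[) (f r * weight r)%:E)%E.

Let weight_ge0 r : 0 <= r -> 0 <= weight r.
Proof. by move=> r0; rewrite le_min ler01 mulr_ge0// ltW. Qed.

Let mfw (A : set R) : measurable_fun A (fun r => (f r * weight r)%:E).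
Proof. by apply/measurable_EFinP; apply: measurable_funM; apply: measurable_funTS. Qed.

Lemma renewal_int_ge0 : (\int[leb]_(t in `[0%R, +oo[) (f t)%:E = 1)%E.
Proof.
rewrite -f_int integral_mkcond; apply: eq_integral => t _; rewrite patchE.
case: ifPn => //; rewrite notin_setE/= in_itv/= andbT => /negP; rewrite -ltNge => t0.
by rewrite f_neg.
Qed.

(** If [D] were 0, then [f] would vanish almost everywhere on the positive half-line, against its
    total mass 1. *)
Let D_gt0 : (0 < D)%E.
Proof.
rewrite lt_neqAle integral_ge0 ?andbT; last first.
  by move=> r; rewrite /= in_itv/= andbT => r0; rewrite lee_fin mulr_ge0 ?weight_ge0.
apply/negP => /eqP D0.
have h : (\int[leb]_(r in `[0%R, +oo[) `|(f r * weight r)%:E| = 0)%E.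
  rewrite [RHS]D0; apply: eq_integral => r; rewrite inE/= in_itv/= andbT => r0.
  by rewrite /= ger0_norm// mulr_ge0 ?weight_ge0.
have mI : measurable (`[0%R, +oo[%classic : set R) by exact: measurable_itv.
move/(ae_eq_integral_abs leb mI (@mfw _)) : h => h.
have := renewal_int_ge0.
have -> : (\int[leb]_(t in `[0%R, +oo[) (f t)%:E = 0)%E.
  apply: etrans (_ : \int[leb]_(t in `[0%R, +oo[) (cst 0 t) = 0)%E; last by rewrite integral0.
  apply: ge0_ae_eq_integral => //; first exact: measurable_funTS.
    by move=> t _; rewrite lee_fin.
  have h0 : {ae leb, forall t : R, t != 0}.
    exists [set 0]; split => //; first exact: lebesgue_measure_set1.
    by move=> t /= /negP; rewrite negbK => /eqP.
  apply: filterS2 h h0 => t /= h t0 tI; have [/eqP] := h tI.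
  rewrite mulf_eq0 => /orP[/eqP-> //|].
  move: tI; rewrite in_itv/= andbT => tge0.
  have t1 : 0 < t by rewrite lt_neqAle eq_sym t0.
  by rewrite gt_eqF// lt_min ltr01 mulr_gt0.
by move=> /eqP; rewrite lt_eqF// lte_fin.
Qed.

Let D_le1 : (D <= 1)%E.
Proof.
rewrite -renewal_int_ge0; apply: ge0_le_integral => //.
- by move=> r; rewrite /= in_itv/= andbT => r0; rewrite lee_fin mulr_ge0 ?weight_ge0.
- exact: mfw.
- exact: measurable_funTS.
- by move=> r; rewrite /= in_itv/= andbT => r0; rewrite lee_fin ler_piMr// ge_min lexx.
Qed.

Let c : R := (fine D)^-1.

Let fD : D = (fine D)%:E.
Proof. by apply/esym/fineK; rewrite (ge0_fin_numE (ltW D_gt0)); exact: le_lt_trans D_le1 (ltry 1). Qed.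

Let c0 : 0 < c.
Proof. by rewrite invr_gt0 -lte_fin -fD. Qed.

Let cD : (c%:E * D = 1)%E.
Proof. by rewrite fD -EFinM mulVf// gt_eqF// -lte_fin -fD. Qed.

(* A bounded supersolution of [u = exp (- kappa t) + f * u]. *)
Definition barrier (t : R) : R := 2 * c - c * expR (- (kappa * t)).

Lemma barrier_ge0 t : 0 <= t -> 0 <= barrier t.
Proof.
move=> t0; have : expR (- (kappa * t)) <= 1 by rewrite expR_le1 oppr_le0 mulr_ge0// ltW.
by move/(ler_wpM2l (ltW c0)); rewrite /barrier; have := c0; lra.
Qed.

Lemma barrier_le t : barrier t <= 2 * c.
Proof. by rewrite /barrier gerBl mulr_ge0 ?expR_ge0// ltW. Qed.

Lemma measurable_barrier : measurable_fun setT barrier.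
Proof.
apply: measurable_funB => //; apply: measurable_funM => //; apply: measurableT_comp => //.
by apply: measurableT_comp => //; exact: measurable_funM.
Qed.

(** For [r <= t] this is [exp (kappa r) >= 1 + kappa r]; for [r > t] the barrier is at least [c].
    Integrated against [f], the first term becomes [exp (- kappa t)] because [c D = 1]. *)
Let barrier_pointwise t r : 0 <= t -> 0 <= r ->
  c * expR (- (kappa * t)) * weight r + (if r <= t then barrier (t - r) else 0) <= barrier t.
Proof.
move=> t0 r0; set x := expR (- (kappa * t)).
have x0 : 0 < x by exact: expR_gt0.
have x1 : x <= 1 by rewrite /x expR_le1 oppr_le0 mulr_ge0// ltW.
have cx : 0 < c * x by rewrite mulr_gt0.
have w1 : weight r <= 1 by rewrite ge_min lexx.
have w2 : weight r <= kappa * r by rewrite ge_min lexx orbT.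
case: ifPn => rt.
  have -> : barrier (t - r) = 2 * c - c * x * expR (kappa * r).
    by rewrite /barrier -mulrA /x -expRD; congr (_ - _ * expR _); ring.
  have := expR_ge1Dx (kappa * r); rewrite /barrier -/x => h.
  have : c * x * (1 + weight r) <= c * x * expR (kappa * r) by rewrite ler_pM2l//; lra.
  lra.
rewrite addr0 /barrier -/x.
have : c * x * weight r <= c * x * 1 by rewrite ler_pM2l.
have : c * x <= c * 1 by rewrite ler_pM2l.
lra.
Qed.

Lemma barrier_super K t : 0 <= K -> 0 <= t ->
  ((K * expR (- (kappa * t)))%:E + volterra (fun s => (K * barrier s)%:E) t <= (K * barrier t)%:E)%E.
Proof.
move=> K0 t0.
have mb u : measurable_fun (I u) (fun s => (barrier s)%:E).
  by apply/measurable_EFinP; apply: measurable_funTS; exact: measurable_barrier.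
have b0 u s : 0 <= s <= u -> (0 <= (barrier s)%:E)%E.
  by move=> /andP[s0 _]; rewrite lee_fin barrier_ge0.
under eq_volterra do rewrite EFinM.
rewrite volterraZ//; last exact: b0.
rewrite !EFinM -ge0_muleDr ?lee_fin ?expR_ge0//; last by apply: volterra_ge0 => // s; exact: b0.
apply: lee_wpmul2l => //.
rewrite volterra_reflect//; last exact: b0.
have xE : (expR (- (kappa * t)))%:E = (\int[leb]_(r in `[0%R, +oo[) (c * expR (- (kappa * t)) * (f r * weight r))%:E)%E.
  under eq_integral do rewrite EFinM.
  rewrite ge0_integralZl_EFin//.
  - rewrite [c * _]mulrC EFinM -muleA; apply/esym.
    by rewrite -[X in (_ * X)%E]/(c%:E * D)%E cD mule1.
  - by move=> r; rewrite /= in_itv/= andbT => r0; rewrite lee_fin mulr_ge0 ?weight_ge0.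
  - exact: mfw.
  - by rewrite mulr_ge0 ?expR_ge0// ltW.
have bE : (barrier t)%:E = (\int[leb]_(r in `[0%R, +oo[) (barrier t * f r)%:E)%E.
  under eq_integral do rewrite EFinM.
  rewrite ge0_integralZl_EFin//; first by rewrite renewal_int_ge0 mule1.
  - by move=> r _; rewrite lee_fin.
  - exact: measurable_funTS.
  - exact: barrier_ge0.
pose g r := f r * (if r <= t then barrier (t - r) else 0).
have cE : (\int[leb]_(r in `[0%R, t]) ((f r)%:E * (barrier (t - r))%:E) =
    \int[leb]_(r in `[0%R, +oo[) (g r)%:E)%E.
  rewrite integral_mkcond [RHS]integral_mkcond; apply: eq_integral => r _; rewrite !patchE /g.
  have -> : (r \in `[0, t]%classic) = (r \in `[0, +oo[%classic) && (r <= t).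
    by apply/idP/andP; rewrite !inE/= !in_itv/= ?andbT; [move=> /andP|move=> [-> ->]].
  by case: (r \in _) => //=; case: (r <= t); rewrite ?EFinM ?mule0.
have mg : measurable_fun (`[0%R, +oo[%classic : set R) g.
  apply: measurable_funM; first exact: measurable_funTS.
  apply: measurable_funTS; apply: measurable_fun_ifT => //; first exact: measurable_fun_ler.
  by apply: measurableT_comp measurable_barrier _; exact: measurable_funB.
have g0 r : 0 <= r -> 0 <= g r.
  move=> r0; rewrite mulr_ge0//; case: ifPn => // rt.
  by rewrite barrier_ge0// subr_ge0.
have mcfw : measurable_fun (`[0%R, +oo[%classic : set R) (fun r => (c * expR (- (kappa * t)) * (f r * weight r))%:E).
  by apply/measurable_EFinP; apply: measurable_funM => //; apply/measurable_EFinP; exact: mfw.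
rewrite cE xE bE -ge0_integralD//.
- apply: ge0_le_integral => //.
  + move=> r; rewrite /= in_itv/= andbT => r0.
    by rewrite -EFinD lee_fin addr_ge0 ?g0// !mulr_ge0 ?expR_ge0 ?weight_ge0// ltW.
  + by apply: emeasurable_funD; [exact: mcfw|exact/measurable_EFinP].
  + by apply/measurable_EFinP; apply: measurable_funM => //; exact: measurable_funTS.
  + move=> r; rewrite /= in_itv/= andbT => r0.
    rewrite -EFinD lee_fin /g [barrier t * _]mulrC mulrCA -mulrDr ler_wpM2l//.
    exact: barrier_pointwise.
- move=> r; rewrite /= in_itv/= andbT => r0.
  by rewrite lee_fin !mulr_ge0 ?expR_ge0 ?weight_ge0// ltW.
- by move=> r; rewrite /= in_itv/= andbT => r0; rewrite lee_fin g0.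
- exact/measurable_EFinP.
Qed.

(** In the weight [exp (theta t)] the Volterra operator has norm at most [Cf / theta], so it
    contracts for [theta] large. *)
Lemma volterra_expR (theta t : R) : 0 < theta -> 0 <= t ->
  (volterra (fun s => (expR (theta * s))%:E) t <= (Cf / theta * expR (theta * t))%:E)%E.
Proof.
move=> th0 t0; rewrite volterra_reflect//; last first.
  by apply/measurable_EFinP; apply: measurable_funTS; apply: measurableT_comp => //; exact: measurable_funM.
apply: (@le_trans _ _ (\int[leb]_(r in `[0%R, +oo[) ((Cf * expR (theta * t)) * expR (- (theta * r)))%:E)%E); last first.
  under eq_integral do rewrite EFinM.
  rewrite ge0_integralZl_EFin//.
  - by rewrite integral_expR// mulr0 oppr0 expR0 mulr1 -EFinM lee_fin mulrAC.
  - apply/measurable_EFinP; apply: measurable_funTS; apply: measurableT_comp => //.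
    by apply: measurableT_comp => //; exact: measurable_funM.
  - by rewrite mulr_ge0 ?expR_ge0.
have me : measurable_fun setT (fun r => (Cf * expR (theta * t) * expR (- (theta * r)))%:E).
  apply/measurable_EFinP; apply: measurable_funM => //; apply: measurableT_comp => //.
  by apply: measurableT_comp => //; exact: measurable_funM.
apply: (@le_trans _ _ (\int[leb]_(r in `[0%R, t]) ((Cf * expR (theta * t)) * expR (- (theta * r)))%:E)%E).
  apply: ge0_le_integral => //.
  - by move=> r _; rewrite mule_ge0 ?lee_fin ?expR_ge0.
  - apply: emeasurable_funM; first exact: measurable_funTS.
    apply/measurable_EFinP; apply: measurable_funTS; apply: measurableT_comp => //.
    by apply: measurable_funM => //; exact: measurable_funB.
  - exact: measurable_funTS.
  - move=> r; rewrite /= in_itv/= => /andP[r0 rt].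
    rewrite -EFinM lee_fin -mulrA -expRD -mulrN -mulrDr.
    rewrite ler_wpM2r ?expR_ge0//; apply: le_trans (f_le r0) _.
    by rewrite ler_piMr// expR_le1 oppr_le0 mulr_ge0// ltW.
apply: ge0_subset_integral => //.
- exact: measurable_funTS.
- by move=> r _; rewrite lee_fin !mulr_ge0 ?expR_ge0.
- by move=> r; rewrite /= !in_itv/= andbT => /andP[].
Qed.

(** The inequality at level [n] refers to level [n + 1], so it is iterated [k] times. The a priori
    bound grows like [2^k] while each iteration gains 1/4 in the weight [exp (th t)]; the rest is of
    order [2^-k]. The growth [2^n] is that of the weights [2^|i|] under averaging. *)
Lemma renewal_comparison (K C T : R) (u : nat -> R -> \bar R) : 0 <= K -> 0 <= C ->
  (forall n, measurable_fun (I T) (u n)) ->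
  (forall n s, 0 <= s <= T -> (0 <= u n s)%E) ->
  (forall n s, 0 <= s <= T -> (u n s <= (C * 2 ^+ n)%:E)%E) ->
  (forall n t, 0 <= t <= T -> (u n t <= (K * expR (- (kappa * t)))%:E + volterra (u n.+1) t)%E) ->
  forall n t, 0 <= t <= T -> (u n t <= (K * barrier t)%:E)%E.
Proof.
move=> K0 C0 mu u0 uC ueq.
(* Chosen so that [Cf / th <= 1/4]. *)
pose th := 4 * Cf + 1; have th0 : 0 < th by rewrite ltr_wpDl// mulr_ge0.
have th4 : Cf / th <= 4^-1 by rewrite ler_pdivrMr// mulrDr mulrA mulVf// mul1r lerDl.
have main k : forall n t, 0 <= t <= T ->
    (u n t <= (K * barrier t + C * 2 ^+ (n + k) * 4 ^- k * expR (th * t))%:E)%E.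
  elim: k => [|k IH] n t tT; have /andP[t0 tT'] := tT.
    apply: le_trans (uC n t tT) _; rewrite lee_fin addn0 expr0 invr1 mulr1.
    have h1 : 0 <= K * barrier t by rewrite mulr_ge0 ?barrier_ge0.
    have h2 : C * 2 ^+ n <= C * 2 ^+ n * expR (th * t).
      by rewrite ler_peMr ?mulr_ge0 ?exprn_ge0// -expR0 ler_expR mulr_ge0// ltW.
    lra.
  have sub s : 0 <= s <= t -> 0 <= s <= T by move=> /andP[-> st]; exact: le_trans st tT'.
  have subI : I t `<=` I T by move=> s; rewrite /= !in_itv/=; exact: sub.
  have mb : measurable_fun (I t) (fun s => (K * barrier s)%:E).
    by apply/measurable_EFinP; apply: measurable_funM => //; apply: measurable_funTS; exact: measurable_barrier.
  have me : measurable_fun (I t) (fun s => (expR (th * s))%:E).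
    by apply/measurable_EFinP; apply: measurable_funTS; apply: measurableT_comp => //; exact: measurable_funM.
  set a := C * 2 ^+ (n.+1 + k) * 4 ^- k.
  have a0 : 0 <= a by rewrite !mulr_ge0 ?exprn_ge0// invr_ge0 exprn_ge0.
  apply: le_trans (ueq n t tT) _.
  have h : (volterra (u n.+1) t <= volterra (fun s => (K * barrier s)%:E + a%:E * (expR (th * s))%:E)%E t)%E.
    apply: le_volterra => //.
    - by apply: measurable_funS (mu n.+1).
    - by apply: emeasurable_funD => //; exact: emeasurable_funM.
    - by move=> s /sub; exact: u0.
    - by move=> s /sub /(IH n.+1 s); rewrite EFinD EFinM.
  rewrite volterraD// in h; last 3 first.
  - exact: emeasurable_funM.
  - by move=> s /andP[s0 _]; rewrite lee_fin mulr_ge0 ?barrier_ge0.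
  - by move=> s _; rewrite mule_ge0 ?lee_fin ?expR_ge0.
  rewrite volterraZ// in h.
  apply: le_trans (leeD (lexx _) h) _; rewrite addeA EFinD; apply: leeD.
    exact: barrier_super.
  apply: le_trans (lee_wpmul2l _ (volterra_expR th0 t0)) _; first by rewrite lee_fin.
  rewrite -EFinM lee_fin.
  have -> : C * 2 ^+ (n + k.+1) * 4 ^- k.+1 * expR (th * t) = a * (4^-1 * expR (th * t)).
    by rewrite /a addSnnS exprS invfM; ring.
  by rewrite ler_wpM2l// ler_wpM2r ?expR_ge0.
move=> n t tT; apply/lee_addgt0Pr => e e0.
pose M := C * 2 ^+ n * expR (th * t).
have M0 : 0 <= M by rewrite !mulr_ge0 ?exprn_ge0 ?expR_ge0.
pose k := Num.bound (M / e).
apply: le_trans (main k n t tT) _; rewrite -EFinD lee_fin lerD2l.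
have -> : C * 2 ^+ (n + k) * 4 ^- k * expR (th * t) = M / 2 ^+ k.
  rewrite /M exprD (_ : 4 = 2 * 2 :> R); last by ring.
  by rewrite exprMn; field; rewrite expf_neq0.
rewrite ler_pdivrMr ?exprn_gt0// mulrC -ler_pdivrMr//.
apply: le_trans (ltW (archi_boundP _)) _; first by rewrite divr_ge0// ltW.
by rewrite -natrX ler_nat ltnW// ltn_expl.
Qed.

Local Notation alpha := (2 * kappa).
Local Notation g := (fun t : R => t * expR (- (alpha * t))).

Let g_le t : 0 <= t -> g t <= kappa^-1 * expR (- (kappa * t)).
Proof.
move=> t0; have := @mul_expR_le R alpha t (mulr_gt0 (ltr0n _ 2) kappa0) t0.
have -> : 2 / alpha = kappa^-1 by field; rewrite gt_eqF.
by have -> : alpha / 2 = kappa by field.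
Qed.

Let mg (A : set R) : measurable_fun A (fun t => (g t)%:E).
Proof.
apply: measurable_funTS; apply/measurable_EFinP; apply: measurable_funM => //.
by apply: measurableT_comp => //; apply: measurableT_comp => //; exact: measurable_funM.
Qed.

(** Picard iteration from 0. It is cut to 0 at negative times, where the source is negative, so that
    all iterates are nonnegative on the whole line. *)
Fixpoint renewal_iter (k : nat) (t : R) : \bar R :=
  if k is k'.+1 then (if (0 <= t)%R then (g t)%:E + volterra (renewal_iter k') t else 0)%E else 0%E.

Let renewal_iterS k t : renewal_iter k.+1 t =
  (if (0 <= t)%R then (g t)%:E + volterra (renewal_iter k) t else 0)%E.
Proof. by []. Qed.

Lemma renewal_iter_ge0 k t : (0 <= renewal_iter k t)%E.
Proof.
elim: k t => [//|k IH] t /=; case: ifPn => // t0.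
by rewrite adde_ge0 ?lee_fin ?mulr_ge0 ?expR_ge0// volterra_ge0.
Qed.

Lemma measurable_renewal_iter k : measurable_fun setT (renewal_iter k).
Proof.
elim: k => [|k IH] /=; first exact: measurable_cst.
apply: measurable_fun_ifT => //; first exact: measurable_fun_ler.
apply: emeasurable_funD; first exact: mg.
apply: (measurable_volterra f_ge0 mf IH).
exact: renewal_iter_ge0.
Qed.

Let mI k t : measurable_fun (I t) (renewal_iter k).
Proof. by apply: measurable_funTS; exact: measurable_renewal_iter. Qed.

Lemma renewal_iter_nd t : nondecreasing_seq (renewal_iter ^~ t).
Proof.
apply/nondecreasing_seqP => k; elim: k t => [|k IH] t; first exact: renewal_iter_ge0.
rewrite !renewal_iterS; case: ifPn => // t0; apply: leeD => //.
by apply: le_volterra => // s _; exact: renewal_iter_ge0.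
Qed.

(** The source is at most [kappa^-1 exp (- kappa t)], so [kappa^-1] times the barrier is a
    supersolution. *)
Lemma renewal_iter_le k t : 0 <= t -> (renewal_iter k t <= (kappa^-1 * barrier t)%:E)%E.
Proof.
have k0 : 0 <= kappa^-1 by rewrite invr_ge0 ltW.
elim: k t => [|k IH] t t0; first by rewrite lee_fin mulr_ge0// barrier_ge0.
rewrite /= t0; apply: le_trans (barrier_super k0 t0); apply: leeD.
  by rewrite lee_fin g_le.
apply: le_volterra => //.
- by apply/measurable_EFinP; apply: measurable_funM => //; apply: measurable_funTS; exact: measurable_barrier.
- by move=> s _; exact: renewal_iter_ge0.
- by move=> s /andP[s0 _]; exact: IH.
Qed.

(** Without the discount the source is [t], which is nondecreasing, and the iteration preserves
    this. The resulting one-sided regularity of the solution feeds the window argument. *)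
Lemma renewal_iter_mono k s t : 0 <= s -> s <= t ->
  (renewal_iter k s <= (expR (alpha * (t - s)))%:E * renewal_iter k t)%E.
Proof.
elim: k s t => [|k IH] s t s0 st; first by rewrite mule0.
have t0 := le_trans s0 st.
rewrite /= s0 t0 ge0_muleDr ?lee_fin ?mulr_ge0 ?expR_ge0//; last first.
  by apply: volterra_ge0 => // r _; exact: renewal_iter_ge0.
apply: leeD.
  rewrite -EFinM lee_fin mulrCA -expRD.
  have -> : alpha * (t - s) + - (alpha * t) = - (alpha * s) by ring.
  by rewrite ler_wpM2r ?expR_ge0.
rewrite !volterra_reflect//; try by move=> r _; exact: renewal_iter_ge0.
have mr u (A : set R) : measurable_fun A (fun r : R => (f r)%:E * renewal_iter k (u - r)%R)%E.
  apply: measurable_funTS; apply: emeasurable_funM => //.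
  by apply: measurableT_comp (measurable_renewal_iter k) _; exact: measurable_funB.
have r0 u r : (0 <= (f r)%:E * renewal_iter k (u - r)%R)%E.
  by rewrite mule_ge0 ?lee_fin ?renewal_iter_ge0.
rewrite -ge0_integralZl_EFin ?expR_ge0//; last exact: mr.
have le_s : (\int[leb]_(r in `[0%R, s]) ((f r)%:E * renewal_iter k (s - r)%R) <=
    \int[leb]_(r in `[0%R, s]) ((expR (alpha * (t - s)))%:E * ((f r)%:E * renewal_iter k (t - r)%R)))%E.
  apply: ge0_le_integral => //.
  - exact: mr.
  - by apply: emeasurable_funM => //; exact: mr.
  - move=> r; rewrite /= in_itv/= => /andP[r0' rs].
    rewrite muleCA lee_wpmul2l ?lee_fin//.
    have := IH (s - r) (t - r); rewrite subr_ge0 lerD2r.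
    have -> : t - r - (s - r) = t - s by ring.
    by apply.
apply: le_trans le_s _; apply: ge0_subset_integral => //.
- by apply: emeasurable_funM => //; exact: mr.
- by move=> r _; rewrite mule_ge0 ?lee_fin ?expR_ge0.
- by move=> r; rewrite /= !in_itv/= => /andP[-> rs]; exact: le_trans rs st.
Qed.

(** The increasing limit of the Picard iterates, finite below the barrier; both the equation and the
    monotonicity pass to it. *)
Lemma renewal_solution : exists h : R -> R,
  [/\ measurable_fun setT h, (forall t, 0 <= h t),
      (exists B, forall t, 0 <= t -> h t <= B),
      (forall t, 0 <= t -> ((h t)%:E = (g t)%:E + volterra (fun s => (h s)%:E) t)%E) &
      forall s t, 0 <= s -> s <= t -> h s <= expR (alpha * (t - s)) * h t].
Proof.
pose H t := limn (renewal_iter ^~ t).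
have cH t : renewal_iter k t @[k --> \oo] --> H t.
  by apply: ereal_nondecreasing_is_cvgn; exact: renewal_iter_nd.
have H0 t : (0 <= H t)%E.
  apply: lime_ge; first by apply/cvg_ex; eexists; exact: cH.
  by apply: nearW => k; exact: renewal_iter_ge0.
have HB t : 0 <= t -> (H t <= (kappa^-1 * barrier t)%:E)%E.
  move=> t0; apply: lime_le; first by apply/cvg_ex; eexists; exact: cH.
  by apply: nearW => k; exact: renewal_iter_le.
have Hneg t : t < 0 -> H t = 0%E.
  move=> t0; apply/cvg_lim => //; rewrite (_ : (fun k => _) = cst 0%E); first exact: cvg_cst.
  by apply/funext => -[|k]//=; rewrite leNgt t0.
have fH t : H t \is a fin_num.
  have [t0|t0] := leP 0 t; last by rewrite Hneg.
  by rewrite ge0_fin_numE//; apply: le_lt_trans (HB t t0) _; rewrite ltry.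
have mH : measurable_fun setT H.
  by apply: (emeasurable_fun_cvg renewal_iter) => //; exact: measurable_renewal_iter.
exists (fun t => fine (H t)); split.
- exact: measurableT_comp.
- by move=> t; exact: fine_ge0.
- exists (kappa^-1 * (2 * c)) => t t0; rewrite -lee_fin fineK//; apply: le_trans (HB t t0) _.
  by rewrite lee_fin ler_wpM2l ?invr_ge0 ?(ltW kappa0)// barrier_le.
- move=> t t0; rewrite fineK//; under eq_volterra do rewrite fineK//.
  have -> : volterra H t = limn (fun k => volterra (renewal_iter k) t).
    rewrite /volterra -monotone_convergence//.
    + apply: eq_integral => s _; apply/esym/cvg_lim => //.
      by apply: cvgeZl => //; exact: cH.
    + by move=> k; exact: measurable_volterra_integrand.
    + by move=> k s _; rewrite mule_ge0 ?lee_fin ?renewal_iter_ge0.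
    + by move=> s _ k l kl; rewrite lee_wpmul2l ?lee_fin// renewal_iter_nd.
  have cc : volterra (renewal_iter k) t @[k --> \oo] --> limn (fun k => volterra (renewal_iter k) t).
    apply: ereal_nondecreasing_is_cvgn => k l kl; apply: le_volterra => //.
    + by move=> s _; exact: renewal_iter_ge0.
    + by move=> s _; exact: renewal_iter_nd.
  have c1 : renewal_iter k.+1 t @[k --> \oo] --> ((g t)%:E + limn (fun k => volterra (renewal_iter k) t))%E.
    under eq_fun do rewrite renewal_iterS t0.
    by apply: cvgeD => //; exact: cvg_cst.
  have c2 : renewal_iter k.+1 t @[k --> \oo] --> H t.
    by rewrite (cvg_shiftS (renewal_iter ^~ t)).
  exact: cvg_unique c2 c1.
- move=> s t s0 st; rewrite -lee_fin EFinM !fineK//.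
  apply: lime_le; first by apply/cvg_ex; eexists; exact: cH.
  apply: nearW => k; apply: le_trans (renewal_iter_mono k s0 st) _.
  rewrite lee_wpmul2l ?lee_fin ?expR_ge0//.
  apply: lime_ge; first by apply/cvg_ex; eexists; exact: cH.
  by exists k => // l /= kl; exact: renewal_iter_nd.
Qed.

End renewal.

(** * Upper limits of bounded functions *)

Section limsup.
Context {R : realType}.

(** [L] is the infimum of the eventual upper bounds; the last two clauses are the form in which an
    upper limit is used below. *)
Lemma limsup_exists (k : R -> R) (B : R) : (forall t, 0 <= t -> 0 <= k t <= B) ->
  exists L, [/\ 0 <= L, L <= B,
    (forall e, 0 < e -> exists T, 0 <= T /\ forall t, T <= t -> k t <= L + e) &
    (forall e T, 0 < e -> exists t, T <= t /\ L - e <= k t)].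
Proof.
move=> kB.
pose S : set R := [set c | exists T, 0 <= T /\ forall t, T <= t -> k t <= c].
have SB : S B by exists 0; split=> // t /kB /andP[].
have S0 c : S c -> 0 <= c.
  by move=> [T [T0 kc]]; apply: le_trans (kc T (lexx T)); have /andP[] := kB T T0.
have hS : has_inf S by split; [exists B|exists 0 => c /S0].
exists (inf S); split.
- by apply: lb_le_inf; [exists B|move=> c /S0].
- by apply: ge_inf => //; exact: hS.2.
- move=> e e0; have [c [T [T0 kc]] ce] := inf_adherent e0 hS.
  by exists T; split=> // t /kc /le_trans; apply; exact: ltW.
- move=> e T e0; apply: contrapT => nt.
  have : S (inf S - e).
    exists (Num.max T 0); split; first by rewrite le_max lexx orbT.
    move=> t; rewrite ge_max => /andP[Tt _]; rewrite leNgt; apply/negP => h; apply: nt.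
    by exists t; split => //; exact: ltW.
  move/(ge_inf hS.2); lra.
Qed.

End limsup.

(** * Long windows of values near the upper limit *)

Section renewal_window.
Context {R : realType}.
Local Notation leb := (@lebesgue_measure R).
Local Notation I t := (`[0%R, t%R]%classic : set R).
Variables (f : R -> R) (kappa Cf : R).
Hypotheses (f_ge0 : forall t, 0 <= f t) (mf : measurable_fun setT f).
Hypotheses (kappa0 : 0 < kappa) (Cf0 : 0 <= Cf).
Hypothesis f_le : forall t, 0 <= t -> f t <= Cf * expR (- (kappa * t)).
Hypothesis f_int : (\int[leb]_(t in `[0%R, +oo[) (f t)%:E = 1)%E.
Variables (a b w c1 : R).
Hypotheses (w0 : 0 < w) (aw : w < a) (ab : a < b) (c10 : 0 < c1).
Hypothesis f_ge : forall r, a - w <= r <= b + w -> c1 <= f r.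
Local Notation volterra := (volterra f).

Variables (k g : R -> R) (B L : R).
Hypotheses (mk : measurable_fun setT k) (kB : forall t, 0 <= t -> 0 <= k t <= B).
Hypothesis g0 : g t @[t --> +oo] --> 0.
Hypothesis keq : forall t, 0 <= t -> ((k t)%:E = (g t)%:E + volterra (fun s => (k s)%:E) t)%E.
Hypothesis L0 : 0 <= L.
Hypothesis L_ub : forall e, 0 < e -> exists T, 0 <= T /\ forall t, T <= t -> k t <= L + e.
Hypothesis L_freq : forall e T, 0 < e -> exists t, T <= t /\ L - e <= k t.
(** A low value persists on an interval of length [eta]. The interval lies on the left of [x] for
    the renewal function [h] and on the right for [B - h]; the free endpoint [x0] covers both
    uses. *)
Hypothesis k_reg : forall delta, 0 < delta -> exists eta, [/\ 0 < eta, eta <= w &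
  forall x, w <= x -> k x < L - delta ->
    exists x0, [/\ x - eta <= x0, x0 <= x & forall y, x0 <= y <= x0 + eta -> k y <= L - delta / 2]].

Lemma renewal_tail T : 0 <= T ->
  (\int[leb]_(r in `[T, +oo[) (f r)%:E <= (Cf / kappa * expR (- (kappa * T)))%:E)%E.
Proof.
move=> T0.
have me : measurable_fun setT (fun r : R => (expR (- (kappa * r)))%:E).
  apply/measurable_EFinP; apply: measurableT_comp => //; exact: measurableT_comp.
have mce : measurable_fun setT (fun r : R => Cf%:E * (expR (- (kappa * r)))%:E)%E.
  exact: emeasurable_funM.
apply: (@le_trans _ _ (\int[leb]_(r in `[T, +oo[) (Cf%:E * (expR (- (kappa * r)))%:E))%E).
  apply: ge0_le_integral => //.
  - by move=> r _; rewrite lee_fin.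
  - by apply: measurable_funTS; exact/measurable_EFinP.
  - exact: measurable_funTS mce.
  - move=> r; rewrite /= in_itv/= andbT => Tr; rewrite -EFinM lee_fin f_le//.
    exact: le_trans Tr.
rewrite ge0_integralZl_EFin//; last exact: measurable_funTS.
by rewrite integral_expR// -EFinM mulrA.
Qed.

(** In the renewal equation a deficit [delta / 2] on an interval of length [eta], seen through lags
    where [f >= c1], lowers [k t] by [delta / 2 * c1 * eta]. Lags beyond [t - T0], where only
    [k <= B] is known, weigh no more than the tail of [f]. *)
Let one_step_bound t T0 e delta eta x0 : 0 <= t -> 0 <= e -> 0 <= T0 -> T0 <= t -> 0 < delta -> 0 < eta ->
  (forall s, T0 <= s -> k s <= L + e) ->
  (forall y, x0 <= y <= x0 + eta -> k y <= L - delta / 2) ->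
  a - w <= t - (x0 + eta) -> t - x0 <= b + w -> b + w <= t ->
  k t <= g t + L + e + B * (Cf / kappa * expR (- (kappa * (t - T0)))) - delta / 2 * c1 * eta.
Proof.
move=> t0 e0 T00 T0t d0 eta0 kT0 ky ha hb hbt.
have B0 : 0 <= B by have /andP[h1 h2] := kB (lexx 0); exact: le_trans h1 h2.
pose J : set R := `[t - (x0 + eta), t - x0]%classic.
have mJ : measurable J by exact: measurable_itv.
have mkr (A : set R) : measurable_fun A (fun r => (k (t - r))%:E).
  apply: measurable_funTS; apply/measurable_EFinP; apply: measurableT_comp mk _.
  exact: measurable_funB.
have mEf (A : set R) : measurable_fun A (fun r => (f r)%:E).
  by apply: measurable_funTS; exact/measurable_EFinP.
have Le0 : 0 <= L + e by rewrite addr_ge0.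
have kge0 r : 0 <= r <= t -> 0 <= k (t - r).
  move=> /andP[r0 rt]; have tr0 : 0 <= t - r by rewrite subr_ge0.
  by have /andP[] := kB tr0.
have mfk (A : set R) : measurable_fun A (fun r => (f r)%:E * (k (t - r))%:E)%E.
  exact: emeasurable_funM.
have dc0 : 0 <= delta / 2 * c1 by rewrite !mulr_ge0// ?ltW// invr_ge0.
have mind (c : R) (A : set R) : measurable A -> measurable_fun (I t) (fun r => c%:E * (\1_A r)%:E)%E.
  move=> mA; apply: emeasurable_funM; first exact: measurable_cst.
  by apply: measurable_funTS; apply/measurable_EFinP; exact: measurable_indic.
pose S : set R := `[t - T0, +oo[%classic.
have mS : measurable S by exact: measurable_itv.
have mfS (A : set R) : measurable_fun A (fun r => (f r)%:E * (\1_S r)%:E)%E.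
  apply: measurable_funTS; apply: emeasurable_funM; first exact/measurable_EFinP.
  by apply/measurable_EFinP; exact: measurable_indic.
have mrhs (A : set R) : measurable_fun A (fun r => (L + e)%:E * (f r)%:E + B%:E * ((f r)%:E * (\1_S r)%:E))%E.
  apply: emeasurable_funD; apply: emeasurable_funM; first exact: measurable_cst.
  - exact: mEf.
  - exact: measurable_cst.
  - exact: mfS.
have tot : (\int[leb]_(r in I t) ((f r)%:E * (k (t - r))%:E + (delta / 2 * c1)%:E * (\1_J r)%:E) <=
    \int[leb]_(r in `[0%R, +oo[) ((L + e)%:E * (f r)%:E + B%:E * ((f r)%:E * (\1_S r)%:E)))%E.
  apply: (@le_trans _ _ (\int[leb]_(r in I t) ((L + e)%:E * (f r)%:E + B%:E * ((f r)%:E * (\1_S r)%:E)))%E).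
    apply: ge0_le_integral => //.
    - move=> r; rewrite /= in_itv/= => rt.
      by rewrite -!EFinM -EFinD lee_fin addr_ge0// mulr_ge0// kge0.
    - by apply: emeasurable_funD; [exact: mfk|exact: mind].
    - exact: mrhs.
    - move=> r; rewrite /= in_itv/= => rt.
      rewrite -!EFinM -!EFinD lee_fin !indicE.
      have fr := f_ge0 r.
      have hS : 0 <= B * (f r * (r \in S)%:R) by rewrite !mulr_ge0.
      case: (boolP (r \in J)) => rJ.
        have rJ' : t - (x0 + eta) <= r <= t - x0 by move: rJ; rewrite inE /J /= in_itv/=.
        have fc : c1 <= f r by apply: f_ge; case/andP: rJ' => h1 h2; apply/andP; split; lra.
        have kk : k (t - r) <= L - delta / 2.
          by apply: ky; case/andP: rJ' => h1 h2; apply/andP; split; lra.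
        have h1 := ler_wpM2l fr kk.
        have h2 : delta / 2 * c1 <= delta / 2 * f r by rewrite ler_wpM2l// divr_ge0// ltW.
        have h3 : 0 <= e * f r by rewrite mulr_ge0.
        have -> : (L + e) * f r = L * f r + e * f r by ring.
        move: h1; rewrite mulrBr mulr1 => h1.
        lra.
      rewrite mulr0 addr0.
      case: (boolP (r \in S)) => rS.
        have /andP[r0 rt'] := rt.
        have tr0 : 0 <= t - r by rewrite subr_ge0.
        have /andP[_ kb] := kB tr0.
        have := ler_wpM2l fr kb; have : 0 <= (L + e) * f r by rewrite mulr_ge0.
        rewrite mulr1 [B * _]mulrC; lra.
      rewrite !mulr0 addr0 mulrC ler_wpM2r// kT0//.
      by move: rS; rewrite notin_setE /S /= in_itv/= andbT => /negP; rewrite -ltNge => h; lra.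
  apply: ge0_subset_integral => //.
  - exact: mrhs.
  - by move=> r _; rewrite -!EFinM -!EFinD lee_fin addr_ge0// mulr_ge0// mulr_ge0.
  - by move=> r; rewrite /= !in_itv/= andbT => /andP[].
rewrite ge0_integralD// in tot; last 4 first.
- by move=> r; rewrite /= in_itv/= => rt; rewrite mule_ge0 ?lee_fin ?kge0.
- exact: mfk.
- by move=> r _; rewrite -EFinM lee_fin mulr_ge0.
- exact: mind.
rewrite ge0_integralD// in tot; last 4 first.
- by move=> r _; rewrite -EFinM lee_fin mulr_ge0.
- by apply: emeasurable_funM; [exact: measurable_cst|exact: mEf].
- by move=> r _; rewrite -!EFinM lee_fin mulr_ge0// mulr_ge0.
- by apply: emeasurable_funM; [exact: measurable_cst|exact: mfS].
have Fge0 r : (0 <= (f r)%:E)%E by rewrite lee_fin.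
have FSge0 r : (0 <= (f r)%:E * (\1_S r)%:E)%E by rewrite -EFinM lee_fin mulr_ge0.
have i1 : (\int[leb]_(r in I t) ((delta / 2 * c1)%:E * (\1_J r)%:E) = (delta / 2 * c1)%:E * \int[leb]_(r in I t) (\1_J r)%:E)%E.
  rewrite ge0_integralZl_EFin//.
  by apply/measurable_EFinP; exact: measurable_indic.
have i2 : (\int[leb]_(r in `[0%R, +oo[) ((L + e)%:E * (f r)%:E) = (L + e)%:E * \int[leb]_(r in `[0%R, +oo[) (f r)%:E)%E.
  by rewrite ge0_integralZl_EFin//; exact: mEf.
have i3 : (\int[leb]_(r in `[0%R, +oo[) (B%:E * ((f r)%:E * (\1_S r)%:E)) = B%:E * \int[leb]_(r in `[0%R, +oo[) ((f r)%:E * (\1_S r)%:E))%E.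
  by rewrite ge0_integralZl_EFin//; exact: mfS.
rewrite i1 i2 i3 in tot.
rewrite f_int mule1 in tot.
have JI : J `&` I t = J.
  have hl : 0 <= t - (x0 + eta) by apply: le_trans ha; rewrite subr_ge0 ltW.
  apply/setIidPl => r; rewrite /J /= !in_itv/= => /andP[h1 h2]; apply/andP; split.
    exact: le_trans hl h1.
  exact: le_trans h2 (le_trans hb hbt).
have lJ : leb J = eta%:E.
  rewrite /J lebesgue_measure_itv/= lte_fin ifT; last lra.
  by rewrite -EFinB; congr EFin; ring.
have i4 : (\int[leb]_(r in I t) (\1_J r)%:E = eta%:E)%E.
  by rewrite integral_indic// -[RHS]lJ; congr (leb _); exact: JI.
rewrite i4 -EFinM in tot.
have tailS : (\int[leb]_(r in `[0%R, +oo[) ((f r)%:E * (\1_S r)%:E) <= (Cf / kappa * expR (- (kappa * (t - T0))))%:E)%E.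
  have tT : 0 <= t - T0 by rewrite subr_ge0.
  apply: le_trans _ (renewal_tail tT).
  rewrite integral_mkcond [leRHS]integral_mkcond le_eqVlt; apply/orP; left; apply/eqP.
  apply: eq_integral => r _; rewrite !patchE indicE.
  case: (boolP (r \in S)) => rS; last by rewrite mule0; case: ifP.
  rewrite mule1 ifT//; move: rS; rewrite !inE/S/= !in_itv/= !andbT; exact: le_trans.
rewrite -lee_fin keq// volterra_reflect//; last 2 first.
- by apply: measurable_funTS; exact/measurable_EFinP.
- by move=> s st; rewrite lee_fin; have /andP[s0 _] := st; have /andP[] := kB s0.
have {}tot := le_trans tot (leeD (lexx _) (lee_wpmul2l (_ : 0 <= B%:E)%E tailS)).
have {}tot := tot B0; move: tot; rewrite -EFinM -EFinD -leeBrDr// -EFinB => h.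
apply: le_trans (leeD (lexx _) h) _; rewrite -EFinD lee_fin le_eqVlt; apply/orP; left; apply/eqP; ring.
Qed.

(** The contrapositive of the one-step bound: a deficit would cost [c], while the source, the tail
    and the excess over [L] together bring at most [c / 2], so [k t] would fall below
    [L - c / 4]. *)
Let window_step delta : 0 < delta -> exists e T, [/\ 0 < e, 0 <= T &
  forall t, T <= t -> L - e <= k t -> forall s, t - b <= s <= t - a -> L - delta <= k s].
Proof.
move=> d0; have [eta [eta0 etaw reg]] := k_reg d0.
pose c := delta / 2 * c1 * eta.
have c0 : 0 < c by rewrite !mulr_gt0.
have c40 : 0 < c / 4 by rewrite divr_gt0.
have [T0 [T00 kT0]] := L_ub c40.
have lim0 : (g t + B * (Cf / kappa * expR (- (kappa * (t - T0))))) @[t --> +oo] --> (0 : R).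
  have -> : (fun t => g t + B * (Cf / kappa * expR (- (kappa * (t - T0))))) =
      (fun t => g t + (B * (Cf / kappa) * expR (kappa * T0)) * expR (- (kappa * t))).
    apply/funext => t; rewrite (_ : - (kappa * (t - T0)) = kappa * T0 + - (kappa * t)); last by ring.
    by rewrite expRD !mulrA.
  rewrite -[X in _ --> X](_ : 0 + (B * (Cf / kappa) * expR (kappa * T0)) * 0 = 0); last by rewrite mulr0 addr0.
  apply: cvgD => //; apply: cvgM; first exact: cvg_cst.
  exact: expR_lin_cvg0.
have [T1 [_ hT1]] := (@cvgr_lt _ _ _ _ _ _ lim0 (c / 4) c40).
pose T := Num.max (T1 + 1) (Num.max T0 (b + w)).
exists (c / 4), T; split => //; first by rewrite /T !le_max T00 orbT.
move=> t; rewrite /T !ge_max => /and3P[tT1 tT0 tbw] kt s /andP[s1 s2].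
rewrite leNgt; apply/negP => ks.
have ws : w <= s by lra.
have [x0 [h1 h2 h3]] := reg s ws ks.
have t0 : 0 <= t by lra.
have := @one_step_bound t T0 (c / 4) delta eta x0 t0 (ltW c40) T00 tT0 d0 eta0 kT0 h3.
have -> : a - w <= t - (x0 + eta) by lra.
have -> : t - x0 <= b + w by lra.
move=> /(_ isT isT tbw); rewrite -/c.
have := hT1 t; have -> : T1 < t by lra.
move=> /(_ isT); lra.
Qed.

Let window_iter n : forall delta, 0 < delta -> exists e T, [/\ 0 < e, 0 <= T &
  forall t, T <= t -> L - e <= k t ->
    forall s, t - n%:R * b <= s <= t - n%:R * a -> L - delta <= k s].
Proof.
elim: n => [|n IH] delta d0.
  exists delta, 0; split => // t _ kt s; rewrite !mul0r subr0 => /andP[h1 h2].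
  by rewrite (_ : s = t)//; apply/eqP; rewrite eq_le h1 h2.
have [e1 [T1 [e10 T10 h1]]] := IH delta d0.
have [e [T [e0 T0 h]]] := window_step e10.
exists e, (Num.max T (T1 + b)); split=> //; first by rewrite le_max T0.
move=> t; rewrite ge_max => /andP[tT tT1] kt s /andP[s1 s2].
(* The total lag is divided into [n + 1] equal lags, each of which lies in [[a, b]]. *)
pose x := (t - s) / n.+1%:R.
have xE : t - s = n.+1%:R * x by rewrite /x mulrC divfK// pnatr_eq0.
have n0 : 0 < n.+1%:R :> R by rewrite ltr0n.
have xa : a <= x by rewrite /x ler_pdivlMr// mulrC lerBrDr addrC -lerBrDr.
have xb : x <= b by rewrite /x ler_pdivrMr// mulrC lerBlDr addrC -lerBlDr.
have nxE : n.+1%:R * x = n%:R * x + x by rewrite -natr1 mulrDl mul1r.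
have na : n%:R * a <= n%:R * x by rewrite ler_wpM2l.
have nb : n%:R * x <= n%:R * b by rewrite ler_wpM2l.
apply: (h1 (t - x)).
- lra.
- apply: h tT kt _ _; apply/andP; split; lra.
- apply/andP; split; lra.
Qed.

(** Sums of [n] lags in [[a, b]] fill [[n a, n b]], whose length exceeds [W] for [n] large. *)
Lemma renewal_window W delta T : 0 < delta ->
  exists s, T <= s /\ forall y, s - W <= y <= s -> L - delta <= k y.
Proof.
move=> d0.
have ba : 0 < b - a by rewrite subr_gt0.
have [n hn] : exists n : nat, W <= n%:R * (b - a).
  exists (Num.bound `|W / (b - a)|); rewrite -ler_pdivrMr//.
  exact: le_trans (ler_norm _) (ltW (archi_boundP (normr_ge0 _))).
have [e [T1 [e0 T10 h]]] := window_iter n d0.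
have [t [tT kt]] := L_freq (Num.max T1 (T + n%:R * a)) e0.
move: tT; rewrite ge_max => /andP[tT1 tT].
exists (t - n%:R * a); split; first by rewrite lerBrDr.
move=> y /andP[y1 y2]; apply: (h t) => //; apply/andP; split => //.
by apply: le_trans y1; rewrite mulrBr in hn; lra.
Qed.

End renewal_window.

(** * Conservation of mass in the renewal equation *)

Section renewal_tail.
Context {R : realType}.
Local Notation leb := (@lebesgue_measure R).
Local Notation I t := (`[0%R, t%R]%classic : set R).
Variable f : R -> R.
Hypotheses (f_ge0 : forall t, 0 <= f t) (mf : measurable_fun setT f).
Hypothesis f_neg : forall t, t < 0 -> f t = 0.
Hypothesis f_int : (\int[leb]_t (f t)%:E = 1)%E.

Definition lower_mass x : \bar R := (\int[leb]_(r in `]-oo, x]) (f r)%:E)%E.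
Definition upper_mass x : R := fine (\int[leb]_(r in `]x, +oo[) (f r)%:E)%E.

Let mfE (A : set R) : measurable_fun A (fun r => (f r)%:E).
Proof. by apply: measurable_funTS; exact/measurable_EFinP. Qed.

Let int_le1 (A : set R) : measurable A -> (\int[leb]_(r in A) (f r)%:E <= 1)%E.
Proof.
move=> mA; rewrite -f_int; apply: ge0_subset_integral => //.
- exact: mfE.
- by move=> r _; rewrite lee_fin.
Qed.

Let int_fin (A : set R) : measurable A -> (\int[leb]_(r in A) (f r)%:E \is a fin_num)%E.
Proof.
move=> mA; rewrite ge0_fin_numE; first by apply: le_lt_trans (int_le1 mA) _; rewrite ltry.
by apply: integral_ge0 => r _; rewrite lee_fin.
Qed.

Let tailE x : (upper_mass x)%:E = (\int[leb]_(r in `]x, +oo[) (f r)%:E)%E.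
Proof. by rewrite fineK// int_fin. Qed.

Lemma upper_mass_ge0 x : 0 <= upper_mass x.
Proof. by apply: fine_ge0; apply: integral_ge0 => r _; rewrite lee_fin. Qed.

Lemma lower_mass_ge0 x : (0 <= lower_mass x)%E.
Proof. by apply: integral_ge0 => r _; rewrite lee_fin. Qed.

Lemma upper_mass_mono x y : x <= y -> upper_mass y <= upper_mass x.
Proof.
move=> xy; rewrite -lee_fin !tailE; apply: ge0_subset_integral => //.
- exact: mfE.
- by move=> r _; rewrite lee_fin.
- by move=> r; rewrite /= !in_itv/= !andbT; exact: le_lt_trans.
Qed.

Lemma measurable_upper_mass : measurable_fun setT upper_mass.
Proof. by apply: nonincreasing_measurable => // x y; exact: upper_mass_mono. Qed.

Lemma lower_upper_mass x : (lower_mass x + (upper_mass x)%:E = 1)%E.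
Proof.
rewrite tailE -f_int /lower_mass [X in (X + _)%E]integral_mkcond [X in (_ + X)%E]integral_mkcond -ge0_integralD//.
- apply: eq_integral => r _; rewrite !patchE !mem_setE !in_itv/= andbT.
  by case: leP; rewrite ?adde0 ?add0e.
- by move=> r _; rewrite patchE; case: ifP => // _; rewrite lee_fin.
- by apply/(measurable_restrictT _ _).1 => //; exact: mfE.
- by move=> r _; rewrite patchE; case: ifP => // _; rewrite lee_fin.
- by apply/(measurable_restrictT _ _).1 => //; exact: mfE.
Qed.

Lemma upper_mass_neg x : x < 0 -> upper_mass x = 1.
Proof.
move=> x0; have := lower_upper_mass x; rewrite /lower_mass integral_mkcond (_ : _ \_ _ = cst 0%E).
  by rewrite integral0 add0e => -[].
apply/funext => r; rewrite patchE mem_setE in_itv/=; case: ifP => // rx.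
by rewrite f_neg//; exact: le_lt_trans x0.
Qed.

Let shift (u : R) (p : R -> \bar R) : measurable_fun setT p -> (forall x, (0 <= p x)%E) ->
  (\int[leb]_t p (t - u)%R = \int[leb]_t p t)%E.
Proof.
move=> mp p0.
have mpu : measurable_fun setT (fun t : R => p (t - u)%R).
  by apply: measurableT_comp mp _; exact: measurable_funB.
rewrite (ge0_integral_reflect u mpu (fun t => p0 (t - u)%R)) (ge0_integral_reflect 0 mp p0).
by apply: eq_integral => t _; congr p; ring.
Qed.

Variables (k g : R -> R) (B : R).
Hypotheses (mk : measurable_fun setT k) (kB : forall t, 0 <= t -> 0 <= k t <= B).
Hypotheses (mg : measurable_fun setT g) (g0 : forall t, 0 <= t -> 0 <= g t).
Hypothesis keq : forall t, 0 <= t -> ((k t)%:E = (g t)%:E + volterra f (fun s => (k s)%:E) t)%E.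

Let k0 t : 0 <= t -> 0 <= k t. Proof. by move=> /kB /andP[]. Qed.
Let mkE (A : set R) : measurable_fun A (fun r => (k r)%:E).
Proof. by apply: measurable_funTS; exact/measurable_EFinP. Qed.

Let measurable_lower_mass : measurable_fun setT lower_mass.
Proof.
have -> : lower_mass = (fun x => 1 - (upper_mass x)%:E)%E.
  by apply/funext => x; rewrite -(lower_upper_mass x) addeK.
by apply: emeasurable_funB => //; apply/measurable_EFinP; exact: measurable_upper_mass.
Qed.

(** Tonelli: what is emitted at time [u] reaches times up to [s] with the weight
    [lower_mass (s - u)]. *)
Let int_volterra s : 0 <= s ->
  (\int[leb]_(t in I s) volterra f (fun s => (k s)%:E) t = \int[leb]_(u in I s) ((k u)%:E * lower_mass (s - u)%R))%E.
Proof.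
move=> s0.
pose A : set R := `]-oo, s]%classic.
pose D : set R := `[0, +oo[%classic.
pose K (p : R * R) : \bar R := ((\1_A p.1)%:E * ((f (p.1 - p.2))%:E * ((\1_D p.2)%:E * (k p.2)%:E)))%E.
have mA : measurable_fun setT (fun x : R => (\1_A x)%:E : \bar R).
  by apply/measurable_EFinP; apply: measurable_indic; exact: measurable_itv.
have mD : measurable_fun setT (fun x : R => (\1_D x)%:E : \bar R).
  by apply/measurable_EFinP; apply: measurable_indic; exact: measurable_itv.
have mK : measurable_fun setT K.
  apply: emeasurable_funM; first exact: measurableT_comp mA measurable_fst.
  apply: emeasurable_funM.
    apply/measurable_EFinP; apply: measurableT_comp => //.
    by apply: measurable_funB; [exact: measurable_fst|exact: measurable_snd].
  apply: emeasurable_funM; first exact: measurableT_comp mD measurable_snd.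
  by apply/measurable_EFinP; exact: measurableT_comp mk measurable_snd.
have Dk0 u : (0 <= (\1_D u)%:E * (k u)%:E)%E.
  rewrite indicE; case: (boolP (u \in D)) => [|_]; last by rewrite mul0e.
  by rewrite mem_setE in_itv/= andbT mul1e lee_fin; exact: k0.
have K0 p : (0 <= K p)%E by apply: mule_ge0; [rewrite lee_fin|apply: mule_ge0; [rewrite lee_fin|exact: Dk0]].
have := @fubini_tonelli _ _ (measurableTypeR R) (measurableTypeR R) R leb leb K mK K0.
have -> : (\int[leb]_x \int[leb]_y K (x, y) = \int[leb]_(t in I s) volterra f (fun s => (k s)%:E) t)%E.
  rewrite [RHS]integral_mkcond; apply: eq_integral => t _; rewrite patchE /K /=.
  rewrite mem_setE in_itv/= indicE mem_setE in_itv/=.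
  have [ts|ts] := leP t s; last first.
    rewrite andbF; apply: integral0_eq => u _; by rewrite mul0e.
  rewrite andbT; have [t0|t0] := leP 0 t; last first.
    apply: integral0_eq => u _; rewrite mul1e indicE mem_setE in_itv/= andbT.
    have [u0|u0] := leP 0 u; last by rewrite mul0e mule0.
    by rewrite f_neg ?mul0e//; lra.
  rewrite /volterra [RHS]integral_mkcond; apply: eq_integral => u _.
  rewrite patchE mul1e !mem_setE indicE mem_setE !in_itv/= andbT.
  have [u0|u0] := leP 0 u; last by rewrite mul0e mule0.
  rewrite mul1e; have [//|tu] := leP u t.
  by rewrite f_neg ?mul0e//; lra.
move=> ->; rewrite [RHS]integral_mkcond; apply: eq_integral => u _.
rewrite patchE mem_setE in_itv/=.
transitivity (((\1_D u)%:E * (k u)%:E) * lower_mass (s - u)%R)%E; last first.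
  rewrite indicE mem_setE in_itv/= andbT; have [u0|u0] := leP 0 u; last by rewrite !mul0e.
  rewrite mul1e; have [//|us] := leP u s.
  have := lower_upper_mass (s - u); rewrite upper_mass_neg; last by lra.
  by rewrite -[RHS]add0e => /(congr1 (fun x => x - 1)%E); rewrite !addeK// => ->; rewrite mule0.
pose p : R -> \bar R := (fun r => (f r)%:E) \_ (`]-oo, (s - u)]%classic : set R).
have mp : measurable_fun setT p by apply/(measurable_restrictT _ _).1 => //; exact: mfE.
have p0 r : (0 <= p r)%E by rewrite /p patchE; case: ifP => // _; rewrite lee_fin.
have -> : lower_mass (s - u)%R = (\int[leb]_t p (t - u)%R)%E by rewrite shift// /lower_mass integral_mkcond.
have mpu : measurable_fun setT (fun t : R => p (t - u)%R).
  by apply: measurableT_comp mp _; exact: measurable_funB.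
have fn : ((\1_D u)%:E * (k u)%:E)%E = (\1_D u * k u)%:E by rewrite EFinM.
rewrite fn -ge0_integralZl_EFin//; last by have := Dk0 u; rewrite fn lee_fin.
apply: eq_integral => t _; rewrite /K /p patchE -fn [\1_A _]indicE !mem_setE !in_itv/=.
rewrite lerD2r; case: ifP => _; last by rewrite mul0e mule0.
by rewrite mul1e muleC.
Qed.

(* Conservation of mass: every arrival before [s] descends from exactly one
   ancestor, and is counted until its last potential offspring. *)
Lemma volterra_upper_mass s : 0 <= s ->
  (\int[leb]_(r in I s) ((upper_mass r)%:E * (k (s - r))%:E) = \int[leb]_(t in I s) (g t)%:E)%E.
Proof.
move=> s0.
have mgE (A : set R) : measurable_fun A (fun r => (g r)%:E).
  by apply: measurable_funTS; exact/measurable_EFinP.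
have ms : measurable_fun setT (fun u : R => s - u) by exact: measurable_funB.
have mcdf : measurable_fun (I s) (fun u => (k u)%:E * lower_mass (s - u)%R)%E.
  by apply: emeasurable_funM => //; apply: measurable_funTS; apply: measurableT_comp measurable_lower_mass ms.
have mtail : measurable_fun (I s) (fun u => (k u)%:E * (upper_mass (s - u))%:E)%E.
  apply: emeasurable_funM => //; apply: measurable_funTS; apply/measurable_EFinP.
  exact: measurableT_comp measurable_upper_mass ms.
have mvol : measurable_fun (I s) (volterra f (fun s => (k s)%:E)).
  pose k' t := Num.max (k t) 0.
  have mk' : measurable_fun setT (fun t => (k' t)%:E).
    by apply/measurable_EFinP; apply: measurable_funrpos.
  have k'0 t : (0 <= (k' t)%:E)%E by rewrite lee_fin /k' le_max lexx orbT.
  have := measurable_funTS (measurable_volterra f_ge0 mf mk' k'0) => /(_ (I s)).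
  apply: eq_measurable_fun => t; rewrite inE/= in_itv/= => /andP[t0 _].
  apply: eq_volterra => u /andP[u0 _]; congr EFin.
  by apply/max_idPl; exact: k0.
have kI u : u \in I s -> 0 <= k u by rewrite inE/= in_itv/= => /andP[/k0].
(* [e1] and [e2] evaluate the integral of [k] twice, by the equation and by
   [lower_mass + upper_mass = 1]; the common term is finite and cancels. *)
have e1 : (\int[leb]_(t in I s) (k t)%:E = \int[leb]_(t in I s) (g t)%:E + \int[leb]_(u in I s) ((k u)%:E * lower_mass (s - u)%R))%E.
  rewrite -int_volterra// -ge0_integralD//.
  - by apply: eq_integral => t; rewrite inE/= in_itv/= => /andP[t0 _]; exact: keq.
  - by move=> t; rewrite /= in_itv/= => /andP[t0 _]; rewrite lee_fin g0.
  - exact: mgE.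
  - move=> t; rewrite /= in_itv/= => /andP[t0 _]; apply: volterra_ge0 => // u /andP[u0 _].
    by rewrite lee_fin k0.
have e2 : (\int[leb]_(t in I s) (k t)%:E = \int[leb]_(u in I s) ((k u)%:E * (upper_mass (s - u))%:E) + \int[leb]_(u in I s) ((k u)%:E * lower_mass (s - u)%R))%E.
  rewrite -ge0_integralD//.
  - apply: eq_integral => u uI; rewrite -ge0_muleDr ?lee_fin ?upper_mass_ge0 ?lower_mass_ge0//.
    by rewrite addeC lower_upper_mass mule1.
  - by move=> u /mem_set uI; rewrite mule_ge0 ?lee_fin ?upper_mass_ge0 ?kI.
  - by move=> u /mem_set uI; rewrite mule_ge0 ?lower_mass_ge0// lee_fin kI.
have fin : (\int[leb]_(u in I s) ((k u)%:E * lower_mass (s - u)%R))%E \is a fin_num.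
  rewrite ge0_fin_numE; last first.
    by apply: integral_ge0 => u /mem_set uI; rewrite mule_ge0 ?lower_mass_ge0// lee_fin kI.
  apply: (@le_lt_trans _ _ (\int[leb]_(u in I s) B%:E)%E); last first.
    by rewrite integral_cst//= lebesgue_measure_itv/= lte_fin; case: ifP => _; rewrite -?EFinB -EFinM ltry.
  apply: ge0_le_integral => //.
  - by move=> u /mem_set uI; rewrite mule_ge0 ?lower_mass_ge0// lee_fin kI.
  - move=> u uI; apply: (@le_trans _ _ ((k u)%:E * 1)%E).
      by rewrite lee_wpmul2l ?lee_fin ?kI ?mem_set//; exact: int_le1.
    rewrite mule1 lee_fin; move: uI; rewrite /= in_itv/= => /andP[u0 _].
    by have /andP[] := kB u0.
have <- : (\int[leb]_(u in I s) ((k u)%:E * (upper_mass (s - u))%:E) = \int[leb]_(t in I s) (g t)%:E)%E.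
  by rewrite -[LHS](addeK _ fin) -e2 e1 addeK.
rewrite -(@volterra_reflect _ upper_mass upper_mass_ge0 measurable_upper_mass (fun t => (k t)%:E))//.
  by apply: eq_integral => u _; rewrite muleC.
by move=> u /andP[u0 _]; rewrite lee_fin k0.
Qed.

(** The layer-cake formula for the mean lag; it brings the constant of the theorem into the
    limit. *)
Lemma integral_upper_mass :
  (\int[leb]_(x in `[0%R, +oo[) (upper_mass x)%:E = \int[leb]_(r in `[0%R, +oo[) (r * f r)%:E)%E.
Proof.
pose D : set R := `[0, +oo[%classic.
pose A : set (R * R) := [set p | p.1 < p.2].
have mA : measurable A.
  rewrite (_ : A = ~` [set p | p.2 <= p.1]); last by apply/seteqP; split => p /=; rewrite /A/= ltNge => /negP.
  have mle (l k' : R * R -> R) : measurable_fun setT l -> measurable_fun setT k' -> measurable [set p | l p <= k' p].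
    by move=> ml mk'; rewrite -[X in measurable X]setTI; exact: measurable_fun_le.
  by apply: measurableC; apply: mle; [exact: measurable_snd|exact: measurable_fst].
have AE x r : ((x, r) \in A) = (x < r) by apply/idP/idP; rewrite inE.
pose K (p : R * R) : \bar R := ((\1_D p.1)%:E * ((\1_A p)%:E * (f p.2)%:E))%E.
have mD : measurable_fun setT (fun x : R => (\1_D x)%:E : \bar R).
  by apply/measurable_EFinP; apply: measurable_indic; exact: measurable_itv.
have mK : measurable_fun setT K.
  apply: emeasurable_funM; first exact: measurableT_comp mD measurable_fst.
  apply: emeasurable_funM; first by apply/measurable_EFinP; exact: measurable_indic.
  by apply/measurable_EFinP; exact: measurableT_comp mf measurable_snd.
have K0 p : (0 <= K p)%E by rewrite !mule_ge0 ?lee_fin.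
have := @fubini_tonelli _ _ (measurableTypeR R) (measurableTypeR R) R leb leb K mK K0.
have -> : (\int[leb]_x \int[leb]_y K (x, y) = \int[leb]_(x in `[0%R, +oo[) (upper_mass x)%:E)%E.
  rewrite [RHS]integral_mkcond; apply: eq_integral => x _; rewrite patchE /K /= indicE.
  case: ifPn => xD; last by apply: integral0_eq => u _; rewrite mul0e.
  rewrite tailE [RHS]integral_mkcond; apply: eq_integral => r _.
  rewrite mul1e patchE indicE AE mem_setE in_itv/= andbT.
  by case: ifP => _; rewrite ?mul1e ?mul0e.
move=> ->; rewrite [RHS]integral_mkcond; apply: eq_integral => r _; rewrite patchE mem_setE in_itv/= andbT.
transitivity ((f r)%:E * \int[leb]_x (\1_(`[0, r[%classic : set R) x)%:E)%E.
  rewrite -ge0_integralZl_EFin//; last by apply/measurable_EFinP; exact: measurable_indic.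
  apply: eq_integral => x _; rewrite /K /= muleCA muleA muleC; congr (_ * _)%E.
  rewrite -EFinM !indicE AE !mem_setE !in_itv/= andbT.
  by case: (0 <= x); case: (x < r); rewrite ?mulr1 ?mulr0.
have -> : (\int[leb]_x (\1_(`[0%R, r[%classic : set R) x)%:E = leb (`[0%R, r[%classic : set R))%E.
  by rewrite integral_indic// setIT.
rewrite lebesgue_measure_itv/= lte_fin.
have [r0|r0] := ltP 0 r; first by rewrite (ltW r0) -EFinB subr0 -EFinM mulrC.
case: ifP => r0'; last by rewrite mule0.
by rewrite (_ : r = 0) ?mul0r ?mule0//; apply/eqP; rewrite eq_le r0 r0'.
Qed.

End renewal_tail.

(** * The limit of the renewal function *)

Section renewal_limit.
Context {R : realType}.
Local Notation leb := (@lebesgue_measure R).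
Local Notation I t := (`[0%R, t%R]%classic : set R).

Lemma expR_lin_small (kappa C e : R) : 0 < kappa -> 0 < e ->
  exists W, 0 <= W /\ forall t, W <= t -> C * expR (- (kappa * t)) <= e.
Proof.
move=> k0 e0.
have h : C * expR (- (kappa * t)) @[t --> +oo] --> (0 : R).
  by rewrite -(mulr0 C); apply: cvgM; [exact: cvg_cst|exact: expR_lin_cvg0].
have [T [_ hT]] := (@cvgr_le _ _ _ _ _ _ h e e0).
exists (Num.max 0 (T + 1)); split; first by rewrite le_max lexx.
by move=> t; rewrite ge_max => /andP[_ tT]; apply: hT; lra.
Qed.

Lemma expR_sub1_small (alpha B delta w : R) : 0 < alpha -> 0 <= B -> 0 < delta -> 0 < w ->
  exists eta, [/\ 0 < eta, eta <= w & (expR (alpha * eta) - 1) * B <= delta].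
Proof.
move=> a0 B0 d0 w0.
(* The three terms give [eta <= w], [exp y <= 1 + 2 y] and [2 y B <= delta]. *)
pose y := Num.min (alpha * w) (Num.min (1 / 2) (delta / (2 * (B + 1)))).
have B1 : 0 < 2 * (B + 1) by lra.
have y0 : 0 < y by rewrite !lt_min mulr_gt0//= divr_gt0// divr_gt0.
have yw : y <= alpha * w by rewrite /y ge_min lexx.
have y2 : y <= 1 / 2 by rewrite /y !ge_min lexx orbT.
have yd : y * (2 * (B + 1)) <= delta by rewrite -ler_pdivlMr// /y !ge_min lexx !orbT.
exists (y / alpha); split.
- by rewrite divr_gt0.
- by rewrite ler_pdivrMr// mulrC.
- have -> : alpha * (y / alpha) = y by field; rewrite gt_eqF.
  have h := expR_ge1Dx (- y).
  have e0 := expR_gt0 y.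
  have h2 : expR y <= 1 + 2 * y.
    have : (1 - y) * expR y <= 1.
      apply: (@le_trans _ _ (expR (- y) * expR y)); first by rewrite ler_wpM2r// ltW.
      by rewrite -expRD addNr expR0.
    have : 0 <= (1 + 2 * y) * (1 - y) - 1 by nra.
    move=> q1 q2.
    have y1 : 0 < 1 - y by lra.
    by rewrite -(ler_pM2l y1); apply: le_trans q2 _; rewrite mulrC; lra.
  have : (expR y - 1) * B <= 2 * y * B by rewrite ler_wpM2r//; lra.
  nra.
Qed.

Lemma integral_split_le (p : R -> \bar R) (s : R) : 0 <= s ->
  measurable_fun (`[0%R, +oo[%classic : set R) p -> (forall t, (0 <= t)%R -> (0 <= p t)%E) ->
  (\int[leb]_(t in `[0%R, +oo[) p t <= \int[leb]_(t in I s) p t + \int[leb]_(t in `[s, +oo[) p t)%E.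
Proof.
move=> s0 mp p0.
rewrite [X in (X <= _)%E]integral_mkcond [X in (_ <= X + _)%E]integral_mkcond [X in (_ <= _ + X)%E]integral_mkcond.
have r0 (D : set R) : D `<=` `[0, +oo[ -> forall x, (0 <= (p \_ D) x)%E.
  move=> D0 x; rewrite patchE; case: ifPn => // /set_mem /D0; rewrite /= in_itv/= andbT => x0.
  exact: p0.
have mr (D : set R) : measurable D -> D `<=` `[0, +oo[ -> measurable_fun setT (p \_ D).
  by move=> mD D0; apply/(measurable_restrictT _ _).1 => //; exact: measurable_funS mp.
have s1 : I s `<=` `[0, +oo[ by move=> x; rewrite /= !in_itv/= andbT => /andP[].
have s2 : `[s, +oo[ `<=` (`[0, +oo[ : set R) by move=> x; rewrite /= !in_itv/= !andbT; exact: le_trans.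
rewrite -ge0_integralD//; last 4 first.
- by move=> x _; exact: r0.
- exact: mr.
- by move=> x _; exact: r0.
- exact: mr.
apply: ge0_le_integral => //.
- by move=> x _; exact: r0.
- exact: mr.
- by apply: emeasurable_funD; exact: mr.
- move=> x _; have h1 := r0 _ s1 x; have h2 := r0 _ s2 x.
  move: h1 h2; rewrite !patchE !mem_setE !in_itv/= !andbT.
  case: (leP 0 x) => x0 //=; last by move=> *; rewrite adde_ge0.
  case: (leP x s) => xs h1 h2; first by rewrite leeDl.
  by rewrite (ltW xs) add0e.
Qed.

Let growth_above (E u L dl : R) : 1 <= E -> 0 <= u -> 0 < dl -> u < L - dl ->
  (E - 1) * L <= dl / 2 -> E * u <= L - dl / 2.
Proof.
move=> E1 u0 d0 uL es.
have : (E - 1) * u <= (E - 1) * L by rewrite ler_wpM2l//; lra.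
lra.
Qed.

Let growth_below (E u v L dl B : R) : 1 <= E -> u <= E * v -> v <= B -> 0 < dl -> B - u < L - dl ->
  (E - 1) * B <= dl / 2 -> B - v <= L - dl / 2.
Proof.
move=> E1 uv vB d0 uL es.
have : (E - 1) * v <= (E - 1) * B by rewrite ler_wpM2l//; lra.
lra.
Qed.

Variables (f : R -> R) (kappa Cf : R).
Hypotheses (f_ge0 : forall t, 0 <= f t) (mf : measurable_fun setT f).
Hypotheses (kappa0 : 0 < kappa) (Cf0 : 0 <= Cf).
Hypothesis f_le : forall t, 0 <= t -> f t <= Cf * expR (- (kappa * t)).
Hypothesis f_neg : forall t, t < 0 -> f t = 0.
Hypothesis f_int : (\int[leb]_t (f t)%:E = 1)%E.
Variables (x1 rho c1 : R).
Hypotheses (rho0 : 0 < rho) (rhox : rho < x1) (c10 : 0 < c1).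
Hypothesis f_ge : forall r, x1 - rho <= r <= x1 + rho -> c1 <= f r.

Local Notation alpha := (2 * kappa).
Local Notation g := (fun t : R => t * expR (- (alpha * t))).
Local Notation G := (alpha ^- 2).
Local Notation m := (upper_mass f).

Definition renewal_mean : R := fine (\int[leb]_(r in `[0%R, +oo[) (r * f r)%:E)%E.

Local Notation M := renewal_mean.

Let mm (A : set R) : measurable_fun A (fun r => (m r)%:E).
Proof. by apply: measurable_funTS; apply/measurable_EFinP; exact: measurable_upper_mass. Qed.

Let m0 x : 0 <= m x. Proof. exact: upper_mass_ge0. Qed.

Let m_le x : 0 <= x -> m x <= Cf / kappa * expR (- (kappa * x)).
Proof.
move=> x0; rewrite -lee_fin; apply: le_trans (renewal_tail f_ge0 mf kappa0 Cf0 f_le x0).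
rewrite /upper_mass fineK.
  rewrite integral_itv_obnd_cbnd//; apply: measurable_funTS; exact/measurable_EFinP.
rewrite ge0_fin_numE; last by apply: integral_ge0 => r _; rewrite lee_fin.
apply: (@le_lt_trans _ _ 1%E); last by rewrite ltry.
rewrite -f_int; apply: ge0_subset_integral => //.
- exact/measurable_EFinP.
- by move=> r _; rewrite lee_fin.
Qed.

Let c2 := Cf / kappa / kappa.

Let int_m_tail W : 0 <= W ->
  (\int[leb]_(r in `[W, +oo[) (m r)%:E <= (c2 * expR (- (kappa * W)))%:E)%E.
Proof.
move=> W0.
have ck : 0 <= Cf / kappa by rewrite divr_ge0// ltW.
apply: (@le_trans _ _ (\int[leb]_(r in `[W, +oo[) ((Cf / kappa)%:E * (expR (- (kappa * r)))%:E))%E).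
  apply: ge0_le_integral => //.
  - by move=> r _; rewrite lee_fin.
  - exact: mm.
  - apply: measurable_funTS; apply: emeasurable_funM; first exact: measurable_cst.
    apply/measurable_EFinP; apply: measurableT_comp => //; exact: measurableT_comp.
  - move=> r; rewrite /= in_itv/= andbT => Wr; rewrite -EFinM lee_fin m_le//.
    exact: le_trans W0 Wr.
rewrite ge0_integralZl_EFin//; last first.
  apply: measurable_funTS; apply/measurable_EFinP; apply: measurableT_comp => //; exact: measurableT_comp.
by rewrite integral_expR// -EFinM mulrA.
Qed.

Let M_fin : (\int[leb]_(r in `[0%R, +oo[) (m r)%:E \is a fin_num)%E.
Proof.
rewrite ge0_fin_numE; first exact: le_lt_trans (int_m_tail (lexx 0)) (ltry _).
by apply: integral_ge0 => r _; rewrite lee_fin.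
Qed.

Let MeanE : (renewal_mean%:E = \int[leb]_(r in `[0%R, +oo[) (m r)%:E)%E.
Proof. by rewrite /renewal_mean -integral_upper_mass// fineK. Qed.

Let intI_m W : (\int[leb]_(r in I W) (m r)%:E <= renewal_mean%:E)%E.
Proof.
rewrite MeanE; apply: ge0_subset_integral => //.
- exact: mm.
- by move=> r _; rewrite lee_fin.
- by move=> r; rewrite /= !in_itv/= andbT => /andP[].
Qed.

Let M_split W : 0 <= W ->
  (renewal_mean%:E <= \int[leb]_(r in I W) (m r)%:E + (c2 * expR (- (kappa * W)))%:E)%E.
Proof.
move=> W0; rewrite MeanE.
apply: (le_trans (integral_split_le (p := fun r => (m r)%:E) W0 _ _)).
- exact: mm.
- by move=> t _; rewrite lee_fin.
- by apply: leeD => //; exact: int_m_tail.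
Qed.

Lemma renewal_mean_gt0 : 0 < renewal_mean.
Proof.
rewrite -lte_fin MeanE integral_upper_mass//.
pose A : set R := `[x1 - rho, x1 + rho]%classic.
have mA : measurable A by exact: measurable_itv.
apply: (@lt_le_trans _ _ (\int[leb]_(r in A) (((x1 - rho) * c1)%:E))%E).
  rewrite integral_cst/=; last exact: measurable_itv.
  have lt12 : x1 - rho < x1 + rho by rewrite ltrBlDr -addrA ltrDl addr_gt0.
  rewrite lebesgue_measure_itv/= lte_fin lt12 -EFinB -EFinM lte_fin mulr_gt0 ?subr_gt0//.
  by rewrite mulr_gt0// subr_gt0.
have mrf (D : set R) : measurable_fun D (fun r => (r * f r)%:E).
  by apply: measurable_funTS; apply/measurable_EFinP; exact: measurable_funM.
apply: (@le_trans _ _ (\int[leb]_(r in A) (r * f r)%:E)%E).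
  apply: ge0_le_integral => //.
  - by move=> r _; rewrite lee_fin mulr_ge0// ltW// subr_gt0.
  - exact: mrf.
  - move=> r; rewrite /A /= in_itv/= => rA; rewrite lee_fin ler_pM ?(ltW c10) ?f_ge//.
      by rewrite ltW// subr_gt0.
    by case/andP: rA.
apply: ge0_subset_integral => //.
- exact: mrf.
- by move=> r; rewrite /= in_itv/= andbT => r0; rewrite lee_fin mulr_ge0.
- move=> r; rewrite /A /= !in_itv/= andbT => /andP[h _]; apply: le_trans h.
  by rewrite ltW// subr_gt0.
Qed.

Let mg (A : set R) : measurable_fun A (fun t => (g t)%:E).
Proof.
apply: measurable_funTS; apply/measurable_EFinP; apply: measurable_funM => //.
by apply: measurableT_comp => //; exact: measurableT_comp.
Qed.

Let g_ge0 t : 0 <= t -> 0 <= g t. Proof. by move=> t0; rewrite mulr_ge0 ?expR_ge0. Qed.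

Let alpha0 : 0 < alpha. Proof. by rewrite mulr_gt0. Qed.

Let int_g_le s : (\int[leb]_(t in I s) (g t)%:E <= G%:E)%E.
Proof.
rewrite -integral_mul_expR//; apply: ge0_subset_integral => //.
- exact: mg.
- by move=> r; rewrite /= in_itv/= andbT => r0; rewrite lee_fin g_ge0.
- by move=> r; rewrite /= !in_itv/= andbT => /andP[].
Qed.

Let int_g_ge s : 0 <= s -> (G%:E <= \int[leb]_(t in I s) (g t)%:E + (kappa ^- 2 * expR (- (kappa * s)))%:E)%E.
Proof.
move=> s0; rewrite -integral_mul_expR//.
apply: (le_trans (integral_split_le (p := fun r => (g r)%:E) s0 _ _)).
- exact: mg.
- by move=> t t0; rewrite lee_fin g_ge0.
apply: leeD => //.
apply: (@le_trans _ _ (\int[leb]_(r in `[s, +oo[) ((kappa^-1)%:E * (expR (- (kappa * r)))%:E))%E).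
  apply: ge0_le_integral => //.
  - by move=> r; rewrite /= in_itv/= andbT => sr; rewrite lee_fin g_ge0// (le_trans s0).
  - exact: mg.
  - apply: measurable_funTS; apply: emeasurable_funM; first exact: measurable_cst.
    apply/measurable_EFinP; apply: measurableT_comp => //; exact: measurableT_comp.
  - move=> r; rewrite /= in_itv/= andbT => sr; rewrite -EFinM lee_fin.
    have := @mul_expR_le R alpha r alpha0 (le_trans s0 sr).
    have -> : 2 / alpha = kappa^-1 by field; rewrite gt_eqF.
    by have -> : alpha / 2 = kappa by field.
rewrite ge0_integralZl_EFin ?invr_ge0 ?(ltW kappa0)//; last first.
  apply: measurable_funTS; apply/measurable_EFinP; apply: measurableT_comp => //; exact: measurableT_comp.
by rewrite integral_expR// -EFinM mulrA expr2 invfM.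
Qed.

Let measurable_window h s (D : set R) : measurable_fun setT h -> measurable_fun D (fun r => (m r)%:E * (h (s - r))%:E)%E.
Proof.
move=> mh; apply: emeasurable_funM; first exact: mm.
apply: measurable_funTS; apply/measurable_EFinP; apply: measurableT_comp mh _.
exact: measurable_funB.
Qed.

Lemma renewal_limit : exists h : R -> R,
  [/\ measurable_fun setT h, (forall t, 0 <= h t),
      (exists B, forall t, 0 <= t -> h t <= B),
      (forall t, 0 <= t -> ((h t)%:E = (g t)%:E + volterra f (fun s => (h s)%:E) t)%E) &
      h t @[t --> +oo] --> G / renewal_mean].
Proof.
have [h [mh h0 [B hB] heq hmono]] := renewal_solution f_ge0 mf kappa0 f_neg f_int.
exists h; split => //; first by exists B.
have f_int0 := renewal_int_ge0 f_neg f_int.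
have M0 := renewal_mean_gt0.
have hB2 t : 0 <= t -> 0 <= h t <= B by move=> t0; rewrite h0 hB.
have B0 : 0 <= B by exact: le_trans (h0 0) (hB 0 (lexx 0)).
(* [[a, b]] is the interval around [x1] shrunk by [w] on both sides, so that [f >= c1] still holds
   within distance [w] of it. *)
pose w := rho / 3; have w0 : 0 < w by rewrite divr_gt0.
pose a := x1 - rho + w; pose b := x1 + rho - w.
have wE : w * 3 = rho by rewrite /w divfK.
have wa : w < a by rewrite /a ltrDr subr_gt0.
have ab : a < b.
  have aux (x r v : R) : 0 < v -> v * 3 = r -> x - r + v < x + r - v by move=> *; lra.
  exact: aux.
have f_ge' r : a - w <= r <= b + w -> c1 <= f r.
  by rewrite /a /b addrK subrK; exact: f_ge.
have g0 : g t @[t --> +oo] --> (0 : R) by exact: mul_expR_cvg0.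
have mgR : measurable_fun setT g by apply/measurable_EFinP; exact: mg.
have cons s : 0 <= s -> (\int[leb]_(r in I s) ((m r)%:E * (h (s - r))%:E) = \int[leb]_(t in I s) (g t)%:E)%E.
  by move=> s0; apply: (volterra_upper_mass f_ge0 mf f_neg f_int mh hB2 mgR g_ge0 heq).
have G0 : 0 <= G by rewrite invr_ge0 exprn_ge0// ltW.
have [L [L0 LB L_ub L_freq]] := limsup_exists hB2.
(* On a window of length [W] ending at some [s] the function [h] is at least [L - delta];
   conservation of mass at [s] gives [(L - delta)] times the integral of [m] over [[0, W]] at most
   [G]. *)
have up : L * M <= G.
  apply/ler_addgt0Pl => e e0.
  have M1 : 0 < 2 * (M + 1) by lra.
  pose delta := e / (2 * (M + 1)).
  have d0 : 0 < delta by rewrite divr_gt0.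
  have dM : delta * M <= e / 2.
    have : delta * (2 * (M + 1)) = e by rewrite /delta divfK// gt_eqF.
    nra.
  have [W [W0 hW]] := expR_lin_small (L * c2) kappa0 (divr_gt0 e0 (ltr0n _ 2)).
  (* Going back in time by at most [eta], [h] grows by a factor at most [exp (alpha eta)], so low
     values persist to the left. *)
  have reg dl : 0 < dl -> exists eta, [/\ 0 < eta, eta <= w &
      forall x, w <= x -> h x < L - dl ->
      exists x0, [/\ x - eta <= x0, x0 <= x & forall y, x0 <= y <= x0 + eta -> h y <= L - dl / 2]].
    move=> dl0; have [eta [eta0 etaw es]] := expR_sub1_small alpha0 L0 (divr_gt0 dl0 (ltr0n _ 2)) w0.
    exists eta; split=> // x wx hx; exists (x - eta); split => //; first by rewrite gerBl ltW.
    move=> y /andP[y1 y2]; rewrite subrK in y2.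
    have y0 : 0 <= y by apply: le_trans y1; lra.
    have q1 := hmono y x y0 y2.
    have q2 : expR (alpha * (x - y)) <= expR (alpha * eta).
      by rewrite ler_expR ler_wpM2l// ?(ltW alpha0)//; lra.
    have q3 : 1 <= expR (alpha * eta) by apply: le_trans (expR_ge1Dx _); rewrite lerDl; exact: ltW (mulr_gt0 alpha0 eta0).
    have q4 : expR (alpha * (x - y)) * h x <= expR (alpha * eta) * h x by rewrite ler_wpM2r.
    have q5 := h0 x.
    apply: le_trans q1 (le_trans q4 _).
    exact: growth_above hx es.
  have [s [sW hs]] := renewal_window f_ge0 mf kappa0 Cf0 f_le f_int0 wa ab c10 f_ge' mh hB2 g0 heq L0 L_ub L_freq reg W W d0.
  have s0 : 0 <= s by lra.
  have b1 : ((L - delta)%:E * \int[leb]_(r in I W) (m r)%:E <= G%:E)%E.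
    have [Ld|Ld] := leP 0 (L - delta); last first.
      apply: (@le_trans _ _ 0%E); last by rewrite lee_fin.
      by apply: mule_le0_ge0; [rewrite lee_fin ltW|apply: integral_ge0 => r _; rewrite lee_fin].
    apply: le_trans (int_g_le s); rewrite -cons// -ge0_integralZl_EFin//; last 2 first.
    - by move=> r _; rewrite lee_fin.
    - exact: mm.
    apply: (@le_trans _ _ (\int[leb]_(r in I W) ((m r)%:E * (h (s - r))%:E))%E).
      apply: ge0_le_integral => //.
      - by move=> r _; rewrite -EFinM lee_fin mulr_ge0.
      - by apply: emeasurable_funM; [exact: measurable_cst|exact: mm].
      - exact: measurable_window.
      - move=> r; rewrite /= in_itv/= => /andP[r0 rW]; rewrite muleC lee_wpmul2l ?lee_fin//.
        by apply: hs; apply/andP; split; lra.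
    apply: ge0_subset_integral => //.
    - exact: measurable_window.
    - by move=> r _; rewrite -EFinM lee_fin mulr_ge0.
    - by move=> r; rewrite /= !in_itv/= => /andP[-> rW]; exact: le_trans rW sW.
  pose mW := fine (\int[leb]_(r in I W) (m r)%:E)%E.
  have mWfin : ((\int[leb]_(r in I W) (m r)%:E) \is a fin_num)%E.
    rewrite ge0_fin_numE; last by apply: integral_ge0 => r _; rewrite lee_fin.
    apply: le_lt_trans (intI_m W) _; exact: ltry.
  have mWE : (\int[leb]_(r in I W) (m r)%:E = mW%:E)%E by rewrite fineK.
  have MW := M_split W0; rewrite mWE -EFinD lee_fin in MW.
  have mWM : mW <= M by rewrite -lee_fin -mWE; exact: intI_m.
  rewrite mWE -EFinM lee_fin in b1.
  have q1 := ler_wpM2l L0 MW.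
  have q2 : delta * mW <= delta * M by rewrite ler_wpM2l// ltW.
  have q3 := hW W (lexx W).
  rewrite mulrDr mulrA in q1; rewrite mulrBl in b1; lra.
(* [B - h] solves a renewal equation too, with source [B m - g], which tends to 0. Its upper limit
   [L'] makes [B - L'] the lower limit of [h]. *)
pose k t := B - h t.
have mk : measurable_fun setT k by exact: measurable_funB.
have kB t : 0 <= t -> 0 <= k t <= B.
  by move=> t0; rewrite /k subr_ge0 hB//= gerBl.
pose g' t := B * m t - g t.
have mul_conv t : 0 <= t -> (volterra f (fun s => (k s)%:E) t + volterra f (fun s => (h s)%:E) t = (B - B * m t)%:E)%E.
  move=> t0; have mE (l : R -> R) : measurable_fun setT l -> measurable_fun (I t) (fun s => (l s)%:E).
    by move=> ml; apply: measurable_funTS; exact/measurable_EFinP.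
  rewrite -(volterraD f_ge0 mf (mE _ mk) (mE _ mh)); last 2 first.
  - by move=> s /andP[s0 _]; have /andP[] := kB s s0.
  - by move=> s _; rewrite lee_fin.
  rewrite (@eq_volterra _ f _ (cst B%:E)); last by move=> s _; rewrite -EFinD /k subrK.
  rewrite (@volterra_reflect _ f f_ge0 mf (cst B%:E)); last 2 first.
  - exact: measurable_cst.
  - by move=> s _; rewrite lee_fin.
  have -> : (B - B * m t)%:E = (B%:E * lower_mass f t)%E.
    have /(congr1 (fun x => x - (m t)%:E)%E) := lower_upper_mass f_ge0 mf f_int t.
    by rewrite addeK// => ->; rewrite -EFinB -EFinM mulrBr mulr1.
  transitivity (\int[leb]_(r in `]-oo, t]) (B%:E * (f r)%:E))%E; last first.
    rewrite ge0_integralZl_EFin//; first by move=> r _; rewrite lee_fin.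
    by apply: measurable_funTS; exact/measurable_EFinP.
  rewrite integral_mkcond [RHS]integral_mkcond; apply: eq_integral => r _.
  rewrite !patchE !mem_setE !in_itv/= muleC.
  by case: (leP 0 r) => r0 //=; rewrite f_neg// mule0; case: ifP.
have keq t : 0 <= t -> ((k t)%:E = (g' t)%:E + volterra f (fun s => (k s)%:E) t)%E.
  move=> t0; have := mul_conv t t0.
  have Vh : volterra f (fun s => (h s)%:E) t = (h t - g t)%:E by rewrite EFinB heq// [X in (X - _)%E]addeC addeK.
  rewrite Vh => /(congr1 (fun x => x - (h t - g t)%:E)%E); rewrite addeK// => ->.
  by rewrite -EFinB -EFinD /g' /k; congr EFin; ring.
have g'0 : g' t @[t --> +oo] --> (0 : R).
  rewrite -(subr0 0); apply: cvgB => //; rewrite -(mulr0 B); apply: cvgM; first exact: cvg_cst.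
  apply: (@squeeze_cvgr _ _ _ _ (cst 0) (fun t => Cf / kappa * expR (- (kappa * t)))).
  - near=> t; have t0 : 0 <= t by near: t; exact: nbhs_pinfty_ge.
    by rewrite m0 m_le.
  - exact: cvg_cst.
  - by rewrite -(mulr0 (Cf / kappa)); apply: cvgM; [exact: cvg_cst|exact: expR_lin_cvg0].
have [L' [L'0 L'B L'_ub L'_freq]] := limsup_exists kB.
have lo : G <= (B - L') * M.
  apply/ler_addgt0Pl => e e0.
  have M1 : 0 < 4 * (M + 1) by lra.
  pose delta := e / (4 * (M + 1)).
  have d0 : 0 < delta by rewrite divr_gt0.
  have dM : delta * M <= e / 4.
    have : delta * (4 * (M + 1)) = e by rewrite /delta divfK// gt_eqF.
    nra.
  have e40 : 0 < e / 4 by rewrite divr_gt0.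
  have [W [W0 hW]] := expR_lin_small (B * c2) kappa0 e40.
  have [T [T0 hT]] := expR_lin_small (kappa ^- 2) kappa0 e40.
  have reg dl : 0 < dl -> exists eta, [/\ 0 < eta, eta <= w &
      forall x, w <= x -> k x < L' - dl ->
      exists x0, [/\ x - eta <= x0, x0 <= x & forall y, x0 <= y <= x0 + eta -> k y <= L' - dl / 2]].
    move=> dl0; have [eta [eta0 etaw es]] := expR_sub1_small alpha0 B0 (divr_gt0 dl0 (ltr0n _ 2)) w0.
    exists eta; split=> // x wx hx; exists x; split => //; first by rewrite gerBl ltW.
    move=> y /andP[y1 y2].
    have x0 : 0 <= x by lra.
    have q1 := hmono x y x0 y1.
    have q2 : expR (alpha * (y - x)) <= expR (alpha * eta).
      by rewrite ler_expR ler_wpM2l// ?(ltW alpha0)//; lra.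
    have q4 : expR (alpha * (y - x)) * h y <= expR (alpha * eta) * h y by rewrite ler_wpM2r.
    have q3 : 1 <= expR (alpha * eta) by apply: le_trans (expR_ge1Dx _); rewrite lerDl; exact: ltW (mulr_gt0 alpha0 eta0).
    have q5 : h y <= B by apply: hB; lra.
    exact: growth_below q3 (le_trans q1 q4) q5 dl0 hx es.
  have [s [sT hs]] := renewal_window f_ge0 mf kappa0 Cf0 f_le f_int0 wa ab c10 f_ge' mk kB g'0 keq L'0 L'_ub L'_freq reg W (Num.max T W) d0.
  move: sT; rewrite ge_max => /andP[sT sW].
  have s0 : 0 <= s by lra.
  have c0 : 0 <= B - L' + delta by lra.
  have := int_g_ge s0; rewrite -cons//.
  (* Lags below [W] stay in the window, where [h <= B - L' + delta]; beyond [W] the crude bound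
     [h <= B] is paid for by the tail of [m]. *)
  have b1 : (\int[leb]_(r in I s) ((m r)%:E * (h (s - r))%:E) <= (B - L' + delta)%:E * M%:E + B%:E * \int[leb]_(r in `[W, +oo[) (m r)%:E)%E.
    have mW0 r : (0 <= ((fun r => (m r)%:E) \_ (`[W, +oo[%classic : set R)) r)%E.
      by rewrite patchE; case: ifP => // _; rewrite lee_fin.
    have mmW (D : set R) : measurable_fun D ((fun r => (m r)%:E) \_ (`[W, +oo[%classic : set R)).
      by apply: measurable_funTS; apply/(measurable_restrictT _ _).1 => //; exact: mm.
    have mq (D : set R) : measurable_fun D (fun r => (B - L' + delta)%:E * (m r)%:E + B%:E * ((fun r => (m r)%:E) \_ (`[W, +oo[%classic : set R)) r)%E.
      apply: emeasurable_funD; apply: emeasurable_funM; [exact: measurable_cst|exact: mm|exact: measurable_cst|exact: mmW].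
    have q0 r : (0 <= (B - L' + delta)%:E * (m r)%:E + B%:E * ((fun r => (m r)%:E) \_ (`[W, +oo[%classic : set R)) r)%E.
      by apply: adde_ge0; apply: mule_ge0; rewrite ?lee_fin.
    apply: (@le_trans _ _ (\int[leb]_(r in I s) ((B - L' + delta)%:E * (m r)%:E + B%:E * ((fun r => (m r)%:E) \_ (`[W, +oo[%classic : set R)) r))%E).
      apply: ge0_le_integral => //.
      - by move=> r _; rewrite -EFinM lee_fin mulr_ge0.
      - exact: measurable_window.
      - exact: mq.
      - move=> r; rewrite /= in_itv/= => /andP[r0 rs].
        rewrite patchE mem_setE in_itv/= andbT; have [Wr|rW] := leP W r.
          rewrite -!EFinM -EFinD lee_fin [B * _]mulrC -[leLHS]add0r lerD ?mulr_ge0//.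
          by rewrite ler_wpM2l// hB// subr_ge0.
        rewrite mule0 adde0 -!EFinM lee_fin mulrC ler_wpM2r//.
        have : L' - delta <= k (s - r) by apply: hs; apply/andP; split; lra.
        rewrite /k; lra.
    apply: (@le_trans _ _ (\int[leb]_(r in `[0%R, +oo[) ((B - L' + delta)%:E * (m r)%:E + B%:E * ((fun r => (m r)%:E) \_ (`[W, +oo[%classic : set R)) r))%E).
      apply: ge0_subset_integral => //.
      - exact: mq.
      - by move=> r; rewrite /= !in_itv/= andbT => /andP[].
    rewrite ge0_integralD//; last 4 first.
    - by move=> r _; rewrite -EFinM lee_fin mulr_ge0.
    - by apply: emeasurable_funM; [exact: measurable_cst|exact: mm].
    - by move=> r _; apply: mule_ge0; rewrite ?lee_fin.
    - by apply: emeasurable_funM; [exact: measurable_cst|exact: mmW].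
    have i1 : (\int[leb]_(r in `[0%R, +oo[) ((B - L' + delta)%:E * (m r)%:E) = (B - L' + delta)%:E * M%:E)%E.
      by rewrite MeanE ge0_integralZl_EFin//; [move=> r _; rewrite lee_fin|exact: mm].
    have i2 : (\int[leb]_(r in `[0%R, +oo[) (B%:E * ((fun r => (m r)%:E) \_ (`[W, +oo[%classic : set R)) r) = B%:E * \int[leb]_(r in `[W, +oo[) (m r)%:E)%E.
      rewrite ge0_integralZl_EFin//; last exact: mmW.
      congr (_ * _)%E; rewrite integral_mkcond [RHS]integral_mkcond; apply: eq_integral => r _.
      rewrite !patchE !mem_setE !in_itv/= !andbT; case: ifP => // r0.
      by case: leP => // Wr; move: r0; rewrite (le_trans W0 Wr).
    by rewrite i1 i2.
  have b2 : (\int[leb]_(r in I s) ((m r)%:E * (h (s - r))%:E) <= ((B - L' + delta) * M + B * (c2 * expR (- (kappa * W))))%:E)%E.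
    apply: le_trans b1 _.
    rewrite [leRHS](_ : _ = ((B - L' + delta)%:E * M%:E + B%:E * (c2 * expR (- (kappa * W)))%:E)%E)//.
    apply: (leeD (lexx _)); apply: lee_wpmul2l; first by rewrite lee_fin.
    exact: int_m_tail.
  move=> b3; have := le_trans b3 (leeD b2 (lexx _)); rewrite -EFinD lee_fin => b4.
  have q1 := hW W (lexx W); have q2 := hT s sT.
  rewrite [B * (_ * _)]mulrA [_ * M]mulrDl in b4.
  by apply: le_trans b4 _; lra.
have LG : L <= G / M by rewrite ler_pdivlMr.
have GL' : G / M <= B - L' by rewrite ler_pdivrMr.
apply/cvgrPdist_le => e e0.
have [T1 [_ h1]] := L_ub e e0; have [T2 [_ h2]] := L'_ub e e0.
near=> t.
have t1 : T1 <= t by near: t; exact: nbhs_pinfty_ge (num_real T1).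
have t2 : T2 <= t by near: t; exact: nbhs_pinfty_ge (num_real T2).
have q1 := h1 t t1; have := h2 t t2; rewrite /k => q2.
by rewrite ler_norml; apply/andP; split; lra.
Unshelve. all: end_near. Qed.

End renewal_limit.

(** * Kernels of bounded variation *)

Section bounded_variation.
Context {R : realType}.
Local Notation leb := (@lebesgue_measure R).
Variable phi : R -> R.
Hypothesis phi_ge0 : forall t, 0 <= t -> 0 <= phi t.
Hypothesis mphi : measurable_fun (`[0%R, +oo[%classic : set R) phi.
Hypothesis tv_fin : forall t, 0 <= t -> (total_variation 0 t phi < +oo)%E.

Let V t := fine (total_variation 0 t phi).

Let VE t : 0 <= t -> (V t)%:E = total_variation 0 t phi.
Proof. by move=> t0; rewrite fineK// ge0_fin_numE ?tv_fin//; exact: total_variation_ge0. Qed.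

Let V_var s t : 0 <= s -> s <= t -> `|phi t - phi s| <= V t - V s.
Proof.
move=> s0 st; have t0 := le_trans s0 st.
have := total_variationD phi s0 st; rewrite -!VE// => VD.
have := total_variation_ge phi st; move: VD.
case: (total_variation s t phi) => [r| |]//= VD.
by move: VD; rewrite -EFinD => -[->]; rewrite lee_fin [V s + r]addrC addrK.
Qed.

Let V_nd s t : 0 <= s -> s <= t -> V s <= V t.
Proof. by move=> s0 /(V_var s0); have := normr_ge0 (phi t - phi s); lra. Qed.

(** Both one-sided limits exist by monotonicity; if they were equal, the increment of [V] over a
    small interval around [x] would be less than [e]. *)
Let V_jump n x e : 0 < x < n -> 0 < e ->
  (forall rho, 0 < rho -> rho < x -> e <= V (x + rho) - V (x - rho)) -> discontinuity V x.
Proof.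
move=> /andP[x0 xn] e0 He.
have cl : cvg (V y @[y --> x^'-]).
  apply: nondecreasing_at_left_is_cvgr.
    near=> z; have z0 : 0 < z by near: z; exact: nbhs_left_gt.
    by move=> u v; rewrite !in_itv/= => /andP[zu _] _; apply: V_nd; lra.
  near=> z; have z0 : 0 < z by near: z; exact: nbhs_left_gt.
  by exists (V x) => _ [y + <-]; rewrite /= in_itv/= => /andP[zy yx]; apply: V_nd; lra.
have cr : cvg (V y @[y --> x^'+]).
  apply: nondecreasing_at_right_is_cvgr.
    near=> z; move=> u v; rewrite !in_itv/= => /andP[xu _] _; apply: V_nd; lra.
  by near=> z; exists (V x) => _ [y + <-]; rewrite /= in_itv/= => /andP[xy _]; apply: V_nd; lra.
split => //; apply/eqP => lr.
have [y [yx y0 Vy]] : exists y, [/\ y < x, 0 < y & lim (V y @[y --> x^'-]) - e / 3 < V y].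
  near (x^'-) => y; exists y; split.
  - by near: y; exact: nbhs_left_lt.
  - by near: y; exact: nbhs_left_gt.
  - by near: y; apply: (cvgr_gt _ cl); rewrite ltrBlDr ltrDl divr_gt0.
have [z [xz Vz]] : exists z, x < z /\ V z < lim (V y @[y --> x^'+]) + e / 3.
  near (x^'+) => z; exists z; split.
  - by near: z; exact: nbhs_right_gt.
  - by near: z; apply: (cvgr_lt _ cr); rewrite ltrDl divr_gt0.
pose rho := Num.min (x - y) (z - x).
have r0 : 0 < rho by rewrite lt_min !subr_gt0 yx.
have ry : rho <= x - y by rewrite ge_min lexx.
have rz : rho <= z - x by rewrite ge_min lexx orbT.
have rx : rho < x by lra.
have h1 := He rho r0 rx.
have h2 : V y <= V (x - rho) by apply: V_nd; lra.
have h3 : V (x + rho) <= V z by apply: V_nd; lra.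
rewrite lr in Vy; lra.
Unshelve. all: end_near. Qed.

(** If [phi x > 0] and no interval around [x] bounds [phi] below by [phi x / 2], then at every scale
    the variation around [x] is at least [phi x / 2], so [V] jumps there. A nondecreasing function
    has countably many jumps, hence [phi] would vanish almost everywhere. *)
Lemma bounded_variation_positive : (0 < \int[leb]_(t in `[0%R, +oo[) (phi t)%:E)%E ->
  exists x rho c, [/\ 0 < rho, rho < x, 0 < c & forall r, x - rho <= r <= x + rho -> c <= phi r].
Proof.
move=> int0; apply: contrapT => nex.
pose N : set R := \bigcup_n [set x | x \in `]0, n%:R[%R /\ discontinuity V x].
have cN : countable N.
  apply: bigcup_countable => // n _; apply: discontinuity_countable.
  by move=> s t; rewrite !in_itv/= => /andP[s0 _] _; exact: V_nd.
have N0 : leb N = 0%E by exact: countable_lebesgue_measure0.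
have mN : measurable N by apply: countable_measurable => // t; exact: measurable_set1.
have phi0 x : 0 < x -> ~ N x -> phi x = 0.
  move=> xp nN; have x0 := ltW xp; apply/eqP; rewrite eq_le phi_ge0// andbT leNgt; apply/negP => px.
  apply: nN; exists (Num.bound x) => //; rewrite /=.
  have xb : 0 < x < (Num.bound x)%:R by rewrite xp archi_boundP.
  split; first by rewrite in_itv.
  have p2 : 0 < phi x / 2 by rewrite divr_gt0.
  apply: (V_jump xb p2) => rho r0 rx; rewrite leNgt; apply/negP => hV.
  apply: nex; exists x, rho, (phi x / 2); split => // r /andP[r1 r2].
  have h1 : 0 <= x - rho by lra.
  have hr : `|phi x - phi r| <= V (x + rho) - V (x - rho).
    have [xr|rx'] := leP x r.
      rewrite distrC; apply: le_trans (V_var x0 xr) _.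
      by apply: lerB; apply: V_nd => //; lra.
    have r00 : 0 <= r by lra.
    apply: le_trans (V_var r00 (ltW rx')) _.
    by apply: lerB; apply: V_nd => //; lra.
  have := ler_norm (phi x - phi r); lra.
have mphi' : measurable_fun (`]0%R, +oo[%classic : set R) (fun t => (phi t)%:E).
  apply/measurable_EFinP; apply: measurable_funS mphi => //.
  by move=> x; rewrite /= !in_itv/= !andbT; exact: ltW.
move: int0; rewrite -integral_itv_obnd_cbnd// (ge0_ae_eq_integral (g := cst 0%E)) ?integral0 ?ltxx//.
- by move=> x; rewrite /= in_itv/= andbT => x0; rewrite lee_fin phi_ge0// ltW.
- exists N; split => // x /= nx; apply: contrapT => nN; apply: nx.
  by rewrite in_itv/= andbT => x0; rewrite phi0.
Qed.

End bounded_variation.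

Lemma polynomial_variation_expR (R : realType) (phi : R -> R) (kappa : R) : 0 < kappa ->
  (forall t, 0 <= t -> 0 <= phi t) -> polynomial_variation phi ->
  exists2 C, 0 <= C & forall t, 0 <= t -> phi t <= C * expR (kappa * t).
Proof.
move=> k0 phi0 [C [n Hn]].
(* From [y^(n+1) / (n+1)! <= exp y] at [y = kappa (1 + t)]. *)
pose K := (n.+1)`!%:R / kappa ^+ n.+1 * expR kappa.
have K0 : 0 <= K by rewrite mulr_ge0 ?expR_ge0// divr_ge0// exprn_ge0// ltW.
exists (phi 0 + `|C| * K); first by rewrite addr_ge0 ?phi0// mulr_ge0.
move=> t t0.
have e1 : 1 <= expR (kappa * t) by apply: le_trans (expR_ge1Dx _); rewrite lerDl mulr_ge0// ltW.
have pK : (1 + t) ^+ n <= K * expR (kappa * t).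
  have t1 : 1 <= 1 + t by rewrite lerDl.
  have h : (1 + t) ^+ n <= (1 + t) ^+ n.+1 by rewrite exprS ler_peMl// exprn_ge0// addr_ge0.
  apply: le_trans h _.
  have k1 : 0 <= kappa * (1 + t) by rewrite mulr_ge0 ?addr_ge0// ltW.
  have := expR_ge1Dxn n k1; rewrite exprMn => h'.
  have F0 : 0 < (n.+1)`!%:R :> R by rewrite ltr0n fact_gt0.
  have {}h' : kappa ^+ n.+1 * (1 + t) ^+ n.+1 / (n.+1)`!%:R <= expR (kappa * (1 + t)) by lra.
  have -> : K * expR (kappa * t) = (n.+1)`!%:R * expR (kappa * (1 + t)) / kappa ^+ n.+1.
    by rewrite mulrDr mulr1 expRD /K; ring.
  rewrite ler_pdivlMr ?exprn_gt0// [X in X <= _]mulrC.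
  by move: h'; rewrite ler_pdivrMr// [X in _ <= X -> _]mulrC.
have := total_variation_ge phi t0 => /le_trans/(_ (Hn t t0)); rewrite lee_fin => h.
have h2 : C * (1 + t) ^+ n <= `|C| * (K * expR (kappa * t)).
  apply: (@le_trans _ _ (`|C| * (1 + t) ^+ n)); last by rewrite ler_wpM2l.
  by rewrite ler_wpM2r ?ler_norm// exprn_ge0// addr_ge0.
have h3 : phi 0 <= phi 0 * expR (kappa * t) by rewrite ler_peMr// phi0.
have := ler_norm (phi t - phi 0).
rewrite mulrDl -mulrA; lra.
Qed.

(** * Convergence *)

Section renewal_descent.
Context {R : realType}.
Local Notation leb := (@lebesgue_measure R).
Local Notation I t := (`[0%R, t%R]%classic : set R).
Variables (f : R -> R) (kappa Cf : R).
Hypotheses (f_ge0 : forall t, 0 <= f t) (mf : measurable_fun setT f).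
Hypotheses (kappa0 : 0 < kappa) (Cf0 : 0 <= Cf).
Hypothesis f_le : forall t, 0 <= t -> f t <= Cf * expR (- (kappa * t)).
Hypothesis f_neg : forall t, t < 0 -> f t = 0.
Hypothesis f_int : (\int[leb]_t (f t)%:E = 1)%E.

Let mfE (A : set R) : measurable_fun A (fun r => (f r)%:E).
Proof. by apply: measurable_funTS; exact/measurable_EFinP. Qed.

(** Lags up to [t - T] see the bound [e] and have total mass at most 1; longer lags see the bound
    [B] and have exponentially small mass. *)
Lemma volterra_limsup (u : R -> \bar R) B e T t : measurable_fun setT u -> (forall s, 0 <= u s)%E ->
  (forall s, (0 <= s)%R -> (u s <= B%:E)%E) -> 0 <= B -> 0 <= e -> 0 <= T -> T <= t ->
  (forall s, T <= s -> (u s <= e%:E)%E) ->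
  (volterra f u t <= (e + B * (Cf / kappa * expR (- (kappa * (t - T)))))%:E)%E.
Proof.
move=> mu u0 uB B0 e0 T0 Tt ue; have t0 := le_trans T0 Tt.
rewrite (volterra_reflect f_ge0 mf)//; last exact: measurable_funTS.
pose S : set R := `[t - T, +oo[%classic.
pose v r : \bar R := (e%:E * (f r)%:E + B%:E * ((fun r => (f r)%:E) \_ S) r)%E.
have fS0 r : (0 <= ((fun r => (f r)%:E) \_ S) r)%E by rewrite patchE; case: ifP => // _; rewrite lee_fin.
have mfS (A : set R) : measurable_fun A ((fun r => (f r)%:E) \_ S).
  apply: measurable_funTS; apply/(measurable_restrictT _ _).1; [exact: measurable_itv|exact: mfE].
have v0 r : (0 <= v r)%E by apply: adde_ge0; apply: mule_ge0; rewrite ?lee_fin.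
have mv (A : set R) : measurable_fun A v.
  apply: emeasurable_funD; apply: emeasurable_funM; [exact: measurable_cst|exact: mfE|exact: measurable_cst|exact: mfS].
apply: (@le_trans _ _ (\int[leb]_(r in `[0%R, +oo[) v r)%E).
  apply: (@le_trans _ _ (\int[leb]_(r in I t) v r)%E); last first.
    by apply: ge0_subset_integral => //; [exact: mv|move=> r; rewrite /= !in_itv/= andbT => /andP[]].
  apply: ge0_le_integral => //.
  - by move=> r _; rewrite mule_ge0 ?lee_fin.
  - apply: emeasurable_funM; first exact: mfE.
    by apply: measurable_funTS; apply: measurableT_comp mu _; exact: measurable_funB.
  - exact: mv.
  - move=> r; rewrite /= in_itv/= => /andP[r0 rt].
    rewrite /v patchE mem_setE in_itv/= andbT; have [Sr|rS] := leP (t - T) r.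
      rewrite addeC [X in (_ <= X + _)%E]muleC -[X in (X <= _)%E]adde0.
      apply: leeD; last by apply: mule_ge0; rewrite lee_fin.
      by apply: lee_wpmul2l; rewrite ?lee_fin// uB// subr_ge0.
    rewrite mule0 adde0 muleC; apply: lee_wpmul2r; first by rewrite lee_fin.
    by apply: ue; lra.
rewrite ge0_integralD//; last 4 first.
- by move=> r _; apply: mule_ge0; rewrite lee_fin.
- by apply: emeasurable_funM; [exact: measurable_cst|exact: mfE].
- by move=> r _; apply: mule_ge0; rewrite ?lee_fin.
- by apply: emeasurable_funM; [exact: measurable_cst|exact: mfS].
have -> : (\int[leb]_(r in `[0%R, +oo[) (e%:E * (f r)%:E) = e%:E)%E.
  rewrite ge0_integralZl_EFin//; [|by move=> r _; rewrite lee_fin|exact: mfE].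
  by rewrite (renewal_int_ge0 f_neg f_int) mule1.
have -> : (\int[leb]_(r in `[0%R, +oo[) (B%:E * ((fun r => (f r)%:E) \_ S) r) = B%:E * \int[leb]_(r in `[(t - T)%R, +oo[) (f r)%:E)%E.
  rewrite ge0_integralZl_EFin//; last exact: mfS.
  congr (_ * _)%E; rewrite integral_mkcond [RHS]integral_mkcond; apply: eq_integral => r _.
  rewrite !patchE !mem_setE !in_itv/= !andbT; case: ifP => // r0.
  by case: leP => // Wr; move: r0; rewrite (le_trans _ Wr)// subr_ge0.
rewrite EFinD EFinM; apply: leeD => //; apply: lee_wpmul2l; first by rewrite lee_fin.
by apply: (renewal_tail f_ge0 mf kappa0 Cf0 f_le); rewrite subr_ge0.
Qed.

Variables (q : nat -> R -> \bar R) (B : R).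
Hypothesis mq : forall n, measurable_fun setT (q n).
Hypothesis q_ge0 : forall n t, (0 <= q n t)%E.
Hypothesis B0 : 0 <= B.
Hypothesis q_le : forall n t, 0 <= t -> (q n t <= B%:E)%E.
Hypothesis q_rec : forall n, exists K, forall t, 0 <= t ->
  (q n t <= (K * expR (- (kappa * t)))%:E + volterra f (q n.+1) t)%E.
Hypothesis q_small : forall delta, 0 < delta -> exists n0, forall n t, (n0 <= n)%N -> 0 <= t ->
  (q n t <= (delta * expR (- (kappa * t)))%:E + volterra f (q n.+1) t)%E.

Let limsup_le n e := forall eta, 0 < eta -> exists T, 0 <= T /\ forall t, T <= t -> (q n t <= (e + eta)%:E)%E.

Let limsup_step n e : 0 <= e -> limsup_le n.+1 e -> limsup_le n e.
Proof.
move=> e0 H eta eta0.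
have eta4 : 0 < eta / 4 by rewrite divr_gt0.
have [T1 [T10 h1]] := H _ eta4.
have [K hK] := q_rec n.
have [T2 [T20 h2]] := expR_lin_small K kappa0 eta4.
have [W [W0 hW]] := expR_lin_small (B * (Cf / kappa)) kappa0 eta4.
exists (Num.max T2 (T1 + W)); split; first by rewrite le_max T20.
move=> t; rewrite ge_max => /andP[tT2 tT1W].
have t0 : 0 <= t by lra.
have tT1 : T1 <= t by lra.
have e4 : 0 <= e + eta / 4 by lra.
apply: le_trans (hK t t0) _.
apply: le_trans (leeD (lexx _) (volterra_limsup (mq _) (q_ge0 _) (fun s => @q_le _ s) B0 e4 T10 tT1 h1)) _.
rewrite -EFinD lee_fin.
have q1 := h2 t tT2; have q2 : B * (Cf / kappa) * expR (- (kappa * (t - T1))) <= eta / 4 by apply: hW; lra.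
rewrite [B * (_ * _)]mulrA; lra.
Qed.

Lemma renewal_descent e : 0 < e -> exists T, 0 <= T /\ forall t, T <= t -> (q 0%N t <= e%:E)%E.
Proof.
move=> e0.
(* The upper bound [2 c] of the barrier, with its normalizing constant written out. *)
pose Bc := 2 / fine (\int[leb]_(r in `[0%R, +oo[) (f r * (Num.min 1 (kappa * r)))%:E)%E.
have barB t : barrier f kappa t <= Bc by exact: barrier_le.
have Bc0 : 0 <= Bc.
  by apply: le_trans (barB 0); exact: barrier_ge0.
pose delta := e / (2 * (Bc + 1)).
have B1 : 0 < 2 * (Bc + 1) by lra.
have d0 : 0 < delta by rewrite divr_gt0.
have dB : delta * Bc <= e / 2.
  have : delta * (2 * (Bc + 1)) = e by rewrite /delta divfK// gt_eqF.
  nra.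
have [n0 hn0] := q_small d0.
have dBc0 : 0 <= delta * Bc by rewrite mulr_ge0// ltW.
have base : limsup_le n0 (delta * Bc).
  move=> eta eta0; exists 0; split => // t t0.
  apply: (@le_trans _ _ (delta * barrier f kappa t)%:E); last first.
    rewrite lee_fin; apply: (@le_trans _ _ (delta * Bc)); first by rewrite ler_wpM2l// ltW.
    by rewrite lerDl ltW.
  (* Comparison for the sequence from [n0] on, whose source is at most [delta exp (- kappa t)]; the
     uniform bound [B] serves as the a priori bound. *)
  have := @renewal_comparison R f kappa Cf f_ge0 mf kappa0 Cf0 f_le f_neg f_int delta B t
    (fun n => q (n0 + n)%N) (ltW d0) B0.
  move=> /(_ (fun n => measurable_funTS (mq _)) (fun n s _ => q_ge0 _ _)) H.
  have := H _ _ 0%N t; rewrite addn0; apply.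
  - move=> n s /andP[s0 _]; apply: le_trans (q_le _ s0) _.
    by rewrite lee_fin ler_peMr// exprn_ege1// ler1n.
  - move=> n s /andP[s0 _]; rewrite addnS; apply: hn0 => //; exact: leq_addr.
  - by rewrite t0 lexx.
have all0 : limsup_le 0%N (delta * Bc).
  by elim: n0 {hn0} base => // n IH /(limsup_step dBc0).
have [T [T0 hT]] := all0 (e / 2) (divr_gt0 e0 (ltr0n _ 2)).
exists T; split => // t /hT /le_trans; apply; rewrite lee_fin; lra.
Qed.

End renewal_descent.

(** * Volterra operators on signed functions *)

Section real_volterra.
Context {R : realType}.
Local Notation leb := (@lebesgue_measure R).
Local Notation I t := (`[0%R, t%R]%classic : set R).
Variables (f : R -> R) (C : R).
Hypotheses (f_ge0 : forall t, 0 <= f t) (mf : measurable_fun setT f) (f_le : forall t, f t <= C).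

(** Bounded and measurable up to [t]: enough to integrate the differences whose absolute values are
    the errors to be estimated. *)
Definition tame t (u : R -> R) := measurable_fun (I t) u /\ exists B, forall s, 0 <= s <= t -> `|u s| <= B.
Definition rvolterra (u : R -> R) t : R := \int[leb]_(s in I t) (f (t - s) * u s).

Let mfr t (A : set R) : measurable_fun A (fun s => f (t - s)).
Proof. by apply: measurable_funTS; apply: measurableT_comp => //; exact: measurable_funB. Qed.

Lemma tame_integrable t u : tame t u ->
  leb.-integrable (I t) (EFin \o (fun s => f (t - s) * u s)).
Proof.
move=> [mu [B uB]]; apply: measurable_bounded_integrable.
- exact: measurable_itv.
- by rewrite /= lebesgue_measure_itv/= lte_fin; case: ifP => _; rewrite ?ltry// -EFinB ltry.
- by apply: measurable_funM => //; exact: mfr.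
- exists (C * B); split; first exact: num_real.
  move=> M CM s; rewrite /= in_itv/= => st; apply/ltW/(le_lt_trans _ CM).
  by rewrite normrM ger0_norm// ler_pM// uB.
Qed.

Lemma eq_tame t u v : (forall s, 0 <= s <= t -> u s = v s) -> tame t u -> tame t v.
Proof.
move=> uv [mu [B uB]]; split; last by exists B => s st; rewrite -uv// uB.
by apply: eq_measurable_fun mu => s; rewrite inE/= in_itv/= => /uv.
Qed.

Lemma tameZ t c u : tame t u -> tame t (fun s => c * u s).
Proof.
move=> [mu [B uB]]; split; first exact: measurable_funM.
by exists (`|c| * B) => s st; rewrite normrM ler_wpM2l// uB.
Qed.

Lemma tameD t u v : tame t u -> tame t v -> tame t (fun s => u s + v s).
Proof.
move=> [mu [B uB]] [mv [B' vB]]; split; first exact: measurable_funD.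
by exists (B + B') => s st; apply: le_trans (ler_normD _ _) _; rewrite lerD ?uB ?vB.
Qed.

Lemma tame_sum (A : Type) (l : seq A) (c : A -> R) (u : A -> R -> R) t : (forall k, tame t (u k)) ->
  tame t (fun s => \sum_(k <- l) c k * u k s).
Proof.
move=> tu; elim: l => [|k l IH].
  apply: (@eq_tame t (cst 0)) => [s _|]; first by rewrite big_nil.
  by split; [exact: measurable_cst|exists 0 => s _; rewrite normr0].
apply: (@eq_tame t (fun s => c k * u k s + \sum_(k <- l) c k * u k s)) => [s _|]; first by rewrite big_cons.
by apply: tameD => //; exact: tameZ.
Qed.

Lemma tame_norm t u : tame t u -> tame t (fun s => `|u s|).
Proof.
move=> [mu [B uB]]; split; first exact: measurableT_comp.
by exists B => s st; rewrite normr_id uB.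
Qed.

Lemma eq_rvolterra t u v : (forall s, 0 <= s <= t -> u s = v s) -> rvolterra u t = rvolterra v t.
Proof. by move=> uv; apply: eq_Rintegral => s; rewrite inE/= in_itv/= => st; rewrite uv. Qed.

Lemma rvolterraZ t c u : tame t u -> rvolterra (fun s => c * u s) t = c * rvolterra u t.
Proof.
move=> tu; rewrite /rvolterra -RintegralZl//; last exact: tame_integrable.
by apply: eq_Rintegral => s _; rewrite mulrCA.
Qed.

Lemma rvolterraD t u v : tame t u -> tame t v ->
  rvolterra (fun s => u s + v s) t = rvolterra u t + rvolterra v t.
Proof.
move=> tu tv; rewrite /rvolterra -RintegralD//; [|exact: tame_integrable|exact: tame_integrable].
by apply: eq_Rintegral => s _; rewrite mulrDr.
Qed.

Lemma rvolterra_sum (A : Type) (l : seq A) (c : A -> R) (u : A -> R -> R) t : (forall k, tame t (u k)) ->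
  rvolterra (fun s => \sum_(k <- l) c k * u k s) t = \sum_(k <- l) c k * rvolterra (u k) t.
Proof.
move=> tu; elim: l => [|k l IH].
  rewrite big_nil /rvolterra; under eq_Rintegral do rewrite big_nil mulr0.
  by rewrite Rintegral_cst// mul0r.
rewrite big_cons -IH -rvolterraZ// -rvolterraD; [|exact: tameZ|exact: tame_sum].
by apply: eq_rvolterra => s _; rewrite big_cons.
Qed.

Lemma rvolterraE t u : tame t u -> (forall s, 0 <= s <= t -> 0 <= u s) ->
  (rvolterra u t)%:E = volterra f (fun s => (u s)%:E) t.
Proof.
move=> tu u0; rewrite /rvolterra /Rintegral fineK; first by apply: eq_integral => s _; rewrite EFinM.
by apply: integrable_fin_num => //; exact: tame_integrable.
Qed.

Lemma le_rvolterra_norm t u : tame t u ->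
  (`|rvolterra u t|%:E <= volterra f (fun s => `|u s|%:E) t)%E.
Proof.
move=> tu; rewrite -rvolterraE//; last exact: tame_norm.
rewrite lee_fin; apply: le_trans (le_normr_Rintegral _ (tame_integrable tu)) _ => //.
rewrite le_eqVlt; apply/orP; left; apply/eqP; apply: eq_Rintegral => s _.
by rewrite normrM ger0_norm.
Qed.

End real_volterra.

(** * Random paths under Volterra operators *)

Section joint_measurability.
Context {R : realType} d (T : measurableType d) (P : probability T R).
Local Notation leb := (@lebesgue_measure R).
Local Notation I t := (`[0%R, t%R]%classic : set R).

(* [Z s < y] iff [Z q < y] for some rational [q > s]. *)
Lemma measurable_path (Z : R -> T -> R) : (forall w, is_cumulative (Z ^~ w)) ->
  (forall s, measurable_fun setT (Z s)) -> measurable_fun setT (fun p : R * T => Z p.1 p.2).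
Proof.
move=> Zc mZ.
have lt_y y : measurable [set p : R * T | Z p.1 p.2 < y].
  have -> : [set p : R * T | Z p.1 p.2 < y] =
      \bigcup_(q : rat) (`]-oo, ratr q[%classic `*` [set w | Z (ratr q) w < y]).
    apply/seteqP; split => [[s w] /= Zy|[s w] [q _ [/= sq Zq]]]; last first.
      rewrite in_itv/= in sq.
      by apply: le_lt_trans Zq; have [nd _] := Zc w; apply: nd; exact: ltW.
    have [_ rc] := Zc w.
    have : \forall z \near s^'+, Z z w < y by apply: (cvgr_lt (Z s w)) => //; exact: rc.
    move=> H; near (s^'+) => z.
    have sz : s < z by near: z; exact: nbhs_right_gt.
    have Zz : Z z w < y by near: z.
    have [q] := rat_in_itvoo sz; rewrite in_itv/= => /andP[sq qz].
    exists q => //; split; rewrite /= ?in_itv//=.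
    by apply: le_lt_trans Zz; have [nd _] := Zc w; apply: nd; exact: ltW.
  apply: countable_bigcupT_measurable; first exact: countableP.
  move=> q; apply: measurableX; first exact: measurable_itv.
  have := mZ (ratr q) measurableT _ (measurable_itv `]-oo, y[); rewrite setTI.
  by congr measurable; apply/seteqP; split => w; rewrite /= in_itv.
apply: (measurability _ (@RGenInftyO.measurableE R)) => //.
move=> _ [_ [y ->] <-]; rewrite setTI.
have := lt_y y; congr measurable.
Unshelve. all: end_near. Qed.

Lemma measurable_integral (U : R -> T -> \bar R) :
  measurable_fun setT (fun p : R * T => U p.1 p.2) -> (forall s w, (0 <= U s w)%E) ->
  measurable_fun setT (fun s => \int[P]_w U s w)%E.
Proof.
move=> mU U0.
by have := @measurable_fun_fubini_tonelli_F _ _ (measurableTypeR R) T R P _ mU (fun p => U0 p.1 p.2).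
Qed.

Variables (f : R -> R) (U : R -> T -> \bar R) (t : R).
Hypotheses (f0 : forall t, 0 <= f t) (mf : measurable_fun setT f).
Hypotheses (mU : measurable_fun setT (fun p : R * T => U p.1 p.2)) (U0 : forall s w, (0 <= U s w)%E).

Let A : set R := I t.
Let K (p : R * T) : \bar R := ((\1_A p.1)%:E * ((f (t - p.1))%:E * U p.1 p.2))%E.

Let mK : measurable_fun setT K.
Proof.
have mA : measurable_fun setT (fun x : R => (\1_A x)%:E : \bar R).
  by apply/measurable_EFinP; apply: measurable_indic; exact: measurable_itv.
have mft : measurable_fun setT (fun s : R => (f (t - s))%:E).
  by apply/measurable_EFinP; apply: measurableT_comp => //; exact: measurable_funB.
apply: emeasurable_funM; first exact: measurableT_comp mA measurable_fst.
by apply: emeasurable_funM => //; exact: measurableT_comp mft measurable_fst.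
Qed.

Let K0 p : (0 <= K p)%E.
Proof. by apply: mule_ge0; [rewrite lee_fin|apply: mule_ge0; [rewrite lee_fin|]]. Qed.

Let KE w : (\int[leb]_s K (s, w) = volterra f (U ^~ w) t)%E.
Proof.
rewrite /volterra [RHS]integral_mkcond; apply: eq_integral => s _.
by rewrite patchE /K /= indicE; case: ifPn => sA; rewrite ?mul1e ?mul0e.
Qed.

Lemma measurable_volterra_path : measurable_fun setT (fun w => volterra f (U ^~ w) t).
Proof.
have := @measurable_fun_fubini_tonelli_G _ _ (measurableTypeR R) T R leb K mK K0.
by apply: eq_measurable_fun => w _; exact: KE.
Qed.

Lemma integral_volterra :
  (\int[P]_w volterra f (U ^~ w) t = volterra f (fun s => \int[P]_w U s w) t)%E.
Proof.
under eq_integral do rewrite -KE.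
rewrite -(@fubini_tonelli _ _ (measurableTypeR R) T R leb P K mK K0).
rewrite /volterra [RHS]integral_mkcond; apply: eq_integral => s _.
rewrite patchE /K /= indicE; case: ifPn => sA; last by apply: integral0_eq => w _; rewrite mul0e.
rewrite -ge0_integralZl_EFin//; last by exact: measurableT_comp mU (pair1_measurable s).
by apply: eq_integral => w _; rewrite mul1e.
Qed.

End joint_measurability.

(** * Iterated averages of positive families *)

Section iterated_average.
Context {R : realType} {d : nat}.
Local Notation site := 'rV[int]_d.
Implicit Types (u v : site -> R).

Lemma iter_avgD n u v i : iter n avg (fun k => u k + v k) i = iter n avg u i + iter n avg v i.
Proof.
have [l _ lE] := @iter_avgE R d n i; rewrite !lE -big_split/=.
by apply: eq_bigr => j _; rewrite mulrDr.
Qed.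

Lemma iter_avgZ n a u i : iter n avg (fun k => a * u k) i = a * iter n avg u i.
Proof.
have [l _ lE] := @iter_avgE R d n i; rewrite !lE mulr_sumr.
by apply: eq_bigr => j _; rewrite mulrCA.
Qed.

Lemma iter_avg_ge0 n u i : (forall j, 0 <= u j) -> 0 <= iter n avg u i.
Proof.
move=> u0; have := mono_iter n (@mono_avg R d) (u := fun=> 0) u0 i.
by rewrite (unital_iter n (@unital_avg R d)).
Qed.

Lemma iter_avg_le n u (M : R) i : (forall j, u j <= M) -> iter n avg u i <= M.
Proof.
move=> uM; have := mono_iter n (@mono_avg R d) (u' := fun=> M) uM i.
by rewrite (unital_iter n (@unital_avg R d)).
Qed.

(** One step changes the norm by at most 1, hence the weight by a factor at most 2. This is the
    growth that [renewal_comparison] tolerates. *)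
Lemma iter_avg_powR n (i : site) : iter n avg (fun j : site => 2 `^ enorm R j) i <= 2 ^+ n * 2 `^ enorm R i.
Proof.
elim: n => [|n IH]; first by rewrite expr0 mul1r.
have a1 (j : site) : avg (fun j : site => 2 `^ enorm R j) j <= 2 * 2 `^ enorm R j.
  (* Monotonicity asks for a bound at every site, so the weight is replaced by the bound itself away
     from the neighbours of [j]. *)
  have := mono_avg (u := fun k => if k \in nbrs j then 2 `^ enorm R k else 2 * 2 `^ enorm R j)
     (u' := fun=> 2 * 2 `^ enorm R j).
  have e2 : 2 * 2 `^ enorm R j = 2 `^ (enorm R j + 1) :> R.
    by rewrite powRD ?powRr1// 1?mulrC//; apply/implyP => _; rewrite pnatr_eq0.
  move=> /(_ _ j); rewrite (@unital_avg R d) => H.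
  apply: le_trans (H _).
    rewrite /avg ler_wpM2l ?invr_ge0// le_eqVlt; apply/orP; left; apply/eqP.
    by apply: eq_big_seq => k ->.
  move=> k; case: ifPn => // kj; rewrite e2 ler_powR ?ler1n//.
  exact: enorm_nbrs.
rewrite iterSr; apply: le_trans (mono_iter n (@mono_avg R d) a1 i) _.
by rewrite iter_avgZ exprS -mulrA ler_wpM2l.
Qed.

End iterated_average.

(** * Convergence in mean of the normalized process *)

Section hawkes_limit.
Context {R : realType} {d : nat} d0 (T : measurableType d0) (P : probability T R).
Local Notation site := 'rV[int]_d.
Local Notation leb := (@lebesgue_measure R).
Local Notation I t := (`[0%R, t%R]%classic : set R).
Variables (F : R -> set_system T) (N : site -> T -> {measure set (R * R) -> \bar R}).
Variables (phi : R -> R) (m : site -> R) (Z : site -> R -> T -> R).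
Hypothesis CH : clean_hawkes P F N phi m Z.
Hypotheses (d_gt0 : (0 < d)%N).
Hypotheses (phi_ge0 : forall t, 0 <= phi t) (mphi : measurable_fun setT phi).
Variables (kappa Cf : R).
Hypotheses (kappa0 : 0 < kappa) (Cf0 : 0 <= Cf).
Local Notation alpha := (2 * kappa).
Let decay (t : R) : R := expR (- (alpha * t)).
Let f t := phi t * decay t.
Hypothesis f_le : forall t, 0 <= t -> f t <= Cf * expR (- (kappa * t)).
Hypothesis f_neg : forall t, t < 0 -> f t = 0.
Hypothesis f_int : (\int[leb]_t (f t)%:E = 1)%E.
Variables (M mu : R).
Hypotheses (m_ge0 : forall i, 0 <= m i) (m_le : forall i, m i <= M).
Hypotheses (mu_mean : ball_average m r @[r --> +oo] --> mu) (mu0 : 0 <= mu).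
Variables (h : R -> R) (Bh : R).
Hypotheses (mh : measurable_fun setT h) (h0 : forall t, 0 <= h t) (h_le : forall t, 0 <= t -> h t <= Bh).
Hypothesis h_eq : forall t, 0 <= t ->
  ((h t)%:E = (t * decay t)%:E + volterra f (fun s => (h s)%:E) t)%E.

Let m_decay : measurable_fun setT decay.
Proof. by apply: measurableT_comp => //; exact: measurableT_comp. Qed.

Let decay0 t : 0 < decay t. Proof. exact: expR_gt0. Qed.

Let mf : measurable_fun setT f. Proof. exact: measurable_funM. Qed.

Let f_ge0 t : 0 <= f t. Proof. by rewrite mulr_ge0// ltW. Qed.

Let f_C t : f t <= Cf.
Proof.
have [t0|/f_neg->//] := leP 0 t; apply: le_trans (f_le t0) _.
by rewrite ler_piMr// expR_le1 oppr_le0 mulr_ge0// ltW.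
Qed.

(** Extended by 0, the paths are nondecreasing on the whole line, hence jointly measurable in time
    and outcome. *)
Let Zx j s w := extend0 (Z j ^~ w) s.
Let y j s w := decay s * Zx j s w.
Let comp j t w := fine (compensator phi m Z j t w).
Let D j t w := decay t * (Zx j t w - comp j t w).

Let ZxE j s w : 0 <= s -> Zx j s w = Z j s w.
Proof. by rewrite /Zx /extend0 => ->. Qed.

Let Zx_ge0 j s w : 0 <= Zx j s w.
Proof.
rewrite /Zx /extend0; case: ifPn => // s0.
exact: (hawkes_path_ge0 (clean_equation CH)).
Qed.

Let Zx_mono j w s t : s <= t -> Zx j s w <= Zx j t w.
Proof. by have [nd _] := clean_cumulative CH j w; exact: nd. Qed.

Let y_ge0 j s w : 0 <= y j s w. Proof. by rewrite mulr_ge0// ltW. Qed.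

Let decay_le1 s : 0 <= s -> decay s <= 1.
Proof. by move=> s0; rewrite expR_le1 oppr_le0 !mulr_ge0// ltW. Qed.

Let y_tame t j w : tame t (y j ^~ w).
Proof.
split.
  apply: measurable_funTS; apply: measurable_funM => //.
  by apply: nondecreasing_measurable => // s s'; exact: Zx_mono.
exists (Zx j t w) => s /andP[s0 st]; rewrite ger0_norm//.
by apply: le_trans (Zx_mono j w st); rewrite ler_piMl ?decay_le1.
Qed.

Let h_tame t : tame t h.
Proof.
by split; [exact: measurable_funTS|exists Bh => s /andP[s0 _]; rewrite ger0_norm// h_le].
Qed.

(** The discount factors as [decay t = decay (t - s) * decay s], which turns [phi] into [f] and [Z]
    into [y]. *)
Let offspring j t w : 0 <= t ->
  (\int[leb]_(s in I t) (phi (t - s) * Z j s w)%:E = ((decay t)^-1 * rvolterra f (y j ^~ w) t)%:E)%E.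
Proof.
move=> t0; rewrite EFinM (rvolterraE f_ge0 mf f_C (y_tame t j w))//.
rewrite /volterra -ge0_integralZl_EFin ?invr_ge0 ?(ltW (decay0 t))//; last 2 first.
- by move=> s _; rewrite -EFinM lee_fin mulr_ge0.
- apply: (@measurable_volterra_integrand R f mf (fun s => (y j s w)%:E) t).
  by apply/measurable_EFinP; have [] := y_tame t j w.
apply: eq_integral => s; rewrite inE/= in_itv/= => /andP[s0 st].
rewrite -!EFinM /y ZxE// /f; congr EFin.
have -> : decay t = decay (t - s) * decay s by rewrite /decay -expRD; congr expR; ring.
by field; rewrite !gt_eqF.
Qed.

Let comp_eq j t w : 0 <= t -> (decay t * comp j t w) =
  decay t * (m j * t) + avg (fun k => rvolterra f (y k ^~ w) t) j.
Proof.
move=> t0; rewrite /comp (compensatorE phi_ge0 mphi m_ge0 (clean_cumulative CH))//.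
under eq_bigr do rewrite offspring//.
rewrite sumEFin -EFinM -EFinD /= mulrDr; congr (_ + _).
by rewrite -mulr_sumr mulrCA mulVKf ?gt_eqF.
Qed.

Let compensator_finite j t w : 0 <= t -> compensator phi m Z j t w = (comp j t w)%:E.
Proof.
move=> t0; rewrite /comp fineK// (compensatorE phi_ge0 mphi m_ge0 (clean_cumulative CH))//.
by under eq_bigr do rewrite offspring//; rewrite sumEFin -EFinM -EFinD.
Qed.

Let path_eq j t w : 0 <= t ->
  y j t w = D j t w + decay t * (m j * t) + avg (fun k => rvolterra f (y k ^~ w) t) j.
Proof. by move=> t0; rewrite -addrA -comp_eq// /D /y; ring. Qed.

Let S (i : site) n (u : site -> R) := iter n avg u i.

Let S_rvolterra i n (u : site -> R -> R) t : (forall k, tame t (u k)) ->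
  S i n (fun k => rvolterra f (u k) t) = rvolterra f (fun s => S i n (u ^~ s)) t.
Proof.
move=> tu; have [l _ lE] := @iter_avgE R d n i.
rewrite /S lE -(rvolterra_sum f_ge0 mf f_C)//.
by apply: eq_rvolterra => s _; rewrite lE.
Qed.

Let S_tame i n (u : site -> R -> R) t : (forall k, tame t (u k)) -> tame t (fun s => S i n (u ^~ s)).
Proof.
move=> tu; have [l _ lE] := @iter_avgE R d n i.
apply: eq_tame (tame_sum l (fun j => iter n avg (fun x => (x == j)%:R) i) tu) => s _.
by rewrite /S lE.
Qed.

Let S_path i n t w : 0 <= t -> S i n (fun j => y j t w) =
  S i n (fun j => D j t w) + t * decay t * S i n m + rvolterra f (fun s => S i n.+1 (fun j => y j s w)) t.
Proof.
move=> t0; rewrite -S_rvolterra => [|k]; last exact: y_tame.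
rewrite /S iterSr -iter_avgZ -!iter_avgD; congr (iter n avg _ i); apply/funext => j.
by rewrite path_eq//; ring.
Qed.

Let err i n t w := `|S i n (fun j => y j t w) - mu * h t|.

(** [mu] times the equation of [h] is subtracted from [S_path]; the noise and the deviation of
    [A^n m] from [mu] remain as sources. *)
Let err_path i n t w : 0 <= t -> ((err i n t w)%:E <=
  (`|S i n (fun j => D j t w)| + t * decay t * `|S i n m - mu|)%:E + volterra f (fun s => (err i n.+1 s w)%:E) t)%E.
Proof.
move=> t0.
have hE : h t = t * decay t + rvolterra f h t.
  by have := h_eq t0; rewrite -(rvolterraE f_ge0 mf f_C)// -EFinD => -[].
have tS : tame t (fun s => S i n.+1 (fun j => y j s w)).
  exact: (@S_tame i n.+1 (fun k s => y k s w) t (fun k => y_tame t k w)).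
have te : tame t (fun s => S i n.+1 (fun j => y j s w) - mu * h s).
  by apply: (@eq_tame _ t (fun s => S i n.+1 (fun j => y j s w) + (- mu) * h s)) => [s _|];
    [rewrite mulNr|apply: tameD => //; exact: tameZ].
have e1 : S i n (fun j => y j t w) - mu * h t = S i n (fun j => D j t w) + t * decay t * (S i n m - mu)
    + rvolterra f (fun s => S i n.+1 (fun j => y j s w) - mu * h s) t.
  rewrite (@eq_rvolterra _ f t _ (fun s => S i n.+1 (fun j => y j s w) + (- mu) * h s)); last by move=> s _; rewrite mulNr.
  rewrite (rvolterraD f_ge0 mf f_C tS (tameZ _ (h_tame t))) (rvolterraZ f_ge0 mf f_C _ (h_tame t)).
  by rewrite S_path// hE; ring.
apply: le_trans (leeD (lexx _) (le_rvolterra_norm f_ge0 mf f_C te)).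
rewrite -EFinD lee_fin /err e1; apply: le_trans (ler_normD _ _) _; rewrite lerD2r.
apply: le_trans (ler_normD _ _) _; rewrite lerD2l normrM ger0_norm//.
by rewrite mulr_ge0// ltW.
Qed.

Let mZ j s : measurable_fun (setT : set T) (Zx j s).
Proof.
rewrite /Zx /extend0; have [s0|s0] := leP 0 s; last exact: measurable_cst.
by apply: (adapted_measurable_fun (clean_poisson CH) s0); exact: (clean_adapted CH).
Qed.

Let my j : measurable_fun setT (fun p : R * T => y j p.1 p.2).
Proof.
apply: measurable_funM; first exact: measurableT_comp m_decay measurable_fst.
by apply: (@measurable_path R _ T (Zx j)); [exact: (clean_cumulative CH j)|exact: mZ].
Qed.

Let myw j t : measurable_fun (setT : set T) (y j t).
Proof. exact: (@measurable_funM _ _ _ setT (cst (decay t)) (Zx j t)). Qed.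

Let EZ_fin j t : 0 <= t -> (\int[P]_w (Z j t w)%:E < +oo)%E.
Proof.
by move=> t0; have [C /(_ j) hC] := clean_integral CH t0; apply: le_lt_trans hC (ltry _).
Qed.

Let ey j t := fine (\int[P]_w (y j t w)%:E)%E.

Let Ey_le j s t C : s <= t -> 0 <= t -> (\int[P]_w (Z j t w)%:E <= C)%E -> (\int[P]_w (y j s w)%:E <= C)%E.
Proof.
move=> st t0; apply: le_trans; apply: ge0_le_integral => //.
- by move=> w _; rewrite lee_fin.
- by apply/measurable_EFinP; exact: myw.
- by apply/measurable_EFinP; apply: eq_measurable_fun (mZ j t) => w _; exact: ZxE.
- move=> w _; rewrite lee_fin -(ZxE j w t0); apply: le_trans (Zx_mono j w st).
  rewrite /y; have [s0|s0] := leP 0 s; first by rewrite ler_piMl ?decay_le1.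
  by rewrite /Zx /extend0 [0 <= s]leNgt s0 /= mulr0.
Qed.

Let eyE j t : (\int[P]_w (y j t w)%:E = (ey j t)%:E)%E.
Proof.
rewrite fineK// ge0_fin_numE; last by apply: integral_ge0 => w _; rewrite lee_fin.
have tm : 0 <= Num.max t 0 by rewrite le_max lexx orbT.
by apply: le_lt_trans (EZ_fin j tm); apply: Ey_le tm (lexx _); rewrite le_max lexx.
Qed.

Let ey_ge0 j t : 0 <= ey j t.
Proof. by apply: fine_ge0; apply: integral_ge0 => w _; rewrite lee_fin. Qed.

Let m_ey j : measurable_fun setT (ey j).
Proof.
apply/measurable_EFinP; have := @measurable_integral R _ _ P (fun s w => (y j s w)%:E) _ _.
move=> /(_ _ _)/eq_measurable_fun; apply.
- by move=> s _; exact: eyE.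
- by apply/measurable_EFinP; exact: my.
- by move=> s w; rewrite lee_fin.
Qed.

Let ey_tame j t : tame t (ey j).
Proof.
split; first by apply: measurable_funTS; exact: m_ey.
have [t0|t0] := leP 0 t; last by exists 0 => s /andP[s0 st]; move: t0; rewrite ltNge (le_trans s0 st).
have [C /(_ j) hC] := clean_integral CH t0.
exists (C * 2 `^ enorm R j) => s /andP[s0 st]; rewrite ger0_norm// -lee_fin -eyE.
exact: Ey_le st t0 hC.
Qed.

(** By [integral_compensator] the process and its compensator have the same mean, so the means solve
    the equation without noise. *)
Let mean_eq j t : 0 <= t -> ey j t = decay t * (m j * t) + avg (fun k => rvolterra f (ey k) t) j.
Proof.
move=> t0; apply: EFin_inj; rewrite -eyE.
have -> : (\int[P]_w (y j t w)%:E = \int[P]_w ((decay t * comp j t w)%:E))%E.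
  under eq_integral do rewrite /y ZxE// EFinM.
  under [RHS]eq_integral do rewrite EFinM -compensator_finite//.
  have mc := compensator_measurable (clean_poisson CH) phi_ge0 mphi m (clean_cumulative CH) (clean_adapted CH) j t0.
  rewrite !ge0_integralZl_EFin ?(ltW (decay0 t))//.
  - by rewrite (integral_compensator (clean_poisson CH) phi_ge0 mphi (clean_cumulative CH) (clean_adapted CH) (clean_null CH) (clean_equation CH)).
  - by move=> w _; rewrite lee_fin -(ZxE j w t0).
  - by apply/measurable_EFinP; apply: eq_measurable_fun (mZ j t) => w _; exact: ZxE.
have rvE k w : (rvolterra f (y k ^~ w) t)%:E = volterra f (fun s => (y k s w)%:E) t.
  by rewrite (rvolterraE f_ge0 mf f_C (y_tame t k w)).
have myE k : measurable_fun setT (fun p : R * T => (y k p.1 p.2)%:E).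
  by apply/measurable_EFinP; exact: my.
have yE0 k s w : (0 <= (y k s w)%:E)%E by rewrite lee_fin.
have mv k : measurable_fun (setT : set T) (fun w => (rvolterra f (y k ^~ w) t)%:E).
  apply: eq_measurable_fun (measurable_volterra_path t f_ge0 mf (myE k) (yE0 k)) => w _.
  by rewrite rvE.
have rv0 k w : (0 <= (rvolterra f (y k ^~ w) t)%:E)%E.
  by rewrite rvE; apply: volterra_ge0.
have Erv k : (\int[P]_w (rvolterra f (y k ^~ w) t)%:E = (rvolterra f (ey k) t)%:E)%E.
  under eq_integral do rewrite rvE.
  rewrite (integral_volterra P t f_ge0 mf (myE k) (yE0 k)) (rvolterraE f_ge0 mf f_C (ey_tame k t))//.
  by apply: eq_volterra => s _; exact: eyE.
have dm0 : 0 <= decay t * (m j * t) by rewrite !mulr_ge0// ltW.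
have c0 : 0 <= (2 * d + 1)%:R^-1 :> R by rewrite invr_ge0.
have cE w : (decay t * comp j t w)%:E = ((decay t * (m j * t))%:E +
    ((2 * d + 1)%:R^-1)%:E * \sum_(k <- nbrs j) (rvolterra f (y k ^~ w) t)%:E)%E.
  by rewrite comp_eq// /avg sumEFin -EFinM -EFinD.
under eq_integral do rewrite cE.
rewrite ge0_integralD//; last 2 first.
- by move=> w _; apply: mule_ge0; [rewrite lee_fin|apply: sume_ge0].
- by apply: emeasurable_funM; [exact: measurable_cst|exact: emeasurable_sum].
rewrite integral_cst_prob ge0_integralZl_EFin//; last 2 first.
- by move=> w _; apply: sume_ge0.
- exact: emeasurable_sum.
rewrite ge0_integral_sum//; under eq_bigr do rewrite Erv.
by rewrite sumEFin -EFinM -EFinD.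
Qed.

Let z i n t := S i n (fun j => ey j t).

Let z_eq i n t : 0 <= t -> z i n t = t * decay t * S i n m + rvolterra f (z i n.+1) t.
Proof.
move=> t0; rewrite -(S_rvolterra i n.+1) => [|k]; last exact: ey_tame.
rewrite /z /S iterSr -iter_avgZ -!iter_avgD; congr (iter n avg _ i); apply/funext => j.
by rewrite mean_eq//; ring.
Qed.

Let M0 : 0 <= M. Proof. exact: le_trans (m_ge0 0) (m_le 0). Qed.

Let t_decay t : 0 <= t -> t * decay t <= kappa^-1 * expR (- (kappa * t)).
Proof.
move=> t0; have := @mul_expR_le R alpha t (mulr_gt0 (ltr0n _ 2) kappa0) t0.
have -> : 2 / alpha = kappa^-1 by field; rewrite gt_eqF.
by have -> : alpha / 2 = kappa by field.
Qed.

Let z_tame i n t : tame t (z i n). Proof. by apply: S_tame => k; exact: ey_tame. Qed.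

Let z_ge0 i n t : 0 <= z i n t. Proof. by apply: iter_avg_ge0 => j; exact: ey_ge0. Qed.

(** [renewal_comparison] for the mean equation, with the source bounded by [M t decay t]. The a
    priori bound is that of the weights [2^|i|], which [n] averages multiply by at most [2^n]. *)
Let z_bound i : exists2 K, 0 <= K & forall n t, 0 <= t -> z i n t <= K.
Proof.
pose Bc := 2 / fine (\int[leb]_(r in `[0%R, +oo[) (f r * (Num.min 1 (kappa * r)))%:E)%E.
have barB t : barrier f kappa t <= Bc by exact: barrier_le.
have Bc0 : 0 <= Bc by apply: le_trans (barB 0); exact: barrier_ge0.
have Mk : 0 <= M * kappa^-1 by rewrite mulr_ge0// invr_ge0 ltW.
exists (M * kappa^-1 * Bc) => [|n t t0]; first by rewrite mulr_ge0.
apply: (@le_trans _ _ (M * kappa^-1 * barrier f kappa t)); last by rewrite ler_wpM2l.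
have [C hC] := clean_integral CH t0.
pose C' := Num.max C 0 * 2 `^ enorm R i.
have C'0 : 0 <= C' by rewrite mulr_ge0 ?powR_ge0// le_max lexx orbT.
rewrite -lee_fin.
apply: (@renewal_comparison R f kappa Cf f_ge0 mf kappa0 Cf0 f_le f_neg f_int (M * kappa^-1) C' t (fun n s => (z i n s)%:E) Mk C'0).
- by move=> n'; apply/measurable_EFinP; have [] := z_tame i n' t.
- by move=> n' s _; rewrite lee_fin.
- move=> n' s /andP[s0 st]; rewrite lee_fin.
  apply: (@le_trans _ _ (S i n' (fun j => Num.max C 0 * 2 `^ enorm R j))).
    apply: (mono_iter n' (@mono_avg R d)) => j; rewrite -lee_fin -eyE.
    apply: Ey_le st t0 _; apply: le_trans (hC j) _.
    by rewrite lee_fin ler_wpM2r ?powR_ge0// le_max lexx.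
  rewrite /S iter_avgZ /C' -mulrA ler_wpM2l ?le_max ?lexx ?orbT// mulrC.
  exact: iter_avg_powR.
- move=> n' s /andP[s0 st]; rewrite z_eq// EFinD (rvolterraE f_ge0 mf f_C (z_tame i n'.+1 s))//.
  apply: leeD => //; rewrite lee_fin mulrC -mulrA ler_pM//.
  + by apply: iter_avg_ge0.
  + by rewrite mulr_ge0// ltW.
  + exact: iter_avg_le.
  + exact: t_decay.
- by rewrite t0 lexx.
Qed.

Let mcomp j t : 0 <= t -> measurable_fun (setT : set T) (comp j t).
Proof.
move=> t0; apply: measurableT_comp => //.
exact: (compensator_measurable (clean_poisson CH) phi_ge0 mphi m (clean_cumulative CH) (clean_adapted CH)).
Qed.

Let EZE j t : 0 <= t -> (\int[P]_w (Z j t w)%:E = ((decay t)^-1 * ey j t)%:E)%E.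
Proof.
move=> t0; rewrite EFinM -eyE -ge0_integralZl_EFin ?invr_ge0 ?(ltW (decay0 t))//.
- by apply: eq_integral => w _; rewrite -EFinM /y mulKf ?gt_eqF// ZxE.
- by move=> w _; rewrite lee_fin.
- by apply/measurable_EFinP; exact: myw.
Qed.

Let mSD i n t : 0 <= t -> measurable_fun (setT : set T) (fun w => S i n (fun j => D j t w)).
Proof.
move=> t0; have [l _ lE] := @iter_avgE R d n i.
under [X in measurable_fun _ X]funext => w do rewrite /S lE.
apply: measurable_sum => j; apply: measurable_funM => //.
apply: (@measurable_funM _ _ _ setT (cst (decay t)) (fun w => Zx j t w - comp j t w)) => //.
by apply: measurable_funB; [exact: mZ|exact: mcomp].
Qed.

(** [sum c_j^2 E Z_j <= eps sum c_j E Z_j], and the last sum is [z i n t / decay t]. The square root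
    of the second moment is replaced by Young's inequality with a free parameter [delta], to be
    fixed before [eps] is made small. *)
Let noise_bound i n (eps K : R) delta t :
  (forall j, iter n avg (fun x : site => (x == j)%:R) i <= eps) ->
  (forall t, 0 <= t -> z i n t <= K) -> 0 < delta -> 0 <= t ->
  (\int[P]_w `|S i n (fun j => D j t w)|%:E <= ((delta + eps * K / delta) / 2 * expR (- (kappa * t)))%:E)%E.
Proof.
move=> ceps zK de0 t0; have [l ul lE] := @iter_avgE R d n i.
pose c (j : site) : R := iter n avg (fun x : site => (x == j)%:R) i.
have c0 j : 0 <= c j by apply: iter_avg_ge0 => k.
have eps0 : 0 <= eps := le_trans (c0 i) (ceps i).
pose X w := \sum_(j <- l) c j * (Z j t w - comp j t w).
have SX w : S i n (fun j => D j t w) = decay t * X w.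
  by rewrite /S lE mulr_sumr; apply: eq_bigr => j _; rewrite /D ZxE// mulrCA.
have mX : measurable_fun (setT : set T) X.
  apply: measurable_sum => j; apply: measurable_funM => //; apply: measurable_funB; last exact: mcomp.
  by apply: eq_measurable_fun (mZ j t) => w _; rewrite ZxE.
have dt := decay0 t.
pose V := eps * ((decay t)^-1 * K).
have X2 : (\int[P]_w (X w ^+ 2)%:E <= V%:E)%E.
  apply: le_trans (noise_second_moment (clean_poisson CH) phi_ge0 mphi (clean_cumulative CH) (clean_adapted CH)
    EZ_fin (clean_null CH) (clean_equation CH) ul c0 t0) _.
  under eq_bigr do rewrite EZE// -EFinM.
  rewrite sumEFin lee_fin.
  apply: (@le_trans _ _ (\sum_(j <- l) eps * ((decay t)^-1 * (c j * ey j t)))).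
    apply: ler_sum => j _; rewrite expr2 -mulrA [(decay t)^-1 * (_ * _)]mulrCA.
    apply: ler_wpM2r; last exact: ceps.
    by rewrite mulr_ge0// mulr_ge0// invr_ge0 ltW.
  rewrite -mulr_sumr -mulr_sumr -lE /V ler_wpM2l// ler_wpM2l ?invr_ge0 ?(ltW dt)//.
  exact: zK.
pose E := expR (kappa * t); have E0 : 0 < E := expR_gt0 _.
have dE : decay t = E^-1 * E^-1 by rewrite /E -expRN -expRD /decay; congr expR; ring.
(* With [decay t = E^-2] this choice gives both terms of Young's inequality the common rate [1 / E]:
   they become [delta / (2 E)] and [eps K / (2 delta E)]. *)
pose r := delta * E; have r0 : 0 < r by rewrite mulr_gt0.
apply: (@le_trans _ _ (\int[P]_w ((decay t * (r / 2))%:E + (decay t / (2 * r))%:E * (X w ^+ 2)%:E))%E).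
  apply: ge0_le_integral => //.
  - by apply/measurable_EFinP; apply: measurableT_comp => //; exact: mSD.
  - apply: emeasurable_funD; first exact: measurable_cst.
    apply: emeasurable_funM; first exact: measurable_cst.
    by apply/measurable_EFinP; exact: measurable_funX.
  - move=> w _; rewrite -EFinM -EFinD lee_fin SX normrM ger0_norm ?(ltW dt)//.
    rewrite -[decay t / _ * _]mulrA -mulrDr ler_wpM2l ?(ltW dt)//.
    (* AM-GM *)
    have -> : X w ^+ 2 = `|X w| ^+ 2 by rewrite real_normK ?num_real.
    rewrite -subr_ge0.
    have -> : r / 2 + (2 * r)^-1 * `|X w| ^+ 2 - `|X w| = (2 * r)^-1 * (r - `|X w|) ^+ 2.
      by field; rewrite gt_eqF.
    by rewrite mulr_ge0 ?sqr_ge0// invr_ge0 mulr_ge0// ltW.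
have dr0 : 0 <= decay t / (2 * r) by rewrite divr_ge0 ?(ltW dt)// mulr_ge0// ltW.
rewrite ge0_integralD//; last 3 first.
- by move=> w _; rewrite lee_fin mulr_ge0 ?(ltW dt)// divr_ge0// ltW.
- by move=> w _; rewrite -EFinM lee_fin mulr_ge0 ?sqr_ge0.
- apply: emeasurable_funM; first exact: measurable_cst.
  by apply/measurable_EFinP; exact: measurable_funX.
rewrite integral_cst_prob ge0_integralZl_EFin//; last 2 first.
- by move=> w _; rewrite lee_fin sqr_ge0.
- by apply/measurable_EFinP; exact: measurable_funX.
apply: le_trans (leeD (lexx _) (lee_wpmul2l _ X2)) _; first by rewrite lee_fin.
rewrite -EFinM -EFinD lee_fin le_eqVlt; apply/orP; left; apply/eqP.
rewrite /V dE expRN -/E /r.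
by field; rewrite !gt_eqF.
Qed.

Let q i n t : \bar R := (\int[P]_w (err i n t w)%:E)%E.

Let err_ge0 i n t w : 0 <= err i n t w. Proof. exact: normr_ge0. Qed.

Let m_err i n : measurable_fun setT (fun p : R * T => (err i n p.1 p.2)%:E).
Proof.
have [l _ lE] := @iter_avgE R d n i.
apply/measurable_EFinP; apply: measurableT_comp => //; apply: measurable_funB; last first.
  by apply: measurable_funM => //; exact: measurableT_comp mh measurable_fst.
under [X in measurable_fun _ X]funext => p do rewrite /S lE.
by apply: measurable_sum => j; apply: measurable_funM => //; exact: my.
Qed.

Let m_errw i n t : measurable_fun (setT : set T) (fun w => (err i n t w)%:E).
Proof. exact: measurableT_comp (m_err i n) (pair1_measurable t). Qed.

Let mq i n : measurable_fun setT (q i n).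
Proof.
apply: (@measurable_integral R _ _ P (fun s w => (err i n s w)%:E)); first exact: m_err.
by move=> s w; rewrite lee_fin.
Qed.

Let q_rec i n (eps K : R) delta t :
  (forall j, iter n avg (fun x : site => (x == j)%:R) i <= eps) ->
  (forall t, 0 <= t -> z i n t <= K) -> 0 < delta -> 0 <= t ->
  (q i n t <= (((delta + eps * K / delta) / 2 + kappa^-1 * `|S i n m - mu|) * expR (- (kappa * t)))%:E
     + volterra f (q i n.+1) t)%E.
Proof.
move=> ceps zK de0 t0.
have td0 : 0 <= t * decay t * `|S i n m - mu| by rewrite !mulr_ge0// ltW.
have err0 s w : (0 <= (err i n.+1 s w)%:E)%E by rewrite lee_fin.
have mv : measurable_fun (setT : set T) (fun w => volterra f (fun s => (err i n.+1 s w)%:E) t).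
  exact: (measurable_volterra_path t f_ge0 mf (m_err i n.+1) err0).
have v0 w : (0 <= volterra f (fun s => (err i n.+1 s w)%:E) t)%E by apply: volterra_ge0.
have mD : measurable_fun (setT : set T) (fun w => `|S i n (fun j => D j t w)|%:E).
  by apply/measurable_EFinP; apply: measurableT_comp => //; exact: mSD.
apply: (@le_trans _ _ (\int[P]_w (`|S i n (fun j => D j t w)|%:E + (t * decay t * `|S i n m - mu|)%:E
   + volterra f (fun s => (err i n.+1 s w)%:E) t))%E).
  apply: ge0_le_integral => //.
  - by move=> w _; rewrite lee_fin.
  - by apply: emeasurable_funD => //; apply: emeasurable_funD => //; exact: measurable_cst.
  - by move=> w _; rewrite -EFinD; exact: err_path.
rewrite ge0_integralD//; last 2 first.
- by move=> w _; rewrite -EFinD lee_fin addr_ge0.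
- by apply: emeasurable_funD => //; exact: measurable_cst.
rewrite ge0_integralD//.
rewrite integral_cst_prob (integral_volterra P t f_ge0 mf (m_err i n.+1) err0).
apply: leeD => //; rewrite mulrDl EFinD; apply: leeD; first exact: noise_bound.
rewrite lee_fin [kappa^-1 * _ * _]mulrAC; apply: ler_wpM2r => //; exact: t_decay.
Qed.

Let q_le i n K t : (forall t, 0 <= t -> z i n t <= K) -> 0 <= t -> (q i n t <= (K + mu * Bh)%:E)%E.
Proof.
move=> zK t0; have [l _ lE] := @iter_avgE R d n i.
pose c (j : site) : R := iter n avg (fun x : site => (x == j)%:R) i.
have c0 j : 0 <= c j by apply: iter_avg_ge0 => k.
have mcy j : measurable_fun (setT : set T) (fun w => (c j)%:E * (y j t w)%:E)%E.
  by apply: emeasurable_funM; [exact: measurable_cst|apply/measurable_EFinP; exact: myw].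
have cy0 j w : (0 <= (c j)%:E * (y j t w)%:E)%E by rewrite -EFinM lee_fin mulr_ge0.
have mb0 : 0 <= mu * h t by rewrite mulr_ge0.
apply: (@le_trans _ _ (\int[P]_w (\sum_(j <- l) (c j)%:E * (y j t w)%:E + (mu * h t)%:E))%E).
  apply: ge0_le_integral => //.
  - by move=> w _; rewrite lee_fin.
  - by apply: emeasurable_funD; [exact: emeasurable_sum|exact: measurable_cst].
  - move=> w _; under eq_bigr do rewrite -EFinM.
    rewrite sumEFin -EFinD lee_fin /err /S lE; apply: le_trans (ler_normB _ _) _.
    rewrite (ger0_norm mb0) ger0_norm// sumr_ge0// => j _.
    by rewrite mulr_ge0// c0.
rewrite ge0_integralD//; last 2 first.
- by move=> w _; apply: sume_ge0.
- exact: emeasurable_sum.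
rewrite integral_cst_prob ge0_integral_sum//.
have -> : (\sum_(j <- l) \int[P]_w ((c j)%:E * (y j t w)%:E) = (z i n t)%:E)%E.
  rewrite /z /S lE -sumEFin; apply: eq_bigr => j _.
  rewrite ge0_integralZl_EFin//; first by rewrite eyE -EFinM.
    by move=> w _; rewrite lee_fin.
  by apply/measurable_EFinP; exact: myw.
by rewrite -EFinD lee_fin; apply: lerD; [exact: zK|apply: ler_wpM2l => //; exact: h_le].
Qed.

Lemma clean_hawkes_limit i e : 0 < e -> exists t0, 0 <= t0 /\ forall t, t0 <= t ->
  (\int[P]_w `|decay t * Z i t w - mu * h t|%:E <= e%:E)%E.
Proof.
move=> e0; have [K K0 zK] := z_bound i.
have [eps eps0 ceps] := @avg_kernel_decay R d d_gt0.
have Bh0 : 0 <= Bh := le_trans (h0 0) (h_le (lexx 0)).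
have q0 n t : (0 <= q i n t)%E by apply: integral_ge0 => w _; rewrite lee_fin.
have B0 : 0 <= K + mu * Bh by rewrite addr_ge0// mulr_ge0.
have qB n t : 0 <= t -> (q i n t <= (K + mu * Bh)%:E)%E by move=> t0; exact: (@q_le i n K t (@zK n) t0).
have rec n : exists K', forall t, 0 <= t ->
    (q i n t <= (K' * expR (- (kappa * t)))%:E + volterra f (q i n.+1) t)%E.
  exists ((1 + eps n * K / 1) / 2 + kappa^-1 * `|S i n m - mu|) => t t0.
  exact: (q_rec (ceps n i) (@zK n) ltr01 t0).
have small delta : 0 < delta -> exists n0, forall n t, (n0 <= n)%N -> 0 <= t ->
    (q i n t <= (delta * expR (- (kappa * t)))%:E + volterra f (q i n.+1) t)%E.
  move=> de0.
  (* With Young's parameter [delta / 2] and [eps n * K <= delta^2 / 4], the noise contributes at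
     most [delta / 2]; the deterministic source contributes at most [delta / 4]. *)
  have k40 : 0 < kappa * (delta / 4) by rewrite mulr_gt0// divr_gt0.
  have K1 : 0 < 4 * (K + 1) by lra.
  have d40 : 0 < delta * delta / (4 * (K + 1)) by rewrite divr_gt0// mulr_gt0.
  have Sm : S i n m @[n --> \oo] --> mu.
    by apply: (avg_mean d_gt0 (M := M)) => // j; rewrite ger0_norm.
  have /cvgrPdist_le/(_ _ k40)[n1 _ hn1] := Sm.
  have [n2 _ hn2] := cvgr_le _ eps0 _ d40.
  exists (maxn n1 n2) => n t; rewrite geq_max => /andP[nn1 nn2] t0.
  have d20 : 0 < delta / 2 by rewrite divr_gt0.
  apply: le_trans (q_rec (ceps n i) (@zK n) d20 t0) _.
  apply: leeD => //; rewrite lee_fin ler_wpM2r ?expR_ge0//.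
  have h1 : `|S i n m - mu| <= kappa * (delta / 4) by rewrite distrC; exact: hn1.
  have h1' : kappa^-1 * `|S i n m - mu| <= delta / 4 by rewrite ler_pdivrMl.
  have h2 : eps n <= delta * delta / (4 * (K + 1)) by exact: hn2.
  have h2' : eps n * K <= delta * delta / 4.
    apply: le_trans (ler_wpM2r K0 h2) _.
    rewrite mulrAC ler_pdivrMr//.
    have -> : delta * delta / 4 * (4 * (K + 1)) = delta * delta * (K + 1) by field.
    by rewrite ler_wpM2l ?mulr_ge0 ?(ltW de0)// lerDl.
  have h3 : eps n * K / (delta / 2) <= delta / 2.
    rewrite ler_pdivrMr//; apply: le_trans h2' _.
    by rewrite le_eqVlt; apply/orP; left; apply/eqP; field.
  lra.
have [t1 [t10 ht1]] := renewal_descent f_ge0 mf kappa0 Cf0 f_le f_neg f_int (mq i) q0 B0 qB rec small e0.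
exists t1; split => // t tt1; apply: le_trans _ (ht1 t tt1).
rewrite le_eqVlt; apply/orP; left; apply/eqP; apply: eq_integral => w _.
by rewrite /err /S /= /y ZxE// (le_trans t10).
Qed.

End hawkes_limit.

Lemma mean_cvg_in_probability (R : realType) (d : measure_display) (T : measurableType d)
    (P : probability T R) (X Y : R -> T -> R) (g : R -> R) (a : R) :
  (forall t, 0 <= t -> measurable_fun setT (X t)) ->
  (forall t, 0 <= t -> measurable_fun setT (Y t)) ->
  {ae P, forall w, forall t, Y t w = X t w} ->
  g t @[t --> +oo] --> a ->
  (forall e, 0 < e -> exists t0, 0 <= t0 /\ forall t, t0 <= t ->
     (\int[P]_w `|Y t w - g t|%:E <= e%:E)%E) ->
  cvg_in_probability P X a.
Proof.
move=> mX mY [N [mN PN0 YX]] ga YL e e0.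
have e2 : 0 < e / 2 by rewrite divr_gt0.
have mge (D : T -> R) (b c : R) : measurable_fun setT D -> measurable [set w | c <= `|D w - b|].
  move=> mD; rewrite -[X in measurable X]setTI.
  by apply: measurable_fun_le => //; apply: measurableT_comp => //; exact: measurable_funB.
apply: cvg_EFin.
  near=> t; have t0 : 0 <= t by near: t; exact: nbhs_pinfty_ge.
  by rewrite fin_num_measure//; apply: mge; exact: mX.
apply/cvgrPdist_le => eps eps0.
(* Markov's inequality at the level [e / 2]; the other half of [e] is left for the distance from
   [g t] to [a]. *)
have [t1 [t10 ht1]] := YL _ (mulr_gt0 e2 eps0).
move/cvgrPdist_le : ga => /(_ _ e2) [t2 [_ ht2]].
near=> t.
have tt1 : t1 <= t by near: t; exact: nbhs_pinfty_ge (num_real t1).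
have tt2 : t2 < t by near: t; exact: nbhs_pinfty_gt (num_real t2).
have t0 : 0 <= t by exact: le_trans tt1.
have mA := mge _ a e (mX t t0).
have mA' := mge _ (g t) (e / 2) (mY t t0).
set A' := [set w | _] in mA'.
have PA : (P [set w | (e <= `|X t w - a|)%R] <= P A' + P N)%E.
  apply: le_trans (measureU2 P mA' mN); apply: le_measure; rewrite ?inE//.
    exact: measurableU.
  move=> w /= ew; have [wN|wN] := pselect (N w); [by right|left].
  rewrite /A' /=; have -> : Y t w = X t w.
    by apply: contrapT => h; apply: wN; apply: YX => /= /(_ t).
  have h1 := ht2 t tt2.
  have h2 : `|X t w - a| <= `|X t w - g t| + `|g t - a| by exact: ler_distD.
  rewrite distrC in h1; lra.
have PA' : (P A' <= eps%:E)%E.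
  have fA' : P A' \is a fin_num by rewrite fin_num_measure.
  rewrite -(fineK fA') lee_fin -(ler_pM2l e2) -lee_fin.
  apply: le_trans (ht1 t tt1).
  rewrite EFinM fineK// -(setIT A') -integral_indic// -ge0_integralZl_EFin//; last 2 first.
  - by apply/measurable_EFinP; exact: measurable_indic.
  - exact: ltW.
  apply: ge0_le_integral => //.
  - by move=> w _; rewrite -EFinM lee_fin mulr_ge0// ltW.
  - by apply: emeasurable_funM; [exact: measurable_cst|apply/measurable_EFinP; exact: measurable_indic].
  - by apply/measurable_EFinP; apply: measurableT_comp => //; apply: measurable_funB => //; exact: mY.
  - move=> w _; rewrite -EFinM lee_fin indicE; case: (boolP (w \in A')) => [|_]; last by rewrite mulr0.
    by rewrite inE mulr1.
rewrite PN0 adde0 in PA.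
have := le_trans PA PA'; rewrite sub0r normrN /= => h.
have fA : P [set w | (e <= `|X t w - a|)%R] \is a fin_num by rewrite fin_num_measure.
by rewrite ger0_norm ?fine_ge0// -lee_fin fineK.
Unshelve. all: end_near. Qed.

(** The intensity integrates over [u < s], so it reads [phi] at positive arguments only. *)
Lemma hawkes_eq_kernel (R : realType) (d : nat) (d0 : measure_display) (T : measurableType d0)
    (P : probability T R) F N (phi psi : R -> R) (m : 'rV[int]_d -> R) Z :
  (forall t, 0 < t -> phi t = psi t) -> hawkes P F N phi m Z -> hawkes P F N psi m Z.
Proof.
move=> pp; rewrite /hawkes.
have -> // : @intensity R d phi m = intensity psi m.
apply/funext => z; apply/funext => i; apply/funext => s; rewrite /intensity.
congr (_ + _ * _)%E; apply: eq_fsbigr => j _; apply: eq_integral => u.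
by rewrite inE/= in_itv/= => /andP[_ us]; rewrite pp// subr_gt0.
Qed.

Theorem theorem15 (R : realType) (d : nat) (d_ge1 : (1 <= d)%N)
  (d0 : measure_display) (T : measurableType d0) (P : probability T R)
  (F : R -> set_system T) (F_filt : is_filtration F)
  (N : 'rV[int]_d -> T -> {measure set (R * R) -> \bar R})
  (N_poisson : iid_poisson_measures P F N)
  (phi : R -> R) (phi_ge0 : forall t, 0 <= t -> 0 <= phi t)
  (phi_int : locally_integrable_pos phi)
  (Lambda_gt1 : (1 < \int[lebesgue_measure]_(t in `[0%R, +oo[) (phi t)%:E)%E)
  (phi_var : polynomial_variation phi)
  (alpha0 : R) (alpha0_gt0 : 0 < alpha0)
  (alpha0_def :
     (\int[lebesgue_measure]_(t in `[0%R, +oo[)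
        (expR (- (alpha0 * t)) * phi t)%:E = 1)%E)
  (m : 'rV[int]_d -> R) (m_ge0 : forall i, 0 <= m i)
  (m_bounded : exists M : R, forall i, m i <= M)
  (mu : R) (mu_mean : ball_average m r @[r --> +oo] --> mu) (mu_gt0 : 0 < mu)
  (Z : 'rV[int]_d -> R -> T -> R) (Z_hawkes : hawkes P F N phi m Z) :
  forall i : 'rV[int]_d,
    cvg_in_probability P (fun t w => expR (- (alpha0 * t)) * Z i t w)
      (mu * alpha0 ^- 2 *
       (\int[lebesgue_measure]_(t in `[0%R, +oo[)
          (t * phi t * expR (- (alpha0 * t))))^-1).
Proof.
move=> i.
(* Half of the discount, to be spent on the growth of [phi]. *)
pose kappa := alpha0 / 2; have kappa0 : 0 < kappa by rewrite divr_gt0.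
have aE : alpha0 = 2 * kappa by rewrite /kappa; field.
(* [phi] is given on the nonnegative half-line; cut to 0 elsewhere it becomes measurable and
   nonnegative on the whole line, as the convolution lemmas require. *)
pose psi := phi \_ (`[0, +oo[%classic : set R).
have psiE t : 0 <= t -> psi t = phi t by move=> t0; rewrite /psi patchE mem_setE in_itv/= t0.
have psi_neg t : t < 0 -> psi t = 0 by move=> t0; rewrite /psi patchE mem_setE in_itv/= leNgt t0.
have mphi : measurable_fun (`[0%R, +oo[%classic : set R) phi.
  have -> : (`[0%R, +oo[%classic : set R) = \bigcup_n `[0%R, n%:R]%classic.
    apply/seteqP; split => t /=; last by move=> [n _]; rewrite /= !in_itv/= andbT => /andP[].
    rewrite in_itv/= andbT => t0; exists (Num.bound t) => //=.
    by rewrite in_itv/= t0 ltW// archi_boundP.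
  apply/measurable_fun_bigcup => n; first exact: measurable_itv.
  by apply/measurable_EFinP; apply: measurable_int (phi_int n%:R _).
have mpsi : measurable_fun setT psi.
  by apply/(measurable_restrictT _ _).1 => //; exact: measurable_itv.
have psi_ge0 t : 0 <= psi t.
  by have [t0|/psi_neg->//] := leP 0 t; rewrite psiE// phi_ge0.
have hpsi : hawkes P F N psi m Z.
  by apply: hawkes_eq_kernel Z_hawkes => t t0; rewrite psiE// ltW.
have [F' [N' [Z' [CH aeZ]]]] := hawkes_clean F_filt N_poisson psi_ge0 mpsi hpsi.
pose f t := psi t * expR (- (2 * kappa * t)).
have mf : measurable_fun setT f.
  by apply: measurable_funM => //; apply: measurableT_comp => //; exact: measurableT_comp.
have f_ge0 t : 0 <= f t by rewrite mulr_ge0// expR_ge0.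
have [Cf Cf0 phi_le] := polynomial_variation_expR kappa0 phi_ge0 phi_var.
have f_le t : 0 <= t -> f t <= Cf * expR (- (kappa * t)).
  move=> t0; rewrite /f psiE//; apply: le_trans (ler_wpM2r (expR_ge0 _) (phi_le t t0)) _.
  by rewrite -[Cf * _ * _]mulrA -expRD le_eqVlt; apply/orP; left; apply/eqP; congr (_ * expR _); ring.
have f_neg t : t < 0 -> f t = 0 by move=> t0; rewrite /f psi_neg// mul0r.
have f_int : (\int[lebesgue_measure]_t (f t)%:E = 1)%E.
  rewrite -alpha0_def [RHS]integral_mkcond; apply: eq_integral => t _.
  rewrite patchE mem_setE in_itv/= andbT; have [t0|/f_neg->//] := leP 0 t.
  by rewrite /f psiE// mulrC -aE.
have tv_fin t : 0 <= t -> (total_variation 0 t phi < +oo)%E.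
  by move=> t0; have [C [n hC]] := phi_var; apply: le_lt_trans (hC t t0) (ltry _).
have [x [rho [c [rho0 rhox c0 phi_c]]]] :=
  bounded_variation_positive phi_ge0 mphi tv_fin (lt_trans lte01 Lambda_gt1).
have f_ge r : x - rho <= r <= x + rho -> c * expR (- (2 * kappa * (x + rho))) <= f r.
  move=> rx; have /andP[r1 r2] := rx.
  have r0 : 0 <= r by apply: le_trans r1; rewrite subr_ge0 ltW.
  rewrite /f psiE// ler_pM ?expR_ge0 ?(ltW c0) ?phi_c//.
  by rewrite ler_expR lerN2 ler_wpM2l// mulr_ge0// ltW.
have c1 : 0 < c * expR (- (2 * kappa * (x + rho))) by rewrite mulr_gt0 ?expR_gt0.
have [h [mh h0 [Bh h_le] h_eq h_lim]] :=
  renewal_limit f_ge0 mf kappa0 Cf0 f_le f_neg f_int rho0 rhox c1 f_ge.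
have [M m_le] := m_bounded.
have mZ t : 0 <= t -> measurable_fun setT (Z i t).
  move=> t0 _ B mB; rewrite setTI.
  by apply: ((F_filt.1 t t0).2); have [+ _ _ _] := Z_hawkes; apply => //; exists B; rewrite ?setTI.
have mZ' t : 0 <= t -> measurable_fun setT (Z' i t).
  by move=> t0; apply: (adapted_measurable_fun (clean_poisson CH) t0); exact: (clean_adapted CH).
apply: (@mean_cvg_in_probability _ _ _ P _ (fun t w => expR (- (alpha0 * t)) * Z' i t w) (fun t => mu * h t)).
- by move=> t t0; apply: measurable_funM => //; exact: mZ.
- by move=> t t0; apply: measurable_funM => //; exact: mZ'.
- by apply: filterS aeZ => w Zw t; rewrite Zw.
- rewrite -mulrA; apply: cvgM; first exact: cvg_cst.
  move: h_lim; rewrite -aE /renewal_mean.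
  congr (_ --> _); congr (_ / _); rewrite /Rintegral; congr fine.
  apply: eq_integral => t; rewrite inE/= in_itv/= andbT => t0.
  by rewrite /f psiE// mulrA aE.
- move=> e e0; rewrite aE.
  exact: (clean_hawkes_limit CH d_ge1 psi_ge0 mpsi kappa0 Cf0 f_le f_neg f_int m_ge0 m_le mu_mean (ltW mu_gt0) mh h0 h_le h_eq i e0).
Qed.
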